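(* Assume that $U$ is compact-valued with Borel graph, that $f,g$ satisfy the regularity conditions stated in the context, and that $u^0\in\mathfrak U$ is $\tau$-optimal, with trajectory $x^0=x^{u^0}$. Then there exists a $\tau$-vanishing Lagrange multiplier $(\lambda^0,\psi^0)\in\Lambda$. For example, such a multiplier is obtained (after multiplication by a positive scalar) from a limit of sequences as follows: there exist a sequence $(\hat x^n,\hat\eta^n,\hat\lambda^n,\hat\psi^n)_{n\in\mathbb N}$ in $\widetilde{\mathfrak Y}$ and a subsequence $\hat\tau$ of $\tau$ such that (1) for some $(\hat\lambda,\hat\psi)$ with $(x^0,u^0,\hat\lambda,\hat\psi)\in\mathfrak Z$ one has $(\hat x^n,\hat\eta^n,\hat\lambda^n,\hat\psi^n)\to(x^0,\widetilde u^0,\hat\lambda,\hat\psi)$ in $C_{loc}(\mathbb T,\mathbb X)\times\widetilde{\mathfrak U}\times[0,1]\times C_{loc}(\mathbb T,\mathbb X)$; (2) for some sequence $\delta_n\downarrow 0$, $\varkappa\big(t,(\hat\psi^n(t),\hat x^n(t),\hat\lambda^n)\big)\in(\hat\psi(0),x_{**},\hat\lambda)+\delta_n\mathbb D\times\delta_n\mathbb D\times[-\delta_n,\delta_n]$ for all $t\in\mathbb T$, $n\in\mathbb N$; (3) $\widetilde J^{\hat\eta^n}(\hat\tau_n)-J^{u^0}(\hat\tau_n)\to 0+$; (4) $\hat\lambda^n I^{\hat\eta^n}(\hat\tau_n)\to\hat\psi(0)$, and $\hat\psi^n(\hat\tau_n)=0$ for all $n\in\mathbb N$; and $(\hat\lambda,\hat\psi)$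 is then a $\tau$-vanishing Lagrange multiplier. Moreover, for every $\tau$-vanishing Lagrange multiplier $(\lambda^0,\psi^0)\in\Lambda$ there exist a subsequence $\tau'$ of $\tau$, a sequence $(\xi^n)_{n\in\mathbb N}$ in $\mathbb X$ converging to $0$, and a sequence $(\lambda^n)_{n\in\mathbb N}$ in $(0,1]$ converging to $\lambda^0$ such that $$\psi^0(0)=\lim_{n\to\infty}\lambda^n I_{\xi^n}(\tau'_n),$$ $$\psi^0(T)=\lim_{n\to\infty}\lambda^n\big(I_{\xi^n}(\tau'_n)-I_{\xi^n}(T)\big)A_{\xi^n}^{-1}(T)=\lim_{n\to\infty}\lambda^n\int_T^{\tau'_n}\frac{\partial g}{\partial x}(t,x_{\xi^n}(t),u^0(t))A_{\xi^n}(t)\,dt\;A_0^{-1}(T)$$ for $T\in\mathbb T$, and all these limits are uniform in $T$ on every compact subset of $\mathbb T$. If, in addition, $\lambda^0>0$, then one can take $\lambda^n=\lambda^0=1$.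
   Context: Setting. $\mathbb T=[0,\infty)$, $\mathbb X=\mathbb R^m$ with unit ball $\mathbb D$, $\mathbb L$ is the space of real $m\times m$ matrices with operator norm, $\mathbb U$ is a finite-dimensional Euclidean space. $U$ assigns to each $t\in\mathbb T$ a subset $U(t)\subset\mathbb U$; $\mathfrak U$ is the set of Borel measurable locally bounded $u:\mathbb T\to\mathbb U$ with $u(t)\in U(t)$. Let $f:\mathbb T\times\mathbb X\times\mathbb U\to\mathbb X$, $g:\mathbb T\times\mathbb X\times\mathbb U\to\mathbb R$, $x_{**}\in\mathbb X$. For $u\in\mathfrak U$, $x^u$ solves $\dot x=f(t,x,u(t))$, $x(0)=x_{**}$, and $J^u(T)=\int_0^T g(t,x^u(t),u(t))\,dt$. $C_{loc}$ denotes continuous functions with the compact-open topology. Regularity conditions on $f,g$: each of $a=f,\ g,\ \partial f/\partial x,\ \partial g/\partial x$ is defined on $\mathbb T\times\mathbb X\times\mathbb U$, is Carath\'eodory (Borel in $t$ for all $(x,u)$, continuous in $(x,u)$ for a.e. $t$), and for each compact $K\subset\mathbb X\times\mathbb U$ there are locally integrable $L^a_K,M^a_K:\mathbb T\to\mathbb T$ with $\|a(t,x,u)-a(t,y,u)\|\le L^a_K(t)\|x-y\|$ and $\|a(t,x,u)\|\le M^a_K(t)$ for all $(x,u),(y,u)\in K$, $t\in\mathbb T$. Moreover $f$ has sublinear growth in $x$: for each compact $C\subset\mathbb U$ there is a locally integrable $l_C$ with $\|f(t,x,u)\|\le l_C(t)(1+\|x\|)$ for $u\in C$. $\tau$-optimality.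 $\tau=(\tau_n)_{n\in\mathbb N}$ is a sequence of times with $\tau_n\uparrow\infty$; $u^0\in\mathfrak U$ is $\tau$-optimal if $\limsup_{n\to\infty}\sup_{u\in\mathfrak U}(J^u(\tau_n)-J^{u^0}(\tau_n))=0$. Multipliers. Shadow prices $\psi$ and $\partial g/\partial x$ are row vectors. $\mathcal H(x,t,u,\lambda,\psi)=\psi f(t,x,u)+\lambda g(t,x,u)$ for $\lambda\ge0$. A Lagrange multiplier associated with $(x^0,u^0)$ is a nontrivial pair $(\lambda,\psi)\in[0,1]\times C(\mathbb T,\mathbb X)$ with, for a.e. $t$, $\dot\psi(t)=-\frac{\partial\mathcal H}{\partial x}(x^0(t),t,u^0(t),\lambda,\psi(t))$ and $\sup_{p\in U(t)}\mathcal H(x^0(t),t,p,\lambda,\psi(t))=\mathcal H(x^0(t),t,u^0(t),\lambda,\psi(t))$. $\Lambda$ is the set of such multipliers with either $\lambda=1$, or $\lambda=0$ and $\|\psi(0)\|=1$. Consider the system (S) for $(\psi,x,\lambda)$, $\lambda\ge0$: $\dot\psi=-\frac{\partial\mathcal H}{\partial x}(x(t),t,u^0(t),\lambda,\psi(t))$, $\dot x=f(t,x(t),u^0(t))$, $\dot\lambda=0$. A Lagrange multiplier $(\lambda^0,\psi^0)$ associated with $(x^0,u^0)$ is $\tau$-vanishing if there are a subsequence $\tau'$ of $\tau$ and solutions $(\psi_n,x_n,\lambda_n)$ of (S) converging pointwise to $(\psi^0,x^0,\lambda^0)$ with $\psi_n(\tau'_n)=0$ for every $n$. $\varkappa(t,y)$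 is the value at time $0$ of the solution of (S) that equals $y$ at time $t$. For $\xi\in\mathbb X$: $\dot x_\xi=f(t,x_\xi,u^0(t))$, $x_\xi(0)=x_{**}+\xi$; $\dot A_\xi=\frac{\partial f}{\partial x}(t,x_\xi(t),u^0(t))A_\xi$, $A_\xi(0)=1_{\mathbb L}$ (identity); $I_\xi(T)=\int_0^T\frac{\partial g}{\partial x}(t,x_\xi(t),u^0(t))A_\xi(t)\,dt$. $A_0,I_0$ correspond to $\xi=0$. Generalized controls. $\widetilde{\mathfrak U}$ is the set of weakly measurable maps $\eta$ from $\mathbb T$ to Radon probability measures on $\mathbb U$ with $\eta(t)(U(t))=1$ for a.e. $t$, with the weakest topology making all restrictions to $[0,n]$ continuous for the weak-$*$ topology (generated by $\eta\mapsto\int_0^n\int_{U(t)}\varphi(t,u)\,d\eta(t)(u)\,dt$, $\varphi$ Carath\'eodory with $t\mapsto\sup_{u\in U(t)}|\varphi(t,u)|$ integrable). $u\in\mathfrak U$ is identified with $t\mapsto$ Dirac measure at $u(t)$; $\widetilde u^0$ is the image of $u^0$. For $\eta\in\widetilde{\mathfrak U}$: $\dot x^\eta=\int_{U(t)}f(t,x^\eta,u)\,d\eta(t)(u)$, $x^\eta(0)=x_{**}$; $\dot A^\eta=\int_{U(t)}\frac{\partial f}{\partial x}(t,x^\eta(t),u)\,d\eta(t)(u)\,A^\eta$, $A^\eta(0)=1_{\mathbb L}$; $I^\eta(T)=\int_0^T\int_{U(t)}\frac{\partial g}{\partial x}(t,x^\eta(t),u)\,d\eta(t)(u)\,A^\eta(t)\,dt$;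 $\widetilde J^\eta(T)=\int_0^T\int_{U(t)}g(t,x^\eta(t),u)\,d\eta(t)(u)\,dt$. $\mathfrak Y$ is the set of $(x,u,\lambda,\psi)$ with $u\in\mathfrak U$, $\lambda\in[0,1]$, $\dot x=f(t,x,u(t))$, $\dot\psi=-\frac{\partial\mathcal H}{\partial x}(x(t),t,u(t),\lambda,\psi(t))$, $x(0)=x_{**}$, $\|\psi(0)\|+\lambda=1$. $\mathfrak Z\subset\mathfrak Y$ consists of those also satisfying $\sup_{p\in U(t)}\mathcal H(x(t),t,p,\lambda,\psi(t))=\mathcal H(x(t),t,u(t),\lambda,\psi(t))$ a.e. $\widetilde{\mathfrak Y}$ is the closure of (the image of) $\mathfrak Y$ in $C_{loc}(\mathbb T,\mathbb X)\times\widetilde{\mathfrak U}\times[0,1]\times C_{loc}(\mathbb T,\mathbb X)$. ''$\to0+$'' means convergence to $0$ through nonnegative values. *)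

(* Defs.v *)
From HB Require Import structures.
From mathcomp Require Import all_boot all_order all_algebra.
From mathcomp Require Import all_classical all_reals all_analysis.

Set Implicit Arguments.
Unset Strict Implicit.
Unset Printing Implicit Defensive.

Import Order.TTheory GRing.Theory Num.Theory.
Import numFieldNormedType.Exports.

Local Open Scope classical_set_scope.
Local Open Scope ring_scope.

Section Generalities.
Context {R : realType}.

(* On row and column vectors this is the Euclidean norm; the norm `|.| that
   the library puts on matrices is the max-norm (same topology). *)
Definition enorm p q (A : 'M[R]_(p, q)) : R :=
  Num.sqrt (\sum_i \sum_j A i j ^+ 2).

Definition opnorm p q (A : 'M[R]_(p, q)) : R :=
  sup [set enorm (A *m x) | x in [set x : 'cV[R]_q | enorm x <= 1]].

Definition partial m (V : normedModType R) (h : 'cV[R]_m -> V) (x : 'cV[R]_m)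
    (j : 'I_m) : V :=
  'D_(delta_mx j 0) h x.

Definition grad m (h : 'cV[R]_m -> R) (x : 'cV[R]_m) : 'rV[R]_m :=
  \row_j partial h x j.

Definition jac m (h : 'cV[R]_m -> 'cV[R]_m) (x : 'cV[R]_m) : 'M[R]_m :=
  \matrix_(i, j) partial h x j i 0.

(* The time axis; functions of time are functions on R whose values at negative
   times are irrelevant. *)
Definition Time : set R := `[0, +oo[.

Definition borelType (V : ptopologicalType) := g_sigma_algebraType (@open V).

Definition borel_fun (V : ptopologicalType) (D : set R) (h : R -> V) : Prop :=
  measurable_fun D (h : R -> borelType V).

Definition caratheodory (W : topologicalType) (V : ptopologicalType)
    (D : set R) (a : R -> W -> V) : Prop :=
  (forall w, borel_fun D (a ^~ w)) /\
  {ae lebesgue_measure, forall t, D t -> continuous (a t)}.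

(* lebesgue_measure lives on the Borel sigma-algebra; its completion is used so
   that Lebesgue measurable functions qualify. *)
Definition integrable_on (D : set R) (h : R -> \bar R) : Prop :=
  (@completed_lebesgue_measure R).-integrable D h.

Definition locally_integrable_on_Time (h : R -> R) : Prop :=
  forall K, compact K -> K `<=` Time -> integrable_on K (EFin \o h).

Definition oriented_integral (a b : R) (h : R -> R) : R :=
  if a <= b then \int[lebesgue_measure]_(t in `[a, b]) h t
  else - \int[lebesgue_measure]_(t in `[b, a]) h t.

Definition absolutely_continuous_on (V : normedModType R) (a b : R)
    (x : R -> V) : Prop :=
  forall e : R, 0 < e -> exists2 d : R, 0 < d &
    forall (n : nat) (l r : 'I_n -> R),
      (forall i, a <= l i /\ l i <= r i /\ r i <= b) ->
      trivIset setT (fun i => `]l i, r i[%classic) ->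
      \sum_i (r i - l i) < d -> \sum_i `|x (r i) - x (l i)| < e.

(* Caratheodory solutions on the whole half-line. *)
Definition ode (V : normedModType R) (F : R -> V -> V) (x : R -> V) : Prop :=
  (forall b, 0 <= b -> absolutely_continuous_on 0 b x) /\
  {ae lebesgue_measure, forall t, Time t -> is_derive t 1 x (F t (x t))}.

Definition ivp (V : normedModType R) (F : R -> V -> V) (y : V) (x : R -> V) :=
  ode F x /\ x 0 = y.

(* A name for the solution, whose values on Time are unique under the regularity
   conditions imposed below; the zero function when there is no solution. *)
Definition ivp_sol (V : normedModType R) (F : R -> V -> V) (y : V) : R -> V :=
  xget (fun=> 0) [set x | ivp F y x].

Definition subsequence_of (tau' tau : nat -> R) : Prop :=
  exists2 s : nat -> nat, {homo s : i j / (i < j)%N} & tau' = tau \o s.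

Definition increasing_to_infinity (tau : nat -> R) : Prop :=
  [/\ forall n, 0 <= tau n, nondecreasing_seq tau & tau @ \oo --> +oo].

Definition locally_uniform_limit (V : normedModType R) (F : nat -> R -> V)
    (h : R -> V) : Prop :=
  forall K, compact K -> K `<=` Time -> {uniform K, F @ \oo --> h}.

End Generalities.

Record control_problem (R : realType) (m k : nat) := ControlProblem {
  dyn : R -> 'cV[R]_m -> 'cV[R]_k -> 'cV[R]_m;
  cost : R -> 'cV[R]_m -> 'cV[R]_k -> R;
  cset : R -> set 'cV[R]_k;
  xinit : 'cV[R]_m }.

Section Problem.
Context {R : realType} {m k : nat}.
Variable P : control_problem R m k.

Local Notation X := 'cV[R]_m.
Local Notation Xr := 'rV[R]_m.
Local Notation UU := 'cV[R]_k.
Local Notation L := 'M[R]_m.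
Local Notation f := (dyn P).
Local Notation g := (cost P).
Local Notation U := (cset P).
Local Notation mu := (@lebesgue_measure R).

Definition control := R -> UU.

Definition dfdx (t : R) (x : X) (u : UU) : L := jac (fun y => f t y u) x.
Definition dgdx (t : R) (x : X) (u : UU) : Xr := grad (fun y => g t y u) x.

Definition regular_map (V : normedModType R) (nrm : V -> R)
    (a : R -> X -> UU -> V) : Prop :=
  caratheodory Time (fun t (w : X * UU) => a t w.1 w.2) /\
  forall K : set (X * UU), compact K ->
    exists LK MK : R -> R,
      [/\ locally_integrable_on_Time LK, locally_integrable_on_Time MK,
          forall t, Time t -> 0 <= LK t /\ 0 <= MK t,
          forall t x y u, Time t -> K (x, u) -> K (y, u) ->
            nrm (a t x u - a t y u) <= LK t * enorm (x - y) &
          forall t x u, Time t -> K (x, u) -> nrm (a t x u) <= MK t].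

Definition sublinear_growth : Prop :=
  forall C : set UU, compact C ->
    exists2 lC : R -> R, locally_integrable_on_Time lC &
      forall t x u, Time t -> C u -> enorm (f t x u) <= lC t * (1 + enorm x).

Definition regular_problem : Prop :=
  [/\ forall t x u, Time t -> differentiable (fun y => f t y u) x,
      forall t x u, Time t -> differentiable (fun y => g t y u : R^o) x,
      regular_map (@enorm R m 1) f /\
      regular_map (fun r : R^o => `|r|) (g : R -> X -> UU -> R^o),
      regular_map (@opnorm R m m) dfdx /\ regular_map (@enorm R 1 m) dgdx &
      sublinear_growth].

Definition compact_valued : Prop := forall t, Time t -> compact (U t).

Definition borel_graph : Prop :=
  <<s @open (R * UU)%type >> [set tu : R * UU | Time tu.1 /\ U tu.1 tu.2].

Definition admissible (u : control) : Prop :=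
  [/\ borel_fun Time u,
      forall K, compact K -> K `<=` Time -> bounded_set (u @` K) &
      forall t, Time t -> U t (u t)].

Definition traj (u : control) : R -> X :=
  ivp_sol (fun t y => f t y (u t)) (xinit P).

Definition payoff (u : control) (T : R) : R :=
  \int[mu]_(t in `[0, T]) g t (traj u t) (u t).

Definition tau_optimal (tau : nat -> R) (u0 : control) : Prop :=
  admissible u0 /\
  limn_esup (fun n => ereal_sup
    [set (payoff u (tau n) - payoff u0 (tau n))%:E | u in admissible]) = 0%E.

Definition hamiltonian (x : X) (t : R) (u : UU) (lam : R) (psi : Xr) : R :=
  (psi *m f t x u) 0 0 + lam * g t x u.

Definition dHdx (x : X) (t : R) (u : UU) (lam : R) (psi : Xr) : Xr :=
  grad (fun y => hamiltonian y t u lam psi) x.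

Definition adjoint (x : R -> X) (u : control) (lam : R) (psi : R -> Xr) : Prop :=
  ode (fun t q => - dHdx (x t) t (u t) lam q) psi.

Definition maximum_condition (x : R -> X) (u : control) (lam : R)
    (psi : R -> Xr) : Prop :=
  {ae mu, forall t, Time t ->
    ereal_sup [set (hamiltonian (x t) t p lam (psi t))%:E | p in U t] =
    (hamiltonian (x t) t (u t) lam (psi t))%:E}.

Definition lagrange_multiplier (x : R -> X) (u : control) (lam : R)
    (psi : R -> Xr) : Prop :=
  [/\ 0 <= lam <= 1, {within Time, continuous psi},
      ~ (lam = 0 /\ forall t, Time t -> psi t = 0),
      adjoint x u lam psi & maximum_condition x u lam psi].

Definition normalized_multiplier (x : R -> X) (u : control) (lam : R)
    (psi : R -> Xr) : Prop :=
  lagrange_multiplier x u lam psi /\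
  (lam = 1 \/ lam = 0 /\ enorm (psi 0) = 1).

Definition state := (Xr * X * R^o)%type.

(* Adjoint and state equations along u0 jointly; [w.1.1], [w.1.2] and [w.2] are psi, x and lambda. *)
Definition joint_system (u0 : control) (z : R -> state) : Prop :=
  ode (fun t (w : state) =>
    (- dHdx w.1.2 t (u0 t) w.2 w.1.1, f t w.1.2 (u0 t), 0) : state) z /\
  forall t, Time t -> 0 <= (z t).2.

(* The value at time 0 of the solution that equals [y] at time [t]. *)
Definition kappa (u0 : control) (t : R) (y : state) : state :=
  xget (fun=> y) [set z : R -> state | joint_system u0 z /\ z t = y] 0.

Definition vanishing (tau : nat -> R) (x0 : R -> X) (u0 : control) (lam : R)
    (psi : R -> Xr) : Prop :=
  exists (tau' : nat -> R) (z : nat -> R -> state),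
    [/\ subsequence_of tau' tau,
        forall n, joint_system u0 (z n),
        forall t, Time t -> z n t @[n --> \oo] --> ((psi t, x0 t, lam) : state) &
        forall n, (z n (tau' n)).1.1 = 0].

(* x_xi, A_xi, the integrand of I_xi, and I_xi. *)
Definition traj_shift (u0 : control) (xi : X) : R -> X :=
  ivp_sol (fun t y => f t y (u0 t)) (xinit P + xi).

Definition fund (u0 : control) (xi : X) : R -> L :=
  ivp_sol (fun t B => dfdx t (traj_shift u0 xi t) (u0 t) *m B) 1%:M.

Definition dcost (u0 : control) (xi : X) (t : R) : Xr :=
  dgdx t (traj_shift u0 xi t) (u0 t) *m fund u0 xi t.

Definition dpayoff (u0 : control) (xi : X) (T : R) : Xr :=
  \row_j \int[mu]_(t in `[0, T]) dcost u0 xi t 0 j.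

(* Every Borel probability measure on a Euclidean space is Radon. *)
Definition relaxed := R -> probability (borelType UU) R.

Definition generalized (eta : relaxed) : Prop :=
  (forall c : UU -> R, continuous c -> (exists M, forall v, `|c v| <= M) ->
    measurable_fun Time (fun t => \int[eta t]_v c v)) /\
  {ae mu, forall t, Time t -> eta t (U t) = 1%E}.

Definition dirac_control (u : control) : relaxed :=
  fun t => dirac (u t : borelType UU).

Definition test_functions : set (nat * (R -> UU -> R)) :=
  [set p | caratheodory `[0, p.1%:R] p.2 /\
     integrable_on `[0, p.1%:R]
       (fun t => ereal_sup [set `|p.2 t v|%:E | v in U t])].

(* The topology of the space of generalized controls is the initial topology
   for this map. *)
Definition test_values (eta : relaxed) : {ptws test_functions -> R} :=
  fun p => \int[mu]_(t in `[0, (val p).1%:R])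
             \int[eta t]_(v in U t) (val p).2 t v.

(* x^eta, A^eta, I^eta and J^eta for a generalized control. *)
Definition traj_gen (eta : relaxed) : R -> X :=
  ivp_sol (fun t y => \col_i \int[eta t]_(v in U t) f t y v i 0) (xinit P).

Definition fund_gen (eta : relaxed) : R -> L :=
  ivp_sol (fun t B =>
    (\matrix_(i, j) \int[eta t]_(v in U t) dfdx t (traj_gen eta t) v i j) *m B)
    1%:M.

Definition dpayoff_gen (eta : relaxed) (T : R) : Xr :=
  \row_j \int[mu]_(t in `[0, T])
    ((\row_i \int[eta t]_(v in U t) dgdx t (traj_gen eta t) v 0 i)
       *m fund_gen eta t) 0 j.

Definition payoff_gen (eta : relaxed) (T : R) : R :=
  \int[mu]_(t in `[0, T]) \int[eta t]_(v in U t) g t (traj_gen eta t) v.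

(* The sets Y and Z of quadruples (x, u, lam, psi). *)
Definition extremal_system (x : R -> X) (u : control) (lam : R) (psi : R -> Xr)
    : Prop :=
  [/\ admissible u, 0 <= lam <= 1, ivp (fun t y => f t y (u t)) (xinit P) x,
      adjoint x u lam psi & enorm (psi 0) + lam = 1].

Definition extremal (x : R -> X) (u : control) (lam : R) (psi : R -> Xr) : Prop :=
  extremal_system x u lam psi /\ maximum_condition x u lam psi.

Definition quadruple := ((R -> X) * relaxed * R * (R -> Xr))%type.

Definition ambient : set quadruple :=
  [set q | let: (x, eta, lam, psi) := q in
     [/\ {within Time, continuous x}, generalized eta, 0 <= lam <= 1 &
         {within Time, continuous psi}]].

(* [ambient] carries the initial topology for this map. *)
Definition embed (q : quadruple) :
    ({compact-open, @Time R -> X} * {ptws test_functions -> R} * R *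
     {compact-open, @Time R -> Xr})%type :=
  let: (x, eta, lam, psi) := q in
  (sigL Time x, test_values eta, lam, sigL Time psi).

Definition extremal_system_image : set quadruple :=
  [set q | exists x u lam psi,
     extremal_system x u lam psi /\ q = (x, dirac_control u, lam, psi)].

Definition extremal_system_closure : set quadruple :=
  ambient `&` [set q | closure (embed @` extremal_system_image) (embed q)].

(* Here x_, eta_, lam_, psi_ and tau_ are the approximating sequences, whose
   limit is (x0, u0, lam, psi) with x0 the trajectory of u0. *)
Definition approximating_data (tau : nat -> R) (u0 : control) (x_ : nat -> R -> X)
    (eta_ : nat -> relaxed) (lam_ : nat -> R) (psi_ : nat -> R -> Xr)
    (tau_ : nat -> R) (lam : R) (psi : R -> Xr) : Prop :=
  let x0 := traj u0 in
  (forall n, extremal_system_closure (x_ n, eta_ n, lam_ n, psi_ n)) /\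
  subsequence_of tau_ tau /\
  [/\ extremal x0 u0 lam psi /\
      embed (x_ n, eta_ n, lam_ n, psi_ n) @[n --> \oo] -->
        embed (x0, dirac_control u0, lam, psi),
      exists delta : nat -> R,
        [/\ forall n, 0 < delta n, nonincreasing_seq delta,
            delta @ \oo --> 0 &
            forall n t, Time t ->
              let y := kappa u0 t ((psi_ n t, x_ n t, lam_ n) : state) in
              [/\ enorm (y.1.1 - psi 0) <= delta n,
                  enorm (y.1.2 - xinit P) <= delta n &
                  `|y.2 - lam| <= delta n]],
      (forall n, 0 <= payoff_gen (eta_ n) (tau_ n) - payoff u0 (tau_ n)) /\
      payoff_gen (eta_ n) (tau_ n) - payoff u0 (tau_ n) @[n --> \oo] --> 0 &
      lam_ n *: dpayoff_gen (eta_ n) (tau_ n) @[n --> \oo] --> psi 0 /\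
      forall n, psi_ n (tau_ n) = 0].

End Problem.

(* Main.v *)
Require Import Defs.
From HB Require Import structures.
From mathcomp Require Import all_boot all_order all_algebra.
From mathcomp Require Import all_classical all_reals all_analysis.
From mathcomp Require Import measurable_realfun ring lra zify.

(* The approximating generalized controls are Dirac measures at ordinary controls.
   For each n let u_n almost maximize the payoff at some tau_i minus delta times the
   weighted measure of the set where a control differs from u0, among the controls
   bounded by n plus a fixed local bound of u0 that equal u0 after tau_i.
   Optimality of u0 makes the payoff gap nonnegative and small, and the penalty makes
   u_n close to u0. Let psi_n solve the adjoint equation with psi_n(tau_i) = 0. A needle
   variation on a set E changes the payoff by the integral over E of the increment of
   the Hamiltonian, up to a multiple of rho(E)^2, where rho is an absolutely continuous
   measure; cutting E into many pieces of equal rho-measure removes the quadratic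
   error, so u_n satisfies an integrated maximum condition up to a small error. A
   Gronwall estimate with the factor exp built into the weight shows that kappa moves
   (psi_n(t), x_n(t)) by at most the penalized distance, uniformly in t; hence after
   normalization the initial values, and then the whole solutions, converge. The
   integrated maximum condition passes to the limit, and becomes pointwise by
   measurable selection: a Borel set with non-negligible projection contains a compact
   set whose projection has positive measure (capacitability of Souslin sets), and a
   multifunction with compact graph has a lexicographically minimal selection.

   Conversely, solving (S) backwards from (0, x_n(tau'_n), lambda_n) at time tau'_n
   gives a sequence whose values at time 0 are controlled by kappa, which yields the
   vanishing property, and the formulas for psi follow from the identity
   psi(T) A(T) = psi(0) - lambda I(T) along any solution of (S). *)

Set Implicit Arguments.
Unset Strict Implicit.
Unset Printing Implicit Defensive.

Import Order.TTheory GRing.Theory Num.Theory.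
Import numFieldNormedType.Exports.

Local Open Scope classical_set_scope.
Local Open Scope ring_scope.

(** * Absolutely continuous functions and linear estimates *)

Section AbsoluteContinuity.
Context {R : realType}.
Local Notation mu := (@lebesgue_measure R).

(** The order of the choices shapes the construction. Bounds on states and adjoints hold for all
    controls below a common bound and on the whole half-line, so the weight [w] and the penalty [d]
    depend on [n] only. The index [i] comes next, with optimality gap at most [d * d]: this is what
    turns the penalty inequality [d * D u <= d * d] into [D u <= d]. The needle constant, the number
    of cuts and the accuracy of the maximization depend on [tau i] and come last. Admissible
    controls are only locally bounded and moduli only locally integrable, so constants are replaced
    by nondecreasing bounds [b : R -> nat] in time, which select members of a monotone family
    [ell n] of densities. In the limit, competitors are inserted only where [u_n] equals [u0]; there
    the integrands converge uniformly on bounded intervals up to a factor [ell], and the remaining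
    set has small weighted measure. Continuity holds only for almost every time, and the moduli are
    integrable only for the completed measure; passing to Borel representatives at the start settles
    both. *)

Definition ac (V : normedModType R) (x : R -> V) :=
  forall b, 0 <= b -> absolutely_continuous_on 0 b x.

(* A chain of disjoint subintervals of [O] carries all the variation of [x] on
   [[a, t]] up to [e * (t - a)]. *)
Let charged (x : R -> R^o) (O : set R) (a e t : R) :=
  exists n (l r : nat -> R),
    [/\ forall i, (i < n)%N -> [/\ a <= l i, l i <= r i & r i <= t],
        forall i, (i < n)%N -> `]l i, r i[ `<=` O,
        forall i j, (i < j)%N -> (j < n)%N -> r i <= l j &
        `|x t - x a| <= e * (t - a) + \sum_(i < n) `|x (r i) - x (l i)|].

Let charged_step x O a (e t v : R) : 0 <= e -> a <= t -> t <= v -> charged x O a e t ->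
  (`|x v - x t| <= e * (v - t) \/ `]t, v[ `<=` O) -> charged x O a e v.
Proof.
move=> e0 at_ tv [n [l [r [H1 H2 H3 H4]]]] [xe|tvO].
  exists n, l, r; split => //.
    by move=> i /H1[? ? ?]; split => //; lra.
  have := ler_normD (x v - x t) (x t - x a); rewrite addrA subrK.
  move/le_trans; apply; have -> : v - a = (v - t) + (t - a) by ring.
  by rewrite mulrDr -addrA lerD.
exists n.+1, (fun i => if i == n then t else l i),
  (fun i => if i == n then v else r i); split.
- move=> i; rewrite ltnS leq_eqVlt; case: eqP => //= _ /H1[]*; split => //; lra.
- by move=> i; rewrite ltnS leq_eqVlt; case: eqP => //= _ /H2.
- move=> i j ij; rewrite ltnS leq_eqVlt; case: (eqVneq j n) ij => /= [-> ij _|_ ij jn].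
    by rewrite ltn_eqF//; have [] := H1 i ij.
  by rewrite ltn_eqF ?(ltn_trans ij)//; exact: H3.
- rewrite big_ord_recr /= eqxx.
  under eq_bigr do rewrite ltn_eqF//.
  have := ler_normD (x v - x t) (x t - x a); rewrite addrA subrK.
  move/le_trans; apply; rewrite addrA (addrC (`|x v - x t|)) lerD2r.
  by rewrite (le_trans H4)// lerD2r ler_wpM2l// lerD2r.
Qed.

Let der0_small (x : R -> R^o) (c e : R) : 0 < e -> is_derive c 1 x 0 ->
  exists2 d : R, 0 < d & forall v, `|v - c| < d -> `|x v - x c| <= e * `|v - c|.
Proof.
move=> e0 [dx vx]; move: dx; rewrite /derivable => /cvg_ex[l] xl.
have l0 : l = 0 by rewrite -vx; apply/esym/cvg_lim.
move: xl; rewrite {}l0 => /cvgrPdist_lt /(_ _ e0)/nbhs_ballP[d /= d0 hd].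
exists d => // v vd; have [->|vc] := eqVneq v c.
  by rewrite !subrr !normr0 mulr0.
have h0 : v - c != 0 by rewrite subr_eq0.
have := hd (v - c); rewrite /ball /= sub0r normrN vd => /(_ isT h0).
rewrite sub0r normrN scaler1 subrK /= normrZ normfV ltNge.
move=> H; rewrite leNgt; apply: contra H => H.
by rewrite mulrC ler_pdivlMr ?normr_gt0// ltW.
Qed.

(** Near a point of derivative 0 the increment is at most [e] times the length. The exceptional null
    set lies in an open set [O] of measure below the [d] that absolute continuity assigns to [e], so
    the intervals inside [O] contribute at most [e] in total. *)
Lemma ac_const (x : R -> R^o) (b : R) : 0 <= b ->
  absolutely_continuous_on 0 b x ->
  {ae mu, forall t, Time t -> is_derive t 1 x 0} -> x b = x 0.
Proof.
move=> b0 acx [N [mN N0 hN]].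
have key (e : R) : 0 < e -> `|x b - x 0| <= e * b + e.
  move=> e0; have [d d0 hd] := acx _ e0.
  have Nfin : (mu N < +oo)%E by rewrite N0.
  have [W [oO NO Od]] := lebesgue_regularity_outer mN Nfin d0.
  set O := W in NO Od oO *; have mO : measurable O by exact: open_measurable.
  have {}Od : (mu O < d%:E)%E.
    by rewrite -(setDKU NO) measureU0//; exact: measurableD.
  have dich c : 0 <= c -> exists2 d : R, 0 < d &
     (forall v, `|v - c| < d -> `|x v - x c| <= e * `|v - c|) \/ ball c d `<=` O.
    move=> c0; have [Nc|Nc] := pselect (N c).
      have : nbhs c O by apply: open_nbhs_nbhs; split => //; exact: NO.
      by move=> /nbhs_ballP[r r0 rO]; exists r => //; right.
    have : is_derive c 1 x 0.
      apply: contrapT => H; apply: Nc; apply: hN => /=; apply: contra_not H.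
      by apply; rewrite /Time /= in_itv /= c0.
    by move=> /(der0_small e0)[r r0 rO]; exists r => //; left.
  have chb : charged x O 0 e b.
    (* Real induction: a chain ending close enough below the supremum [c] of [S] extends to every
       [v] slightly beyond [c], which forces [c = b]. *)
    pose S := [set t | 0 <= t <= b /\ charged x O 0 e t].
    have S0 : S 0.
      split; first by rewrite lexx.
      exists 0%N, (fun=> 0), (fun=> 0); split => //.
      by rewrite big_ord0 !subrr normr0 mulr0 addr0.
    have Sb : has_sup S.
      by split; [exists 0|exists b => t [/andP[_ ->]]].
    pose c := sup S.
    have c0 : 0 <= c by apply: ub_le_sup => //; exact: Sb.2.
    have cb : c <= b by apply: ge_sup; [exists 0|move=> t [/andP[_ ->]]].
    have [r r0 hr] := dich c c0.
    have [t [/andP[t0 tb] cht] tr] := sup_adherent r0 Sb.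
    have tc : t <= c by apply: ub_le_sup => //; [exact: Sb.2|split=> //; apply/andP].
    rewrite -/c in tr.
    have chv v : c <= v -> v <= b -> v < c + r -> charged x O 0 e v.
      move=> cv vb vr; apply: charged_step cht _ => //; [exact: ltW|exact: (le_trans tc cv)|].
      case: hr => [hr|hr]; [left|right].
        have H1 := hr v; have H2 := hr t.
        have := ler_normD (x v - x c) (x c - x t); rewrite addrA subrK.
        move/le_trans; apply.
        rewrite (distrC (x c)).
        rewrite ger0_norm ?subr_ge0// in H1.
        rewrite (distrC t) ger0_norm ?subr_ge0// in H2.
        have := H1 _; have := H2 _ => {H1 H2} h2 h1.
        have -> : v - t = (v - c) + (c - t) by ring.
        by rewrite mulrDr lerD// ?h1 ?h2//; lra.
      move=> y /=; rewrite in_itv/= => /andP[ty yv]; apply: hr.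
      by rewrite /ball /= ltr_norml; apply/andP; split; lra.
    have bc : b <= c.
      rewrite leNgt; apply/negP => ltcb.
      pose v := Num.min b (c + r / 2).
      have cv : c < v by rewrite lt_min ltcb ltrDl divr_gt0.
      have vb : v <= b by rewrite ge_min lexx.
      have vr : v < c + r.
        by rewrite gt_min; apply/orP; right; lra.
      have : v <= c.
        apply: ub_le_sup; first exact: Sb.2.
        by split; [apply/andP; split => //; lra|apply: chv => //; exact: ltW].
      by rewrite leNgt cv.
    by apply: chv => //; lra.
  move: chb => [n [l [r [H1 H2 H3 H4]]]].
  rewrite (le_trans H4)// subr0 lerD2l// ltW//.
  have tI : trivIset setT (fun i : 'I_n => `]l i, r i[%classic).
    move=> i j _ _ [y [/=]]; rewrite !in_itv/= => /andP[a1 a2] /andP[a3 a4].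
    apply: val_inj; case: (ltngtP (val i) (val j)) => // ij.
      by exfalso; have := H3 _ _ ij (ltn_ord j); lra.
    by exfalso; have := H3 _ _ ij (ltn_ord i); lra.
  apply: (hd n (fun i => l i) (fun i => r i)) => //.
    by move=> i; have [] := H1 i (ltn_ord i).
  rewrite -lte_fin (le_lt_trans _ Od)// -sumEFin.
  have -> : (\sum_(i < n) (r i - l i)%:E = \sum_(i < n) mu `]l i, r i[%classic)%E.
    apply: eq_bigr => i _; rewrite lebesgue_measure_itv/= lte_fin.
    have [_ + _] := H1 i (ltn_ord i); rewrite le_eqVlt => /predU1P[->|->//].
    by rewrite ltxx subrr.
  rewrite -(@measure_semi_additive_ord _ _ _ mu n (fun i : 'I_n => `]l i, r i[%classic))//; last first.
    by apply: bigsetU_measurable.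
  rewrite le_measure ?inE//; first exact: bigsetU_measurable.
  elim/big_ind : _ => //; first by move=> ? ? ? ?; rewrite subUset.
  by move=> i _; exact: H2.
apply/eqP; rewrite -subr_eq0 -normr_le0; apply/ler_addgt0Pl => e e0.
have b1 : 0 < b + 1 by lra.
have := key (e / (b + 1)) (divr_gt0 e0 b1).
by rewrite -{2}(mulr1 (e / _)) -mulrDr mulfVK ?gt_eqF// addr0.
Qed.
End AbsoluteContinuity.

(** * Primitives of locally integrable functions *)

Section Primitive.
Context {R : realType}.
Local Notation mu := (@lebesgue_measure R).
Implicit Types (h k : R -> R) (b s t : R).

(** Local integrability on the half-line for the Borel sigma-algebra; [locally_integrable_on_Time]
    refers to the completed measure instead. *)
Definition lint h := forall b, mu.-integrable `[0, b] (EFin \o h).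

Definition prim h t := \int[mu]_(s in `[0, t]) h s.

Lemma Time_bigcup : @Time R = \bigcup_n `[0, n%:R]%classic.
Proof.
apply/seteqP; split=> t; rewrite /Time /= in_itv /=; last first.
  by move=> [n _] /=; rewrite in_itv/= => /andP[->].
rewrite andbT => t0; exists (Num.truncn t).+1 => //=.
by rewrite in_itv/= t0 ltW// truncnS_gt.
Qed.

Lemma measurable_Time : measurable (@Time R).
Proof. exact: measurable_itv. Qed.

Lemma itv_Time b : `[0, b] `<=` @Time R.
Proof. by move=> t; rewrite /Time /= !in_itv/= => /andP[->]. Qed.

Lemma lint_measurable h : lint h -> measurable_fun Time h.
Proof.
move=> ih; rewrite Time_bigcup; apply/measurable_fun_bigcup => // n.
by apply/measurable_EFinP; exact: measurable_int (ih n%:R).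
Qed.

Lemma measurable_itvS b h : measurable_fun Time h -> measurable_fun `[0, b] h.
Proof. by apply: measurable_funS; [exact: measurable_Time|exact: itv_Time]. Qed.

Lemma lint_cst c : lint (cst c).
Proof.
move=> b; apply: measurable_bounded_integrable => //.
  by rewrite /= lebesgue_measure_itv/=; case: ifP => _; rewrite ltry.
by exists `|c|; split=> // M cM y _ /=; exact: ltW.
Qed.

Lemma lintD h k : lint h -> lint k -> lint (fun t => h t + k t).
Proof. by move=> ih ik b; apply: (integrableD _ (ih b) (ik b)). Qed.

Lemma lintZ c h : lint h -> lint (fun t => c * h t).
Proof. by move=> ih b; apply: (integrableZl _ c (ih b)). Qed.

Lemma lintN h : lint h -> lint (fun t => - h t).
Proof. by move=> ih b; apply: (integrableN (ih b)). Qed.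

Lemma lintB h k : lint h -> lint k -> lint (fun t => h t - k t).
Proof. by move=> ih ik; apply: lintD => //; exact: lintN. Qed.

Lemma lint_norm h : lint h -> lint (fun t => `|h t|).
Proof. by move=> ih b; apply: (integrable_abse (ih b)). Qed.

Lemma lint_le h k : measurable_fun Time h ->
  (forall t, 0 <= t -> `|h t| <= k t) -> lint k -> lint h.
Proof.
move=> mh hk ik b; apply: le_integrable (ik b) => //.
  by apply/measurable_EFinP; exact: measurable_itvS.
move=> t /=; rewrite in_itv/= => /andP[t0 _].
by rewrite lee_fin (le_trans (hk _ t0))// ler_norm.
Qed.

Lemma eq_lint h k : (forall t, 0 <= t -> h t = k t) -> lint h -> lint k.
Proof.
move=> hk ih b; apply: eq_integrable (ih b) => //.
by move=> t; rewrite inE /= in_itv/= => /andP[t0 _]; rewrite hk.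
Qed.

Lemma lint_sum I (r : seq I) (h : I -> R -> R) :
  (forall i, lint (h i)) -> lint (fun t => \sum_(i <- r) h i t).
Proof.
move=> ih; elim: r => [|i r IH].
  by apply: eq_lint (lint_cst 0) => t _; rewrite big_nil.
by apply: eq_lint (lintD (ih i) IH) => t _; rewrite big_cons.
Qed.

Lemma lint_bounded h k : measurable_fun Time h -> lint k ->
  (forall b, exists M, forall t, 0 <= t <= b -> `|h t| <= M) ->
  lint (fun t => h t * k t).
Proof.
move=> mh ik hM b; have [M hb] := hM b.
apply: (integrableMr _ _ _ (ik b)) => //; first exact: measurable_itvS.
exists M; split; first exact: num_real.
by move=> N MN t /=; rewrite in_itv/= => /hb /le_trans; apply; exact: ltW.
Qed.

Lemma lint_indic h (E : set R) : lint h -> measurable E ->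
  lint (fun t => h t * \1_E t).
Proof.
move=> ih mE; apply: (@lint_le _ (fun t => `|h t|)) (lint_norm ih).
  apply: measurable_funM; first exact: lint_measurable.
  exact: measurable_funTS.
by move=> t _; rewrite normrM ler_piMr// ger0_norm ?indic_ge0// indicE lern1 leq_b1.
Qed.

Lemma prim0 h : prim h 0 = 0.
Proof. by rewrite /prim set_itv1 Rintegral_set1. Qed.

Lemma eq_prim h k t : (forall s, 0 <= s <= t -> h s = k s) -> prim h t = prim k t.
Proof.
by move=> hk; apply: eq_Rintegral => s; rewrite inE/= in_itv/= => /hk.
Qed.

Lemma primD h k t : lint h -> lint k ->
  prim (fun s => h s + k s) t = prim h t + prim k t.
Proof. by move=> ih ik; rewrite /prim RintegralD. Qed.

Lemma primZ c h t : lint h -> prim (fun s => c * h s) t = c * prim h t.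
Proof. by move=> ih; rewrite /prim RintegralZl. Qed.

Lemma primN h t : lint h -> prim (fun s => - h s) t = - prim h t.
Proof.
by move=> ih; rewrite -mulN1r -primZ//; apply: eq_prim => s _; rewrite mulN1r.
Qed.

Lemma primB h k t : lint h -> lint k ->
  prim (fun s => h s - k s) t = prim h t - prim k t.
Proof. by move=> ih ik; rewrite /prim RintegralB. Qed.

Lemma prim_cst c t : 0 <= t -> prim (cst c) t = c * t.
Proof.
move=> t0; rewrite /prim Rintegral_cst//= lebesgue_measure_itv/= lte_fin.
by case: ltgtP t0 => // [t0 _|<- _] /=; rewrite ?subr0.
Qed.

Lemma prim_incr h s t : lint h -> 0 <= s -> s <= t ->
  prim h t - prim h s = \int[mu]_(r in `]s, t]) h r.
Proof. by move=> ih s0 st; rewrite /prim Rintegral_itvB// ?bnd_simp. Qed.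

Lemma lint_itv h s t : lint h -> 0 <= s -> mu.-integrable `]s, t] (EFin \o h).
Proof.
move=> ih s0; apply: integrableS (ih t) => //.
by apply: subset_itvr; rewrite bnd_simp.
Qed.

Lemma prim_le2 h k s t : lint h -> lint k -> 0 <= s -> s <= t ->
  (forall r, s <= r <= t -> h r <= k r) ->
  prim h t - prim h s <= prim k t - prim k s.
Proof.
move=> ih ik s0 st hk; rewrite !prim_incr//.
apply: le_Rintegral => //; try exact: lint_itv.
by move=> r /=; rewrite in_itv/= => /andP[sr rt]; apply: hk; rewrite ltW.
Qed.

Lemma prim_le h k t : lint h -> lint k -> 0 <= t ->
  (forall r, 0 <= r <= t -> h r <= k r) -> prim h t <= prim k t.
Proof.
by move=> ih ik t0 hk; have := prim_le2 ih ik (lexx 0) t0 hk; rewrite !prim0 !subr0.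
Qed.

Lemma prim_norm_le2 h k s t : lint h -> lint k -> 0 <= s -> s <= t ->
  (forall r, s <= r <= t -> `|h r| <= k r) ->
  `|prim h t - prim h s| <= prim k t - prim k s.
Proof.
move=> ih ik s0 st hk; rewrite ler_norml; apply/andP; split.
  have := @prim_le2 (fun r => - k r) h s t (lintN ik) ih s0 st.
  rewrite !primN// opprB opprK => H; rewrite (le_trans _ (H _)) 1?addrC//.
  by move=> r /hk; rewrite ler_norml => /andP[].
by apply: prim_le2 => // r /hk; exact: le_trans (ler_norm _).
Qed.

Lemma prim_norm_le h k t : lint h -> lint k -> 0 <= t ->
  (forall r, 0 <= r <= t -> `|h r| <= k r) -> `|prim h t| <= prim k t.
Proof.
by move=> ih ik t0 hk; have := prim_norm_le2 ih ik (lexx 0) t0 hk; rewrite !prim0 !subr0.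
Qed.

Lemma prim_homo h s t : lint h -> (forall r, 0 <= r -> 0 <= h r) ->
  0 <= s -> s <= t -> prim h s <= prim h t.
Proof.
move=> ih h0 s0 st; rewrite -subr_ge0 prim_incr//.
apply: Rintegral_ge0 => r /=; rewrite in_itv/= => /andP[sr _].
by apply: h0; rewrite ltW// (le_lt_trans s0).
Qed.

Lemma prim_ge0 h t : (forall r, 0 <= r -> 0 <= h r) -> 0 <= prim h t.
Proof.
by move=> h0; apply: Rintegral_ge0 => r /=; rewrite in_itv/= => /andP[/h0].
Qed.

End Primitive.

Lemma prim_indic {R : realType} (E : set R) (t : R) : measurable E ->
  prim (\1_E : R -> R) t = fine (@lebesgue_measure R (E `&` `[0, t]%classic)).
Proof. by move=> mE; rewrite /prim /Rintegral integral_indic//; exact: measurable_itv. Qed.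

Lemma primE {R : realType} (h : R -> R) (t : R) :
  prim h t = \int[@lebesgue_measure R]_(s in `[0, t]) h s.
Proof. by []. Qed.

(** * Absolutely continuous functions with their densities *)

Section Carried.
Context {R : realType}.
Local Notation mu := (@lebesgue_measure R).
Implicit Types (h k x y : R -> R) (b s t : R).

Lemma aeS (P Q : R -> Prop) : {ae mu, forall t, P t} ->
  (forall t, P t -> Q t) -> {ae mu, forall t, Q t}.
Proof.
move=> HP PQ; apply: filterS HP; first exact: (ae_filter_ringOfSetsType mu).
exact: PQ.
Qed.

Lemma aeS2 (P P' Q : R -> Prop) : {ae mu, forall t, P t} ->
  {ae mu, forall t, P' t} -> (forall t, P t -> P' t -> Q t) ->
  {ae mu, forall t, Q t}.
Proof.
move=> HP HP' PQ; apply: filterS2 HP HP'; first exact: (ae_filter_ringOfSetsType mu).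
exact: PQ.
Qed.

Lemma ae_pos (P : R -> Prop) :
  {ae mu, forall t, 0 < t -> P t} -> {ae mu, forall t, Time t -> P t}.
Proof.
move=> H; have : {ae mu, forall t, t <> 0}.
  exists [set 0]; split => //; first exact: lebesgue_measure_set1.
  by move=> t /= /contrapT ->.
move=> H'; apply: (aeS2 H H') => {H'}t {}H tn0; rewrite /Time /= in_itv/= andbT le_eqVlt => /predU1P[|//].
by move=> /esym/tn0.
Qed.

(** Disjointness turns the sum of the increments into one integral over the union of the intervals,
    to which absolute continuity of the integral applies. *)
Lemma ac_prim h : lint h -> ac (prim h : R -> R^o).
Proof.
move=> ih b b0 e e0.
have ihb : mu.-integrable setT (EFin \o (h \_ `[0, b])).
  by have := ih b; rewrite integrable_mkcond//= restrict_EFin.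
have [d [d0 hd]] := integral_normr_continuous ihb e0.
exists d => // n l r lr tI lrd.
have lrE i : `|prim h (r i) - prim h (l i)| <=
   \int[mu]_(s in `]l i, r i[) `|(h \_ `[0, b]) s|.
  have [l0 [lri rb]] := lr i.
  have inh := lint_norm ih.
  rewrite prim_incr// (le_trans (le_normr_Rintegral _ _))//; first exact: lint_itv.
  rewrite -Rintegral_itv_bndo_bndc//; last first.
    by apply: integrableS (lint_itv (r i) inh l0) => //; apply: subset_itvl; rewrite bnd_simp.
  rewrite le_eqVlt; apply/orP; left; apply/eqP; apply: eq_Rintegral => s.
  rewrite inE/= in_itv/= => /andP[ls sr]; rewrite patchE mem_set//= in_itv/=.
  by rewrite !ltW ?(le_lt_trans l0)//= (lt_le_trans sr).
apply: (@le_lt_trans _ _ (\sum_i \int[mu]_(s in `]l i, r i[) `|(h \_ `[0, b]) s|)).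
  exact: ler_sum.
pose D := \big[setU/set0]_(i < n) `]l i, r i[%classic.
have mD : measurable D by exact: bigsetU_measurable.
have -> : \sum_i \int[mu]_(s in `]l i, r i[) `|(h \_ `[0, b]) s| =
   \int[mu]_(s in D) `|(h \_ `[0, b]) s|.
  rewrite /Rintegral [in RHS]/D ge0_integral_bigsetU//=; last 3 first.
  - by rewrite index_enum_uniq.
  - by apply: sub_trivIset tI.
  - apply: measurable_funS (_ : measurable_fun setT _) => //.
    exact: measurable_int (integrable_abse ihb).
  rewrite sum_fine// => i _; apply: integrable_fin_num => //.
  by apply: integrableS (integrable_abse ihb).
apply: hd => //.
have muD : mu D = (\sum_(i < n) mu `]l i, r i[%classic)%E.
  by rewrite (@measure_semi_additive_ord _ _ _ mu n (fun i : 'I_n => `]l i, r i[%classic)).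
move: lrd; rewrite -lte_fin -sumEFin => /(le_lt_trans _); apply.
rewrite le_eqVlt -[X in X == _]/(mu D) muD; apply/orP; left; apply/eqP.
apply: eq_bigr => i _.
rewrite lebesgue_measure_itv/= lte_fin.
have [_ [+ _]] := lr i; rewrite le_eqVlt => /predU1P[->|->//].
by rewrite ltxx subrr.
Qed.

(** [FTC1] asks for local integrability on the whole line, so [h] is first extended by 0 to negative
    times; the endpoint 0 is discarded as a null set by [ae_pos]. *)
Lemma prim_der h : lint h ->
  {ae mu, forall t, Time t -> is_derive t 1 (prim h : R -> R^o) (h t)}.
Proof.
move=> ih; pose f := h \_ Time.
have fE (y : R) : mu.-integrable [set` `]-oo, y]] (EFin \o f).
  have : mu.-integrable (`]-oo, y] `&` Time) (EFin \o h).
    apply: integrableS (ih y) => //.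
      by apply: measurableI => //; exact: measurable_Time.
    by move=> t [] /=; rewrite /Time /= !in_itv/= andbT => -> ->.
  by move=> H; rewrite -restrict_EFin; apply: (iffLR (integrable_restrict _ _ _ _)) H => //; exact: measurable_Time.
have fI (y : R) : mu.-integrable `[0, y] (EFin \o f).
  by apply: integrableS (fE y) => // t /=; rewrite !in_itv/= => /andP[].
have fL : locally_integrable setT f.
  split; [|exact: openT|].
    apply/(measurable_restrictT _ _).1; first exact: measurable_Time.
    exact: lint_measurable.
  move=> K _ cK; have mK := compact_measurable cK.
  have [M [_ hM]] := compact_bounded cK.
  have KM : K `<=` `]-oo, M + 1].
    move=> t Kt; rewrite /= in_itv/= (le_trans (ler_norm t))//.
    by apply: hM Kt; rewrite ltrDl.
  have iK : mu.-integrable K (EFin \o f).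
    by apply: integrableS (fE (M + 1)) => //; exact: measurable_itv.
  by have /integrableP[] := iK.
apply: ae_pos; apply: (aeS (FTC1 fI fL)) => t H tgt0.
have t0 := ltW tgt0.
case: H => [|dF vF]; first by rewrite /Order.lt /=.
have ft : f t = h t by rewrite /f patchE mem_set// /Time /= in_itv/= andbT.
have FE : prim f = prim h.
  apply/funext => x; apply: eq_prim => s /andP[s0 _].
  by rewrite /f patchE mem_set// /Time /= in_itv/= andbT.
have {}dF : derivable (prim f) t 1 := dF.
have {}vF : derive1 (prim f) t = f t := vF.
by move: dF vF; rewrite FE ft derive1E => dF vF; split.
Qed.

(** The working form of absolute continuity: a Borel density is carried along, so that an almost
    everywhere differential equation becomes an identity between primitives. *)
Definition acd x h := lint h /\ forall t, 0 <= t -> x t = x 0 + prim h t.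

Lemma ac_continuous (V : normedModType R) (x : R -> V) :
  ac x -> {within Time, continuous x}.
Proof.
move=> acx; apply/subspace_continuousP => t; rewrite /Time /= in_itv/= andbT => t0.
apply/cvgrPdist_lt => e e0.
have [|d d0 hd] := acx (t + 1) _ e e0; first lra.
have m0 : 0 < Num.min 1 d by rewrite lt_min ltr01.
near=> s.
have s0 : 0 <= s.
  have : Time s by near: s; exact: withinT.
  by rewrite /Time /= in_itv/= andbT.
have st1 : `|t - s| < Num.min 1 d.
  by near: s; apply: cvg_within; apply: nbhsx_ballx.
move: st1; rewrite lt_min => /andP[st1 std].
have key u v : 0 <= u -> u <= v -> v <= t + 1 -> v - u < d -> `|x v - x u| < e.
  move=> u0 uv vt uvd; have := hd 1%N (fun=> u) (fun=> v).
  rewrite !big_ord1; apply => //.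
  by move=> i j _ _ _; rewrite !ord1.
have [ts|st] := leP t s.
  rewrite distrC; apply: key => //; move: st1 std; rewrite distrC ger0_norm ?subr_ge0//; lra.
by apply: key => //; move: st1 std; rewrite ger0_norm ?subr_ge0//; lra.
Unshelve. all: by end_near. Qed.

Lemma ac_measurable (x : R -> R^o) : ac x -> measurable_fun Time (x : R -> R).
Proof.
move=> acx; apply: subspace_continuous_measurable_fun; first exact: measurable_Time.
exact: ac_continuous.
Qed.

Lemma eq_ac (V : normedModType R) (x y : R -> V) :
  (forall t, 0 <= t -> x t = y t) -> ac x -> ac y.
Proof.
move=> xy acx b b0 e e0; have [d d0 hd] := acx b b0 e e0; exists d => // n l r lr tI lrd.
rewrite (eq_bigr (fun i => `|x (r i) - x (l i)|)); first exact: hd.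
by move=> i _; have [? [? ?]] := lr i; rewrite !xy// (le_trans _ (_ : l i <= _)).
Qed.

Lemma acD (V : normedModType R) (x y : R -> V) : ac x -> ac y -> ac (fun t => x t + y t).
Proof.
move=> acx acy b b0 e e0; have e2 : 0 < e / 2 by rewrite divr_gt0.
have [d d0 hd] := acx b b0 _ e2; have [d' d'0 hd'] := acy b b0 _ e2.
exists (Num.min d d'); first by rewrite lt_min d0.
move=> n l r lr tI; rewrite lt_min => /andP[l1 l2].
rewrite (le_lt_trans (_ : _ <= \sum_i (`|x (r i) - x (l i)| + `|y (r i) - y (l i)|)))//.
  by apply: ler_sum => i _; rewrite opprD addrACA ler_normD.
by rewrite big_split /= (splitr e) ltrD// ?hd// hd'.
Qed.

(** Serves negation, entries, norms and exponentials, each of which is Lipschitz in the given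
    function over bounded time intervals. *)
Lemma ac_dominated (V W : normedModType R) (x : R -> V) (y : R -> W) :
  (forall b, 0 <= b -> exists C, forall s t, 0 <= s <= b -> 0 <= t <= b ->
     `|y t - y s| <= C * `|x t - x s|) -> ac x -> ac y.
Proof.
move=> xy acx b b0 e e0; have [C hC] := xy b b0.
have C0 : 0 < `|C| + 1 by rewrite ltr_wpDl.
have [d d0 hd] := acx b b0 _ (divr_gt0 e0 C0).
exists d => // n l r lr tI lrd.
have := hd n l r lr tI lrd; rewrite ltr_pdivlMr// mulrC mulr_sumr.
apply: le_lt_trans; apply: ler_sum => i _.
have [l0 [lri rb]] := lr i.
rewrite (le_trans (hC _ _ _ _))//; try by apply/andP; split; lra.
by rewrite ler_wpM2r// (le_trans (ler_norm _))// lerDl.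
Qed.

Lemma acN (V : normedModType R) (x : R -> V) : ac x -> ac (fun t => - x t).
Proof.
apply: ac_dominated => b b0; exists 1 => s t _ _.
by rewrite mul1r -opprD normrN.
Qed.

Lemma ac_cst (V : normedModType R) (v : V) : ac (fun=> v).
Proof.
move=> b b0 e e0; exists 1 => // n l r _ _ _.
by rewrite big1// => i _; rewrite subrr normr0.
Qed.

Lemma acd_lint x h : acd x h -> lint h. Proof. by case. Qed.

Lemma acd_ac x h : acd x h -> ac (x : R -> R^o).
Proof.
move=> [ih xE]; apply: (@eq_ac _ (fun t => x 0 + prim h t)).
  by move=> t t0; rewrite -xE.
by apply: acD; [exact: ac_cst|exact: ac_prim].
Qed.

Lemma acd_measurable x h : acd x h -> measurable_fun Time x.
Proof. by move=> /acd_ac/ac_measurable. Qed.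

Lemma acd_bounded x h b : acd x h -> exists M, forall t, 0 <= t <= b -> `|x t| <= M.
Proof.
move=> [ih xE]; exists (`|x 0| + prim (fun t => `|h t|) b) => t /andP[t0 tb].
rewrite xE// (le_trans (ler_normD _ _))// lerD2l//.
rewrite (@le_trans _ _ (prim (fun t => `|h t|) t))//.
  by apply: prim_norm_le => //; exact: lint_norm.
by apply: prim_homo => //; exact: lint_norm.
Qed.

Lemma is_derive_near (x y : R -> R^o) t d : 0 < t ->
  (forall s, 0 <= s -> x s = y s) -> is_derive t 1 x d -> is_derive t 1 y d.
Proof.
move=> t0 xy; apply: near_eq_is_derive.
near=> s; apply/xy/ltW; near: s; exact: lt_nbhsr.
Unshelve. all: by end_near. Qed.

Lemma acd_der x h : acd x h ->
  {ae mu, forall t, Time t -> is_derive t 1 (x : R -> R^o) (h t)}.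
Proof.
move=> [ih xE]; apply: ae_pos; apply: (aeS (prim_der ih)) => t H t0.
apply: (@is_derive_near (cst (x 0) + prim h)) => //.
  by move=> s s0; rewrite [RHS]xE.
rewrite -(add0r (h t)); apply: is_deriveD.
by apply: H; rewrite /Time /= in_itv/= andbT ltW.
Qed.

(** The difference of [x] and the primitive of [h] has derivative 0 almost everywhere, so [ac_const]
    applies. *)
Lemma acd_intro (x : R -> R^o) h : ac x -> lint h ->
  {ae mu, forall t, Time t -> is_derive t 1 x (h t)} -> acd x h.
Proof.
move=> acx ih dx; split=> // t t0.
have : (fun s => x s - prim h s : R^o) t = (fun s => x s - prim h s : R^o) 0.
  apply: (@ac_const _ (fun s => x s - prim h s : R^o)) => //.
    by apply: acD => //; apply: acN; exact: ac_prim.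
  apply: (aeS2 dx (prim_der ih)) => s H1 H2 s0.
  by rewrite -(subrr (h s)); apply: is_deriveB; [exact: H1|exact: H2].
by rewrite /= prim0 subr0 => /eqP; rewrite subr_eq => /eqP.
Qed.

End Carried.

Global Opaque prim.

(** * Calculus rules for scalar and matrix functions *)

Section Calculus.
Context {R : realType}.
Local Notation mu := (@lebesgue_measure R).
Implicit Types (h k x y : R -> R) (b s t : R).

Lemma ae_forall_fin (I : finType) (P : I -> R -> Prop) :
  (forall i, {ae mu, forall t, P i t}) -> {ae mu, forall t, forall i, P i t}.
Proof.
move=> HP; apply: filter_forall HP; exact: (ae_filter_ringOfSetsType mu).
Qed.

Lemma eq_acd x y h k : (forall t, 0 <= t -> x t = y t) ->
  (forall t, 0 <= t -> h t = k t) -> acd x h -> acd y k.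
Proof.
move=> xy hk [ih xE]; split; first exact: eq_lint ih.
move=> t t0; rewrite -!xy// xE//; congr (_ + _).
by apply: eq_prim => s /andP[s0 _]; exact: hk.
Qed.

Lemma acd_cst (c : R) : acd (cst c) (cst 0).
Proof.
by split=> [|t t0]; [exact: lint_cst|rewrite prim_cst// mul0r addr0].
Qed.

Lemma acd_prim h : lint h -> acd (prim h) h.
Proof. by move=> ih; split=> // t t0; rewrite prim0 add0r. Qed.

Lemma acdD x y h k : acd x h -> acd y k ->
  acd (fun t => x t + y t) (fun t => h t + k t).
Proof.
move=> [ih xE] [ik yE]; split; first exact: lintD.
by move=> t t0; rewrite primD// xE// yE// addrACA.
Qed.

Lemma acdN x h : acd x h -> acd (fun t => - x t) (fun t => - h t).
Proof.
move=> [ih xE]; split; first exact: lintN.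
by move=> t t0; rewrite primN// xE// opprD.
Qed.

Lemma acdB x y h k : acd x h -> acd y k ->
  acd (fun t => x t - y t) (fun t => h t - k t).
Proof. by move=> xh /acdN; exact: acdD. Qed.

Lemma acdZ c x h : acd x h -> acd (fun t => c * x t) (fun t => c * h t).
Proof.
move=> [ih xE]; split; first exact: lintZ.
by move=> t t0; rewrite primZ// xE// mulrDr.
Qed.

Lemma acd_sum I (r : seq I) (x h : I -> R -> R) : (forall i, acd (x i) (h i)) ->
  acd (fun t => \sum_(i <- r) x i t) (fun t => \sum_(i <- r) h i t).
Proof.
move=> H; elim: r => [|i r IH].
  by apply: eq_acd (acd_cst 0) => t _; rewrite big_nil.
by apply: eq_acd (acdD (H i) IH) => t _; rewrite big_cons.
Qed.

Lemma lint_acdM x h k : acd x h -> lint k -> lint (fun t => x t * k t).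
Proof.
move=> xh ik; apply: lint_bounded => //; first exact: acd_measurable xh.
by move=> b; apply: acd_bounded xh.
Qed.

Let acM (x y : R -> R^o) : ac x -> ac y ->
  (forall b, exists M, forall t, 0 <= t <= b -> `|x t| <= M) ->
  (forall b, exists M, forall t, 0 <= t <= b -> `|y t| <= M) ->
  ac (fun t => x t * y t : R^o).
Proof.
move=> acx acy bx by_ b b0 e e0.
have [M1 hM1] := bx b; have [M2 hM2] := by_ b.
pose M := `|M1| + `|M2| + 1.
have M0 : 0 < M by rewrite ltr_wpDl// addr_ge0.
have M1M : M1 <= M by rewrite (le_trans (ler_norm _))// /M -addrA lerDl addr_ge0.
have M2M : M2 <= M by rewrite (le_trans (ler_norm _))// /M (addrC `|M1|) -addrA lerDl addr_ge0.
have eM : 0 < e / 2 / M by rewrite !divr_gt0.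
have [d d0 hd] := acx b b0 _ eM; have [d' d'0 hd'] := acy b b0 _ eM.
exists (Num.min d d'); first by rewrite lt_min d0.
move=> n l r lr tI; rewrite lt_min => /andP[l1 l2].
apply: (@le_lt_trans _ _ (\sum_i (M * `|x (r i) - x (l i)| + M * `|y (r i) - y (l i)|))).
  apply: ler_sum => i _; have [l0 [lri rb]] := lr i.
  have -> : x (r i) * y (r i) - x (l i) * y (l i) =
    (y (r i)) * (x (r i) - x (l i)) + x (l i) * (y (r i) - y (l i)) :> R.
    by rewrite !mulrBr (mulrC (y _)) (mulrC (y _)) addrA subrK.
  rewrite (le_trans (ler_normD _ _))// !normrM lerD// ler_wpM2r//.
    by rewrite (le_trans (hM2 _ _))//; apply/andP; split; lra.
  by rewrite (le_trans (hM1 _ _))//; apply/andP; split; lra.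
rewrite big_split /= -!mulr_sumr (splitr e) ltrD//.
  by rewrite mulrC -ltr_pdivlMr//; exact: hd.
by rewrite mulrC -ltr_pdivlMr//; exact: hd'.
Qed.

(** Local boundedness of both factors makes the product absolutely continuous; its almost everywhere
    derivative then determines it through [acd_intro]. *)
Lemma acdM x y h k : acd x h -> acd y k ->
  acd (fun t => x t * y t) (fun t => h t * y t + x t * k t).
Proof.
move=> xh yk; apply: acd_intro.
- apply: acM; [exact: acd_ac xh|exact: acd_ac yk| |] => b.
    exact: acd_bounded xh.
  exact: acd_bounded yk.
- apply: lintD; last exact: lint_acdM xh (acd_lint yk).
  by apply: eq_lint (lint_acdM yk (acd_lint xh)) => t _; rewrite mulrC.
- apply: (aeS2 (acd_der xh) (acd_der yk)) => t H1 H2 t0.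
  have := is_deriveM (H1 t0) (H2 t0).
  by rewrite /GRing.scale /= (addrC (h t * y t)) (mulrC (h t)).
Qed.

Lemma acd_exp x h : acd x h -> acd (fun t => expR (x t)) (fun t => h t * expR (x t)).
Proof.
move=> xh.
have acE : ac (fun t => expR (x t) : R^o).
  apply: ac_dominated (acd_ac xh) => b b0.
  have [M hM] := acd_bounded b xh; exists (expR M) => s t sb tb.
  have key u v : 0 <= u <= b -> x u <= x v -> expR (x v) - expR (x u) <= expR (x v) * (x v - x u).
    move=> ub uv; have := expR_ge1Dx (x u - x v).
    have -> : expR (x u) = expR (x v) * expR (x u - x v) by rewrite -expRD addrC subrK.
    move=> H1; rewrite -{1}(mulr1 (expR (x v))) -mulrBr ler_wpM2l ?expR_ge0//; lra.
  have eM u : 0 <= u <= b -> expR (x u) <= expR M.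
    by move=> /hM; rewrite ler_expR; apply: le_trans; exact: ler_norm.
  wlog st : s t sb tb / x s <= x t => [H|].
    have [/H|/ltW/H] := leP (x s) (x t); first exact.
    by rewrite distrC (distrC (x s)); exact.
  rewrite !ger0_norm ?subr_ge0// ?ler_expR//.
  by rewrite (le_trans (key _ _ sb st))// ler_wpM2r ?subr_ge0// eM.
apply: acd_intro => //.
  apply: (@eq_lint _ (fun t => expR (x t) * h t)) => [t _|]; first by rewrite mulrC.
  apply: lint_bounded (acd_lint xh) _; first exact: ac_measurable.
  move=> b; have [M hM] := acd_bounded b xh; exists (expR M) => t tb.
  by rewrite ger0_norm ?expR_ge0// ler_expR (le_trans (ler_norm _))// hM.
apply: (aeS (acd_der xh)) => t H t0.
have := is_derive1_comp (is_derive_expR (x t)) (H t0).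
by rewrite mulrC.
Qed.

Section Matrices.
Context {p q : nat}.
Implicit Types (X H : R -> 'M[R]_(p, q)).

Lemma mx_norm_entry (A : 'M[R]_(p, q)) i j : `|A i j| <= `|A|.
Proof.
rewrite [leRHS]/Num.Def.normr/= mx_normrE.
exact: (le_bigmax _ (fun ij => `|A ij.1 ij.2|) (i, j)).
Qed.

Lemma mx_norm_le (A : 'M[R]_(p, q)) c : 0 <= c ->
  (forall i j, `|A i j| <= c) -> `|A| <= c.
Proof.
by move=> c0 Ac; rewrite [leLHS]/Num.Def.normr/= mx_normrE bigmax_le.
Qed.

Definition acdx X H := forall i j, acd (fun t => X t i j) (fun t => H t i j).

Lemma ac_entry X i j : ac X -> ac (fun t => X t i j : R^o).
Proof.
apply: ac_dominated => b b0; exists 1 => s t _ _; rewrite mul1r.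
by have := mx_norm_entry (X t - X s) i j; rewrite !mxE.
Qed.

Lemma ac_mx X : (forall i j, ac (fun t => X t i j : R^o)) -> ac X.
Proof.
move=> H.
have S (V : normedModType R) I (r : seq I) (Y : I -> R -> V) :
    (forall i, ac (Y i)) -> ac (fun t => \sum_(i <- r) Y i t).
  move=> HY; elim: r => [|i r IH].
    by apply: eq_ac (ac_cst 0) => t _; rewrite big_nil.
  by apply: eq_ac (acD (HY i) IH) => t _; rewrite big_cons.
apply: (@eq_ac _ _ (fun t => \sum_i \sum_j X t i j *: delta_mx i j)).
  by move=> t _; rewrite -matrix_sum_delta.
apply: (S _ _ _ (fun i t => \sum_j X t i j *: delta_mx i j)) => i.
apply: (S _ _ _ (fun j t => X t i j *: delta_mx i j)) => j.
apply: ac_dominated (H i j) => b b0; exists `|delta_mx i j : 'M[R]_(p, q)| => s t _ _.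
by rewrite -scalerBl normrZ mulrC.
Qed.

Lemma acdx_ac X H : acdx X H -> ac X.
Proof. by move=> XH; apply: ac_mx => i j; exact: acd_ac (XH i j). Qed.

Lemma is_derive_mxP X D t :
  is_derive t 1 X D <-> forall i j, is_derive t 1 (fun s => X s i j : R^o) (D i j).
Proof.
split=> [[dX <-] i j|H].
  split; first by move/derivable_mxP : dX.
  by rewrite derive_mx// mxE.
have dX : derivable X t 1 by apply/derivable_mxP => i j; have [] := H i j.
split=> //; rewrite derive_mx//; apply/matrixP => i j; rewrite mxE.
by have [_ ->] := H i j.
Qed.

Lemma acdx_ode (F : R -> 'M[R]_(p, q) -> 'M[R]_(p, q)) X H : acdx X H ->
  {ae mu, forall t, Time t -> H t = F t (X t)} -> ode F X.
Proof.
move=> XH HF; split; first exact: acdx_ac XH.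
have dX : {ae mu, forall t, forall ij : 'I_p * 'I_q,
    Time t -> is_derive t 1 (fun s => X s ij.1 ij.2 : R^o) (H t ij.1 ij.2)}.
  by apply: ae_forall_fin => ij; exact: acd_der (XH ij.1 ij.2).
apply: (aeS2 dX HF) => t H1 H2 t0; rewrite -H2//.
by apply/is_derive_mxP => i j; exact: (H1 (i, j)).
Qed.

(** The right-hand side of the equation need not be Borel in time; [H] is a locally integrable
    representative of it. *)
Lemma ode_acdx (F : R -> 'M[R]_(p, q) -> 'M[R]_(p, q)) X H : ode F X ->
  (forall i j, lint (fun t => H t i j)) ->
  {ae mu, forall t, Time t -> H t = F t (X t)} -> acdx X H.
Proof.
move=> [acX dX] iH HF i j; apply: acd_intro => //; first exact: ac_entry.
apply: (aeS2 dX HF) => t H1 H2 t0; rewrite H2//.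
by have /is_derive_mxP := H1 t0; exact.
Qed.

Lemma acdx_measurable X H i j : acdx X H -> measurable_fun Time (fun t => X t i j).
Proof. by move=> XH; exact: acd_measurable (XH i j). Qed.

Lemma acdx_lint X H i j : acdx X H -> lint (fun t => H t i j).
Proof. by move=> XH; exact: acd_lint (XH i j). Qed.

Lemma eq_acdx X Y H K : (forall t, 0 <= t -> X t = Y t) ->
  (forall t, 0 <= t -> H t = K t) -> acdx X H -> acdx Y K.
Proof.
move=> XY HK XH i j; apply: eq_acd (XH i j) => t t0; first by rewrite XY.
by rewrite HK.
Qed.

Lemma acdxB X Y H K : acdx X H -> acdx Y K ->
  acdx (fun t => X t - Y t) (fun t => H t - K t).
Proof.
by move=> XH YK i j; apply: eq_acd (acdB (XH i j) (YK i j)) => t _; rewrite !mxE.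
Qed.

Lemma acdx_incr X H k s t : acdx X H -> lint k -> 0 <= s -> s <= t ->
  (forall r, s <= r <= t -> `|H r| <= k r) ->
  `|X t - X s| <= prim k t - prim k s.
Proof.
move=> XH ik s0 st Hk; apply: mx_norm_le.
  rewrite subr_ge0 -subr_ge0 prim_incr//; apply: Rintegral_ge0 => r /=.
  rewrite in_itv/= => /andP[sr rt]; rewrite (le_trans _ (Hk _ _))// rt andbT; exact: ltW.
move=> i j; have [ih XE] := XH i j.
rewrite !mxE XE ?(le_trans s0)// [X in _ - X]XE// opprD addrACA subrr add0r.
apply: prim_norm_le2 => // r rst; exact: le_trans (mx_norm_entry _ _ _) (Hk _ rst).
Qed.

Lemma acdx_bounded X H b : acdx X H -> exists M, forall t, 0 <= t <= b -> `|X t| <= M.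
Proof.
move=> XH; exists (`|X 0| + prim (fun t => \sum_ij `|H t ij.1 ij.2|) b) => t /andP[t0 tb].
have ik : lint (fun t => \sum_ij `|H t ij.1 ij.2|).
  by apply: lint_sum => ij; apply: lint_norm; exact: acdx_lint XH.
have -> : X t = X 0 + (X t - X 0) by rewrite addrC subrK.
rewrite (le_trans (ler_normD _ _))// lerD2l.
rewrite (le_trans (acdx_incr XH ik (lexx 0) t0 _))//.
  move=> r _; apply: mx_norm_le; first exact: sumr_ge0.
  by move=> i j; rewrite (bigD1 (i, j))//= lerDl sumr_ge0.
by rewrite prim0 subr0; apply: prim_homo => // r _; exact: sumr_ge0.
Qed.

Lemma ac_norm X : ac X -> ac (fun t => `|X t| : R^o).
Proof.
apply: ac_dominated => b b0; exists 1 => s t _ _; rewrite mul1r.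
exact: ler_dist_dist.
Qed.

Lemma lint_normM X H k : acdx X H -> lint k -> lint (fun t => `|X t| * k t).
Proof.
move=> XH ik; apply: lint_bounded => //.
  by apply: ac_measurable; apply: ac_norm; exact: acdx_ac XH.
move=> b; have [M hM] := acdx_bounded b XH; exists M => t tb.
by rewrite normr_id hM.
Qed.

End Matrices.
End Calculus.

Global Opaque expR.

(** * Gronwall inequalities and uniqueness *)

Section Gronwall.
Context {R : realType}.
Implicit Types (h k x y phi L m : R -> R) (b s t : R).

Lemma acd_ge x h k s t : acd x h -> lint k -> 0 <= s -> s <= t ->
  (forall r, s <= r <= t -> k r <= h r) -> prim k t - prim k s <= x t - x s.
Proof.
move=> [ih xE] ik s0 st hk; have t0 := le_trans s0 st.
rewrite (xE t)// (xE s)// opprD addrACA subrr add0r.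
exact: prim_le2.
Qed.

(** The factor [expR (- prim L)] removes the linear term: its product with the right-hand side [Psi]
    of the hypothesis grows at rate at most [m]. *)
Lemma gronwall_fwd phi L m (c b : R) : lint L -> (forall t, 0 <= t -> 0 <= L t) ->
  lint m -> (forall t, 0 <= t -> 0 <= m t) -> lint (fun s => phi s * L s) -> 0 <= c ->
  (forall t, 0 <= t <= b -> phi t <= c + prim (fun s => phi s * L s + m s) t) ->
  forall t, 0 <= t <= b -> phi t <= expR (prim L t) * (c + prim m t).
Proof.
move=> iL L0 im m0 iLp c0 Hphi t tb.
have iH : lint (fun s => phi s * L s + m s) by exact: lintD.
pose Psi s := c + prim (fun s => phi s * L s + m s) s.
have dPsi : acd Psi (fun s => 0 + (phi s * L s + m s)).
  by apply: acdD (acd_cst c) (acd_prim iH).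
have dE := acd_exp (acdN (acd_prim iL)).
have d := acdM dE dPsi.
have [t0 tb'] := andP tb.
rewrite (le_trans (Hphi t tb))// -/(Psi t).
have -> : Psi t = expR (prim L t) * (expR (- prim L t) * Psi t).
  by rewrite mulrA -expRD subrr expR0 mul1r.
rewrite ler_wpM2l ?expR_ge0// (d.2 _ t0) {1}/Psi !prim0 oppr0 expR0 mul1r addr0 lerD2l.
apply: prim_le => //; first exact: d.1.
move=> r /andP[r0 rt]; rewrite add0r.
have E1 : expR (- prim L r) <= 1.
  by rewrite -expR0 ler_expR oppr_le0; apply: prim_ge0.
have E0 := expR_ge0 (- prim L r).
have HH := Hphi r; rewrite r0 (le_trans rt tb') -/(Psi r) in HH.
have {}HH : phi r <= Psi r by exact: HH.
have H1 : expR (- prim L r) * L r * phi r <= expR (- prim L r) * L r * Psi r.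
  by rewrite ler_wpM2l// mulr_ge0// L0.
have H2 : expR (- prim L r) * m r <= m r by rewrite ler_piMl// m0.
by move: H1 H2; lra.
Qed.

(** The mirror argument: [E * Psi] decreases at rate at most [E * m]. The factor [E] stays under the
    integral instead of being estimated, so that a weight can absorb it later. *)
Lemma gronwall_bwd phi L m (c b : R) : lint L -> (forall t, 0 <= t -> 0 <= L t) ->
  lint m -> lint (fun s => phi s * L s) ->
  (forall t, 0 <= t <= b ->
     phi t <= c + (prim (fun s => phi s * L s + m s) b - prim (fun s => phi s * L s + m s) t)) ->
  let E s := expR (prim L s) in
  forall t, 0 <= t <= b ->
    E t * phi t <= E b * c + (prim (fun s => E s * m s) b - prim (fun s => E s * m s) t).
Proof.
move=> iL L0 im iLp Hphi E t /andP[t0 tb].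
have iH : lint (fun s => phi s * L s + m s) by exact: lintD.
pose cb := c + prim (fun s => phi s * L s + m s) b.
pose Psi s := cb - prim (fun s => phi s * L s + m s) s.
have dPsi : acd Psi (fun s => 0 - (phi s * L s + m s)).
  by apply: acdB (acd_cst cb) (acd_prim iH).
have dE := acd_exp (acd_prim iL).
have d := acdM dE dPsi.
have iEm : lint (fun s => E s * m s) by apply: lint_acdM dE im.
have Hp s : 0 <= s <= b -> phi s <= Psi s.
  by move=> /Hphi; rewrite /Psi /cb addrA.
have HPb : Psi b = c by rewrite /Psi /cb addrK.
rewrite (@le_trans _ _ (E t * Psi t))//.
  by rewrite ler_wpM2l ?expR_ge0// Hp// t0.
have b0 := le_trans t0 tb.
have iN := lintN iEm.
have := acd_ge d iN t0 tb; rewrite !primN// -/(E b) -/(E t) HPb => H.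
have aux (p1 p2 p3 p4 : R) : - p1 - - p2 <= p3 - p4 -> p4 <= p3 + (p1 - p2) by clear; lra.
apply: aux.
apply: H => r /andP[tr rb].
have Hr : phi r <= Psi r by apply: Hp; rewrite rb (le_trans t0 tr).
have H1 : E r * L r * phi r <= E r * L r * Psi r.
  by rewrite ler_wpM2l// mulr_ge0 ?expR_ge0// L0// (le_trans t0 tr).
by move: H1; rewrite -/(E r); lra.
Qed.

Section Vectors.
Context {p q : nat}.
Implicit Types (X H : R -> 'M[R]_(p, q)).

Lemma acdx_fwd X H L m b : acdx X H -> lint L -> (forall t, 0 <= t -> 0 <= L t) ->
  lint m -> (forall t, 0 <= t -> 0 <= m t) ->
  (forall s, 0 <= s <= b -> `|H s| <= `|X s| * L s + m s) ->
  forall t, 0 <= t <= b -> `|X t| <= expR (prim L t) * (`|X 0| + prim m t).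
Proof.
move=> XH iL L0 im m0 HX; apply: gronwall_fwd => //; first exact: lint_normM XH iL.
move=> t /andP[t0 tb]; have iH := lintD (lint_normM XH iL) im.
have := acdx_incr XH iH (lexx 0) t0; rewrite prim0 subr0 => HH.
have -> : X t = X 0 + (X t - X 0) by rewrite addrC subrK.
rewrite (le_trans (ler_normD _ _))// lerD2l HH// => r /andP[r0 rt].
by rewrite HX// r0 (le_trans rt).
Qed.

Lemma acdx_bwd X H L m b : acdx X H -> lint L -> (forall t, 0 <= t -> 0 <= L t) ->
  lint m ->
  (forall s, 0 <= s <= b -> `|H s| <= `|X s| * L s + m s) ->
  let E s := expR (prim L s) in
  forall t, 0 <= t <= b ->
    E t * `|X t| <= E b * `|X b| + (prim (fun s => E s * m s) b - prim (fun s => E s * m s) t).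
Proof.
move=> XH iL L0 im HX; apply: gronwall_bwd => //; first exact: lint_normM XH iL.
move=> t /andP[t0 tb]; have iH := lintD (lint_normM XH iL) im.
have HH := acdx_incr XH iH t0 tb.
have -> : X t = X b - (X b - X t) by rewrite opprB addrC subrK.
rewrite (le_trans (ler_normB _ _))// lerD2l HH// => r /andP[tr rb].
by rewrite HX// rb (le_trans t0).
Qed.

(** Equality at [t0] is first carried back to time 0 by the backward inequality and from there to
    all times by the forward one. *)
Lemma acdx_uniq X Y H K L b : acdx X H -> acdx Y K -> lint L ->
  (forall t, 0 <= t -> 0 <= L t) ->
  (forall s, 0 <= s <= b -> `|H s - K s| <= `|X s - Y s| * L s) ->
  forall t0, 0 <= t0 <= b -> X t0 = Y t0 -> forall t, 0 <= t <= b -> X t = Y t.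
Proof.
move=> XH YK iL L0 HK t0 t0b XY0.
have d := acdxB XH YK.
have i0 : lint (cst 0 : R -> R) := lint_cst 0.
have HK' s : 0 <= s <= b -> `|H s - K s| <= `|X s - Y s| * L s + cst 0 s.
  by move=> /HK; rewrite /= addr0.
have X0 : X 0 = Y 0.
  have HK2 s : 0 <= s <= t0 -> `|H s - K s| <= `|X s - Y s| * L s + cst 0 s.
    by move=> /andP[s0 st]; apply: HK'; rewrite s0 (le_trans st)//; case/andP: t0b.
  have aux (u v w : R) : v = 0 -> w = 0 -> u <= v + w -> u <= 0.
    by move=> -> ->; rewrite addr0.
  have z : 0 <= (0 : R) <= t0 by case/andP: t0b => t00 _; rewrite lexx t00.
  have := aux _ _ _ _ _ (acdx_bwd d iL L0 i0 HK2 z).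
  rewrite pmulr_rle0 ?expR_gt0// normr_le0 subr_eq0 => H0; apply/eqP/H0.
    by rewrite XY0 subrr normr0 mulr0.
  have E0 s : expR (prim L s) * cst 0 s = cst 0 s by rewrite /= mulr0.
  rewrite (@eq_prim _ _ (cst 0) t0) => [|s _]; last exact: E0.
  by rewrite prim0 prim_cst ?mul0r ?subrr//; case/andP: t0b.
move=> t tb.
have := acdx_fwd d iL L0 i0 (fun _ _ => lexx 0) HK' tb.
case/andP: tb => t_0 _; rewrite X0 subrr normr0 add0r prim_cst// mul0r mulr0.
by rewrite normr_le0 subr_eq0 => /eqP.
Qed.

End Vectors.
End Gronwall.

(** * Global existence by Picard iteration *)

Section Picard.
Context {R : realType}.
Local Notation mu := (@lebesgue_measure R).

Lemma acd_norm_le (h x k : R -> R) (s t : R) : acd x k -> lint h -> 0 <= s -> s <= t ->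
  (forall r, s <= r <= t -> `|h r| <= k r) -> `|prim h t - prim h s| <= x t - x s.
Proof.
move=> [ik xE] ih s0 st hk; have t0 := le_trans s0 st.
rewrite (xE t)// (xE s)// opprD addrACA subrr add0r.
exact: prim_norm_le2.
Qed.

(** The limit is built as the supremum of the lower bounds [w k], which yields the explicit rate at
    once. *)
Lemma halving_cvg (u : nat -> R) (D : R) :
  (forall k, `|u k.+1 - u k| <= D / 2 ^+ k) ->
  exists l, forall k, `|l - u k| <= 2 * D / 2 ^+ k.
Proof.
move=> hu.
have h1 n k : `|u (k + n)%N - u k| <= 2 * D / 2 ^+ k - 2 * D / 2 ^+ (k + n).
  elim: n => [|n IH]; first by rewrite addn0 !subrr normr0.
  rewrite addnS -(subrK (u (k + n)%N) (u _)) -addrA (le_trans (ler_normD _ _))//.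
  have := hu (k + n)%N; rewrite exprS invfM.
  move: IH.
  move: (`|u (k + n)%N - u k|) (`|u (k + n).+1 - u _|) ((2 ^+ k)^-1) ((2 ^+ (k + n))^-1).
  by clear => p1 p2 p3 p4; lra.
have D0 : 0 <= D by have := hu 0%N; rewrite expr0 divr1; apply: le_trans.
have h2 n k : (k <= n)%N -> `|u n - u k| <= 2 * D / 2 ^+ k.
  move=> kn; have := h1 (n - k)%N k; rewrite subnKC// => /le_trans; apply.
  by rewrite lerBlDr lerDl divr_ge0 ?exprn_ge0 ?mulr_ge0.
pose w k := u k - 2 * D / 2 ^+ k.
have wub k n : w n <= u k + 2 * D / 2 ^+ k.
  rewrite /w; have [nk|/ltnW kn] := leqP n k.
    have := h2 k n nk; rewrite ler_norml => /andP[+ _].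
    have : 0 <= 2 * D / 2 ^+ k by rewrite divr_ge0 ?exprn_ge0 ?mulr_ge0.
    move: (2 * D / 2 ^+ k) (2 * D / 2 ^+ n) (u k) (u n) => p1 p2 p3 p4.
    by clear; lra.
  have := h2 n k kn; rewrite ler_norml => /andP[_].
  have : 0 <= 2 * D / 2 ^+ n by rewrite divr_ge0 ?exprn_ge0 ?mulr_ge0.
  move: (2 * D / 2 ^+ k) (2 * D / 2 ^+ n) (u k) (u n) => p1 p2 p3 p4.
  by clear; lra.
have hs : has_sup (range w).
  by split; [exists (w 0%N), 0%N|exists (u 0%N + 2 * D / 2 ^+ 0) => _ [n _ <-]; exact: wub].
exists (sup (range w)) => k.
have l1 : w k <= sup (range w) by apply: ub_le_sup; [exact: hs.2|exists k].
have l2 : sup (range w) <= u k + 2 * D / 2 ^+ k.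
  by apply: ge_sup; [exact: hs.1|move=> _ [n _ <-]; exact: wub].
by rewrite ler_norml; move: l1 l2; rewrite /w => l1 l2; apply/andP; split; lra.
Qed.

Context (L : R -> R) (t0 : R).
Hypotheses (iL : lint L) (L0 : forall t, 0 <= t -> 0 <= L t) (t00 : 0 <= t0).

(** A Bielecki weight. Its derivative is [2 * L * W] after [t0] and the opposite before, so in the
    norm weighted by [W] the Picard map contracts by one half on the whole half-line, in both time
    directions. *)
Let W t := expR (2 * `|prim L t - prim L t0|).

Let Wint (h : R -> R) (a t : R) : lint h -> 0 <= a -> 0 <= t ->
  (forall s, 0 <= s -> `|h s| <= a * (L s * W s)) ->
  `|prim h t - prim h t0| <= a / 2 * W t.
Proof.
move=> ih a0 tge0 hW.
have [tt|/ltW tt] := leP t0 t.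
- pose P s := expR (2 * (prim L s - prim L t0)).
  have dP : acd (fun s => (a / 2) * P s) (fun s => a / 2 * (2 * (L s - 0) * P s)).
    apply: acdZ; apply: acd_exp; apply: acdZ.
    by apply: acdB (acd_prim iL) (acd_cst _).
  have HP s : t0 <= s -> W s = P s.
    move=> ts; rewrite /W ger0_norm// subr_ge0; exact: prim_homo.
  have aux (u v : R) : 0 <= v -> u - v <= u by rewrite lerBlDr lerDl.
  rewrite HP//; apply: le_trans (aux _ (a / 2 * P t0) _); last first.
    by rewrite mulr_ge0 ?expR_ge0// divr_ge0.
  apply: (acd_norm_le dP) => // s /andP[ts _].
  have s0 := le_trans t00 ts.
  rewrite (le_trans (hW s s0))// HP// subr0 le_eqVlt; apply/orP; left; apply/eqP.
  by field.
- pose P s := expR (2 * (prim L t0 - prim L s)).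
  have dP : acd (fun s => (- (a / 2)) * P s) (fun s => - (a / 2) * (2 * (0 - L s) * P s)).
    apply: acdZ; apply: acd_exp; apply: acdZ.
    by apply: acdB (acd_cst _) (acd_prim iL).
  have HP s : 0 <= s -> s <= t0 -> W s = P s.
    by move=> s0 ts; rewrite /W distrC ger0_norm// subr_ge0; exact: prim_homo.
  have aux (u v w : R) : 0 <= u * v -> - u * v - - u * w <= u * w.
    by rewrite !mulNr opprK gerDr oppr_le0.
  rewrite distrC HP//; apply: le_trans (aux _ (P t0) _ _); last first.
    by rewrite mulr_ge0 ?expR_ge0// divr_ge0.
  apply: (acd_norm_le dP) => // s /andP[ts st].
  have s0 := le_trans tge0 ts.
  rewrite (le_trans (hW s s0))// HP// sub0r le_eqVlt; apply/orP; left; apply/eqP.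
  by field.
Qed.

Context (p q : nat) (Fn : R -> 'M[R]_(p, q) -> 'M[R]_(p, q)) (y : 'M[R]_(p, q)).
Hypothesis mF : forall X : R -> 'M[R]_(p, q),
  (forall i j, measurable_fun Time (fun t => X t i j)) ->
  forall i j, measurable_fun Time (fun t => Fn t (X t) i j).
Hypothesis lipF : forall t x x', 0 <= t -> `|Fn t x - Fn t x'| <= `|x - x'| * L t.
Hypothesis F0 : forall t, 0 <= t -> `|Fn t 0| <= L t.

Let mprim (H : R -> 'M[R]_(p, q)) t := \matrix_(i, j) prim (fun s => H s i j) t.
Let next (X : R -> 'M[R]_(p, q)) t :=
  y + (mprim (fun s => Fn s (X s)) t - mprim (fun s => Fn s (X s)) t0).

Let lint_F (X : R -> 'M[R]_(p, q)) :
  (forall i j, measurable_fun Time (fun t => X t i j)) ->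
  (forall b, exists M, forall t, 0 <= t <= b -> `|X t| <= M) ->
  forall i j, lint (fun s => Fn s (X s) i j).
Proof.
move=> mX bX i j b; have [M hM] := bX b.
apply: (@le_integrable _ _ _ mu `[0, b] _ _ (EFin \o (fun s => (1 + M) * L s))) => //.
- by apply/measurable_EFinP; apply: measurable_itvS; exact: mF.
- move=> s /=; rewrite in_itv /= => sb; rewrite lee_fin.
  have [s0 _] := andP sb.
  rewrite (le_trans _ (ler_norm _))// (le_trans (mx_norm_entry _ _ _))//.
  rewrite -(subrK (Fn s 0) (Fn s (X s))) (le_trans (ler_normD _ _))//.
  rewrite mulrDl mul1r addrC lerD ?F0// (le_trans (lipF _ _ s0))// subr0.
  by rewrite ler_wpM2r ?L0// hM.
- exact: (lintZ (1 + M) iL).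
Qed.

Let it k := iter k next (fun=> y).

Let it_acd k : exists H, acdx (it k) H.
Proof.
elim: k => [|k [H XH]].
  exists (fun=> 0) => i j; apply: eq_acd (acd_cst (y i j)) => // t _.
  by rewrite mxE.
exists (fun s => Fn s (it k s)) => i j.
have iF := lint_F (fun i j => acdx_measurable i j XH) (fun b => acdx_bounded b XH) i j.
apply: eq_acd (acdD (acd_cst (y i j - prim (fun s => Fn s (it k s) i j) t0)) (acd_prim iF)).
  by move=> t _; rewrite /it iterS -/(it k) /next /mprim !mxE /= -addrA (addrC (- _)).
by move=> t _; rewrite /= add0r.
Qed.

Let it_lint k i j : lint (fun s => Fn s (it k s) i j).
Proof.
have [H XH] := it_acd k.
exact: (lint_F (fun i j => acdx_measurable i j XH) (fun b => acdx_bounded b XH)).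
Qed.

Let it_dist k t : 0 <= t -> `|it k.+1 t - it k t| <= (`|y| + 1) / 2 ^+ k * W t.
Proof.
have C0 : 0 <= `|y| + 1 by rewrite addr_ge0.
elim: k t => [|k IH] t tge0.
  rewrite expr0 divr1; apply: mx_norm_le.
    by rewrite mulr_ge0 ?expR_ge0.
  move=> i j; rewrite /it /= /next /mprim (addrC y) addrK !mxE.
  rewrite (@le_trans _ _ ((`|y| + 1) / 2 * W t))//; last first.
    by rewrite ler_wpM2r ?expR_ge0// ler_piMr// invf_le1// ler1n.
  apply: Wint => //; first exact: (it_lint 0 i j).
  move=> s s0; rewrite (le_trans (mx_norm_entry _ _ _))//.
  rewrite -(subrK (Fn s 0) (Fn s y)) (le_trans (ler_normD _ _))//.
  rewrite (@le_trans _ _ ((`|y| + 1) * L s))//.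
    by rewrite mulrDl mul1r lerD ?F0// (le_trans (lipF _ _ s0))// subr0.
  rewrite ler_wpM2l// ler_peMr ?L0// -expR0 ler_expR.
  by rewrite mulr_ge0.
apply: mx_norm_le; first by rewrite mulr_ge0 ?expR_ge0// divr_ge0// exprn_ge0.
move=> i j; have itS k' : it k'.+1 t = next (it k') t by [].
rewrite !itS /next /mprim !mxE.
have -> (a b c d e : R) : a + (b - c) - (a + (d - e)) = (b - d) - (c - e) by ring.
rewrite -!primB; try exact: it_lint.
have -> : (`|y| + 1) / 2 ^+ k.+1 = (`|y| + 1) / 2 ^+ k / 2.
  by rewrite exprSr invfM mulrA.
apply: Wint => //.
  by apply: lintB; exact: it_lint.
move=> s s0; have := mx_norm_entry (Fn s (it k.+1 s) - Fn s (it k s)) i j.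
rewrite !mxE => /le_trans; apply; rewrite (le_trans (lipF _ _ s0))//.
by rewrite mulrCA mulrC ler_wpM2l ?L0// IH.
Qed.

(** The iterates converge pointwise at rate [2 ^- k] times [W]. Both the limit [X] and [next X] are
    within [D / 2 ^+ k] of the iterate [k.+1], which gives the fixed point equation. *)
Lemma picard : exists X, acdx X (fun t => Fn t (X t)) /\ X t0 = y.
Proof.
have C0 : 0 <= `|y| + 1 by rewrite addr_ge0.
have lim (t : R) : exists x : 'M[R]_(p, q), 0 <= t -> forall k,
    `|x - it k t| <= 2 * ((`|y| + 1) * W t) / 2 ^+ k.
  have [tge0|tlt0] := leP 0 t; last by exists 0.
  have H i j : exists l, forall k, `|l - it k t i j| <= 2 * ((`|y| + 1) * W t) / 2 ^+ k.
    apply: halving_cvg => k.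
    have := mx_norm_entry (it k.+1 t - it k t) i j; rewrite !mxE => /le_trans; apply.
    by rewrite mulrAC it_dist.
  exists (\matrix_(i, j) projT1 (cid (H i j))) => _ k; apply: mx_norm_le.
    by rewrite divr_ge0 ?exprn_ge0// mulr_ge0// mulr_ge0 ?expR_ge0.
  by move=> i j; rewrite !mxE; case: cid.
have [X HX] := choice lim.
have mX i j : measurable_fun Time (fun t => X t i j).
  apply: (@measurable_fun_cvg _ _ _ _ (fun k t => it k t i j)) => [k|t].
    by have [H XH] := it_acd k; exact: acdx_measurable XH.
  rewrite /Time /= in_itv/= andbT => tge0.
  apply/cvgrPdist_le => e e0.
  have : (fun k => 2 * ((`|y| + 1) * W t) / 2 ^+ k) @ \oo --> (0 : R).
    rewrite -(mulr0 (2 * ((`|y| + 1) * W t))); apply: cvgMr.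
    rewrite (_ : (fun k => _) = (fun k => (2^-1 : R) ^+ k)); last first.
      by apply/funext => k; rewrite exprVn.
    by apply: cvg_expr; rewrite ger0_norm// invf_lt1// ltr1n.
  move/cvgrPdist_le => /(_ e e0); apply: filterS => k; rewrite sub0r normrN.
  move=> /(le_trans (ler_norm _)); apply: le_trans.
  have := mx_norm_entry (X t - it k t) i j; rewrite !mxE => /le_trans; apply.
  exact: HX.
have bX b : exists M, forall t, 0 <= t <= b -> `|X t| <= M.
  have [M hM] := acd_bounded (Num.max b t0) (acd_prim iL).
  exists (`|y| + 2 * ((`|y| + 1) * expR (2 * (M + M)))) => t /andP[tge0 tb].
  rewrite -(subrK y (X t)) addrC (le_trans (ler_normD _ _))// lerD2l.
  have := HX t tge0 0%N; rewrite expr0 divr1 => /le_trans; apply.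
  rewrite ler_wpM2l// ler_wpM2l// ler_expR ler_wpM2l//.
  rewrite (le_trans (ler_normB _ _))// lerD// hM//.
    by rewrite tge0 le_max tb.
  by rewrite t00 le_max lexx orbT.
have iX i j := lint_F mX bX i j.
have iI k i j := it_lint k i j.
have XE (t : R) : 0 <= t -> X t = next X t.
  move=> tge0; apply/eqP; rewrite -subr_eq0 -normr_le0; apply/ler_addgt0Pl => e e0.
  rewrite addr0.
  pose D := (`|y| + 1) * W t.
  have D0 : 0 <= D by rewrite mulr_ge0 ?expR_ge0.
  have [k hk] : exists k, 2 * D / 2 ^+ k <= e.
    have : (fun k => 2 * D * (2^-1 : R) ^+ k) @ \oo --> 2 * D * 0.
      by apply: cvgMr; apply: cvg_expr; rewrite ger0_norm// invf_lt1// ltr1n.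
    rewrite mulr0 => /cvgrPdist_le => /(_ e e0)[k _ /(_ k (leqnn k))] /=.
    rewrite sub0r normrN exprVn => H; exists k; exact: le_trans (ler_norm _) H.
  rewrite (le_trans _ hk)//.
  have -> : X t - next X t = (X t - it k.+1 t) + (it k.+1 t - next X t) by rewrite addrA subrK.
  rewrite (le_trans (ler_normD _ _))//.
  have hX1 : `|X t - it k.+1 t| <= D / 2 ^+ k.
    rewrite (le_trans (HX t tge0 k.+1))// -/D exprS le_eqVlt; apply/orP; left; apply/eqP.
    by field; rewrite expf_neq0.
  have hX2 : `|it k.+1 t - next X t| <= D / 2 ^+ k.
    apply: mx_norm_le; first by rewrite divr_ge0 ?exprn_ge0.
    move=> i j; have itS k' : it k'.+1 t = next (it k') t by [].
    rewrite itS /next /mprim !mxE.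
    have -> (a b c d r : R) : a + (b - c) - (a + (d - r)) = (b - d) - (c - r) by ring.
    rewrite -!primB//.
    have -> : D / 2 ^+ k = (2 * (`|y| + 1) / 2 ^+ k) / 2 * W t by rewrite /D; field.
    apply: Wint => //.
      exact: lintB.
    move=> s s0; have := mx_norm_entry (Fn s (it k s) - Fn s (X s)) i j.
    rewrite !mxE => /le_trans; apply; rewrite (le_trans (lipF _ _ s0))//.
    have aux (l a c w : R) : 0 <= l -> a <= c * w -> a * l <= c * (l * w).
      by move=> l0 h; rewrite mulrCA (mulrC a) ler_wpM2l.
    apply: (aux _ _ _ _ (L0 s0)).
    rewrite (distrC (it k s)).
    apply: (le_trans (HX s s0 k)).
    by move: (`|y| + 1) (W s) => u w; rewrite mulrA mulrAC.
  have aux (u v z : R) : u <= z -> v <= z -> u + v <= 2 * z.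
    by move=> h1 h2; rewrite mulrDl mul1r lerD.
  have -> : 2 * D / 2 ^+ k = 2 * (D / 2 ^+ k) by rewrite -mulrA.
  exact: (aux _ _ _ hX1 hX2).
exists X; split.
  move=> i j.
  apply: eq_acd (acdD (acd_cst (y i j - prim (fun s => Fn s (X s) i j) t0)) (acd_prim (iX i j))).
    by move=> t tge0; rewrite XE// /next /mprim !mxE /= -addrA (addrC (- _)).
  by move=> t tge0; rewrite /= add0r.
by rewrite XE// /next subrr addr0.
Qed.

End Picard.

(** * Measurability *)

Section AlmostEverywhereIntegral.
Import HBSimple HBNNSimple.
Context d (T : measurableType d) (R : realType) (mu : {measure set T -> \bar R}).
Local Open Scope ereal_scope.

Let ge0_le_integral_ae (D N : set T) (f g : T -> \bar R) : measurable N -> mu N = 0 ->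
  (forall x, D x -> 0 <= f x) -> (forall x, D x -> 0 <= g x) ->
  (forall x, D x -> ~ N x -> f x = g x) ->
  \int[mu]_(x in D) f x <= \int[mu]_(x in D) g x.
Proof.
move=> mN N0 f0 g0 fg; rewrite !ge0_integralE//.
apply: ge_ereal_sup => _ [h /= hf <-].
have mNC := measurableC mN.
have -> : sintegral mu h = sintegral mu (proj_nnsfun h mNC).
  rewrite -!integralT_nnsfun; apply: ae_eq_integral => //.
  - exact/measurable_EFinP.
  - exact/measurable_EFinP.
  exists N; split => // x /= H; apply: contrapT => Nx; apply: H => _.
  by rewrite mindicE mem_set// mulr1.
apply: ereal_sup_ubound; exists (proj_nnsfun h mNC) => // x /=.
rewrite mindicE; have [Nx|Nx] := pselect (N x).
  rewrite memNset ?mulr0; last by move=> /(_ Nx).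
  by apply: erestrict_ge0.
rewrite mem_set// mulr1 (le_trans (hf x))//.
rewrite !patchE; case: ifPn => //; rewrite inE => Dx; rewrite fg//.
Qed.

(** Valid without measurability of [f] and [g], as required for [g t (x t) (u t)] when continuity
    fails on a null set of times. The integral of a nonnegative function is a supremum over simple
    functions below it, and these may be cut off on the null set. *)
Lemma Rintegral_ae_eq (D : set T) (f g : T -> R) :
  {ae mu, forall x, D x -> f x = g x} ->
  (\int[mu]_(x in D) f x = \int[mu]_(x in D) g x)%R.
Proof.
move=> [N [mN N0 hN]].
have fg x : D x -> ~ N x -> f x = g x.
  by move=> Dx Nx; apply: contrapT => fg; apply: Nx; apply: hN => /= /(_ Dx).
rewrite /Rintegral; congr fine; rewrite integralE [RHS]integralE.
congr (_ - _); apply/eqP; rewrite eq_le; apply/andP; split;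
  apply: (@ge0_le_integral_ae _ N) => // x Dx Nx; rewrite ?funeposE ?funenegE fg//.
Qed.

End AlmostEverywhereIntegral.

Section Measurability.
Context {R : realType}.

Let grid (n : nat) (r : R) : R := (Num.floor (r * 2 ^+ n))%:~R / 2 ^+ n.

Let grid_dist n r : `|r - grid n r| <= (2 ^+ n)^-1.
Proof.
have p0 : 0 < 2 ^+ n :> R by rewrite exprn_gt0.
have -> : r - grid n r = (r * 2 ^+ n - (Num.floor (r * 2 ^+ n))%:~R) / 2 ^+ n.
  by rewrite mulrBl mulfK ?gt_eqF.
have := floor_itv (r * 2 ^+ n); rewrite intrD => /andP[h1 h2].
have q0 : 0 <= (2 ^+ n)^-1 :> R by rewrite invr_ge0 ltW.
rewrite normrM (ger0_norm q0) ler_piMl//.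
by rewrite ger0_norm ?subr_ge0//; move: h2; lra.
Qed.

Let grid_cvg (r : R) : (fun n => grid n r) @ \oo --> r.
Proof.
apply/cvgrPdist_le => e e0.
have : (fun k => (2^-1 : R) ^+ k) @ \oo --> (0 : R).
  by apply: cvg_expr; rewrite ger0_norm// invf_lt1// ltr1n.
move/cvgrPdist_le => /(_ e e0); apply: filterS => n; rewrite sub0r normrN exprVn.
by move=> /(le_trans (ler_norm _)); apply: le_trans; exact: grid_dist.
Qed.

Let mx_cvg (p q : nat) (X : nat -> 'M[R]_(p, q)) (Y : 'M[R]_(p, q)) :
  (forall i j, (fun n => X n i j) @ \oo --> Y i j) -> X @ \oo --> Y.
Proof.
move=> H; apply/cvgrPdist_le => e e0.
have : \forall n \near \oo, forall ij : 'I_p * 'I_q, `|Y ij.1 ij.2 - X n ij.1 ij.2| <= e.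
  apply: filter_forall => ij; have /cvgrPdist_le := H ij.1 ij.2; exact.
apply: filterS => n Hn; apply: mx_norm_le; first exact: ltW.
by move=> i j; rewrite !mxE; exact: (Hn (i, j)).
Qed.

(** Rounding state and control to a dyadic grid leaves countably many values, so the rounded
    composition is glued from sections with fixed arguments; continuity lets the mesh tend to 0. *)
Lemma caratheodory_comp d (T : measurableType d) (m k : nat)
    (a : R -> 'cV[R]_m -> 'cV[R]_k -> R) (D : set T) (h : T -> R)
    (x : T -> 'cV[R]_m) (u : T -> 'cV[R]_k) :
  measurable D -> measurable_fun D h -> (forall w, D w -> 0 <= h w) ->
  (forall i, measurable_fun D (fun w => x w i 0)) ->
  (forall i, measurable_fun D (fun w => u w i 0)) ->
  (forall y v, measurable_fun Time (fun t => a t y v)) ->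
  (forall t, 0 <= t -> continuous (fun w : 'cV[R]_m * 'cV[R]_k => a t w.1 w.2)) ->
  measurable_fun D (fun w => a (h w) (x w) (u w)).
Proof.
move=> mD mh h0 mx mu_ ma ca.
pose gm (p : nat) n (y : 'cV[R]_p) := map_mx (grid n) y.
apply: (@measurable_fun_cvg _ _ _ _ (fun n w => a (h w) (gm _ n (x w)) (gm _ n (u w)))); last first.
  move=> w Dw.
  have gc p (y : 'cV[R]_p) : (fun n => gm p n y) @ \oo --> y.
    apply: mx_cvg => i j; rewrite (_ : (fun n => _) = (fun n => grid n (y i j))).
      exact: grid_cvg.
    by apply/funext => n; rewrite mxE.
  apply: (@cvg_comp _ _ _ (fun n => (gm _ n (x w), gm _ n (u w)))
    (fun w0 => a (h w) w0.1 w0.2) _ (nbhs (x w, u w))).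
    by have H := cvg_pair (gc _ (x w)) (gc _ (u w)); apply: H; typeclasses eauto.
  exact: ca (h0 _ Dw) (x w, u w).
move=> n.
pose C := ('cV[int]_m * 'cV[int]_k)%type.
pose fl (p : nat) (y : 'cV[R]_p) : 'cV[int]_p := map_mx (fun r => Num.floor (r * 2 ^+ n)) y.
pose gi (p : nat) (c : 'cV[int]_p) : 'cV[R]_p := map_mx (fun z : int => z%:~R / 2 ^+ n) c.
have gE p (y : 'cV[R]_p) : gm p n y = gi p (fl p y).
  by apply/matrixP => i j; rewrite !mxE.
move=> _ Y mY.
pose S (c : C) := (D `&` [set w | fl _ (x w) = c.1 /\ fl _ (u w) = c.2]) `&`
   (D `&` ((fun w => a (h w) (gi _ c.1) (gi _ c.2)) @^-1` Y)).
rewrite (_ : _ `&` _ = \bigcup_c S c); last first.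
  apply/seteqP; split=> w.
    move=> [Dw]; rewrite /preimage /= !gE => Yw.
    by exists (fl _ (x w), fl _ (u w)).
  by move=> [c _] [[Dw /= [c1 c2]] [_ /= Yw]]; split=> //; rewrite /preimage /= !gE c1 c2.
apply: countable_bigcupT_measurable; first exact: countableP.
have mfl p (y : T -> 'cV[R]_p) (c : 'cV[int]_p) :
    (forall i, measurable_fun D (fun w => y w i 0)) ->
    measurable (D `&` [set w | fl p (y w) = c]).
  move=> my.
  rewrite (_ : _ `&` _ = D `&` \bigcap_(i in [set: 'I_p])
     (D `&` ((fun w => y w i 0 * 2 ^+ n) @^-1` `[(c i 0)%:~R, (c i 0 + 1)%:~R[%classic))); last first.
    apply/seteqP; split=> w [Dw].
      move=> wc; split=> // i _; split=> //.
      rewrite /preimage /= in_itv/= -wc mxE; exact: floor_itv.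
    move=> H; split => //=; apply/matrixP => i j; rewrite !mxE ord1.
    have [_] := H i I; rewrite /preimage /= in_itv/= => Hi.
    exact: floor_def.
  apply: measurableI => //; apply: fin_bigcap_measurable; first exact: finite_finset.
  move=> i _; apply: (measurable_funM (my i) (@measurable_cst _ _ _ _ _ _)) => //.
move=> c; apply: measurableI.
  rewrite (_ : _ `&` _ = (D `&` [set w | fl _ (x w) = c.1]) `&` (D `&` [set w | fl _ (u w) = c.2])).
    by apply: measurableI; exact: mfl.
  by apply/seteqP; split=> w [] => [Dw [c1 c2]|[Dw c1] [_ c2]].
have : measurable_fun D ((fun t => a t (gi _ c.1) (gi _ c.2)) \o h).
  apply: (@measurable_comp _ _ _ _ _ _ Time) => //; first exact: measurable_Time.
  by move=> _ [w Dw <-]; rewrite /Time /= in_itv/= andbT h0.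
by move=> /(_ mD Y mY).
Qed.

Lemma continuous_borel (V : ptopologicalType) (c : V -> R) : continuous c ->
  measurable_fun setT (c : borelType V -> R).
Proof.
move=> cc; apply: (measurability (@RGenOInfty.G R)).
  exact: RGenOInfty.measurableE.
move=> _ [_ [r ->] <-]; rewrite setTI; apply: sub_sigma_algebra.
by apply: open_comp => //; exact: open_gt.
Qed.

Lemma borel_open (V : ptopologicalType) (A : set V) :
  open A -> measurable (A : set (borelType V)).
Proof. by move=> oA; exact: sub_sigma_algebra. Qed.

Lemma borel_closed (V : ptopologicalType) (A : set V) :
  closed A -> measurable (A : set (borelType V)).
Proof.
by move=> /closed_openC/borel_open/measurableC; rewrite setCK.
Qed.

Lemma borel_fun_entry (p q : nat) (D : set R) (h : R -> 'M[R]_(p, q)) : measurable D ->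
  borel_fun D h -> forall i j, measurable_fun D (fun t => h t i j).
Proof.
move=> mD mh i j.
apply: (@measurable_comp _ _ _ _ _ _ setT
  (fun v : borelType 'M[R]_(p, q) => (v : 'M[R]_(p, q)) i j)) => //.
by apply: continuous_borel; exact: coord_continuous.
Qed.

Lemma borel_fun_real (D : set R) (h : R -> R^o) : measurable D ->
  borel_fun D h -> measurable_fun D (h : R -> R).
Proof.
move=> mD mh; apply: (@measurable_comp _ _ _ _ _ _ setT (fun v : borelType R^o => v : R)) => //.
by apply: (@continuous_borel R^o (fun v => v)) => v.
Qed.

(** An open set is a countable union of boxes with rational centres, and the preimage of a box is
    described entry by entry. *)
Lemma entry_borel_fun (k : nat) (D : set R) (h : R -> 'cV[R]_k) : measurable D ->
  (forall i, measurable_fun D (fun t => h t i 0)) -> borel_fun D h.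
Proof.
move=> mD mh; rewrite /borel_fun; apply: (@measurability _ _ _ (borelType 'cV[R]_k) D h (@open 'cV[R]_k)) => //.
move=> _ [A oA <-].
pose box (cn : 'cV[rat]_k * nat) (y : 'cV[R]_k) :=
  forall i, `|y i 0 - ratr (cn.1 i 0)| < cn.2.+1%:R^-1.
pose S cn := [set t | D t /\ (box cn `<=` A) /\ box cn (h t)].
rewrite (_ : _ `&` _ = \bigcup_cn S cn); last first.
  apply/seteqP; split=> t; last first.
    by move=> [cn _ [Dt [cA /cA]]].
  move=> [Dt At]; have /nbhs_ballP[e /= e0 eA] : nbhs (h t) A.
    by apply: open_nbhs_nbhs.
  have [n hn] : exists n, n.+1%:R^-1 < e / 2.
    have e2 : 0 < e / 2 by rewrite divr_gt0.
    by have [n /= hn] := ltr_add_invr (y := 0) e2; exists n; move: hn; rewrite add0r.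
  have n0 : 0 < n.+1%:R^-1 :> R by rewrite invr_gt0.
  have H i : exists q : rat, `|h t i 0 - ratr q| < n.+1%:R^-1.
    have aux (a v : R) : 0 < v -> exists q : rat, `|a - ratr q| < v.
      move=> v0; have av : a - v < a + v by lra.
      have [q] := rat_in_itvoo av; rewrite in_itv/= => /andP[q1 q2].
      by exists q; rewrite ltr_norml; apply/andP; split; lra.
    exact: aux.
  pose c : 'cV[rat]_k := \col_i projT1 (cid (H i)).
  have cE i : c i 0 = projT1 (cid (H i)) by rewrite mxE.
  exists (c, n) => //; split=> //; split; last first.
    by move=> i; rewrite cE; case: cid.
  move=> y by_; apply: eA; rewrite mx_norm_ball /ball_ /=.
  apply: (@le_lt_trans _ _ (2 * n.+1%:R^-1)); last by rewrite mulrC -ltr_pdivlMr.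
  apply: mx_norm_le; first by rewrite mulr_ge0// ltW.
  move=> i j; rewrite ord1 !mxE.
  have h1 := by_ i; rewrite /= in h1.
  have : `|h t i 0 - ratr (c i 0)| < n.+1%:R^-1 by rewrite cE; case: cid.
  have := ler_normD (h t i 0 - ratr (c i 0)) (ratr (c i 0) - y i 0).
  rewrite addrA subrK (distrC (ratr _) (y i 0)); move: h1.
  by clear => h1 h2 h3; rewrite (le_trans h2)// mulrDl mul1r lerD// ltW.
apply: countable_bigcupT_measurable; first exact: countableP.
move=> cn; have [cA|cA] := pselect (box cn `<=` A); last first.
  by rewrite (_ : S cn = set0)//; apply/seteqP; split=> t // [_ [/cA]].
rewrite (_ : S cn = D `&` \bigcap_(i in [set: 'I_k])
     (D `&` ((fun t => h t i 0) @^-1` (ball (ratr (cn.1 i 0) : R) cn.2.+1%:R^-1)))); last first.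
  apply/seteqP; split=> t.
    by move=> [Dt [_ bt]]; split=> // i _; split => //; rewrite /preimage /ball /= distrC.
  move=> [Dt H]; split=> //; split=> // i.
  by have [_] := H i I; rewrite /preimage /ball /= distrC.
apply: measurableI => //; apply: fin_bigcap_measurable; first exact: finite_finset.
by move=> i _; apply: mh => //; exact: measurable_ball.
Qed.

End Measurability.

(** * Borel versions of functions integrable for the completed measure *)

Section Completion.
Context {R : realType}.
Local Notation mu := (@lebesgue_measure R).
Local Notation cmu := (@completed_lebesgue_measure R).
Local Notation cara := ((wlength (@idfun R))^*%mu).-cara.-measurable.

Let borel_cara (A : set R) : measurable A -> cara A.
Proof. exact: sub_caratheodory. Qed.

Let cara_split (A : set R) : cara A ->
  exists B N : set R, [/\ measurable B, measurable N, mu N = 0, A `<=` B `|` N & B `<=` A].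
Proof.
rewrite -completed_caratheodory_measurable g_sigma_completed_algebra_genE.
move=> -[B mB [N' [N [mN N0 N'N]]] <-]; exists B, N; split => //.
  exact: setUS.
Qed.

(** Each superlevel set at a rational height is a Borel set up to a Borel null set. Outside the
    union of these countably many null sets, and of the one where [h] is infinite, [h] is Borel;
    inside it is replaced by 0. *)
Lemma completed_integrable_borel (D : set R) (Ds : nat -> set R) (h : R -> \bar R) :
  measurable D -> (forall n, measurable (Ds n)) -> D = \bigcup_n Ds n ->
  (forall n, integrable_on (Ds n) h) -> exists h' : R -> R,
    [/\ measurable_fun D h', forall n, mu.-integrable (Ds n) (EFin \o h') &
    {ae mu, forall t, D t -> h t = (h' t)%:E}].
Proof.
move=> mD mDs DE ih; have mDc := borel_cara mD.
have mDsc n := borel_cara (mDs n).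
have mh : @measurable_fun _ _ (caratheodory_type ((wlength (@idfun R))^*%mu)) _ D h.
  rewrite DE; apply/measurable_fun_bigcup => // n.
  exact: measurable_int (ih n).
have HA (q : rat) : exists BN : set R * set R, [/\ measurable BN.1, measurable BN.2, mu BN.2 = 0,
    D `&` [set t | ((ratr q)%:E < h t)%E] `<=` BN.1 `|` BN.2 &
    BN.1 `<=` D `&` [set t | ((ratr q)%:E < h t)%E]].
  have := cara_split (emeasurable_fun_o_infty mDc mh (ratr q)%:E).
  by move=> [B [N [? ? ? ? ?]]]; exists (B, N).
have [BN hBN] := choice HA.
have [F [mF F0 hF]] : {ae cmu, forall t, D t -> h t \is a fin_num}.
  have : {ae cmu, forall t, forall n, Ds n t -> h t \is a fin_num}.
    by apply: ae_foralln => n; exact: integrable_ae (ih n).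
  move=> [F [mF F0 hF]]; exists F; split => // t /= H; apply: hF => /= H'; apply: H.
  by rewrite DE => -[n _]; exact: H'.
have [B [N' [mB mN' N'0 FB BF]]] := cara_split mF.
have B0 : mu B = 0.
  apply/eqP; rewrite eq_le measure_ge0 andbT.
  by have : (mu B <= cmu F)%E; [exact: le_outer_measure|rewrite F0].
pose N := (B `|` N') `|` \bigcup_(q : rat) (BN q).2.
have mN : measurable N.
  apply: measurableU; first exact: measurableU.
  apply: countable_bigcupT_measurable; first exact: countableP.
  by move=> q; have [] := hBN q.
have N0 : mu N = 0.
  rewrite measureU0//; first by rewrite measureU0.
  - exact: measurableU.
  - apply: countable_bigcupT_measurable; first exact: countableP.
    by move=> q; have [] := hBN q.
  have : mu.-negligible (\bigcup_n (if unpickle n is Some q then (BN q).2 else set0)).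
    apply: negligible_bigcup => n; case: unpickle => [q|]; last exact: negligible_set0.
    by have [_ m2 n2 _ _] := hBN q; exists (BN q).2; split.
  move=> [M [mM M0 hM]]; apply/eqP; rewrite eq_le measure_ge0 andbT -M0.
  apply: le_outer_measure; apply: subset_trans hM => t [q _ qt].
  by exists (pickle q); [exact: I|rewrite pickleK].
pose h' t := if t \in N then 0 else fine (h t).
have fin t : D t -> ~ N t -> h t \is a fin_num.
  move=> Dt Nt; apply: contrapT => H; apply: Nt; left; apply: FB; apply: hF => /=.
  by move=> /(_ Dt).
have mh' : measurable_fun D h'.
  apply: (measurability (@RGenOInfty.G R)); first exact: RGenOInfty.measurableE.
  move=> _ [_ [r ->] <-].
  rewrite (_ : _ `&` _ = (D `&` N `&` [set t | r < 0]) `|`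
    (\bigcup_(q in [set q : rat | r <= ratr q]) (BN q).1) `\` N); last first.
    apply/seteqP; split=> t.
      move=> [Dt]; rewrite /preimage /= in_itv/= andbT /h'; case: ifPn.
        by rewrite inE => Nt r0; left.
      move=> /negP Nt rh; right; split; last by move=> H; apply: Nt; rewrite inE.
      have {}Nt : ~ N t by move=> H; apply: Nt; rewrite inE.
      have [q] := rat_in_itvoo rh; rewrite in_itv/= => /andP[rq qh].
      exists q; first exact: ltW.
      have [_ _ _ + _] := hBN q => /(_ t) []//.
        by split=> //=; rewrite -(fineK (fin _ Dt Nt)) lte_fin.
      by move=> N2; exfalso; apply: Nt; right; exists q.
    case=> [[[Dt Nt] /= r0]|[[q /= rq] Bt] Nt].
      by split=> //; rewrite /preimage /= in_itv/= andbT /h' mem_set.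
    have [_ _ _ _ /(_ _ Bt)[Dt /= qh]] := hBN q.
    split=> //; rewrite /preimage /= in_itv/= andbT /h' memNset//.
    by rewrite (le_lt_trans rq)// -lte_fin fineK// fin.
  apply: measurableU.
    have [r0|r0] := boolP (r < 0).
      rewrite (_ : [set t : R | true] = setT); last by apply/seteqP.
      by rewrite setIT; exact: measurableI.
    rewrite (_ : [set t : R | false] = set0); last by apply/seteqP; split.
    by rewrite setI0.
  apply: measurableD => //.
  rewrite bigcup_mkcond; apply: countable_bigcupT_measurable; first exact: countableP.
  by move=> q; case: ifPn => // _; have [] := hBN q.
exists h'; split => //; last first.
  exists N; split=> // t /= H; apply: contrapT => Nt; apply: H => Dt.
  by rewrite /h' memNset// fineK// fin.
move=> n; have DsD : Ds n `<=` D by rewrite DE; exact: bigcup_sup.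
have mhn : measurable_fun (Ds n) h' by apply: measurable_funS mh'.
apply/integrableP; split; first exact/measurable_EFinP.
have mabs : measurable_fun (Ds n) (fun t => `|(h' t)%:E|%E).
  by apply: measurableT_comp => //; exact/measurable_EFinP.
pose cT := caratheodory_type ((wlength (@idfun R))^*%mu).
have mid : measurable_fun setT (idfun : cT -> measurableTypeR R).
  by move=> _ Y mY; rewrite setTI; exact: borel_cara.
(* The identity from the completed space to the Borel one pushes the completed measure forward to
   [lebesgue_measure], which makes the two integrals comparable. *)
pose phi : {mfun cT >-> measurableTypeR R} :=
  HB.pack (idfun : cT -> measurableTypeR R) (isMeasurableFun.Build _ _ _ _ _ mid).
have -> : (\int[mu]_(x in Ds n) `|(EFin \o h') x| =
    \int[pushforward cmu phi]_(x in Ds n) `|(EFin \o h') x|)%E.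
  have m12 (A : set (measurableTypeR R)) : measurable A -> A `<=` Ds n ->
    mu A = pushforward cmu phi A by [].
  have H := @eq_measure_integral _ (measurableTypeR R) R (Ds n) (pushforward cmu phi) mu (fun x => `|(EFin \o h') x|%E) m12.
  exact: H.
rewrite (ge0_integral_pushforward mid _ (mDs n))//.
have /integrableP[mhcn] := ih n; apply: le_lt_trans.
apply: ge0_le_integral.
- exact: (mDsc n).
- by move=> t _ /=; rewrite lee_fin.
- by move=> _ Y mY; exact: (borel_cara (mabs (mDs n) Y mY)).
- by move: mhcn => /(measurableT_comp _); apply.
move=> t Dt; rewrite /= /h'; case: ifPn => [_|]; first by rewrite normr0 abse_ge0.
by case: (h t) => [r||] //= _; rewrite ?normr0 ?leey.
Qed.

Lemma locally_integrable_borel (h : R -> R) : locally_integrable_on_Time h ->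
  exists2 h' : R -> R, lint h' & {ae mu, forall t, Time t -> h t = h' t}.
Proof.
move=> ih.
have iN n : integrable_on `[0, n%:R] (EFin \o h).
  by apply: ih; [exact: segment_compact|exact: itv_Time].
have [h' [mh' ih' hh']] := completed_integrable_borel measurable_Time
  (fun n => measurable_itv _) Time_bigcup iN.
exists h'; last by apply: (aeS hh') => t H /H[].
move=> b; apply: integrableS (ih' (Num.truncn b).+1) => //.
by apply: subset_itvl; rewrite bnd_simp ltW// truncnS_gt.
Qed.

End Completion.

(** * Comparison of norms and a Taylor estimate *)

Section Norms.
Context {R : realType}.

Lemma entry_le_enorm p q (A : 'M[R]_(p, q)) i j : `|A i j| <= enorm A.
Proof.
rewrite /enorm -sqrtr_sqr ler_wsqrtr// (bigD1 i)//= (bigD1 j)//= -addrA lerDl.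
by rewrite addr_ge0// !sumr_ge0// => *; rewrite ?sumr_ge0// => *; rewrite sqr_ge0.
Qed.

Lemma enorm_ge0 p q (A : 'M[R]_(p, q)) : 0 <= enorm A.
Proof. exact: sqrtr_ge0. Qed.

Lemma norm_le_enorm p q (A : 'M[R]_(p, q)) : `|A| <= enorm A.
Proof. by apply: mx_norm_le => *; [exact: enorm_ge0|exact: entry_le_enorm]. Qed.

Lemma enorm_le p q (A : 'M[R]_(p, q)) : enorm A <= (p * q).+1%:R * `|A|.
Proof.
rewrite -[leRHS]ger0_norm ?mulr_ge0// -sqrtr_sqr ler_wsqrtr//.
apply: (@le_trans _ _ (\sum_(i < p) \sum_(j < q) `|A| ^+ 2)).
  apply: ler_sum => i _; apply: ler_sum => j _.
  by rewrite -real_normK ?num_real// ler_sqr ?nnegrE// mx_norm_entry.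
rewrite sumr_const sumr_const !card_ord -mulrnA mulnC -[leLHS]mulr_natl exprMn.
rewrite ler_wpM2r ?sqr_ge0// -natrX ler_nat; nia.
Qed.

Lemma norm_le_opnorm p q (A : 'M[R]_(p, q)) : `|A| <= opnorm A.
Proof.
have hs : has_sup [set enorm (A *m x) | x in [set x : 'cV[R]_q | enorm x <= 1]].
  split.
    exists (enorm (A *m (0 : 'cV_q))), 0 => //=; rewrite /enorm big1 ?sqrtr0// => i _.
    by rewrite big1// => j _; rewrite mxE expr0n.
  exists ((p * 1).+1%:R * (q%:R * `|A|)) => _ [x /= x1 <-].
  rewrite (le_trans (enorm_le _))// ler_wpM2l//; apply: mx_norm_le; first by rewrite mulr_ge0.
  move=> i j; rewrite mxE (le_trans (ler_norm_sum _ _ _))//.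
  rewrite -[q in q%:R]card_ord -sumr_const mulr_suml; apply: ler_sum => l _.
  rewrite normrM mul1r (le_trans (ler_piMr _ _))//; last exact: mx_norm_entry.
  by rewrite (le_trans _ x1)// entry_le_enorm.
have op0 : 0 <= opnorm A.
  have [z zS] := hs.1; apply: le_trans (ub_le_sup hs.2 zS).
  by case: zS => x _ <-; exact: enorm_ge0.
apply: mx_norm_le => // i j.
have -> : A i j = (A *m (delta_mx j 0 : 'cV_q)) i 0.
  rewrite mxE (bigD1 j)//= big1 ?addr0 => [|l lj]; first by rewrite mxE !eqxx mulr1.
  by rewrite mxE (negbTE lj) mulr0.
rewrite (le_trans (entry_le_enorm _ _ _))//; apply: ub_le_sup; first exact: hs.2.
exists (delta_mx j 0) => //=; rewrite /enorm.
rewrite (eq_bigr (fun l => (l == j)%:R)); last first.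
  by move=> l _; rewrite big_ord1 mxE andbT; case: eqP; rewrite ?expr1n ?expr0n.
rewrite (bigD1 j)//= eqxx big1 ?addr0 ?sqrtr1// => l lj.
by rewrite (negbTE lj).
Qed.

Lemma mx_norm_mul p q r (A : 'M[R]_(p, q)) (B : 'M[R]_(q, r)) :
  `|A *m B| <= q%:R * `|A| * `|B|.
Proof.
apply: mx_norm_le; first by rewrite !mulr_ge0.
move=> i j; rewrite mxE (le_trans (ler_norm_sum _ _ _))//.
rewrite -[q in q%:R]card_ord -sumr_const !mulr_suml; apply: ler_sum => l _.
by rewrite normrM mul1r ler_pM// mx_norm_entry.
Qed.

(** The mean value theorem on the segment from [x] to [y]; the factor [m] comes from the product
    bound for the max-norm. *)
Lemma mean_value_estimate m (h : 'cV[R]_m -> R) (gr : 'cV[R]_m -> 'rV[R]_m)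
    (x y : 'cV[R]_m) (L : R) :
  (forall z, differentiable (h : 'cV[R]_m -> R^o) z) ->
  (forall z j, gr z 0 j = 'D_(delta_mx j 0) (h : _ -> R^o) z) ->
  (forall s : R, 0 <= s <= 1 -> `|gr (x + s *: (y - x)) - gr x| <= L * `|y - x|) ->
  `|h y - h x - (gr x *m (y - x)) 0 0| <= m%:R * L * `|y - x| ^+ 2.
Proof.
move=> dh hgr hL; set d := y - x.
pose p (s : R) : R := h (x + s *: d).
have grE z : 'D_d (h : _ -> R^o) z = (gr z *m d) 0 0.
  rewrite deriveE// {1}(matrix_sum_delta d) linear_sum mxE; apply: eq_bigr => j _.
  by rewrite big_ord1 linearZ/= hgr deriveE// mulrC.
have dp (s : R) : is_derive s 1 (p : R -> R^o) ((gr (x + s *: d) *m d) 0 0).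
  have E : (fun e : R => e^-1 *: ((p \o shift s) (e *: (1 : R)) - p s) : R^o) =
    (fun e : R => e^-1 *: (((h : _ -> R^o) \o shift (x + s *: d)) (e *: d) - h (x + s *: d))).
    apply/funext => e; rewrite /= /p; congr (_ *: (h _ - _)).
    by rewrite /= scalerDl /GRing.scale /= mulr1 addrCA.
  have dd : derivable (h : _ -> R^o) (x + s *: d) d by exact: diff_derivable.
  split; first by rewrite /derivable E.
  by rewrite -grE /derive E.
have cp : {within `[0, 1], continuous p}.
  apply: continuous_subspaceT => s; apply: differentiable_continuous.
  by apply/derivable1_diffP; have [] := dp s.
have [c c01] := MVT ltr01 (fun s _ => dp s) cp.
have p1 : p 1 = h y by rewrite /p scale1r /d addrC subrK.
have p0 : p 0 = h x by rewrite /p scale0r addr0.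
rewrite p1 p0 subr0 mulr1 => ->.
have -> : (gr (x + c *: d) *m d) 0 0 - (gr x *m d) 0 0 = ((gr (x + c *: d) - gr x) *m d) 0 0.
  by rewrite mulmxBl !mxE.
rewrite (le_trans (mx_norm_entry _ _ _))// (le_trans (mx_norm_mul _ _))//.
rewrite expr2 -!mulrA ler_wpM2l// mulrA ler_wpM2r//.
by apply: hL; move: c01; rewrite in_itv/= => /andP[? ?]; rewrite !ltW.
Qed.

Lemma cV_ball_compact (p n : nat) : compact [set x : 'cV[R]_p | `|x| <= n%:R].
Proof.
have -> : [set x : 'cV[R]_p | `|x| <= n%:R] =
    (fun y : 'rV[R]_p => y^T) @` [set y : 'rV[R]_p | `|y| <= n%:R].
  have tr (a b : nat) (A : 'M[R]_(a, b)) : `|A^T| <= `|A|.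
    by apply: mx_norm_le => // i j; rewrite mxE mx_norm_entry.
  apply/seteqP; split=> x /=.
    by move=> xn; exists x^T; rewrite ?trmxK// (le_trans (tr _ _ _)).
  by move=> [y yn <-]; rewrite (le_trans (tr _ _ _)).
apply: continuous_compact.
  apply: continuous_subspaceT => y A /nbhs_ballP[e /= e0 eA].
  apply/nbhs_ballP; exists e => //= z; rewrite mx_norm_ball /ball_ /= => yz.
  apply: eA; rewrite mx_norm_ball /ball_ /= (le_lt_trans _ yz)//.
  by apply: mx_norm_le => // i j; have := mx_norm_entry (y - z) j i; rewrite !mxE.
apply: bounded_closed_compact.
  by exists n%:R; split => // M nM y /= /le_trans; apply; exact: ltW.
rewrite (_ : mkset _ = (fun y : 'rV[R]_p => `|y|) @^-1` [set r | r <= n%:R])//.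
by apply: closed_comp => [y _|]; [exact: norm_continuous|exact: closed_le].
Qed.

End Norms.

(** * Borel representatives of the data *)

(* The data of a regular problem after redefinition by 0 on a null set of times,
   with one Borel bound [ell n] for everything that happens in the balls of
   radius [n]. *)
Record model (R : realType) (m k : nat) (P : control_problem R m k) := Model {
  mF : R -> 'cV[R]_m -> 'cV[R]_k -> 'cV[R]_m;
  mFx : R -> 'cV[R]_m -> 'cV[R]_k -> 'M[R]_m;
  mG : R -> 'cV[R]_m -> 'cV[R]_k -> R;
  mGx : R -> 'cV[R]_m -> 'cV[R]_k -> 'rV[R]_m;
  ell : nat -> R -> R;
  mF_meas : forall x u i, measurable_fun Time (fun t => mF t x u i 0);
  mFx_meas : forall x u i j, measurable_fun Time (fun t => mFx t x u i j);
  mG_meas : forall x u, measurable_fun Time (fun t => mG t x u);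
  mGx_meas : forall x u j, measurable_fun Time (fun t => mGx t x u 0 j);
  mF_cont : forall t, 0 <= t -> continuous (fun w : 'cV[R]_m * 'cV[R]_k => mF t w.1 w.2);
  mFx_cont : forall t, 0 <= t -> continuous (fun w : 'cV[R]_m * 'cV[R]_k => mFx t w.1 w.2);
  mG_cont : forall t, 0 <= t -> continuous (fun w : 'cV[R]_m * 'cV[R]_k => mG t w.1 w.2);
  mGx_cont : forall t, 0 <= t -> continuous (fun w : 'cV[R]_m * 'cV[R]_k => mGx t w.1 w.2);
  ell_lint : forall n, lint (ell n);
  ell_ge1 : forall n t, 0 <= t -> 1 <= ell n t;
  ell_mono : forall n p t, (n <= p)%N -> 0 <= t -> ell n t <= ell p t;
  mF_bound : forall n t x u, 0 <= t -> `|x| <= n%:R -> `|u| <= n%:R -> `|mF t x u| <= ell n t;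
  mFx_bound : forall n t x u, 0 <= t -> `|x| <= n%:R -> `|u| <= n%:R -> `|mFx t x u| <= ell n t;
  mG_bound : forall n t x u, 0 <= t -> `|x| <= n%:R -> `|u| <= n%:R -> `|mG t x u| <= ell n t;
  mGx_bound : forall n t x u, 0 <= t -> `|x| <= n%:R -> `|u| <= n%:R -> `|mGx t x u| <= ell n t;
  mF_lip : forall n t x y u, 0 <= t -> `|x| <= n%:R -> `|y| <= n%:R -> `|u| <= n%:R ->
    `|mF t x u - mF t y u| <= `|x - y| * ell n t;
  mFx_lip : forall n t x y u, 0 <= t -> `|x| <= n%:R -> `|y| <= n%:R -> `|u| <= n%:R ->
    `|mFx t x u - mFx t y u| <= `|x - y| * ell n t;
  mGx_lip : forall n t x y u, 0 <= t -> `|x| <= n%:R -> `|y| <= n%:R -> `|u| <= n%:R ->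
    `|mGx t x u - mGx t y u| <= `|x - y| * ell n t;
  mF_growth : forall n t x u, 0 <= t -> `|u| <= n%:R -> `|mF t x u| <= (1 + `|x|) * ell n t;
  mF_taylor : forall n t x y u, 0 <= t -> `|x| <= n%:R -> `|y| <= n%:R -> `|u| <= n%:R ->
    `|mF t y u - mF t x u - mFx t x u *m (y - x)| <= `|y - x| ^+ 2 * ell n t;
  mG_taylor : forall n t x y u, 0 <= t -> `|x| <= n%:R -> `|y| <= n%:R -> `|u| <= n%:R ->
    `|mG t y u - mG t x u - (mGx t x u *m (y - x)) 0 0| <= `|y - x| ^+ 2 * ell n t;
  model_ae : {ae lebesgue_measure, forall t, Time t ->
    [/\ dyn P t = mF t, cost P t = mG t, dfdx P t = mFx t, dgdx P t = mGx t &
      forall x u (lam : R) psi, dHdx P x t u lam psi = psi *m mFx t x u + lam *: mGx t x u]} }.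

Section ModelExists.
Context {R : realType} {m k : nat} (P : control_problem R m k).
Local Notation mu := (@lebesgue_measure R).
Local Notation X := 'cV[R]_m.
Local Notation UU := 'cV[R]_k.

(** Converts the moduli on the ball of radius [n] from the norms of the hypotheses to the max-norm,
    and from the completed measure to the Borel one. *)
Let boundf (V : normedModType R) (nrm : V -> R) (a : R -> X -> UU -> V) :
  (forall v, `|v| <= nrm v) -> regular_map nrm a ->
  forall n : nat, exists2 l : R -> R, lint l & {ae mu, forall t, Time t ->
    [/\ forall x u, `|x| <= n%:R -> `|u| <= n%:R -> `|a t x u| <= l t &
      forall x y u, `|x| <= n%:R -> `|y| <= n%:R -> `|u| <= n%:R ->
        `|a t x u - a t y u| <= `|x - y| * l t]}.
Proof.
move=> hn [_ H] n.
have cK := compact_setX (@cV_ball_compact R m n) (@cV_ball_compact R k n).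
have [L [M [iL iM LM0 HL HM]]] := H _ cK.
have [L' iL' LL'] := locally_integrable_borel iL.
have [M' iM' MM'] := locally_integrable_borel iM.
exists (fun t => (m * 1).+1%:R * L' t + M' t).
  by apply: lintD => //; exact: lintZ.
apply: (aeS2 LL' MM') => t LL MM t0; have [L0 M0] := LM0 t t0.
have Lp := LL t0; have Mp := MM t0; split => [x u xn un|x y u xn yn un].
  rewrite (le_trans (hn _))// (le_trans (HM _ _ _ t0 _))// -Mp lerDr.
  by rewrite mulr_ge0// -Lp.
rewrite (le_trans (hn _))// (le_trans (HL _ x y u t0 _ _))// -Lp -Mp mulrDr.
rewrite ler_wpDr ?mulr_ge0// mulrA mulrC (mulrC `|_|).
by rewrite ler_wpM2r// enorm_le.
Qed.

Let growthf : sublinear_growth P ->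
  forall n : nat, exists2 l : R -> R, lint l & {ae mu, forall t, Time t ->
    forall x u, `|u| <= n%:R -> `|dyn P t x u| <= (1 + `|x|) * l t}.
Proof.
move=> H n; have [l il hl] := H _ (@cV_ball_compact R k n).
have [l' il' ll'] := locally_integrable_borel il.
exists (fun t => (m * 1).+1%:R * l' t); first exact: lintZ.
apply: (aeS ll') => t lt t0 x u un.
have := hl t x u t0 un; rewrite (lt t0) => h.
have l0 : 0 <= l' t.
  have := le_trans (enorm_ge0 _) h; rewrite pmulr_lge0// ltr_pwDl//; exact: enorm_ge0.
rewrite (le_trans (norm_le_enorm _))// (le_trans h)// mulrA mulrC ler_wpM2r//.
by rewrite mulrDl mul1r (mulrC `|x|) lerD// ?ler1n// enorm_le.
Qed.

Let ball_convex (p n : nat) (x y : 'cV[R]_p) (s : R) : `|x| <= n%:R -> `|y| <= n%:R ->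
  0 <= s <= 1 -> `|x + s *: (y - x)| <= n%:R.
Proof.
move=> xn yn /andP[s0 s1].
have -> : x + s *: (y - x) = (1 - s) *: x + s *: y.
  by rewrite scalerBr scalerBl scale1r [RHS]addrAC addrA.
rewrite (le_trans (ler_normD _ _))// !normrZ ger0_norm ?subr_ge0// (ger0_norm s0).
apply: (@le_trans _ _ ((1 - s) * n%:R + s * n%:R)).
  by rewrite lerD// ler_wpM2l// subr_ge0.
by rewrite -mulrDl subrK mul1r.
Qed.

Let derive_entry (p q : nat) (h : X -> 'M[R]_(p, q)) x v i j : differentiable h x ->
  is_derive x v (fun y => h y i j : R^o) ('D_v h x i j).
Proof.
move=> dh; have dv : derivable h x v by exact: diff_derivable.
split; first by move/derivable_mxP : dv.
by rewrite derive_mx// mxE.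
Qed.

(** The null set [N] collects the times at which continuity or one of the countably many bounds
    fails. Multiplication by the indicator [chi] of its complement makes all conditions hold at
    every time. *)
Lemma model_exists : regular_problem P -> inhabited (model P).
Proof.
move=> [df dg [rf rg] [rfx rgx] gr].
have hf := boundf (@norm_le_enorm R m 1) rf.
have hg := boundf (fun r : R^o => lexx `|r|) rg.
have hfx := boundf (@norm_le_opnorm R m m) rfx.
have hgx := boundf (@norm_le_enorm R 1 m) rgx.
have hgr := growthf gr.
have ch (Q : (R -> R) -> nat -> Prop) : (forall n, exists2 l, lint l & Q l n) ->
    exists l : nat -> R -> R, forall n, lint (l n) /\ Q (l n) n.
  move=> H; have H' n : exists l, lint l /\ Q l n by have [l] := H n; exists l.
  by have [l hl] := choice H'; exists l.
have {hf}[lf hf] := ch _ hf; have {hg}[lg hg] := ch _ hg.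
have {hfx}[lfx hfx] := ch _ hfx; have {hgx}[lgx hgx] := ch _ hgx.
have {hgr}[lgr hgr] := ch _ hgr.
(* The factor [m.+1] covers both the plain bounds and the factor [m] of [mean_value_estimate]. In
   [L], the sum over smaller radii gives monotonicity in [n], and the summand 1 gives [ell_ge1]. *)
pose c : R := m.+1%:R.
have c1 : 1 <= c by rewrite ler1n.
have c0 : 0 <= c by exact: le_trans c1.
pose T n t := `|lf n t| + `|lg n t| + c * `|lfx n t| + c * `|lgx n t| + `|lgr n t|.
pose L n t := 1 + \sum_(i < n.+1) T i t.
have T0 n t : 0 <= T n t by rewrite !addr_ge0// mulr_ge0.
have TL n t : T n t <= L n t.
  by rewrite /L big_ord_recr /= addrA lerDr addr_ge0// sumr_ge0.
have TE n t : [/\ lf n t <= L n t, lg n t <= L n t, c * lfx n t <= L n t, c * lgx n t <= L n t & lgr n t <= L n t].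
  have cn h : 0 <= c * `|h : R| by rewrite mulr_ge0.
  have ab h : c * h <= c * `|h : R| by rewrite ler_wpM2l// ler_norm.
  have := TL n t; rewrite /T.
  have := (ler_norm (lf n t), ler_norm (lg n t), ab (lfx n t), ab (lgx n t), ler_norm (lgr n t)).
  have := (normr_ge0 (lf n t), normr_ge0 (lg n t), cn (lfx n t), cn (lgx n t), normr_ge0 (lgr n t)).
  move: (L n t) (lf n t) (lg n t) (c * lfx n t) (c * lgx n t) (lgr n t)
   (`|lf n t|) (`|lg n t|) (c * `|lfx n t|) (c * `|lgx n t|) (`|lgr n t|).
  clear => u0 u1 u2 u3 u4 u5 v1 v2 v3 v4 v5 [[[[p1 p2] p3] p4] p5] [[[[q1 q2] q3] q4] q5] h.
  by split; lra.
have cfxL n t h : 0 <= h -> h <= lfx n t -> h <= L n t.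
  have [_ _ + _ _] := TE n t; move=> H h0 hl; rewrite (le_trans hl)// (le_trans _ H)//.
  by rewrite ler_peMl// (le_trans h0).
have cgxL n t h : 0 <= h -> h <= lgx n t -> h <= L n t.
  have [_ _ _ + _] := TE n t; move=> H h0 hl; rewrite (le_trans hl)// (le_trans _ H)//.
  by rewrite ler_peMl// (le_trans h0).
have lfxL n t : lfx n t <= L n t.
  have [h|/ltW h] := leP 0 (lfx n t); first exact: cfxL.
  by rewrite (le_trans h)// (le_trans (T0 n t)).
have lgxL n t : lgx n t <= L n t.
  have [h|/ltW h] := leP 0 (lgx n t); first exact: cgxL.
  by rewrite (le_trans h)// (le_trans (T0 n t)).
pose good t := [/\ continuous (fun w : X * UU => dyn P t w.1 w.2),
   continuous (fun w : X * UU => dfdx P t w.1 w.2),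
   continuous (fun w : X * UU => cost P t w.1 w.2 : R^o) &
   continuous (fun w : X * UU => dgdx P t w.1 w.2)].
pose Bd (V : normedModType R) (a : R -> X -> UU -> V) (l : nat -> R -> R) t :=
  forall n, (forall x u, `|x| <= n%:R -> `|u| <= n%:R -> `|a t x u| <= l n t) /\
      (forall x y u, `|x| <= n%:R -> `|y| <= n%:R -> `|u| <= n%:R ->
        `|a t x u - a t y u| <= `|x - y| * l n t).
have aeand (Q1 Q2 : R -> Prop) : {ae mu, forall t, Time t -> Q1 t} ->
    {ae mu, forall t, Time t -> Q2 t} -> {ae mu, forall t, Time t -> Q1 t /\ Q2 t}.
  by move=> h1 h2; apply: (aeS2 h1 h2) => t q1 q2 t0; split; [exact: q1|exact: q2].
have aegood : {ae mu, forall t, Time t -> good t}.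
  have [_ h1] := rf.1; have [_ h2] := rfx.1; have [_ h3] := rg.1; have [_ h4] := rgx.1.
  apply: (aeS (aeand _ _ (aeand _ _ h1 h2) (aeand _ _ h3 h4))) => t H t0.
  by have [[? ?] [? ?]] := H t0; split.
have aeBd (V : normedModType R) (a : R -> X -> UU -> V) (l : nat -> R -> R) :
   (forall n, lint (l n) /\ {ae mu, forall t, Time t ->
    (forall x u, `|x| <= n%:R -> `|u| <= n%:R -> `|a t x u| <= l n t) /\
    (forall x y u, `|x| <= n%:R -> `|y| <= n%:R -> `|u| <= n%:R ->
        `|a t x u - a t y u| <= `|x - y| * l n t)}) ->
   {ae mu, forall t, Time t -> Bd V a l t}.
  move=> H; have : {ae mu, forall t, forall n, Time t ->
      (forall x u, `|x| <= n%:R -> `|u| <= n%:R -> `|a t x u| <= l n t) /\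
      (forall x y u, `|x| <= n%:R -> `|y| <= n%:R -> `|u| <= n%:R ->
        `|a t x u - a t y u| <= `|x - y| * l n t)}.
    by apply: ae_foralln => n; exact: (H n).2.
  by move=> H'; apply: (aeS H') => t Ht t0 n; exact: Ht.
have aegr : {ae mu, forall t, Time t -> forall n x u, `|u| <= n%:R ->
     `|dyn P t x u| <= (1 + `|x|) * lgr n t}.
  have : {ae mu, forall t, forall n, Time t -> forall x u, `|u| <= n%:R ->
     `|dyn P t x u| <= (1 + `|x|) * lgr n t}.
    by apply: ae_foralln => n; exact: (hgr n).2.
  by move=> H'; apply: (aeS H') => t Ht t0 n; exact: Ht.
have := aeand _ _ aegood (aeand _ _ aegr (aeand _ _ (aeand _ _ (aeBd _ _ _ hf) (aeBd _ _ _ hfx))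
   (aeand _ _ (aeBd _ _ _ hg) (aeBd _ _ _ hgx)))).
move=> [N [mN N0 hN]].
pose chi t : R := \1_(~` N) t.
have chi_meas : measurable_fun Time chi by exact/measurable_funTS/measurable_indic/measurableC.
have chiP t : Time t -> chi t = 0 \/ chi t = 1 /\
    (good t /\ (forall n x u, `|u| <= n%:R -> `|dyn P t x u| <= (1 + `|x|) * lgr n t) /\
    (Bd _ (dyn P) lf t /\ Bd _ (dfdx P) lfx t) /\
     (Bd _ (cost P : R -> X -> UU -> R^o) lg t /\ Bd _ (dgdx P) lgx t)).
  move=> t0; rewrite /chi indicE; have [Nt|Nt] := pselect (N t).
    by left; rewrite memNset//; exact.
  right; rewrite mem_set//; split => //; apply: contrapT => H; apply: Nt; apply: hN => /=.
  by move=> /(_ t0).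
have tT t : 0 <= t -> @Time R t by rewrite /Time /= in_itv/= andbT.
have L0 n t : 0 <= L n t by rewrite (le_trans _ (TL n t)).
have B1 (V : normedModType R) t (v : V) (b : R) : chi t = 0 -> 0 <= b ->
  `|chi t *: v| <= b by move=> ->; rewrite scale0r normr0.
constructor; apply: (@Model _ _ _ P (fun t x u => chi t *: dyn P t x u)
  (fun t x u => chi t *: dfdx P t x u) (fun t x u => chi t * cost P t x u)
  (fun t x u => chi t *: dgdx P t x u) L).
- move=> x u i; under eq_fun do rewrite mxE; apply: measurable_funM => //.
  by apply: borel_fun_entry; [exact: measurable_Time|exact: (rf.1.1 (x, u))].
- move=> x u i j; under eq_fun do rewrite mxE; apply: measurable_funM => //.
  by apply: borel_fun_entry; [exact: measurable_Time|exact: (rfx.1.1 (x, u))].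
- move=> x u; apply: measurable_funM => //.
  by apply: borel_fun_real; [exact: measurable_Time|exact: (rg.1.1 (x, u))].
- move=> x u j; under eq_fun do rewrite mxE; apply: measurable_funM => //.
  by apply: borel_fun_entry; [exact: measurable_Time|exact: (rgx.1.1 (x, u))].
- move=> t /tT t0; have [->|[-> [[cf _ _ _] _]]] := chiP t t0.
    by under eq_fun do rewrite scale0r; move=> w; exact: cvg_cst.
  by under eq_fun do rewrite scale1r.
- move=> t /tT t0; have [->|[-> [[_ cf _ _] _]]] := chiP t t0.
    by under eq_fun do rewrite scale0r; move=> w; exact: cvg_cst.
  by under eq_fun do rewrite scale1r.
- move=> t /tT t0; have [->|[-> [[_ _ cf _] _]]] := chiP t t0.
    by under eq_fun do rewrite mul0r; move=> w; exact: cvg_cst.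
  by under eq_fun do rewrite mul1r.
- move=> t /tT t0; have [->|[-> [[_ _ _ cf] _]]] := chiP t t0.
    by under eq_fun do rewrite scale0r; move=> w; exact: cvg_cst.
  by under eq_fun do rewrite scale1r.
- move=> n; apply: lintD; first exact: lint_cst.
  apply: (@lint_sum _ _ (index_enum 'I_n.+1) (fun i : 'I_n.+1 => T i)) => i.
  have [h1 _] := hf i; have [h2 _] := hg i; have [h3 _] := hfx i; have [h4 _] := hgx i.
  have [h5 _] := hgr i.
  do !apply: lintD; try exact: lint_norm; apply: lintZ; exact: lint_norm.
- by move=> n t _; rewrite lerDl sumr_ge0.
- move=> n p t np _; rewrite lerD2l (big_ord_widen p.+1 (fun i => T i t)) ?ltnS//.
  by rewrite big_mkcond /=; apply: ler_sum => i _; case: ifP.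
- move=> n t x u /tT t0 xn un; have [z|[z [_ [_ [[B _] _]]]]] := chiP t t0; first exact: B1.
  by rewrite z scale1r (le_trans ((B n).1 _ _ xn un))//; have [] := TE n t.
- move=> n t x u /tT t0 xn un; have [z|[z [_ [_ [[_ B] _]]]]] := chiP t t0; first exact: B1.
  by rewrite z scale1r; apply: cfxL => //; exact: (B n).1.
- move=> n t x u /tT t0 xn un; have [z|[z [_ [_ [_ [B _]]]]]] := chiP t t0.
    by rewrite z mul0r normr0.
  by rewrite z mul1r (le_trans ((B n).1 _ _ xn un))//; have [] := TE n t.
- move=> n t x u /tT t0 xn un; have [z|[z [_ [_ [_ [_ B]]]]]] := chiP t t0; first exact: B1.
  by rewrite z scale1r; apply: cgxL => //; exact: (B n).1.
- move=> n t x y u /tT t0 xn yn un; have [z|[z [_ [_ [[B _] _]]]]] := chiP t t0.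
    by rewrite z !scale0r subrr normr0 mulr_ge0.
  rewrite z !scale1r (le_trans ((B n).2 _ _ _ xn yn un))// ler_wpM2l//.
  by have [] := TE n t.
- move=> n t x y u /tT t0 xn yn un; have [z|[z [_ [_ [[_ B] _]]]]] := chiP t t0.
    by rewrite z !scale0r subrr normr0 mulr_ge0.
  by rewrite z !scale1r (le_trans ((B n).2 _ _ _ xn yn un))// ler_wpM2l.
- move=> n t x y u /tT t0 xn yn un; have [z|[z [_ [_ [_ [_ B]]]]]] := chiP t t0.
    by rewrite z !scale0r subrr normr0 mulr_ge0.
  by rewrite z !scale1r (le_trans ((B n).2 _ _ _ xn yn un))// ler_wpM2l.
- move=> n t x u /tT t0 un; have [z|[z [_ [B _]]]] := chiP t t0.
    by rewrite z scale0r normr0 mulr_ge0// addr_ge0.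
  rewrite z scale1r (le_trans (B n _ _ un))// ler_wpM2l ?addr_ge0//.
  by have [] := TE n t.
- move=> n t x y u /tT t0 xn yn un; have [z|[z [_ [_ [[_ B] _]]]]] := chiP t t0.
    by rewrite z !scale0r mul0mx !subr0 normr0 mulr_ge0// exprn_ge0.
  rewrite z !scale1r; apply: mx_norm_le; first by rewrite mulr_ge0// exprn_ge0.
  move=> i j; rewrite ord1.
  have l0 : 0 <= lfx n t by apply: le_trans ((B n).1 _ _ xn un).
  have H := @mean_value_estimate R m (fun z => dyn P t z u i 0) (fun z => row i (dfdx P t z u)) x y (lfx n t).
  have E : (row i (dfdx P t x u) *m (y - x)) 0 0 = (dfdx P t x u *m (y - x)) i 0.
    by rewrite -row_mul mxE.
  rewrite !mxE in E *; rewrite -{}E in H *; move: H; rewrite !mxE => H.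
  rewrite (le_trans (H _ _ _))//.
  + by move=> w; exact: (differentiable_comp (df t w u t0) (@differentiable_coord _ _ _ (dyn P t w u) i 0)).
  + by move=> w l; rewrite !mxE; have [_ <-] := derive_entry (delta_mx l 0) i 0 (df t w u t0).
  + move=> s s01; rewrite (@le_trans _ _ `|dfdx P t (x + s *: (y - x)) u - dfdx P t x u|)//.
      apply: mx_norm_le => // i' j'; rewrite -linearB mxE; exact: mx_norm_entry.
    rewrite (le_trans ((B n).2 _ _ _ _ xn un))//; first exact: ball_convex.
    rewrite mulrC ler_wpM2l// addrC addKr normrZ ler_piMl//.
    by case/andP: s01 => s0 s1; rewrite ger0_norm.
  rewrite mulrC ler_wpM2l ?exprn_ge0//.
  have [_ _ h _ _] := TE n t; rewrite (le_trans _ h)// ler_wpM2r// ler_nat.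
  exact: leqnSn.
- move=> n t x y u /tT t0 xn yn un; have [z|[z [_ [_ [_ [_ B]]]]]] := chiP t t0.
    by rewrite z !mul0r scale0r mul0mx mxE !subr0 normr0 mulr_ge0// exprn_ge0.
  rewrite z !mul1r !scale1r.
  have l0 : 0 <= lgx n t by apply: le_trans ((B n).1 _ _ xn un).
  rewrite (le_trans (@mean_value_estimate R m (fun z => cost P t z u) (fun z => dgdx P t z u) x y (lgx n t) _ _ _))//.
  + by move=> w; exact: dg.
  + by move=> w l; rewrite !mxE.
  + move=> s s01; rewrite (le_trans ((B n).2 _ _ _ _ xn un))//; first exact: ball_convex.
    rewrite mulrC ler_wpM2l// addrC addKr normrZ ler_piMl//.
    by case/andP: s01 => s0 s1; rewrite ger0_norm.
  rewrite mulrC ler_wpM2l ?exprn_ge0//.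
  have [_ _ _ h _] := TE n t; rewrite (le_trans _ h)// ler_wpM2r// ler_nat.
  exact: leqnSn.
have chi1 : {ae mu, forall t, chi t = 1}.
  exists N; split => // t /= H; apply: contrapT => Nt; apply: H.
  by rewrite /chi indicE mem_set.
apply: (aeS chi1) => t z t0.
split; try by apply/funext => x; apply/funext => u; rewrite z ?scale1r ?mul1r.
move=> x u lam psi; rewrite z !scale1r; apply/rowP => j; rewrite !mxE.
rewrite /hamiltonian /partial.
have h1 i : is_derive x (delta_mx j 0) (fun y => dyn P t y u i 0 : R^o)
    ('D_(delta_mx j 0) (fun y => dyn P t y u) x i 0) by exact/derive_entry/df.
have h2 : is_derive x (delta_mx j 0) (fun y => cost P t y u : R^o)
    ('D_(delta_mx j 0) (fun y => cost P t y u : R^o) x).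
  by apply: derivableP; exact/diff_derivable/dg.
have h3 i := is_deriveZ (psi 0 i) (h1 i).
have h4 := is_deriveD (is_derive_sum h3) (is_deriveZ lam h2).
have E : (fun y => (psi *m dyn P t y u) 0 0 + lam * cost P t y u : R^o) =
  \sum_(i < m) (psi 0 i \*: (fun y => dyn P t y u i 0 : R^o)) + (lam \*: (fun y => cost P t y u : R^o)).
  by apply/funext => y; rewrite mxE !fctE /= fct_sumE.
rewrite E; have [_ ->] := h4; congr (_ + _).
by apply: eq_bigr => i _; rewrite mxE.
Qed.

End ModelExists.

(** * Measurable selection *)

Lemma mkseq_cons (sg : nat -> nat) n : mkseq sg n.+1 = sg 0%N :: mkseq (fun j => sg j.+1) n.
Proof. by rewrite /mkseq -[iota 0 n.+1]/(0%N :: iota (1 + 0) n) map_cons iotaDl -map_comp. Qed.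

(** * Souslin sets and Borel sets *)

Section Souslin.
Context {T : topologicalType}.

(** The Souslin operation on closed sets, indexed by the finite prefixes of [sg]. *)
Definition souslin (A : set T) := exists F : seq nat -> set T,
  (forall s, closed (F s)) /\ A = [set y | exists sg : nat -> nat, forall n, F (mkseq sg n) y].

Lemma souslin_closed (A : set T) : closed A -> souslin A.
Proof.
move=> cA; exists (fun=> A); split=> //; apply/seteqP; split=> y /=.
  by exists (fun=> 0%N).
by move=> [_ /(_ 0%N)].
Qed.

Lemma souslin_bigcup (A : nat -> set T) : (forall i, souslin (A i)) -> souslin (\bigcup_i A i).
Proof.
move=> /choice[F hF].
exists (fun s => if s is i :: s' then F i s' else setT); split=> [[|i s]|].
- exact: closedT.
- by have [] := hF i.
apply/seteqP; split=> y /=.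
  move=> [i _]; have [_ ->] := hF i => -[sg h].
  exists (fun n => if n is n'.+1 then sg n' else i) => -[//|n].
  by rewrite mkseq_cons; exact: h.
move=> [sg h]; exists (sg 0%N) => //; have [_ ->] := hF (sg 0%N).
exists (fun n => sg n.+1) => n.
pose G s := if s is i :: s' then F i s' else setT.
have H : G (mkseq sg n.+1) y by exact: (h n.+1).
by rewrite mkseq_cons in H.
Qed.

(** One sequence encodes countably many through [pickle]. A prefix of it reveals a prefix of the
    [i]-th sequence only as far as all codes involved lie inside it, and only those constraints are
    imposed. *)
Lemma souslin_bigcap (A : nat -> set T) : (forall i, souslin (A i)) -> souslin (\bigcap_i A i).
Proof.
move=> /choice[F hF].
pose code (i j : nat) : nat := pickle (i, j).
exists (fun s => [set y | forall i n, (forall j, (j < n)%N -> (code i j < size s)%N) ->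
   F i (mkseq (fun j => nth 0%N s (code i j)) n) y]); split.
  move=> s; rewrite (_ : mkset _ = \bigcap_(p in [set p : nat * nat |
      forall j, (j < p.2)%N -> (code p.1 j < size s)%N])
      F p.1 (mkseq (fun j => nth 0%N s (code p.1 j)) p.2)).
    by apply: closed_bigI => -[i n] _; have [] := hF i.
  by apply/seteqP; split=> y /= H; [move=> [i n] /= h; exact: H|move=> i n h; exact: (H (i, n) h)].
apply/seteqP; split=> y /=.
  move=> H; have H' i : exists sg : nat -> nat, forall n, F i (mkseq sg n) y.
    by have := H i I; have [_ ->] := hF i.
  have [sg hsg] := choice H'.
  exists (fun c => if unpickle c is Some p then sg (p : nat * nat).1 p.2 else 0%N) => n i p hp.
  have -> : mkseq (fun j => nth 0%N (mkseq (fun c => if unpickle c is Some p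
      then sg (p : nat * nat).1 p.2 else 0%N) n) (code i j)) p = mkseq (sg i) p.
    apply/eq_in_map => j; rewrite mem_iota add0n => /andP[_ jp].
    rewrite nth_mkseq; first by rewrite pickleK.
    by have := hp j jp; rewrite size_mkseq.
  exact: hsg.
move=> [sg h] i _; have [_ ->] := hF i; exists (fun j => sg (code i j)) => n.
pose N := (\max_(j < n) (code i j).+1)%N.
have hN j : (j < n)%N -> (code i j < N)%N.
  by move=> jn; exact: (@leq_bigmax _ (fun j : 'I_n => (code i j).+1) (Ordinal jn)).
have := h N i n; rewrite size_mkseq => /(_ hN).
have -> // : mkseq (fun j => nth 0%N (mkseq sg N) (code i j)) n = mkseq (fun j => sg (code i j)) n.
apply/eq_in_map => j; rewrite mem_iota add0n => /andP[_ jn].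
by rewrite nth_mkseq// hN.
Qed.

End Souslin.

Section SouslinBorel.
Context {R : realType} {V : normedModType R}.

Lemma souslin_open (O : set V) : open O -> souslin O.
Proof.
move=> oO.
have -> : O = \bigcup_n ~` (\bigcup_(z in ~` O) ball z (n.+1%:R^-1 : R)).
  apply/seteqP; split=> y.
    move=> Oy; have /nbhs_ballP[e /= e0 eO] : nbhs y O by exact: open_nbhs_nbhs.
    have [n _ /(_ n (leqnn n)) ne] := near_infty_natSinv_lt (PosNum e0).
    exists n => // -[z nz /ball_sym yz]; apply: nz; apply: eO.
    exact: le_ball (ltW ne) _ yz.
  move=> [n _ H]; apply: contrapT => nO; apply: H; exists y => //; apply: ballxx.
  by rewrite invr_gt0.
apply: souslin_bigcup => n; apply: souslin_closed; apply: open_closedC.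
by apply: bigcup_open => z _; exact: ball_open.
Qed.

(** The Souslin operation does not respect complements, so the induction runs over the sets that are
    Souslin together with their complement; these form a sigma-algebra. *)
Lemma souslin_borel (B : set V) : <<s @open V >> B -> souslin B.
Proof.
move=> bB; have [] // : souslin B /\ souslin (~` B).
move: B bB; apply: smallest_sub; last first.
  by move=> O oO; split; [exact: souslin_open|apply: souslin_closed; exact: open_closedC].
split.
- by split; apply: souslin_closed; rewrite ?setC0; [exact: closed0|exact: closedT].
- by move=> A [sA sC]; rewrite setTD setCK.
- move=> A H; split; first by apply: souslin_bigcup => i; have [] := H i.
  by rewrite setC_bigcup; apply: souslin_bigcap => i; have [] := H i.
Qed.

End SouslinBorel.

(** * Outer measure and capacitability *)

Section Smallness.
Context {R : realType}.
Local Notation mu := (@lebesgue_measure R).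

(** Says that the outer measure of [S] is at most [a]; it makes sense for projections of Borel sets
    before their measurability is known. *)
Definition small (a : R) (S : set R) := exists2 B, measurable B & S `<=` B /\ (mu B <= a%:E)%E.

Lemma smallS a S S' : S `<=` S' -> small a S' -> small a S.
Proof. by move=> SS [B mB [SB h]]; exists B => //; split => //; exact: subset_trans SB. Qed.

(** Continuity of outer measure from below: the cover of [S n] is shrunk to the intersection of all
    later covers, which still contains [S n] and now increases with [n]. *)
Lemma small_bigcup a (S : nat -> set R) : (forall n, S n `<=` S n.+1) -> (forall n, small a (S n)) ->
  small a (\bigcup_n S n).
Proof.
move=> inc H; have H' n : exists B, measurable B /\ (S n `<=` B /\ (mu B <= a%:E)%E).
  by have [B mB h] := H n; exists B.
have [B hB] := choice H'.
pose C n := \bigcap_(i in [set i | (n <= i)%N]) B i.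
have mC n : measurable (C n).
  by apply: bigcap_measurable => [|i _]; [exists n|have [] := hB i] => /=.
have incC : nondecreasing_seq C.
  by move=> n p np; apply/subsetPset => y Cy i pi; apply: Cy => /=; exact: leq_trans pi.
have SC n : S n `<=` C n.
  move=> y Sy i /= ni; have [_ [SB _]] := hB i; apply: SB.
  by rewrite -(subnK ni); elim: (i - n)%N => [//|j IH]; exact: inc.
have mU : measurable (\bigcup_n C n) by exact: bigcupT_measurable.
exists (\bigcup_n C n) => //; split; first by apply: subset_bigcup => n _; exact: SC.
have cv : mu \o C @ \oo --> mu (\bigcup_n C n) by exact: nondecreasing_cvg_mu.
rewrite -(cvg_lim _ cv)//; apply: lime_le; first by apply/cvg_ex; eexists; exact: cv.
near=> n; have [mB [_ h]] := hB n; apply: le_trans h.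
apply: le_measure; rewrite ?inE//; first exact: mC.
by move=> y Cy; apply: Cy => /=.
Unshelve. all: by end_near. Qed.

Lemma not_negligible_small (S : set R) : ~ mu.-negligible S ->
  exists2 a : R, 0 < a & ~ small a S.
Proof.
move=> nS; apply: contrapT => H; apply: nS.
have H' (n : nat) : exists B, measurable B /\ (S `<=` B /\ (mu B <= (n.+1%:R^-1)%:E)%E).
  apply: contrapT => h; apply: H; exists n.+1%:R^-1; first by rewrite invr_gt0.
  by move=> [B mB hB]; apply: h; exists B.
have [B hB] := choice H'.
have mB : measurable (\bigcap_n B n) by apply: bigcapT_measurable => n; have [] := hB n.
exists (\bigcap_n B n); split=> //; last by move=> y Sy n _; have [_ [+ _]] := hB n; apply.
apply/eqP; rewrite eq_le measure_ge0 andbT; apply/lee_addgt0Pr => e e0.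
have [n _ /(_ n (leqnn n)) ne] := near_infty_natSinv_lt (PosNum e0).
rewrite add0e; have [mBn [_ h]] := hB n; apply: le_trans (le_trans _ h) _.
  apply: le_measure; rewrite ?inE//; by move=> y; exact.
by rewrite lee_fin ltW.
Qed.

End Smallness.

Lemma dependent_seq (Pr : seq nat -> Prop) : Pr [::] -> (forall l, Pr l -> exists c, Pr (rcons l c)) ->
  exists sg : nat -> nat, forall n, Pr (mkseq sg n).
Proof.
move=> P0 PS; have H l : exists c, Pr l -> Pr (rcons l c).
  have [h|h] := pselect (Pr l); first by have [c hc] := PS l h; exists c.
  by exists 0%N.
have [f hf] := choice H.
pose l := fix l n := if n is n'.+1 then rcons (l n') (f (l n')) else [::].
exists (fun n => f (l n)) => n.
have -> : mkseq (fun n => f (l n)) n = l n by elim: n => // n IH; rewrite mkseqS IH.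
by elim: n => //= n IH; exact: hf.
Qed.

Lemma take_mkseq (sg : nat -> nat) i n : (i <= n)%N -> take i (mkseq sg n) = mkseq sg i.
Proof. by move=> ni; rewrite /mkseq -map_take take_iota; congr (map _ (iota 0 _)); exact/minn_idPl. Qed.

Section Capacitability.
Context {R : realType} {Y : topologicalType} (pr : Y -> R).
Local Notation mu := (@lebesgue_measure R).
Hypotheses (hY : hausdorff_space Y) (cpr : continuous pr).

Let compact_image_measurable (K : set Y) : compact K -> measurable (pr @` K).
Proof.
move=> cK; apply: closed_measurable; apply: compact_closed; first exact: Rhausdorff.
by apply: continuous_compact => //; exact: continuous_subspaceT.
Qed.

(** Choquet's argument. The sequences that describe [A] are bounded coordinate by coordinate by a
    fixed [m] without making the projection small; prefixes below [m] are finite in number at each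
    length, so the approximations [K_ n] are compact, and their intersection is the required
    subset. *)
Lemma capacitability (A Q : set Y) (a c : R) : souslin A -> compact Q -> A `<=` Q ->
  (forall y, Q y -> 0 <= pr y <= c) -> ~ small a (pr @` A) ->
  exists K, [/\ compact K, K `<=` A & (a%:E <= mu (pr @` K))%E].
Proof.
move=> [F [cF AE]] cQ AQ Qc nsA.
pose Al (l : seq nat) := [set y | exists2 sg : nat -> nat,
  (forall j, (j < size l)%N -> (sg j <= nth 0%N l j)%N) & forall n, F (mkseq sg n) y].
(* Sequences whose next coordinate is at most [c'] exhaust all sequences as [c'] grows; by
   [small_bigcup], some [c'] keeps the projection from being small. *)
have [m hm] : exists m : nat -> nat, forall n, ~ small a (pr @` Al (mkseq m n)).
  apply: (dependent_seq (Pr := fun l => ~ small a (pr @` Al l))).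
    apply: contra_not nsA; apply: smallS => _ [y Ay <-]; exists y => //.
    by move: Ay; rewrite AE => -[sg h]; exists sg.
  move=> l nl; apply: contrapT => H; apply: nl.
  have Hs c' : small a (pr @` Al (rcons l c')) by apply: contrapT => h; apply: H; exists c'.
  apply: smallS (small_bigcup _ Hs); last first.
    move=> n _ [y [sg h1 h2] <-]; exists y => //; exists sg => // j jl.
    apply: leq_trans (h1 j _) _; first by move: jl; rewrite !size_rcons.
    by rewrite !nth_rcons; case: ltnP => // _; case: eqP.
  move=> _ [y [sg h1 h2] <-]; exists (sg (size l)) => //; exists y => //; exists sg => // j.
  rewrite size_rcons ltnS leq_eqVlt nth_rcons => /orP[/eqP ->|jl]; first by rewrite ltnn eqxx.
  by rewrite jl; exact: h1.
pose T s y := (forall j, (j < size s)%N -> (nth 0%N s j <= m j)%N) /\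
  forall i, (i <= size s)%N -> F (take i s) y.
have Ttake s y i : T s y -> T (take i s) y.
  move=> [h1 h2]; split=> [j|j].
    by rewrite size_take_min leq_min => /andP[ji js]; rewrite nth_take//; exact: h1.
  by rewrite size_take_min leq_min => /andP[ji js]; rewrite take_takel//; exact: h2.
(* [K_ n] admits every prefix of length [n] below [m], whether or not it extends at [y]. There are
   finitely many of them, so a finite union of closed sets results. *)
pose K_ n := Q `&` [set y | exists s, size s = n /\ T s y].
have cK_ n : compact (K_ n).
  apply: compact_closedI => //.
  pose N := (\max_(j < n) m j)%N.
  have -> : [set y | exists s, size s = n /\ T s y] =
      \bigcup_(t in [set: n.-tuple 'I_N.+1]) [set y | T (map val t) y].
    apply/seteqP; split=> y /=.
      move=> [s [sn [h1 h2]]].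
      have hs : size (map (@inord N) s) == n by rewrite size_map sn.
      exists (Tuple hs) => //=; rewrite -map_comp.
      have -> : map (val \o @inord N) s = s; last by split.
      rewrite -[RHS]map_id; apply/eq_in_map => v /(nthP 0%N)[j js <-] /=.
      rewrite inordK// ltnS; apply: leq_trans (h1 j js) _.
      rewrite sn in js; exact: (@leq_bigmax _ (fun j : 'I_n => m j) (Ordinal js)).
    by move=> [t _ h]; exists (map val t); rewrite size_map size_tuple.
  apply: closed_bigcup => [|t _]; first exact: finite_finset.
  rewrite (_ : mkset _ = \bigcap_(i in [set i | (i <= size (map val t))%N])
      [set y | (forall j, (j < size (map val t))%N -> (nth 0%N (map val t) j <= m j)%N) /\ F (take i (map val t)) y]).
    apply: closed_bigI => i _.
    have [h|h] := pselect (forall j, (j < size (map val t))%N -> (nth 0%N (map val t) j <= m j)%N).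
      rewrite (_ : mkset _ = F (take i (map val t)))//; apply/seteqP; split=> y //=; first by move=> [].
    rewrite (_ : mkset _ = set0); first exact: closed0.
    by apply/seteqP; split=> y //= -[].
  apply/seteqP; split=> y /=; first by move=> [h1 h2] i /= ni; split => //; exact: h2.
  move=> H; split; first by have [] := H 0%N (leq0n _).
  by move=> i ni; have [] := H i ni.
have decK n : K_ n.+1 `<=` K_ n.
  move=> y [Qy [s [sn Ts]]]; split=> //; exists (take n s); split; last exact: Ttake.
  by rewrite size_takel// sn.
have bigK n : (a%:E <= mu (pr @` K_ n))%E.
  rewrite leNgt; apply/negP => h; apply: (hm n).
  exists (pr @` K_ n); first exact: compact_image_measurable.
  split; last exact: ltW.
  apply: image_subset => y [sg h1 h2]; split.
    by apply: AQ; rewrite AE; exists sg.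
  exists (mkseq sg n); rewrite size_mkseq; split=> //; split; rewrite size_mkseq => j jn.
    by rewrite nth_mkseq//; have := h1 j; rewrite size_mkseq nth_mkseq//; apply.
  by rewrite take_mkseq.
pose K := \bigcap_n K_ n.
have clK n : closed (K_ n) by apply: compact_closed.
have cK : compact K.
  apply: subclosed_compact cQ _; last by move=> y /(_ 0%N I)[].
  by apply: closed_bigI => n _.
exists K; split => //.
  move=> y Ky; rewrite AE.
  (* König's lemma: [s] is good when it has bounded extensions of every length at [y]. Only finitely
     many next coordinates are allowed, so if each failed at some length, an extension beyond all
     these lengths would give a contradiction. *)
  pose good s := forall n, (size s <= n)%N -> exists s', [/\ size s' = n, take (size s) s' = s & T s' y].
  have [sg hsg] : exists sg : nat -> nat, forall n, good (mkseq sg n).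
    apply: dependent_seq.
      by move=> n _; have [_ [s [sn Ts]]] := Ky n I; exists s; rewrite take0.
    move=> s gs; apply: contrapT => H.
    have H1 c' : exists n, (size s < n)%N /\ ~ exists s', [/\ size s' = n, take (size s).+1 s' = rcons s c' & T s' y].
      apply: contrapT => h; apply: H; exists c' => n; rewrite size_rcons => sn.
      by apply: contrapT => h'; apply: h; exists n.
    have [nf hnf] := choice H1.
    pose N := maxn (size s).+1 (\max_(c' < (m (size s)).+1) nf c').
    have sN : (size s < N)%N by rewrite leq_max leqnn.
    have [s' [s'N s't Ts']] := gs N (ltnW sN).
    pose c' := nth 0%N s' (size s).
    have c'm : (c' < (m (size s)).+1)%N by rewrite ltnS; apply: Ts'.1; rewrite s'N.
    have nN : (nf c' <= N)%N.
      by rewrite leq_max; apply/orP; right; exact: (@leq_bigmax _ (fun j : 'I_(m (size s)).+1 => nf j) (Ordinal c'm)).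
    have [sn] := hnf c'; apply; exists (take (nf c') s'); split; last exact: Ttake.
      by rewrite size_takel// s'N.
    rewrite take_takel// (take_nth 0%N); last by rewrite s'N.
    by rewrite s't.
  exists sg => n; have [s' [s1 s2 [_ h]]] := hsg n (size (mkseq sg n)) (leqnn _).
  have := h (size s') (leqnn _); rewrite take_size; congr (F _ y).
  by rewrite -s2 -s1 take_size.
(* Projection commutes with this decreasing intersection: points over [t] chosen in each [K_ n]
   cluster, by compactness of [Q], at a point over [t] that lies in all of them. *)
have -> : pr @` K = \bigcap_n (pr @` K_ n).
  apply/seteqP; split=> t.
    by move=> [y Ky <-] n _; exists y => //; exact: Ky.
  move=> Ht; have H n : exists y, K_ n y /\ pr y = t by have [y Ky yt] := Ht n I; exists y.
  have [p hp] := choice H.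
  have [|y [Qy cy]] := cQ (p @ \oo) _.
    by exists 0%N => // n _; have [[]] := hp n.
  exists y.
    move=> n _; apply: (clK n) => B nB.
    have Fn : (p @ \oo) (K_ n).
      have dec2 i : K_ (i + n)%N `<=` K_ n.
        by elim: i => [//|i IH] z; rewrite addSn => /decK; exact: IH.
      by exists n => // j /= nj; have [h _] := hp j; apply: (dec2 (j - n)%N); rewrite subnK.
    exact: cy Fn nB.
  apply: contrapT => ne; have op : open (pr @^-1` (~` [set t])).
    apply: open_comp => [z _|]; first exact: cpr.
    by apply: closed_openC; apply: accessible_closed_set1; apply: hausdorff_accessible; exact: Rhausdorff.
  have nb : nbhs y (pr @^-1` (~` [set t])) by apply: open_nbhs_nbhs; split.
  have Ft : (p @ \oo) (pr @^-1` [set t]) by exists 0%N => // n _; have [] := hp n.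
  by have [z [/= z1 z2]] := cy _ _ Ft nb.
have mK n : measurable (pr @` K_ n) by exact: compact_image_measurable.
have fin0 : (mu (pr @` K_ 0%N) < +oo)%E.
  apply: (@le_lt_trans _ _ (mu `[0, c]%classic)).
    apply: le_measure; rewrite ?inE//; first exact: mK.
    by move=> _ [y [Qy _] <-]; rewrite /= in_itv /=; exact: Qc.
  by rewrite lebesgue_measure_itv /=; case: ifP => _; rewrite ?ltry.
have cv : mu \o (fun n => pr @` K_ n) @ \oo --> mu (\bigcap_n (pr @` K_ n)).
  apply: nonincreasing_cvg_mu => //; first exact: bigcapT_measurable.
  apply/nonincreasing_seqP => n; apply/subsetPset; apply: image_subset; exact: decK.
rewrite -(cvg_lim _ cv)//; apply: lime_ge; first by apply/cvg_ex; eexists; exact: cv.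
by near=> n; exact: bigK.
Unshelve. all: by end_near. Qed.

End Capacitability.

(** * Selections of compact-valued maps *)

Section Selection.
Context {R : realType} {k : nat}.
Local Notation mu := (@lebesgue_measure R).
Local Notation UU := 'cV[R]_k.

(** A measurable multifunction with nonempty compact values. It is tested on closed sets because the
    lexicographic argument intersects with closed half-spaces. *)
Definition weakly_measurable (E : set R) (Kt : R -> set UU) :=
  (forall t, E t -> compact (Kt t) /\ Kt t !=set0) /\
  forall C, closed C -> measurable (E `&` [set t | Kt t `&` C !=set0]).

Lemma closed_coord_le (i : 'I_k) (c : R) : closed [set p : UU | p i 0 <= c].
Proof.
rewrite (_ : mkset _ = (fun p : UU => p i 0) @^-1` [set r | r <= c])//.
by apply: closed_comp => [y _|]; [exact: coord_continuous|exact: closed_le].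
Qed.

(* Minimizing all coordinates successively leaves one point in each section. *)
Lemma lex_step E Kt i : weakly_measurable E Kt ->
  weakly_measurable E (fun t => Kt t `&` [set p : UU | forall q, Kt t q -> p i 0 <= q i 0]).
Proof.
move=> [ck mk]; have cm t : closed [set p : UU | forall q, Kt t q -> p i 0 <= q i 0].
  rewrite (_ : mkset _ = \bigcap_(q in Kt t) [set p : UU | p i 0 <= q i 0]).
    by apply: closed_bigI => q _; exact: closed_coord_le.
  by apply/seteqP; split.
have mini (C : set UU) : compact C -> C !=set0 -> exists2 p, C p & forall q, C q -> p i 0 <= q i 0.
  move=> cC C0; have [|p pC hp] := @compact_EVT_min _ R (fun p : UU => p i 0) C C0 cC.
    by apply: continuous_subspaceT; exact: coord_continuous.
  by exists p; rewrite inE// in pC => q Cq; apply: hp; rewrite inE.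
split=> [t Et|C cC].
  have [cKt nKt] := ck t Et; split; first exact: compact_closedI.
  by have [p Kp hp] := mini _ cKt nKt; exists p.
(* When [Kt t] meets [C], the minimizers still miss [C] exactly if a rational number separates the
   minimum over [Kt t] from the minimum over its part in [C]. *)
rewrite (_ : _ `&` _ = (E `&` [set t | Kt t `&` C !=set0]) `\`
   \bigcup_(c : rat) ((E `&` [set t | Kt t `&` [set p : UU | p i 0 <= ratr c] !=set0]) `\`
     (E `&` [set t | Kt t `&` (C `&` [set p : UU | p i 0 <= ratr c]) !=set0]))).
  apply: measurableD; first exact: mk.
  apply: bigcupT_measurable_rat => c.
  by apply: measurableD; apply: mk; [|apply: closedI => //]; exact: closed_coord_le.
apply/seteqP; split=> t.
  move=> [Et [p [[Kp hp] Cp]]]; split; first by split=> //; exists p.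
  move=> [c _ [[_ [q [Kq qc]]]]]; apply; split=> //; exists p; split=> //; split => //.
  exact: le_trans (hp q Kq) qc.
move=> [[Et [p0 [Kp0 Cp0]]] H]; split=> //.
have [cKt nKt] := ck t Et.
have [p [Kp Cp] hp] := mini _ (compact_closedI cKt cC) (ex_intro _ p0 (conj Kp0 Cp0)).
have [q Kq hq] := mini _ cKt nKt.
exists p; split => //; split=> // r Kr; apply: le_trans (hq r Kr).
rewrite leNgt; apply/negP => /rat_in_itvoo[c]; rewrite in_itv/= => /andP[qc cp].
apply: H; exists c => //; split; first by split=> //; exists q; split=> //; exact: ltW.
move=> [_ [z [Kz [Cz zc]]]]; have := le_lt_trans (le_trans (hp z (conj Kz Cz)) zc) cp.
by rewrite ltxx.
Qed.

Lemma lex_select (E : set R) (Kt : R -> set UU) (s : seq 'I_k) : weakly_measurable E Kt -> exists Kt',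
  [/\ weakly_measurable E Kt', forall t, Kt' t `<=` Kt t &
    forall t p q i, i \in s -> Kt' t p -> Kt' t q -> p i 0 = q i 0].
Proof.
move=> wm; elim: s => [|i s [Kt' [wm' sub eqs]]]; first by exists Kt; split=> // t p.
exists (fun t => Kt' t `&` [set p : UU | forall q, Kt' t q -> p i 0 <= q i 0]); split.
- exact: lex_step.
- by move=> t p [Kp _]; exact: sub.
- move=> t p q j; rewrite inE => /orP[/eqP ->|js] [Kp hp] [Kq hq]; last exact: eqs js Kp Kq.
  by apply/eqP; rewrite eq_le hp// hq.
Qed.

(** Once all coordinates are minimized, each section is one point, and a superlevel set of a
    coordinate is the complement of the times at which the section meets a closed half-space. *)
Lemma measurable_selection (E : set R) (Kt : R -> set UU) : weakly_measurable E Kt ->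
  exists v : R -> UU, (forall i, measurable_fun E (fun t => v t i 0)) /\ forall t, E t -> Kt t (v t).
Proof.
move=> wm; have [Kt' [[ck mk] sub eqs]] := lex_select (enum 'I_k) wm.
have H t : exists p, E t -> Kt' t p.
  by have [/ck[_ [p Kp]]|nE] := pselect (E t); [exists p|exists 0].
have [v hv] := choice H.
have un t p : E t -> Kt' t p -> p = v t.
  move=> Et Kp; apply/matrixP => i j; rewrite ord1; apply: eqs Kp (hv t Et).
  exact: mem_enum.
exists v; split=> [i|t Et]; last by apply: sub; exact: hv.
apply: (measurability (@RGenOInfty.G R)); first exact: RGenOInfty.measurableE.
move=> _ [_ [c ->] <-].
have mE : measurable E.
  have := mk setT closedT; rewrite (_ : _ `&` _ = E)//; apply/seteqP; split=> t; first by case.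
  by move=> Et; split => //; have [_ [p Kp]] := ck t Et; exists p.
rewrite (_ : _ `&` _ = E `\` (E `&` [set t | Kt' t `&` [set p : UU | p i 0 <= c] !=set0])).
  by apply: measurableD => //; apply: mk; exact: closed_coord_le.
apply/seteqP; split=> t.
  move=> [Et]; rewrite /preimage /= in_itv/= andbT => ct; split=> // -[_ [p [Kp pc]]].
  by move: pc; rewrite /= (un t p Et Kp) leNgt ct.
move=> [Et nt]; split=> //; rewrite /preimage /= in_itv/= andbT ltNge; apply/negP => vc.
by apply: nt; split=> //; exists (v t); split=> //; exact: hv.
Qed.

Lemma compact_weakly_measurable (K : set (R * UU)) : compact K ->
  weakly_measurable (fst @` K) (fun t => [set p | K (t, p)]).
Proof.
move=> cK.
have cl2 : hausdorff_space (R * UU)%type by exact: norm_hausdorff.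
have mim (S : set (R * UU)) : compact S -> measurable (fst @` S).
  move=> cS; apply: closed_measurable; apply: compact_closed; first exact: Rhausdorff.
  by apply: continuous_compact => //; apply: continuous_subspaceT => z; exact: cvg_fst.
have csnd : compact (snd @` K).
  by apply: continuous_compact => //; apply: continuous_subspaceT => z; exact: cvg_snd.
split=> [t [[t' p] Kp /= e]|C cC].
  split; last by exists p; rewrite -e.
  apply: subclosed_compact csnd _; last by move=> q Kq; exists (t, q).
  rewrite (_ : mkset _ = (fun q => (t, q)) @^-1` K)//.
  apply: closed_comp => [q _|]; last exact: compact_closed.
  have h1 : (fun=> t) x @[x --> nbhs q] --> t by exact: cvg_cst.
  have h2 : id x @[x --> nbhs q] --> q by exact: cvg_id.
  exact: cvg_pair h1 h2.
rewrite (_ : _ `&` _ = fst @` (K `&` (snd @^-1` C))).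
  apply: mim; apply: compact_closedI => //.
  by apply: closed_comp => // z _; exact: cvg_snd.
apply/seteqP; split=> t.
  by move=> [_ [p [Kp Cp]]]; exists (t, p).
move=> [[t' p] [Kp Cp] /= <-]; split; first by exists (t', p).
by exists p.
Qed.

(** Boundedness of [B] supplies the compact set required by [capacitability]; the compact subset
    obtained there is the graph of a multifunction to which [measurable_selection] applies. *)
Lemma borel_selection (B : set (R * UU)) (c : R) (n : nat) : <<s @open (R * UU)%type >> B ->
  (forall t p, B (t, p) -> 0 <= t <= c /\ `|p| <= n%:R) -> ~ mu.-negligible (fst @` B) ->
  exists (E : set R) (v : R -> UU), [/\ measurable E, (0 < mu E)%E,
    forall i, measurable_fun E (fun t => v t i 0) & forall t, E t -> B (t, v t)].
Proof.
move=> bB Bb nB; have [a a0 ns] := not_negligible_small nB.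
have sB : souslin B by exact: (@souslin_borel R (R^o * UU)%type).
have cQ := compact_setX (@segment_compact R 0 c) (@cV_ball_compact R k n).
have BQ : B `<=` `[0, c]%classic `*` [set x : UU | `|x| <= n%:R].
  by move=> [t p] /Bb[h1 h2]; split => //=; rewrite in_itv.
have hY : hausdorff_space (R * UU)%type by exact: norm_hausdorff.
have cpr : continuous (fst : R * UU -> R) by move=> z; exact: cvg_fst.
have Qc y : (`[0, c]%classic `*` [set x : UU | `|x| <= n%:R]) y -> 0 <= y.1 <= c.
  by move=> [+ _]; rewrite /= in_itv.
have [K [cK KB aK]] := capacitability hY cpr sB cQ BQ Qc ns.
have wm := compact_weakly_measurable cK.
have [v [mv hv]] := measurable_selection wm.
exists (fst @` K), v; split => //.
- apply: closed_measurable; apply: compact_closed; first exact: Rhausdorff.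
  by apply: continuous_compact => //; exact: continuous_subspaceT.
- by apply: lt_le_trans aK; rewrite lte_fin.
- by move=> t Et; apply: KB; exact: hv.
Qed.

End Selection.

(** * Trajectories, adjoints and their dependence on the data *)

Section LocalBounds.
Context {R : realType}.

(** Time-dependent bounds are natural numbers so that they can index the family [ell]; monotonicity
    makes them Borel and locally bounded. *)
Definition ndec (b : R -> nat) := forall s t, 0 <= s -> s <= t -> (b s <= b t)%N.

Lemma ndec_measurable b : ndec b -> measurable_fun Time (fun t => (b t)%:R : R).
Proof.
move=> nb; apply: (measurability (@RGenOInfty.G R)); first exact: RGenOInfty.measurableE.
move=> _ [_ [r ->] <-]; apply: is_interval_measurable => s t /= [s0 +] [t0 +] z /andP[sz zt].
move: s0 t0; rewrite /Time /preimage /= !in_itv/= !andbT => s0 t0 rs rt.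
have z0 := le_trans s0 sz; split => //.
by rewrite (lt_le_trans rs)// ler_nat nb.
Qed.

Lemma measurable_diag (h : nat -> R -> R) b : ndec b ->
  (forall n, measurable_fun Time (h n)) -> measurable_fun Time (fun t => h (b t) t).
Proof.
move=> nb mh _ Y mY.
rewrite (_ : _ `&` _ = \bigcup_n ((Time `&` (fun t => (b t)%:R : R) @^-1` [set n%:R]) `&`
   (Time `&` h n @^-1` Y))).
  apply: bigcupT_measurable => n; apply: measurableI.
    by apply: (ndec_measurable nb) => //; exact: measurable_Time.
  by apply: mh => //; exact: measurable_Time.
apply/seteqP; split=> t.
  by move=> [Tt Yt]; exists (b t).
move=> [n _] [[Tt /= bn] [_ /= Yt]]; split=> //; rewrite /preimage /=.
by move/eqP : bn; rewrite eqr_nat => /eqP ->.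
Qed.

Lemma lint_diag (h : nat -> R -> R) b : ndec b -> (forall n, lint (h n)) ->
  (forall n t, 0 <= t -> 0 <= h n t) ->
  (forall n p t, (n <= p)%N -> 0 <= t -> h n t <= h p t) -> lint (fun t => h (b t) t).
Proof.
move=> nb ih h0 hm T; apply: le_integrable (ih (b T) T) => //.
  apply/measurable_EFinP; apply: measurable_itvS; apply: measurable_diag => // n.
  exact: lint_measurable.
move=> t /=; rewrite in_itv/= => /andP[t0 tT]; rewrite lee_fin.
by rewrite ger0_norm ?h0// (le_trans _ (ler_norm _))// hm// nb.
Qed.

(** Summing the bounds on [[0, N]] over the integers up to the current time makes them monotone. *)
Lemma ndec_bound (V : normedModType R) (x : R -> V) :
  (forall b, exists M, forall t, 0 <= t <= b -> `|x t| <= M) ->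
  exists2 n, ndec n & forall t, 0 <= t -> `|x t| <= (n t)%:R.
Proof.
move=> H; have H' (N : nat) : exists M : R, forall t, 0 <= t <= N%:R -> `|x t| <= M by exact: H.
have [M hM] := choice H'.
exists (fun t => \sum_(i < (Num.truncn t).+2) (Num.truncn `|M i|).+1)%N.
  move=> s t s0 st.
  have tr : (Num.truncn s <= Num.truncn t)%N by apply: le_truncn.
  rewrite (big_ord_widen (Num.truncn t).+2 (fun i => (Num.truncn `|M i|).+1)) ?ltnS//.
  by rewrite big_mkcond /=; apply: leq_sum => i _; case: ifP.
move=> t t0; have tb : 0 <= t <= (Num.truncn t).+1%:R by rewrite t0 ltW// truncnS_gt.
rewrite (le_trans (hM _ _ tb))// (le_trans (ler_norm _))//.
rewrite (le_trans (ltW (truncnS_gt _)))// ler_nat big_ord_recr /=.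
exact: leq_addl.
Qed.

Lemma ac_locally_bounded (V : normedModType R) (x : R -> V) : ac x ->
  forall b, exists M, forall t, 0 <= t <= b -> `|x t| <= M.
Proof.
move=> acx b.
have cx : {within `[0, b], continuous x}.
  by apply: continuous_subspaceW (ac_continuous acx); exact: itv_Time.
have /compact_bounded[M [_ hM]] := continuous_compact cx (@segment_compact _ 0 b).
exists (M + 1) => t tb; apply: (hM (M + 1)); first by rewrite ltrDl.
by exists t => //=; rewrite in_itv.
Qed.

Definition clip p q (r : R) (x : 'M[R]_(p, q)) := map_mx (fun a => Num.min r (Num.max (- r) a)) x.

Lemma clip_id p q (r : R) (x : 'M[R]_(p, q)) : `|x| <= r -> clip r x = x.
Proof.
move=> xr; apply/matrixP => i j; rewrite mxE.
have := le_trans (mx_norm_entry x i j) xr; rewrite ler_norml => /andP[h1 h2].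
by rewrite (max_r h1) (min_r h2).
Qed.

Lemma clip_norm p q (r : R) (x : 'M[R]_(p, q)) : 0 <= r -> `|clip r x| <= r.
Proof.
move=> r0; apply: mx_norm_le => // i j; rewrite mxE ler_norml ge_min lexx /= andbT.
by rewrite le_min le_max lexx /= andbT; lra.
Qed.

Lemma clip_norm2 p q (r : R) (x : 'M[R]_(p, q)) : 0 <= r -> `|clip r x| <= `|x|.
Proof.
move=> r0; apply: mx_norm_le => // i j; rewrite mxE; apply: le_trans (mx_norm_entry x i j).
have := ler_norm (x i j); have := lerNnormlW (lexx `|x i j|).
rewrite ler_norml /Num.min /Num.max => h1 h2.
by case: (ltP (- r) (x i j)) => h3; case: ltP => h4; apply/andP; split; lra.
Qed.

Lemma clip_lip p q (r : R) (x y : 'M[R]_(p, q)) : 0 <= r -> `|clip r x - clip r y| <= `|x - y|.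
Proof.
move=> r0; apply: mx_norm_le => // i j; rewrite !mxE.
apply: le_trans (_ : `|x i j - y i j| <= _); last first.
  by have := mx_norm_entry (x - y) i j; rewrite !mxE.
move: (x i j) (y i j) => a c {x y}.
wlog ac : a c / a <= c => [H|].
  have [/H//|/ltW/H] := leP a c.
  by rewrite distrC (distrC c).
rewrite (distrC a) (distrC (Num.min _ _)) (@ger0_norm _ (c - a)) ?subr_ge0//.
rewrite /Num.min /Num.max ler_norml.
by case: (ltP (- r) a) => h1; case: (ltP (- r) c) => h2; case: ltP => h3; case: ltP => h4;
  apply/andP; split; lra.
Qed.

(** The estimate goes from [t0] back to time 0 and from there forward to [t], whatever the order of
    [t0] and [t]. *)
Lemma growth_bound p q (X H : R -> 'M[R]_(p, q)) (l : R -> R) : acdx X H -> lint l ->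
  (forall t, 0 <= t -> 0 <= l t) ->
  (forall t, 0 <= t -> `|H t| <= (1 + `|X t|) * l t) ->
  forall t0 t, 0 <= t0 -> 0 <= t ->
  `|X t| <= expR (prim l t) * (expR (prim l t0) * (`|X t0| + prim l t0) + prim l t).
Proof.
move=> XH il l0 hH t0 t t00 tge0.
have hH' (s : R) : 0 <= s -> `|H s| <= `|X s| * l s + l s.
  by move=> s0; rewrite (le_trans (hH s s0))// mulrDl mul1r addrC.
have h0 : `|X 0| <= expR (prim l t0) * (`|X t0| + prim l t0).
  have z : 0 <= (0 : R) <= t0 by rewrite lexx.
  have := acdx_bwd XH il l0 il (fun s h => hH' s (proj1 (andP h))) z.
  rewrite !prim0 expR0 mul1r subr0 => /le_trans; apply; rewrite mulrDr lerD2l.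
  have iE := lintZ (expR (prim l t0)) il.
  have iEl : lint (fun s => expR (prim l s) * l s).
    by apply: lint_acdM (acd_exp (acd_prim il)) il.
  rewrite -(primZ (expR (prim l t0)) t0 il); apply: (prim_le iEl iE t00) => r /andP[r0 rt].
  by apply: ler_wpM2r; [exact: l0|rewrite ler_expR; exact: prim_homo].
have z : 0 <= t <= t by rewrite tge0 lexx.
apply: le_trans (acdx_fwd XH il l0 il l0 (fun s h => hH' s (proj1 (andP h))) z) _.
by rewrite ler_wpM2l ?expR_ge0// lerD2r.
Qed.

End LocalBounds.

(** * State equation, adjoint equation and fundamental matrix *)

Section Flow.
Context {R : realType} {m k : nat} {P : control_problem R m k} (M : model P).
Local Notation X := 'cV[R]_m.
Local Notation Xr := 'rV[R]_m.
Local Notation UU := 'cV[R]_k.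

Definition bctrl p (b : R -> nat) (u : R -> 'cV[R]_p) :=
  (forall i, measurable_fun Time (fun t => u t i 0)) /\
  forall t, 0 <= t -> `|u t| <= (b t)%:R.

Definition ellb b t := ell M (b t) t.

Lemma ell_ge0 N t : 0 <= t -> 0 <= ell M N t.
Proof. by move=> t0; rewrite (le_trans ler01)// ell_ge1. Qed.

Lemma ellb_lint b : ndec b -> lint (ellb b).
Proof.
move=> nb; apply: lint_diag => //; [exact: ell_lint|exact: ell_ge0|].
by move=> N p t Np t0; exact: ell_mono.
Qed.

Lemma ellb_ge0 b t : 0 <= t -> 0 <= ellb b t.
Proof. exact: ell_ge0. Qed.

Section Compositions.
Context d (T : measurableType d) (D : set T) (h : T -> R) (x : T -> X) (u : T -> UU).
Hypotheses (mD : measurable D) (mh : measurable_fun D h) (h0 : forall w, D w -> 0 <= h w).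
Hypotheses (mx : forall i, measurable_fun D (fun w => x w i 0)).
Hypotheses (mu_ : forall i, measurable_fun D (fun w => u w i 0)).

Let entry_cont p q (a : X * UU -> 'M[R]_(p, q)) i j : continuous a ->
  continuous (fun w => a w i j).
Proof.
move=> ca w; apply: (@cvg_comp _ _ _ a (fun A : 'M[R]_(p, q) => A i j) _ (nbhs (a w))).
  exact: ca.
exact: coord_continuous.
Qed.

Lemma mF_comp i : measurable_fun D (fun w => mF M (h w) (x w) (u w) i 0).
Proof.
apply: (@caratheodory_comp R d T m k (fun t y v => mF M t y v i 0) D h x u mD mh h0 mx mu_).
  by move=> y v; exact: mF_meas.
move=> t t0; exact: (@entry_cont _ _ (fun w => mF M t w.1 w.2) i 0 (@mF_cont _ _ _ _ M t t0)).
Qed.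

Lemma mFx_comp i j : measurable_fun D (fun w => mFx M (h w) (x w) (u w) i j).
Proof.
apply: (@caratheodory_comp R d T m k (fun t y v => mFx M t y v i j) D h x u mD mh h0 mx mu_).
  by move=> y v; exact: mFx_meas.
move=> t t0; exact: (@entry_cont _ _ (fun w => mFx M t w.1 w.2) i j (@mFx_cont _ _ _ _ M t t0)).
Qed.

Lemma mG_comp : measurable_fun D (fun w => mG M (h w) (x w) (u w)).
Proof.
apply: (@caratheodory_comp R d T m k (fun t y v => mG M t y v) D h x u mD mh h0 mx mu_).
  by move=> y v; exact: mG_meas.
by move=> t t0; exact: mG_cont.
Qed.

Lemma mGx_comp j : measurable_fun D (fun w => mGx M (h w) (x w) (u w) 0 j).
Proof.
apply: (@caratheodory_comp R d T m k (fun t y v => mGx M t y v 0 j) D h x u mD mh h0 mx mu_).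
  by move=> y v; exact: mGx_meas.
move=> t t0; exact: (@entry_cont _ _ (fun w => mGx M t w.1 w.2) 0 j (@mGx_cont _ _ _ _ M t t0)).
Qed.

End Compositions.

Let mT := @measurable_Time R.
Let midT : measurable_fun Time (fun t : R => t).
Proof. exact: measurable_id. Qed.
Let T0 (t : R) : Time t -> 0 <= t.
Proof. by rewrite /Time /= in_itv/= andbT. Qed.

Definition solx (u : R -> UU) (x : R -> X) := acdx x (fun t => mF M t (x t) (u t)).
Definition psidot (u : R -> UU) (x : R -> X) (lam : R) (psi : R -> Xr) t :=
  - (psi t *m mFx M t (x t) (u t) + lam *: mGx M t (x t) (u t)).
Definition solpsi u x lam psi := acdx psi (psidot u x lam psi).
Definition solA (u : R -> UU) (x : R -> X) (A : R -> 'M[R]_m) := acdx A (fun t => mFx M t (x t) (u t) *m A t).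

(** Sublinear growth provides the bound [rho] before any solution exists. The field truncated at a
    level [N] above [rho] is globally Lipschitz; truncation does not increase norms, so its solution
    obeys the same growth bound and never reaches the truncation. *)
Lemma solx_exists b u t0 y : ndec b -> bctrl b u -> 0 <= t0 ->
  exists2 x, solx u x & x t0 = y.
Proof.
move=> nb [mu_ ub] t00.
have il := ellb_lint nb; have l0 := ellb_ge0 b.
pose rho t := expR (prim (ellb b) t) *
  (expR (prim (ellb b) t0) * (`|y| + prim (ellb b) t0) + prim (ellb b) t).
have brho T : exists C, forall t, 0 <= t <= T -> `|rho t| <= C.
  have d1 := acd_exp (acd_prim il).
  have d2 := acdD (acd_cst (expR (prim (ellb b) t0) * (`|y| + prim (ellb b) t0))) (acd_prim il).
  exact: acd_bounded (acdM d1 d2).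
have [n nn nrho] := @ndec_bound R R^o rho brho.
pose N t := (n t + b t)%N.
have nN : ndec N by move=> s t s0 st; rewrite leq_add ?nn ?nb.
have rN t : 0 <= t -> rho t <= (N t)%:R.
  by move=> t_0; rewrite (le_trans (ler_norm _))// (le_trans (nrho _ t_0))// ler_nat leq_addr.
have uN t : 0 <= t -> `|u t| <= (N t)%:R.
  by move=> t_0; rewrite (le_trans (ub _ t_0))// ler_nat leq_addl.
have iN := ellb_lint nN.
pose Fn t z := mF M t (clip (N t)%:R z) (u t).
have mFn (Z : R -> X) : (forall i j, measurable_fun Time (fun t => Z t i j)) ->
    forall i j, measurable_fun Time (fun t => Fn t (Z t) i j).
  move=> mZ i j; rewrite ord1; apply: mF_comp => // l.
  rewrite (_ : (fun t => _) = (fun t => Num.min (N t)%:R (Num.max (- (N t)%:R) (Z t l 0)))).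
    apply: measurable_minr; first exact: ndec_measurable.
    by apply: measurable_maxr => //; apply: measurable_funN; exact: ndec_measurable.
  by apply/funext => t; rewrite mxE.
have lipFn t z z' : 0 <= t -> `|Fn t z - Fn t z'| <= `|z - z'| * ellb N t.
  move=> t_0; apply: le_trans (mF_lip M t_0 (clip_norm _ (ler0n _ _)) (clip_norm _ (ler0n _ _)) (uN t t_0)) _.
  by apply: ler_wpM2r; [exact: ellb_ge0|exact: clip_lip].
have Fn0 t : 0 <= t -> `|Fn t 0| <= ellb N t.
  by move=> t_0; apply: mF_bound => //; [exact: clip_norm|exact: uN].
have [x [xs x0]] := picard iN (ellb_ge0 N) t00 y mFn lipFn Fn0.
exists x => //.
have xr t : 0 <= t -> `|x t| <= (N t)%:R.
  move=> t_0; apply: le_trans (rN t t_0).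
  have HH s : 0 <= s -> `|Fn s (x s)| <= (1 + `|x s|) * ellb b s.
    move=> s0; apply: le_trans (mF_growth M _ s0 (ub s s0)) _.
    by apply: ler_wpM2r; [exact: ellb_ge0|rewrite lerD2l; exact: clip_norm2].
  by have := growth_bound xs il l0 HH t00 t_0; rewrite x0.
by apply: eq_acdx xs => // t t_0; rewrite /Fn clip_id// xr.
Qed.

Lemma solx_bound b u x t0 t : ndec b -> bctrl b u -> solx u x -> 0 <= t0 -> 0 <= t ->
  `|x t| <= expR (prim (ellb b) t) *
  (expR (prim (ellb b) t0) * (`|x t0| + prim (ellb b) t0) + prim (ellb b) t).
Proof.
move=> nb [mu_ ub] xs t00 t_0.
apply: (growth_bound xs (ellb_lint nb) (ellb_ge0 b)) => // s s0.
exact: mF_growth (ub s s0).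
Qed.

Lemma solx_bctrl u x : solx u x -> exists2 n, ndec n & bctrl n x.
Proof.
move=> xs; have [n nn xn] := ndec_bound (fun b => acdx_bounded b xs).
by exists n => //; split => // i; exact: acdx_measurable xs.
Qed.

Lemma bctrlW p b b' (u : R -> 'cV[R]_p) : (forall t, 0 <= t -> (b t <= b' t)%N) ->
  bctrl b u -> bctrl b' u.
Proof.
move=> bb [mu_ ub]; split=> // t t0; rewrite (le_trans (ub _ t0))// ler_nat; exact: bb.
Qed.

Lemma solpsi_exists b u x lam t0 q : ndec b -> bctrl b u -> bctrl b x -> 0 <= t0 ->
  exists2 psi, solpsi u x lam psi & psi t0 = q.
Proof.
move=> nb [mu_ ub] [mx xb] t00.
pose Fn t (z : Xr) := - (z *m mFx M t (x t) (u t) + lam *: mGx M t (x t) (u t)).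
pose c := m%:R + `|lam|.
have iL := lintZ c (ellb_lint nb).
have c0 : 0 <= c by rewrite addr_ge0.
have L0 t : 0 <= t -> 0 <= c * ellb b t by move=> t_0; rewrite mulr_ge0// ellb_ge0.
have mFn (Z : R -> Xr) : (forall i j, measurable_fun Time (fun t => Z t i j)) ->
    forall i j, measurable_fun Time (fun t => Fn t (Z t) i j).
  move=> mZ i j; rewrite ord1.
  rewrite (_ : (fun t => _) = (fun t => - (\sum_l Z t 0 l * mFx M t (x t) (u t) l j +
      lam * mGx M t (x t) (u t) 0 j))); last by apply/funext => t; rewrite !mxE.
  apply: measurable_funN; apply: measurable_funD.
    by apply: measurable_sum => l; apply: measurable_funM => //; exact: mFx_comp.
  by apply: measurable_funM => //; exact: mGx_comp.
have lipFn t z z' : 0 <= t -> `|Fn t z - Fn t z'| <= `|z - z'| * (c * ellb b t).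
  move=> t_0; have -> : Fn t z - Fn t z' = - ((z - z') *m mFx M t (x t) (u t)).
    by rewrite /Fn mulmxBl -opprD (addrC (z' *m _)) addrKA.
  rewrite normrN (le_trans (mx_norm_mul _ _))//.
  have aux (a e f l g : R) : 0 <= a -> 0 <= e -> 0 <= f -> f <= g -> 0 <= l -> a * e * f <= e * ((a + l) * g).
    move=> a0 e0 f0 fg l0; have := ler_wpM2l (mulr_ge0 a0 e0) fg.
    have := mulr_ge0 e0 (mulr_ge0 l0 (le_trans f0 fg)); nra.
  by apply: aux => //; exact: mFx_bound (xb t t_0) (ub t t_0).
have Fn0 t : 0 <= t -> `|Fn t 0| <= c * ellb b t.
  move=> t_0; rewrite /Fn mul0mx add0r normrN normrZ.
  have g := mGx_bound M t_0 (xb t t_0) (ub t t_0).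
  rewrite (le_trans (ler_wpM2l (normr_ge0 lam) g))// ler_wpM2r ?ellb_ge0//.
  by rewrite /c lerDr.
have [psi [ps p0]] := picard iL L0 t00 q mFn lipFn Fn0.
by exists psi.
Qed.

Section Bounded.
Context (b : R -> nat) (u : R -> UU) (x : R -> X).
Hypotheses (nb : ndec b) (bu : bctrl b u) (bx : bctrl b x).

Lemma lint_mF i : lint (fun t => mF M t (x t) (u t) i 0).
Proof.
apply: lint_le (ellb_lint nb); first by apply: mF_comp => //; [exact: bx.1|exact: bu.1].
move=> t t0; rewrite (le_trans (mx_norm_entry _ _ _))//.
exact: mF_bound (bx.2 t t0) (bu.2 t t0).
Qed.

Lemma lint_mFx i j : lint (fun t => mFx M t (x t) (u t) i j).
Proof.
apply: lint_le (ellb_lint nb); first by apply: mFx_comp => //; [exact: bx.1|exact: bu.1].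
move=> t t0; rewrite (le_trans (mx_norm_entry _ _ _))//.
exact: mFx_bound (bx.2 t t0) (bu.2 t t0).
Qed.

Lemma lint_mG : lint (fun t => mG M t (x t) (u t)).
Proof.
apply: lint_le (ellb_lint nb); first by apply: mG_comp => //; [exact: bx.1|exact: bu.1].
move=> t t0; exact: mG_bound (bx.2 t t0) (bu.2 t t0).
Qed.

Lemma lint_mGx j : lint (fun t => mGx M t (x t) (u t) 0 j).
Proof.
apply: lint_le (ellb_lint nb); first by apply: mGx_comp => //; [exact: bx.1|exact: bu.1].
move=> t t0; rewrite (le_trans (mx_norm_entry _ _ _))//.
exact: mGx_bound (bx.2 t t0) (bu.2 t t0).
Qed.

Lemma solpsi_uniq lam psi phi t0 : solpsi u x lam psi -> solpsi u x lam phi -> 0 <= t0 ->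
  psi t0 = phi t0 -> forall t, 0 <= t -> psi t = phi t.
Proof.
move=> ps ph t00 e t t_0.
have iL := lintZ m%:R (ellb_lint nb).
have L0 (s : R) : 0 <= s -> 0 <= m%:R * ellb b s by move=> s0; rewrite mulr_ge0// ellb_ge0.
have h (s : R) : 0 <= s <= t0 + t ->
  `|psidot u x lam psi s - psidot u x lam phi s| <= `|psi s - phi s| * (m%:R * ellb b s).
  move=> /andP[s0 _]; have -> : psidot u x lam psi s - psidot u x lam phi s =
     - ((psi s - phi s) *m mFx M s (x s) (u s)).
    by rewrite /psidot mulmxBl -opprD (addrC (phi s *m _)) addrKA.
  rewrite normrN (le_trans (mx_norm_mul _ _))// mulrAC mulrC.
  rewrite ler_wpM2l// ler_wpM2l//; exact: mFx_bound (bx.2 s s0) (bu.2 s s0).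
apply: (acdx_uniq ps ph iL L0 h _ e); first by rewrite t00 lerDl.
by rewrite t_0 lerDr.
Qed.

Lemma solA_uniq A B : solA u x A -> solA u x B -> A 0 = B 0 -> forall t, 0 <= t -> A t = B t.
Proof.
move=> As Bs e t t_0.
have iL := lintZ m%:R (ellb_lint nb).
have L0 (s : R) : 0 <= s -> 0 <= m%:R * ellb b s by move=> s0; rewrite mulr_ge0// ellb_ge0.
have h (s : R) : 0 <= s <= t -> `|mFx M s (x s) (u s) *m A s - mFx M s (x s) (u s) *m B s|
    <= `|A s - B s| * (m%:R * ellb b s).
  move=> /andP[s0 _]; rewrite -mulmxBr (le_trans (mx_norm_mul _ _))// [leLHS]mulrC.
  rewrite ler_wpM2l// ler_wpM2l//; exact: mFx_bound (bx.2 s s0) (bu.2 s s0).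
by apply: (acdx_uniq As Bs iL L0 h _ e); rewrite ?lexx t_0.
Qed.

Lemma acdx_mul p q r (A H : R -> 'M[R]_(p, q)) (B K : R -> 'M[R]_(q, r)) :
  acdx A H -> acdx B K -> acdx (fun t => A t *m B t) (fun t => H t *m B t + A t *m K t).
Proof.
move=> AH BK i j.
have h := acd_sum (index_enum _) (fun l => acdM (AH i l) (BK l j)).
apply: eq_acd h => t t0; first by rewrite !mxE.
by rewrite !mxE -big_split.
Qed.

(** The inverse is constructed alongside [A], as the solution [B] of the adjoint matrix equation:
    the derivative of [B *m A] vanishes. *)
Lemma solA_exists : exists2 A, solA u x A & A 0 = 1%:M /\ exists B, [/\ acdx B (fun t => - (B t *m mFx M t (x t) (u t))), B 0 = 1%:M &
    forall t, 0 <= t -> B t *m A t = 1%:M].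
Proof.
have iL := lintZ m%:R (ellb_lint nb).
have L0 (s : R) : 0 <= s -> 0 <= m%:R * ellb b s by move=> s0; rewrite mulr_ge0// ellb_ge0.
have mFn1 (Z : R -> 'M[R]_m) : (forall i j, measurable_fun Time (fun t => Z t i j)) ->
    forall i j, measurable_fun Time (fun t => (mFx M t (x t) (u t) *m Z t) i j).
  move=> mZ i j; rewrite (_ : (fun t => _) = (fun t => \sum_l mFx M t (x t) (u t) i l * Z t l j)).
    by apply: measurable_sum => l; apply: measurable_funM => //; exact: lint_measurable (lint_mFx _ _).
  by apply/funext => t; rewrite !mxE.
have mFn2 (Z : R -> 'M[R]_m) : (forall i j, measurable_fun Time (fun t => Z t i j)) ->
    forall i j, measurable_fun Time (fun t => (- (Z t *m mFx M t (x t) (u t))) i j).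
  move=> mZ i j; rewrite (_ : (fun t => _) = (fun t => - \sum_l Z t i l * mFx M t (x t) (u t) l j)).
    apply: measurable_funN; apply: measurable_sum => l; apply: measurable_funM => //.
    exact: lint_measurable (lint_mFx _ _).
  by apply/funext => t; rewrite !mxE.
have lip1 (s : R) (z z' : 'M[R]_m) : 0 <= s ->
   `|mFx M s (x s) (u s) *m z - mFx M s (x s) (u s) *m z'| <= `|z - z'| * (m%:R * ellb b s).
  move=> s0; rewrite -mulmxBr (le_trans (mx_norm_mul _ _))// [leLHS]mulrC.
  rewrite ler_wpM2l// ler_wpM2l//; exact: mFx_bound (bx.2 s s0) (bu.2 s s0).
have lip2 (s : R) (z z' : 'M[R]_m) : 0 <= s ->
   `|- (z *m mFx M s (x s) (u s)) - - (z' *m mFx M s (x s) (u s))| <= `|z - z'| * (m%:R * ellb b s).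
  move=> s0; rewrite -opprD normrN -mulmxBl (le_trans (mx_norm_mul _ _))// mulrAC mulrC.
  rewrite ler_wpM2l// ler_wpM2l//; exact: mFx_bound (bx.2 s s0) (bu.2 s s0).
have z1 (s : R) : 0 <= s -> `|mFx M s (x s) (u s) *m (0 : 'M[R]_m)| <= m%:R * ellb b s.
  by move=> s0; rewrite mulmx0 normr0 L0.
have z2 (s : R) : 0 <= s -> `|- ((0 : 'M[R]_m) *m mFx M s (x s) (u s))| <= m%:R * ellb b s.
  by move=> s0; rewrite mul0mx oppr0 normr0 L0.
have [A [As A0]] := picard iL L0 (lexx 0) 1%:M mFn1 lip1 z1.
have [B [Bs B0]] := picard iL L0 (lexx 0) 1%:M mFn2 lip2 z2.
exists A => //; split=> //; exists B; split=> // t t0; apply/matrixP => i j.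
have [_ h] := acdx_mul Bs As i j.
rewrite h// A0 B0 mulmx1 (@eq_prim _ _ (cst 0)) ?prim_cst ?mul0r ?addr0//.
by move=> s _; rewrite mulNmx mulmxA addNr mxE.
Qed.

Definition dpay (A : R -> 'M[R]_m) t : Xr :=
  \row_j prim (fun s => (mGx M s (x s) (u s) *m A s) 0 j) t.

Lemma lint_dpay A j : solA u x A -> lint (fun s => (mGx M s (x s) (u s) *m A s) 0 j).
Proof.
move=> As; rewrite (_ : (fun s => _) = (fun s => \sum_l A s l j * mGx M s (x s) (u s) 0 l)).
  by apply: lint_sum => l; apply: lint_acdM (As l j) (lint_mGx l).
by apply/funext => s; rewrite mxE; apply: eq_bigr => l _; rewrite mulrC.
Qed.

(** In the derivative of [psi *m A] the two terms with [mFx] cancel. *)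
Lemma psi_fund lam psi A : solpsi u x lam psi -> solA u x A -> A 0 = 1%:M ->
  forall t, 0 <= t -> psi t *m A t = psi 0 - lam *: dpay A t.
Proof.
move=> ps As A0 t t0; apply/matrixP => i j; rewrite ord1.
have [_ h] := acdx_mul ps As 0 j.
rewrite h// A0 mulmx1 !mxE -(primZ lam _ (lint_dpay j As)) -primN; last exact/lintZ/lint_dpay.
congr (_ + _); apply: eq_prim => s _.
rewrite /psidot mulNmx mulmxDl opprD -mulmxA addrAC addNr add0r -scalemxAl.
by rewrite mxE [in X in - X]mxE.
Qed.

End Bounded.

Lemma solx_uniq b u x y t0 : ndec b -> bctrl b u -> solx u x -> solx u y -> 0 <= t0 ->
  x t0 = y t0 -> forall t, 0 <= t -> x t = y t.
Proof.
move=> nb bu xs ys t00 e t t_0.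
have [n1 nn1 b1] := solx_bctrl xs; have [n2 nn2 b2] := solx_bctrl ys.
pose N t := (b t + n1 t + n2 t)%N.
have nN : ndec N by move=> s r s0 sr; rewrite !leq_add ?nb ?nn1 ?nn2.
have uN : bctrl N u by apply: bctrlW bu => s _; rewrite /N -addnA leq_addr.
have xN : bctrl N x by apply: bctrlW b1 => s _; rewrite /N addnAC leq_addl.
have yN : bctrl N y by apply: bctrlW b2 => s _; rewrite /N leq_addl.
have h (s : R) : 0 <= s <= t0 + t -> `|mF M s (x s) (u s) - mF M s (y s) (u s)| <= `|x s - y s| * ellb N s.
  by move=> /andP[s0 _]; exact: mF_lip (xN.2 s s0) (yN.2 s s0) (uN.2 s s0).
apply: (acdx_uniq xs ys (ellb_lint nN) (ellb_ge0 N) h _ e); first by rewrite t00 lerDl.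
by rewrite t_0 lerDr.
Qed.

End Flow.

Section Pairs.
Context {R : realType}.

Lemma is_derive_cvgP (V : normedModType R) (z : R -> V) (t : R) (d : V) :
  is_derive t 1 z d <-> (fun h : R => h^-1 *: (z (h *: 1 + t) - z t)) @ 0^' --> d.
Proof.
split=> [[dz <-]|H]; first exact: dz.
by split; [exact: cvgP H|exact: cvg_lim H].
Qed.

Lemma is_derive_pairP (V W : normedModType R) (z : R -> V * W) (t : R) (d : V * W) :
  is_derive t 1 z d <-> is_derive t 1 (fun s => (z s).1) d.1 /\ is_derive t 1 (fun s => (z s).2) d.2.
Proof.
split=> [/is_derive_cvgP H|[/is_derive_cvgP H1 /is_derive_cvgP H2]].
  split; apply/is_derive_cvgP.
    exact: (cvg_comp _ (fst : V * W -> V) H cvg_fst).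
  exact: (cvg_comp _ (snd : V * W -> W) H cvg_snd).
apply/is_derive_cvgP; rewrite [d]surjective_pairing.
apply: cvg_trans (cvg_pair H1 H2).
by apply: near_eq_cvg; near=> h.
Unshelve. all: by end_near. Qed.

Lemma ac_fst (V W : normedModType R) (z : R -> V * W) : ac z -> ac (fun s => (z s).1).
Proof.
apply: ac_dominated => b b0; exists 1 => s t _ _; rewrite mul1r.
by rewrite [leRHS]prod_normE le_max lexx.
Qed.

Lemma ac_snd (V W : normedModType R) (z : R -> V * W) : ac z -> ac (fun s => (z s).2).
Proof.
apply: ac_dominated => b b0; exists 1 => s t _ _; rewrite mul1r.
by rewrite [leRHS]prod_normE le_max lexx orbT.
Qed.

Lemma ac_pair (V W : normedModType R) (x : R -> V) (y : R -> W) :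
  ac x -> ac y -> ac (fun s => (x s, y s)).
Proof.
move=> ax ay.
have ax' : ac (fun s => (x s, 0 : W)).
  apply: ac_dominated ax => b b0; exists 1 => s t _ _; rewrite mul1r.
  by rewrite [leLHS]prod_normE /= subrr normr0 ge_max lexx normr_ge0.
have ay' : ac (fun s => (0 : V, y s)).
  apply: ac_dominated ay => b b0; exists 1 => s t _ _; rewrite mul1r.
  by rewrite [leLHS]prod_normE /= subrr normr0 ge_max lexx normr_ge0.
apply: eq_ac (acD ax' ay') => t _.
by congr (_, _); rewrite /= ?addr0 ?add0r.
Qed.

(** Both problems have the same set of solutions, so the choice made by [ivp_sol] returns the same
    function. *)
Lemma eq_ivp_sol (V : normedModType R) (F G : R -> V -> V) (y : V) :
  {ae lebesgue_measure, forall t, Time t -> F t = G t} -> ivp_sol F y = ivp_sol G y.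
Proof.
move=> FG; rewrite /ivp_sol; congr xget; apply/seteqP; split=> x [[ax dx] x0]; (split; [split|]) => //;
  by apply: (aeS2 dx FG) => t + e t0 => /(_ t0); rewrite e.
Qed.

Lemma ivp_solP (V : normedModType R) (F : R -> V -> V) (y : V) (x : R -> V) :
  ivp F y x -> ivp F y (ivp_sol F y).
Proof.
by move=> H; rewrite /ivp_sol; case: xgetP => [z ->//|/(_ x)].
Qed.

End Pairs.

(** * Solutions for the original data and for the representatives *)

Section Bridges.
Context {R : realType} {m k : nat} {P : control_problem R m k} (M : model P).
Local Notation mu := (@lebesgue_measure R).
Local Notation X := 'cV[R]_m.
Local Notation UU := 'cV[R]_k.

Lemma Time_ge0 (t : R) : Time t <-> 0 <= t.
Proof. by rewrite /Time /= in_itv/= andbT. Qed.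

Lemma admissible_bctrl u : admissible P u -> exists2 n, ndec n & bctrl n u.
Proof.
move=> [bu lu _].
have [|n nn un] := @ndec_bound R _ u.
  move=> b; have [M0 [_ hM]] := lu `[0, b]%classic (@segment_compact _ 0 b) (@itv_Time R b).
  exists (M0 + 1) => t tb; apply: (hM (M0 + 1)); first by rewrite ltrDl.
  by exists t => //=; rewrite in_itv.
exists n => //; split => // i; exact: borel_fun_entry (@measurable_Time R) bu i 0.
Qed.

Lemma ac_bctrl p (x : R -> 'cV[R]_p) : ac x -> exists2 n, ndec n & bctrl n x.
Proof.
move=> ax; have [n nn xn] := ndec_bound (ac_locally_bounded ax).
exists n => //; split => // i; exact: ac_measurable (ac_entry i 0 ax).
Qed.

Lemma bctrlD p q (b c : R -> nat) (u : R -> 'cV[R]_p) (v : R -> 'cV[R]_q) :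
  ndec b -> ndec c -> bctrl b u -> bctrl c v ->
  exists n, [/\ ndec n, bctrl n u & bctrl n v].
Proof.
move=> nb nc bu cv; exists (fun t => b t + c t)%N; split.
- by move=> s t s0 st; rewrite leq_add ?nb ?nc.
- by apply: bctrlW bu => t _; rewrite leq_addr.
- by apply: bctrlW cv => t _; rewrite leq_addl.
Qed.

Section Fixed.
Context (b : R -> nat) (u : R -> UU).
Hypotheses (nb : ndec b) (bu : bctrl b u).

Lemma solx_ode x : solx M u x <-> ode (fun t y => dyn P t y (u t)) x.
Proof.
split=> [xs|H].
  by apply: acdx_ode xs _; apply: (aeS (model_ae M)) => t + t0 => /(_ t0)[->].
have [c nc bx] := ac_bctrl H.1; have [n [nn un xn]] := bctrlD nb nc bu bx.
apply: (ode_acdx H); first by move=> i j; rewrite ord1; exact: lint_mF un xn i.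
by apply: (aeS (model_ae M)) => t + t0 => /(_ t0)[->].
Qed.

Lemma trajP y : let x := ivp_sol (fun t y => dyn P t y (u t)) y in
  solx M u x /\ x 0 = y.
Proof.
have [x xs x0] := solx_exists M (t0 := 0) y nb bu (lexx _).
have H : ivp (fun t y => dyn P t y (u t)) y x by split=> //; apply/solx_ode.
by have [H1 H2] := ivp_solP H; split => //; apply/solx_ode.
Qed.

Section FixedX.
Context (x : R -> X).
Hypothesis bx : bctrl b x.

Lemma solpsi_adjoint lam psi : solpsi M u x lam psi <-> adjoint P x u lam psi.
Proof.
split=> [ps|H].
  apply: acdx_ode ps _; apply: (aeS (model_ae M)) => t + t0 => /(_ t0)[_ _ _ _ ->].
  by [].
apply: (ode_acdx (H := psidot M u x lam psi) H).
  move=> i j; rewrite ord1; rewrite (_ : (fun t => _) = (fun t =>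
    - (\sum_l psi t 0 l * mFx M t (x t) (u t) l j + lam * mGx M t (x t) (u t) 0 j))).
    apply: lintN; apply: lintD; last exact/lintZ/(lint_mGx M nb bu bx).
    apply: lint_sum => l; apply: lint_bounded (lint_mFx M nb bu bx l j) _.
      exact: ac_measurable (ac_entry 0 l H.1).
    exact: ac_locally_bounded (ac_entry 0 l H.1).
  by apply/funext => t; rewrite !mxE.
by apply: (aeS (model_ae M)) => t + t0 => /(_ t0)[_ _ _ _ ->].
Qed.

Lemma solA_ode A : solA M u x A <-> ode (fun t B => dfdx P t (x t) (u t) *m B) A.
Proof.
split=> [As|H].
  by apply: acdx_ode As _; apply: (aeS (model_ae M)) => t + t0 => /(_ t0)[_ _ -> _].
apply: (ode_acdx (H := fun t => mFx M t (x t) (u t) *m A t) H).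
  move=> i j; rewrite (_ : (fun t => _) = (fun t =>
    \sum_l A t l j * mFx M t (x t) (u t) i l)).
    apply: lint_sum => l; apply: lint_bounded (lint_mFx M nb bu bx i l) _.
      exact: ac_measurable (ac_entry l j H.1).
    exact: ac_locally_bounded (ac_entry l j H.1).
  by apply/funext => t; rewrite !mxE; apply: eq_bigr => l _; rewrite mulrC.
by apply: (aeS (model_ae M)) => t + t0 => /(_ t0)[_ _ -> _].
Qed.

Lemma fundP : let A := ivp_sol (fun t B => dfdx P t (x t) (u t) *m B) 1%:M in
  [/\ solA M u x A, A 0 = 1%:M & forall t, 0 <= t -> A t \in unitmx].
Proof.
have [A As [A0 _]] := solA_exists M nb bu bx.
have H : ivp (fun t B => dfdx P t (x t) (u t) *m B) 1%:M A by split=> //; apply/solA_ode.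
have [H1 H2] := ivp_solP H; have As' := (solA_ode _).2 H1.
split=> // t t0.
have [A' As'' [A0' [B [_ _ BA]]]] := solA_exists M nb bu bx.
have e := solA_uniq nb bu bx As' As'' (etrans H2 (esym A0')) t0.
by rewrite e; have [] := mulmx1_unit (BA t t0).
Qed.

Lemma dpayoffP A T : (\row_j \int[mu]_(t in `[0, T]) (dgdx P t (x t) (u t) *m A t) 0 j) =
  dpay M u x A T.
Proof.
apply/rowP => j; rewrite !mxE; apply: Rintegral_ae_eq.
apply: (aeS (model_ae M)) => t h tT.
by have [_ _ _ ->] := h (itv_Time tT).
Qed.

Lemma payoffP T : \int[mu]_(t in `[0, T]) cost P t (x t) (u t) =
  prim (fun t => mG M t (x t) (u t)) T.
Proof.
apply: Rintegral_ae_eq.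
apply: (aeS (model_ae M)) => t h tT.
by have [_ -> _ _] := h (itv_Time tT).
Qed.

End FixedX.

Lemma joint_solutions z : joint_system P u z ->
  [/\ solx M u (fun t => (z t).1.2), solpsi M u (fun t => (z t).1.2) (z 0).2 (fun t => (z t).1.1),
   forall t, 0 <= t -> (z t).2 = (z 0).2 & 0 <= (z 0).2].
Proof.
move=> [[az dz] z0].
have d1 : {ae mu, forall t, Time t -> is_derive t 1 (fun s => (z s).1.1)
    (- dHdx P (z t).1.2 t (u t) (z t).2 (z t).1.1)}.
  by apply: (aeS dz) => t + t0 => /(_ t0)/is_derive_pairP[/is_derive_pairP[]].
have d2 : {ae mu, forall t, Time t -> is_derive t 1 (fun s => (z s).1.2)
    (dyn P t (z t).1.2 (u t))}.
  by apply: (aeS dz) => t + t0 => /(_ t0)/is_derive_pairP[/is_derive_pairP[]].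
have d3 : {ae mu, forall t, Time t -> is_derive t 1 (fun s => (z s).2) 0}.
  by apply: (aeS dz) => t + t0 => /(_ t0)/is_derive_pairP[].
have zc (t : R) : 0 <= t -> (z t).2 = (z 0).2.
  move=> t0; have [_ ->] := acd_intro (ac_snd az) (lint_cst 0) d3; last by [].
  by rewrite prim_cst// mul0r addr0.
have xs : solx M u (fun t => (z t).1.2).
  by apply/solx_ode; split => //; exact: ac_snd (ac_fst az).
split => //; last by apply: z0; apply/Time_ge0.
have [c nc bx] := ac_bctrl (acdx_ac xs); have [n [nn un xn]] := bctrlD nb nc bu bx.
have H : ode (fun t q => - dHdx P (z t).1.2 t (u t) (z 0).2 q) (fun t => (z t).1.1).
  split; first exact: ac_fst (ac_fst az).
  by apply: (aeS d1) => t + t0 => /(_ t0); rewrite (zc t)//; exact/Time_ge0.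
apply: (ode_acdx (H := psidot M u (fun t => (z t).1.2) (z 0).2 (fun t => (z t).1.1)) H).
  move=> i j; rewrite ord1; rewrite (_ : (fun t => _) = (fun t =>
    - (\sum_l (z t).1.1 0 l * mFx M t (z t).1.2 (u t) l j + (z 0).2 * mGx M t (z t).1.2 (u t) 0 j))).
    apply: lintN; apply: lintD; last exact/lintZ/(lint_mGx M nn un xn).
    apply: lint_sum => l; apply: lint_bounded (lint_mFx M nn un xn l j) _.
      exact: ac_measurable (ac_entry 0 l H.1).
    exact: ac_locally_bounded (ac_entry 0 l H.1).
  by apply/funext => t; rewrite !mxE.
by apply: (aeS (model_ae M)) => t + t0 => /(_ t0)[_ _ _ _ ->].
Qed.

Lemma solutions_joint x psi (lam : R) : solx M u x -> solpsi M u x lam psi -> 0 <= lam ->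
  joint_system P u (fun t => (psi t, x t, lam)).
Proof.
move=> xs ps l0; split=> //.
have [c nc bx] := ac_bctrl (acdx_ac xs); have [n [nn un xn]] := bctrlD nb nc bu bx.
have [ax dx] := (solx_ode x).1 xs.
have [ap dp] : adjoint P x u lam psi.
  apply: acdx_ode ps _; apply: (aeS (model_ae M)) => t + t0 => /(_ t0)[_ _ _ _ ->].
  by [].
split; first by apply: ac_pair; [exact: ac_pair|exact: ac_cst].
apply: (aeS2 dx dp) => t h1 h2 t0; apply/is_derive_pairP; split => /=.
  by apply/is_derive_pairP; split; [exact: h2|exact: h1].
exact: is_derive_cst.
Qed.

End Fixed.
End Bridges.

(** * Uniform bounds and dependence on the data *)

Section Dependence.
Context {R : realType} {m k : nat} {P : control_problem R m k} (M : model P).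
Local Notation X := 'cV[R]_m.
Local Notation Xr := 'rV[R]_m.

Lemma acd_ndec_bound (b : R -> nat) (x h : R -> R) : ndec b -> acd x h -> exists c,
  [/\ ndec c, forall t, 0 <= t -> (b t <= c t)%N & forall t, 0 <= t -> x t <= (c t)%:R].
Proof.
move=> nb xh; have [n nn xn] := @ndec_bound R R^o x (fun b => acd_bounded b xh).
exists (fun t => b t + n t)%N; split=> [s t s0 st|t _|t t0].
- by rewrite leq_add ?nb ?nn.
- by rewrite leq_addr.
- by rewrite (le_trans (ler_norm _))// (le_trans (xn t t0))// ler_nat leq_addl.
Qed.

(** The bound [c] is common to all controls below [b], so weights built from it can be fixed before
    a control is selected. *)
Lemma solx_unif_bound b (C : R) : ndec b -> exists c,
  [/\ ndec c, forall t, 0 <= t -> (b t <= c t)%N &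
  forall u x, bctrl b u -> solx M u x -> `|x 0| <= C -> bctrl c x].
Proof.
move=> nb; have il := ellb_lint M nb.
have d := acdM (acd_exp (acd_prim il)) (acdD (acd_cst C) (acd_prim il)).
have [c [nc bc xc]] := acd_ndec_bound nb d.
exists c; split => // u x bu xs x0; split => [i|t t0].
  exact: acdx_measurable xs.
apply: le_trans (xc t t0); apply: le_trans (solx_bound nb bu xs (lexx 0) t0) _.
by rewrite prim0 expR0 mul1r addr0 ler_wpM2l ?expR_ge0// lerD2r.
Qed.

Lemma psidot_bound n u x lam psi t : `|u t| <= n%:R -> `|x t| <= n%:R -> 0 <= t ->
  `|psidot M u x lam psi t| <= `|psi t| * (m%:R * ell M n t) + `|lam| * ell M n t.
Proof.
move=> un xn t0; rewrite normrN (le_trans (ler_normD _ _))// lerD//.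
  rewrite (le_trans (mx_norm_mul _ _))// [X in X * _]mulrC -mulrA ler_wpM2l// ler_wpM2l//.
  exact: mFx_bound.
rewrite normrZ ler_wpM2l//; exact: mGx_bound.
Qed.

Lemma solpsi_unif_bound b (C : R) : ndec b -> 0 <= C -> exists c,
  [/\ ndec c, forall t, 0 <= t -> (b t <= c t)%N &
  forall u x lam psi, bctrl b u -> bctrl b x -> solpsi M u x lam psi -> `|lam| <= C -> `|psi 0| <= C ->
    forall t, 0 <= t -> `|psi t| <= (c t)%:R].
Proof.
move=> nb C0; have il := ellb_lint M nb; have il1 := lintZ m%:R il; have il2 := lintZ C il.
have d := acdM (acd_exp (acd_prim il1)) (acdD (acd_cst C) (acd_prim il2)).
have [c [nc bc xc]] := acd_ndec_bound nb d.
exists c; split => // u x lam psi bu bx ps lC p0 t t0.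
apply: le_trans (xc t t0).
have L0 (s : R) : 0 <= s -> 0 <= m%:R * ellb M b s by move=> s0; rewrite mulr_ge0// ellb_ge0.
have m0 (s : R) : 0 <= s -> 0 <= C * ellb M b s by move=> s0; rewrite mulr_ge0// ellb_ge0.
have h (s : R) : 0 <= s <= t -> `|psidot M u x lam psi s| <= `|psi s| * (m%:R * ellb M b s) + C * ellb M b s.
  move=> /andP[s0 _]; rewrite (le_trans (psidot_bound _ _ (bu.2 s s0) (bx.2 s s0) s0))// lerD2l.
  by rewrite ler_wpM2r// ellb_ge0.
have tt : 0 <= t <= t by rewrite t0 lexx.
apply: le_trans (acdx_fwd ps il1 L0 il2 m0 h tt) _.
by rewrite ler_wpM2l ?expR_ge0// lerD2r.
Qed.

Lemma solA_unif_bound b : ndec b -> exists c,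
  [/\ ndec c, forall t, 0 <= t -> (b t <= c t)%N &
  forall u x A, bctrl b u -> bctrl b x -> solA M u x A -> A 0 = 1%:M ->
    forall t, 0 <= t -> `|A t| <= (c t)%:R].
Proof.
move=> nb; have il := ellb_lint M nb; have il1 := lintZ m%:R il; have il0 := lint_cst (0 : R).
have d := acdM (acd_exp (acd_prim il1)) (acdD (acd_cst 1) (acd_prim il0)).
have [c [nc bc xc]] := acd_ndec_bound nb d.
exists c; split => // u x A bu bx As A0 t t0.
apply: le_trans (xc t t0).
have L0 (s : R) : 0 <= s -> 0 <= m%:R * ellb M b s by move=> s0; rewrite mulr_ge0// ellb_ge0.
have m0 (s : R) : 0 <= s -> 0 <= cst (0 : R) s by [].
have h (s : R) : 0 <= s <= t -> `|mFx M s (x s) (u s) *m A s| <= `|A s| * (m%:R * ellb M b s) + cst 0 s.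
  move=> /andP[s0 _]; rewrite addr0 (le_trans (mx_norm_mul _ _))// [leLHS]mulrC.
  rewrite ler_wpM2l// ler_wpM2l//; exact: mFx_bound (bx.2 s s0) (bu.2 s s0).
have tt : 0 <= t <= t by rewrite t0 lexx.
apply: le_trans (acdx_fwd As il1 L0 il0 m0 h tt) _.
rewrite A0 ler_wpM2l ?expR_ge0// lerD2r; apply: mx_norm_le => // i j.
by rewrite mxE; case: (_ == _); rewrite ?normr1 ?normr0.
Qed.

Lemma solx_dep b u x y : ndec b -> bctrl b u -> bctrl b x -> bctrl b y ->
  solx M u x -> solx M u y -> forall t, 0 <= t ->
  `|x t - y t| <= expR (prim (ellb M b) t) * `|x 0 - y 0|.
Proof.
move=> nb bu bx by_ xs ys t t0.
have il := ellb_lint M nb.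
have m0 (s : R) : 0 <= s -> 0 <= cst (0 : R) s by [].
have h (s : R) : 0 <= s <= t -> `|mF M s (x s) (u s) - mF M s (y s) (u s)| <=
    `|x s - y s| * ellb M b s + cst 0 s.
  by move=> /andP[s0 _]; rewrite addr0; exact: mF_lip (bx.2 s s0) (by_.2 s s0) (bu.2 s s0).
have tt : 0 <= t <= t by rewrite t0 lexx.
apply: le_trans (acdx_fwd (acdxB xs ys) il (ellb_ge0 M b) (lint_cst 0) m0 h tt) _.
by rewrite prim_cst// mul0r addr0.
Qed.

Lemma psidot_diff n u x y (lam nu : R) (psi phi : R -> Xr) t : `|u t| <= n%:R -> `|x t| <= n%:R -> `|y t| <= n%:R ->
  0 <= t -> `|phi t| <= n%:R ->
  `|psidot M u x lam psi t - psidot M u y nu phi t| <=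
   `|psi t - phi t| * (m%:R * ell M n t) +
   ((m%:R * n%:R + `|lam|) * `|x t - y t| + `|lam - nu|) * ell M n t.
Proof.
move=> un xn yn t0 pb.
have -> : psidot M u x lam psi t - psidot M u y nu phi t =
  - ((psi t - phi t) *m mFx M t (x t) (u t) +
     (phi t *m (mFx M t (x t) (u t) - mFx M t (y t) (u t)) +
     (lam *: (mGx M t (x t) (u t) - mGx M t (y t) (u t)) + (lam - nu) *: mGx M t (y t) (u t)))).
  rewrite /psidot mulmxBl mulmxBr scalerBr scalerBl.
  move: (psi t *m _) (phi t *m _) (phi t *m _) (lam *: _) (lam *: _) (nu *: _) => a c d e f g.
  by apply/rowP => j; rewrite !mxE; ring.
have hFx := mFx_bound M t0 xn un.
have hGx := mGx_bound M t0 yn un.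
have lFx := mFx_lip M t0 xn yn un.
have lGx := mGx_lip M t0 xn yn un.
rewrite normrN (le_trans (ler_normD _ _))// lerD//.
  rewrite (le_trans (mx_norm_mul _ _))// [X in X * _]mulrC -mulrA ler_wpM2l// ler_wpM2l//.
have aux (p q r b' L D l d : R) : p <= m%:R * b' * (D * L) -> q <= l * (D * L) -> r <= d * L ->
   p + (q + r) <= ((m%:R * b' + l) * D + d) * L by clear; lra.
rewrite (le_trans (ler_normD _ _))//.
apply: le_trans (lerD (lexx _) (ler_normD _ _)) _; apply: aux.
- rewrite (le_trans (mx_norm_mul _ _))// -!mulrA ler_wpM2l//.
  by apply: ler_pM.
- by rewrite normrZ ler_wpM2l.
- by rewrite normrZ ler_wpM2l.
Qed.

(** The difference of the states is estimated first; it then enters the linear equations for the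
    differences of fundamental matrices and adjoints as a source term. *)
Lemma flow_lip b u (C0 T : R) : ndec b -> bctrl b u -> 0 <= C0 -> 0 <= T ->
  exists C : R, 0 <= C /\ forall x y, solx M u x -> solx M u y -> `|x 0| <= C0 -> `|y 0| <= C0 ->
  [/\ forall t, 0 <= t <= T -> `|x t - y t| <= C * `|x 0 - y 0|,
    forall A B, solA M u x A -> solA M u y B -> A 0 = 1%:M -> B 0 = 1%:M ->
    forall t, 0 <= t <= T -> `|A t - B t| <= C * `|x 0 - y 0| &
    forall lam nu psi phi, solpsi M u x lam psi -> solpsi M u y nu phi ->
    `|lam| <= C0 -> `|nu| <= C0 -> `|phi 0| <= C0 ->
    forall t, 0 <= t <= T -> `|psi t - phi t| <= C * (`|psi 0 - phi 0| + `|x 0 - y 0| + `|lam - nu|)].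
Proof.
move=> nb bu C00 T0.
have [b1 [nb1 bb1 H1]] := solx_unif_bound C0 nb.
have bu1 := bctrlW bb1 bu.
have [b2 [nb2 bb2 H2]] := solpsi_unif_bound nb1 C00.
have [b3 [nb3 bb3 H3]] := solA_unif_bound nb2.
have bu3 := bctrlW bb3 (bctrlW bb2 bu1).
have il := ellb_lint M nb3; have il1 := lintZ m%:R il.
have L0 (s : R) : 0 <= s -> 0 <= m%:R * ellb M b3 s by move=> s0; rewrite mulr_ge0// ellb_ge0.
set La := prim (ellb M b3) T.
have La0 : 0 <= La by apply: prim_ge0; exact: ellb_ge0.
pose K : R := m%:R * (b3 T)%:R + C0.
have K0 : 0 <= K by rewrite addr_ge0// mulr_ge0.
have [E Ep EX] : exists2 E, 0 <= E & forall t, 0 <= t <= T -> expR (prim (ellb M b3) t) <= E.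
  exists (expR La); first exact: expR_ge0.
  by move=> t /andP[t0 tT]; rewrite ler_expR; exact: prim_homo (ellb_ge0 M b3) _ _.
have [E1 E1p E1X] : exists2 E1, 0 <= E1 &
    forall t, 0 <= t <= T -> expR (prim (fun s => m%:R * ellb M b3 s) t) <= E1.
  exists (expR (prim (fun s => m%:R * ellb M b3 s) T)); first exact: expR_ge0.
  by move=> t /andP[t0 tT]; rewrite ler_expR; exact: prim_homo L0 _ _.
(* [E] is the growth factor of the states and [E1] that of the linear equations; [(K * E + 1) * La]
   bounds the mass of the source terms per unit of initial error. *)
exists (E + E1 * (1 + (K * E + 1) * La)); split.
  by rewrite addr_ge0// mulr_ge0// addr_ge0// mulr_ge0// addr_ge0// mulr_ge0.
move=> x y xs ys x0 y0.
have bx1 := H1 _ _ bu xs x0; have by1 := H1 _ _ bu ys y0.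
have bx3 := bctrlW bb3 (bctrlW bb2 bx1); have by3 := bctrlW bb3 (bctrlW bb2 by1).
have bx2 := bctrlW bb2 bx1; have by2 := bctrlW bb2 by1; have bu2 := bctrlW bb2 bu1.
have dx t : 0 <= t <= T -> `|x t - y t| <= E * `|x 0 - y 0|.
  move=> tT; have /andP[t0 _] := tT.
  by apply: le_trans (solx_dep nb3 bu3 bx3 by3 xs ys t0) _; apply: ler_wpM2r (EX t tT).
have aux (e1 e q : R) : 0 <= e1 -> 0 <= q -> e * q <= (e + e1) * q.
  by move=> h1 h2; rewrite ler_wpM2r// lerDl.
have mm (c : R) (s : R) : 0 <= c -> 0 <= s -> 0 <= c * ellb M b3 s by move=> c0 s0; rewrite mulr_ge0// ellb_ge0.
have prT (c t : R) : 0 <= c -> 0 <= t <= T -> prim (fun s => c * ellb M b3 s) t <= c * La.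
  move=> c0 /andP[t0 tT]; rewrite -(primZ c T il); apply: prim_homo => //; first exact: lintZ.
  by move=> r r0; exact: mm.
split.
- move=> t tT; rewrite (le_trans (dx t tT))// aux// mulr_ge0// addr_ge0// mulr_ge0// addr_ge0// mulr_ge0//.
- move=> A B As Bs A0 B0 t tT; have /andP[t0 tT'] := tT.
  pose c := K * E * `|x 0 - y 0|.
  have c0 : 0 <= c by rewrite mulr_ge0// mulr_ge0.
  have h (s : R) : 0 <= s <= t -> `|mFx M s (x s) (u s) *m A s - mFx M s (y s) (u s) *m B s| <=
    `|A s - B s| * (m%:R * ellb M b3 s) + c * ellb M b3 s.
    move=> /andP[s0 st]; have sT : 0 <= s <= T by rewrite s0 (le_trans st).
    have -> : mFx M s (x s) (u s) *m A s - mFx M s (y s) (u s) *m B s =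
      mFx M s (x s) (u s) *m (A s - B s) + (mFx M s (x s) (u s) - mFx M s (y s) (u s)) *m B s.
      by rewrite mulmxBr mulmxBl addrA subrK.
    rewrite (le_trans (ler_normD _ _))// lerD//.
      rewrite (le_trans (mx_norm_mul _ _))// [leLHS]mulrC ler_wpM2l// ler_wpM2l//.
      exact: mFx_bound (bx3.2 s s0) (bu3.2 s s0).
    rewrite (le_trans (mx_norm_mul _ _))//.
    have hB := H3 _ _ _ bu2 by2 Bs B0 s s0.
    have hb : (b3 s)%:R <= (b3 T)%:R :> R by rewrite ler_nat nb3// (le_trans st).
    have hl := le_trans (mFx_lip M s0 (bx3.2 s s0) (by3.2 s s0) (bu3.2 s s0)) (ler_wpM2r (ellb_ge0 M b3 s0) (dx s sT)).
    rewrite (le_trans (ler_pM _ _ (ler_wpM2l (ler0n _ _) hl) (le_trans hB hb)))// ?mulr_ge0//.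
    rewrite /c /K -/(ellb M b3 s).
    have := ellb_ge0 M b3 s0; have := normr_ge0 (x 0 - y 0); have := ler0n R (b3 T); have := ler0n R m.
    move: Ep C00; clear; move: `|x 0 - y 0| (ellb M b3 s) (b3 T)%:R m%:R => q l bb mm Ep C00 m0 b0 q0 l0.
    have := mulr_ge0 C00 (mulr_ge0 Ep (mulr_ge0 q0 l0)); nra.
  have tt : 0 <= t <= t by rewrite t0 lexx.
  have := acdx_fwd (acdxB As Bs) il1 L0 (lintZ c il) (fun s => mm c s c0) h tt.
  rewrite A0 B0 subrr normr0 add0r => /le_trans; apply.
  have pr0 : 0 <= prim (fun s => c * ellb M b3 s) t by apply: prim_ge0 => s s0; exact: mm.
  apply: le_trans (ler_pM (expR_ge0 _) pr0 (E1X t tT) (prT c t c0 tT)) _.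
  rewrite /c; have := normr_ge0 (x 0 - y 0); move: Ep E1p K0 La0; clear.
  move: `|x 0 - y 0| => q Ep E1p K0 La0 q0.
  have := mulr_ge0 E1p (mulr_ge0 La0 q0); have := mulr_ge0 E1p q0; have := mulr_ge0 Ep q0; nra.
- move=> lam nu psi phi ps ph lC nC pC t tT; have /andP[t0 tT'] := tT.
  set q := `|x 0 - y 0|; have q0 : 0 <= q by exact: normr_ge0.
  pose c := K * E * q + `|lam - nu|.
  have c0 : 0 <= c by rewrite addr_ge0// mulr_ge0// mulr_ge0.
  have h (s : R) : 0 <= s <= t -> `|psidot M u x lam psi s - psidot M u y nu phi s| <=
    `|psi s - phi s| * (m%:R * ellb M b3 s) + c * ellb M b3 s.
    move=> /andP[s0 st]; have sT : 0 <= s <= T by rewrite s0 (le_trans st).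
    have pb : `|phi s| <= (b3 s)%:R.
      by rewrite (le_trans (H2 _ _ _ _ bu1 by1 ph nC pC s s0))// ler_nat bb3.
    rewrite (le_trans (psidot_diff _ _ _ (bu3.2 s s0) (bx3.2 s s0) (by3.2 s s0) s0 pb))// lerD2l ler_wpM2r ?ellb_ge0// lerD2r.
    have hb : (b3 s)%:R <= (b3 T)%:R :> R by rewrite ler_nat nb3// (le_trans st).
    rewrite -mulrA ler_pM// ?addr_ge0// ?mulr_ge0//; last exact: dx.
    by rewrite lerD// ler_wpM2l.
  have tt : 0 <= t <= t by rewrite t0 lexx.
  have := acdx_fwd (acdxB ps ph) il1 L0 (lintZ c il) (fun s => mm c s c0) h tt.
  move=> /le_trans; apply.
  apply: le_trans (_ : E1 * (`|psi 0 - phi 0| + c * La) <= _).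
    apply: ler_pM; [exact: expR_ge0| |exact: E1X|by rewrite lerD2l prT].
    by rewrite addr_ge0//; apply: prim_ge0 => s s0; exact: mm.
  rewrite /c; have := normr_ge0 (psi 0 - phi 0); have := normr_ge0 (lam - nu).
  move: Ep E1p K0 La0 q0; clear; move: `|psi 0 - phi 0| `|lam - nu| => p l Ep E1p K0 La0 q0 l0 p0.
  have h1 := mulr_ge0 E1p (mulr_ge0 La0 q0); have h2 := mulr_ge0 E1p q0; have h3 := mulr_ge0 Ep q0.
  have h4 := mulr_ge0 E1p (mulr_ge0 La0 p0); have h5 := mulr_ge0 E1p l0; have h6 := mulr_ge0 Ep p0.
  have h7 := mulr_ge0 Ep l0; have KE := mulr_ge0 K0 Ep.
  have h8 := mulr_ge0 KE h4; have h9 := mulr_ge0 KE (mulr_ge0 E1p (mulr_ge0 La0 l0)).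
  lra.
Qed.

End Dependence.

Section Limits.
Context {R : realType}.

Lemma cvg_dist0 (V : normedModType R) (a : nat -> V) (l : V) (e : nat -> R) :
  (forall n, `|a n - l| <= e n) -> e @ \oo --> 0 -> a @ \oo --> l.
Proof.
move=> ae /cvgrPdist_lt e0; apply/cvgrPdist_lt => eps eps0.
have := e0 _ eps0; apply: filterS => n; rewrite sub0r normrN => h.
by rewrite distrC (le_lt_trans (ae n))// (le_lt_trans (ler_norm _)).
Qed.

Lemma locally_uniformP (V : normedModType R) (F : nat -> R -> V) (h : R -> V) :
  (forall T e : R, 0 <= T -> 0 < e ->
     \forall n \near \oo, forall t, 0 <= t <= T -> `|F n t - h t| < e) ->
  locally_uniform_limit F h.
Proof.
move=> H K cK KT; have [M0 [_ hM]] := compact_bounded cK.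
pose T := `|M0| + 1.
have T0 : 0 <= T by rewrite addr_ge0.
have KM t : K t -> 0 <= t <= T.
  move=> Kt; have := KT _ Kt; rewrite /Time /= in_itv/= andbT => ->/=.
  apply: le_trans (ler_norm t) _; apply: (hM T) => //.
  by rewrite (le_lt_trans (ler_norm M0))// ltrDl.
move=> Q /uniform_nbhs[E [entE EQ]].
have [e e0 eE] : exists2 e : R, 0 < e & forall y z : V, ball y e z -> E (y, z).
  move: entE; rewrite -entourage_ballE => -[e /= e0 eE]; exists e => // y z yz; exact: eE.
have := H T e T0 e0; apply: filterS => n Hn; apply: EQ => t Kt; apply: eE.
by rewrite -ball_normE /= distrC; apply: Hn; exact: KM.
Qed.

End Limits.

Section FlowLimits.
Context {R : realType} {m k : nat} {P : control_problem R m k} (M : model P).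
Local Notation mu := (@lebesgue_measure R).
Local Notation X := 'cV[R]_m.
Local Notation Xr := 'rV[R]_m.
Local Notation UU := 'cV[R]_k.

Lemma flow_cvg b u x psi (lam : R) (x_ : nat -> R -> X) (psi_ : nat -> R -> Xr) (lam_ : nat -> R) T e :
  ndec b -> bctrl b u -> solx M u x -> solpsi M u x lam psi ->
  (forall n, solx M u (x_ n)) -> (forall n, solpsi M u (x_ n) (lam_ n) (psi_ n)) ->
  (fun n => x_ n 0) @ \oo --> x 0 -> (fun n => psi_ n 0) @ \oo --> psi 0 -> lam_ @ \oo --> lam ->
  0 <= T -> 0 < e -> \forall n \near \oo, forall t, 0 <= t <= T ->
  [/\ `|x_ n t - x t| < e, `|psi_ n t - psi t| < e &
    forall A B, solA M u (x_ n) A -> solA M u x B -> A 0 = 1%:M -> B 0 = 1%:M -> `|A t - B t| < e].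
Proof.
move=> nb bu xs ps xs_ ps_ cx cp cl T0 e0.
pose C0 := `|x 0| + `|psi 0| + `|lam| + 1.
have C00 : 0 <= C0 by rewrite !addr_ge0.
have [C [Cp HC]] := flow_lip M nb bu C00 T0.
pose d := Num.min 1 (e / (3 * C + 1)).
have C3 : 0 < 3 * C + 1 by rewrite ltr_wpDl// mulr_ge0.
have d0 : 0 < d by rewrite lt_min ltr01 divr_gt0.
have Cd : C * (d + d + d) < e.
  have : d <= e / (3 * C + 1) by rewrite ge_min lexx orbT.
  rewrite ler_pdivlMr//; move: Cp d0; clear; nra.
have near_bound (V : normedModType R) (v v' : V) (c : R) : `|v - v'| < d -> `|v'| <= c -> `|v| <= c + 1.
  move=> h hc; rewrite -(subrK v' v) (le_trans (ler_normD _ _))// addrC lerD//.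
  by rewrite (le_trans (ltW h))// ge_min lexx.
have hC (a : R) : a <= `|x 0| + `|psi 0| + `|lam| -> a <= C0.
  by move=> /le_trans; apply; rewrite lerDl.
have c1 : `|x 0| <= `|x 0| + `|psi 0| + `|lam| by rewrite -addrA lerDl addr_ge0.
have c2 : `|psi 0| <= `|x 0| + `|psi 0| + `|lam| by rewrite addrAC lerDr addr_ge0.
have c3 : `|lam| <= `|x 0| + `|psi 0| + `|lam| by rewrite lerDr addr_ge0.
have hx : \forall n \near \oo, `|x_ n 0 - x 0| < d by move/cvgrPdistC_lt : cx; apply.
have hp : \forall n \near \oo, `|psi_ n 0 - psi 0| < d by move/cvgrPdistC_lt : cp; apply.
have hl : \forall n \near \oo, `|lam_ n - lam| < d by move/cvgrPdistC_lt : cl; apply.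
near=> n.
have dx : `|x_ n 0 - x 0| < d by near: n.
have dp : `|psi_ n 0 - psi 0| < d by near: n.
have dl : `|lam_ n - lam| < d by near: n.
have [H1 H2 H3] := HC _ _ (xs_ n) xs (near_bound _ _ _ _ dx c1) (hC _ c1).
have small (a q : R) : 0 <= q -> q <= d -> a <= C * q -> a < e.
  move=> q0 qd aq; rewrite (le_lt_trans aq)// (le_lt_trans _ Cd)// ler_wpM2l// -addrA.
  by rewrite (le_trans qd)// lerDl addr_ge0// ltW.
move=> t tT; split.
- exact: small _ _ (normr_ge0 _) (ltW dx) (H1 t tT).
- have h := H3 _ _ _ _ (ps_ n) ps (near_bound _ _ _ _ dl c3) (hC _ c3) (hC _ c2) t tT.
  apply: le_lt_trans h (le_lt_trans _ Cd); rewrite ler_wpM2l// !lerD// ltW//.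
- move=> A B As Bs A0 B0; exact: small _ _ (normr_ge0 _) (ltW dx) (H2 A B As Bs A0 B0 t tT).
Unshelve. all: by end_near. Qed.

Lemma max_condP t (y : X) (v : UU) (lam : R) (q : Xr) : cset P t v ->
  ereal_sup [set (hamiltonian P y t p lam q)%:E | p in cset P t] =
    (hamiltonian P y t v lam q)%:E <->
  forall p, cset P t p -> hamiltonian P y t p lam q <= hamiltonian P y t v lam q.
Proof.
move=> ut; split=> [e p pU|H].
  rewrite -lee_fin -e; apply: ereal_sup_ubound; by exists p.
apply/eqP; rewrite eq_le; apply/andP; split; last by apply: ereal_sup_ubound; exists v.
by apply: ge_ereal_sup => _ [p pU <-]; rewrite lee_fin H.
Qed.

Lemma hamiltonianZ (c : R) x t (u : UU) (lam : R) (psi : Xr) :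
  hamiltonian P x t u (c * lam) (c *: psi) = c * hamiltonian P x t u lam psi.
Proof. by rewrite /hamiltonian -scalemxAl mxE mulrDr mulrA. Qed.

Lemma solpsiZ (c : R) u x lam psi : solpsi M u x lam psi -> solpsi M u x (c * lam) (fun t => c *: psi t).
Proof.
move=> ps i j; apply: eq_acd (acdZ c (ps i j)) => t t0; first by rewrite mxE.
have -> : psidot M u x (c * lam) (fun s => c *: psi s) t = c *: psidot M u x lam psi t.
  by rewrite /psidot -scalemxAl -scalerA -scalerDr -scalerN.
by rewrite [RHS]mxE.
Qed.

Lemma eq_solpsi u x y lam psi phi : (forall t, 0 <= t -> x t = y t) -> (forall t, 0 <= t -> psi t = phi t) ->
  solpsi M u x lam psi -> solpsi M u y lam phi.
Proof. by move=> xy pp; apply: eq_acdx => // t t0; rewrite /psidot xy// pp. Qed.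

(** [kappa] picks some solution through [y]; uniqueness of the states, and then of the adjoints
    along the common state, makes its value at 0 independent of the choice. *)
Lemma kappaP b u z t y : ndec b -> bctrl b u -> joint_system P u z -> 0 <= t -> z t = y ->
  kappa P u t y = z 0.
Proof.
move=> nb bu zs t0 zt; rewrite /kappa; case: xgetP => [z' _ [z's z't]|/(_ z)]; last by move=> [].
have [xs ps lc l0] := joint_solutions M nb bu zs.
have [xs' ps' lc' l0'] := joint_solutions M nb bu z's.
have e : z t = z' t by rewrite z't.
have ex := solx_uniq nb bu xs xs' t0 (congr1 (fun w => w.1.2) e).
have el : (z 0).2 = (z' 0).2 by rewrite -(lc t t0) -(lc' t t0) e.
have [c nc bx] := ac_bctrl (acdx_ac xs); have [n [nn un xn]] := bctrlD nb nc bu bx.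
have ps'' : solpsi M u (fun t => (z t).1.2) (z 0).2 (fun t => (z' t).1.1).
  by rewrite el; apply: eq_solpsi ps' => // s s0; rewrite ex.
have ep := solpsi_uniq nn un xn ps ps'' t0 (congr1 (fun w => w.1.1) e).
have := ep 0 (lexx _); have := ex 0 (lexx _); move: el.
by case: (z 0) => [[? ?] ?]; case: (z' 0) => [[? ?] ?] /= -> -> ->.
Qed.

Lemma oriented_prim (h : R -> R) s t : lint h -> 0 <= s -> 0 <= t ->
  oriented_integral s t h = prim h t - prim h s.
Proof.
have aux a b : lint h -> 0 <= a -> a <= b -> \int[mu]_(r in `[a, b]) h r = prim h b - prim h a.
  move=> ih a0 ab; rewrite prim_incr// Rintegral_itv_obnd_cbnd//; exact: lint_itv.
move=> ih s0 t0; rewrite /oriented_integral; case: leP => st; first exact: aux.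
by rewrite aux// ?opprB// ltW.
Qed.

End FlowLimits.

(** * Vanishing multipliers *)

Lemma cvg_pair_inv (V W : topologicalType) (f : nat -> V * W) (l : V * W) : f @ \oo --> l ->
  (fun n => (f n).1) @ \oo --> l.1 /\ (fun n => (f n).2) @ \oo --> l.2.
Proof.
move=> H; split.
  exact: (cvg_comp _ (fst : V * W -> V) H cvg_fst).
exact: (cvg_comp _ (snd : V * W -> W) H cvg_snd).
Qed.

Lemma cvg_pair_intro (V W : topologicalType) (f : nat -> V) (g : nat -> W) (a : V) (c : W) :
  f @ \oo --> a -> g @ \oo --> c -> (fun n => (f n, g n)) @ \oo --> (a, c).
Proof. by move=> fa gc; exact: cvg_pair fa gc. Qed.

Section Multipliers.
Context {R : realType} {m k : nat} {P : control_problem R m k} (M : model P).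
Local Notation X := 'cV[R]_m.
Local Notation Xr := 'rV[R]_m.
Local Notation UU := 'cV[R]_k.

Lemma lagrange_of_extremal x u (lam : R) psi : extremal P x u lam psi -> lagrange_multiplier P x u lam psi.
Proof.
move=> [[_ l01 _ ps e] mc]; split=> //; first by apply: ac_continuous; exact: ps.1.
move=> [l0 p0]; move: e; rewrite l0 addr0 p0; last exact/Time_ge0.
have -> : enorm (0 : Xr) = 0.
  by apply/eqP; rewrite -sqrtr0 /enorm; apply/eqP; congr Num.sqrt; rewrite big1// => i _; rewrite big1// => j _; rewrite mxE expr0n.
by move=> /eqP; rewrite eq_sym oner_eq0.
Qed.

Section FixedControl.
Context (b : R -> nat) (u : R -> UU).
Hypotheses (nb : ndec b) (bu : bctrl b u) (uU : forall t, Time t -> cset P t (u t)).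

Lemma lagrangeZ x (c lam : R) psi : bctrl b x -> 0 < c -> c * lam <= 1 ->
  lagrange_multiplier P x u lam psi -> lagrange_multiplier P x u (c * lam) (fun t => c *: psi t).
Proof.
move=> bx c0 cl [/andP[l0 l1] cp nt ps mc].
have ps' : adjoint P x u (c * lam) (fun t => c *: psi t).
  by apply/(solpsi_adjoint M nb bu bx)/solpsiZ/(solpsi_adjoint M nb bu bx).
split=> //; [by rewrite mulr_ge0 ?(ltW c0)|by apply: ac_continuous; exact: ps'.1| |].
  move=> [h1 h2]; apply: nt; split; first by move/eqP : h1; rewrite mulf_eq0 gt_eqF//= => /eqP.
  by move=> t tT; have /eqP := h2 t tT; rewrite scaler_eq0 gt_eqF//= => /eqP.
apply: (aeS mc) => t H tT; apply/(max_condP _ _ _ (uU tT)) => p pU.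
have /(max_condP _ _ _ (uU tT)) H' := H tT.
by rewrite !hamiltonianZ ler_wpM2l ?(ltW c0)// H'.
Qed.

Lemma vanishingZ tau x0 (c lam : R) psi : 0 < c -> vanishing P tau x0 u lam psi ->
  vanishing P tau x0 u (c * lam) (fun t => c *: psi t).
Proof.
move=> c0 [tau' [z [st zs zc z0]]].
pose l n : R := (z n 0).2.
exists tau', (fun n t => (c *: (z n t).1.1, (z n t).1.2, (c * l n : R))); split=> //.
- move=> n; have [xs ps lc l0] := joint_solutions M nb bu (zs n).
  have H := @solutions_joint R m k P M b u nb bu (fun t => (z n t).1.2) (fun t => c *: (z n t).1.1) (c * l n).
  by apply: H => //; [exact: solpsiZ|exact: mulr_ge0 (ltW c0) l0].
- move=> t tT; have H := zc t tT; have t0 := (Time_ge0 t).1 tT.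
  have [/cvg_pair_inv[/= H11 H12] /= H2] := cvg_pair_inv H.
  have h3 : (fun n => c * l n) @ \oo --> c * lam.
    apply: cvgMl_tmp; apply: cvg_trans H2; apply: near_eq_cvg; near=> n.
    by have [_ _ + _] := joint_solutions M nb bu (zs n) => /(_ t t0) /= ->.
  have h1 : (fun n => c *: (z n t).1.1) @ \oo --> c *: psi t by apply: cvgZ => //; exact: cvg_cst.
  exact: cvg_pair_intro (cvg_pair_intro h1 H12) h3.
by move=> n /=; rewrite z0 scaler0.
Unshelve. all: by end_near. Qed.

Lemma fund_inv_bounded x A T : bctrl b x -> solA M u x A -> A 0 = 1%:M ->
  exists K, forall t, 0 <= t <= T -> `|invmx (A t)| <= K.
Proof.
move=> bx As A0; have [A' As' [A0' [B [Bs _ BA]]]] := solA_exists M nb bu bx.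
have [K hK] := acdx_bounded T Bs.
exists K => t tT; have /andP[t0 _] := tT.
rewrite (solA_uniq nb bu bx As As' (etrans A0 (esym A0')) t0).
have := BA t t0 => h; have [h1 h2] := mulmx1_unit h.
by rewrite -[invmx _]mul1mx -h mulmxK// hK.
Qed.

End FixedControl.

Lemma approximating_vanishing (tau : nat -> R) u0 x_ eta_ lam_ psi_ tau_ lam psi :
  (forall n, 0 <= tau n) -> admissible P u0 ->
  approximating_data P tau u0 x_ eta_ lam_ psi_ tau_ lam psi ->
  [/\ lagrange_multiplier P (traj P u0) u0 lam psi, vanishing P tau (traj P u0) u0 lam psi &
    exists c : R, [/\ 0 < c,
      normalized_multiplier P (traj P u0) u0 (c * lam) (fun t => c *: psi t) &
      vanishing P tau (traj P u0) u0 (c * lam) (fun t => c *: psi t)]].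
Proof.
move=> tau0 au [clo [st [[ext _] [de [de0 _ dec kap]] _ [_ pz]]]].
have [b0 nb0 bu0] := admissible_bctrl au; have [_ _ uU] := au.
have [xs x00] : solx M u0 (traj P u0) /\ traj P u0 0 = xinit P := trajP M nb0 bu0 (xinit P).
have [b1 nb1 bx1] := ac_bctrl (acdx_ac xs); have [b [nb bu bx]] := bctrlD nb0 nb1 bu0 bx1.
have lag := lagrange_of_extremal ext.
have [[_ /andP[l0 l1] _ ps en] _] := ext.
have ps' := (solpsi_adjoint M nb bu bx lam psi).2 ps.
have t0 n : 0 <= tau_ n by case: st => s _ ->; exact: tau0.
have : forall n, exists z : (R -> X) * (R -> Xr),
    [/\ solx M u0 z.1, solpsi M u0 z.1 (lam_ n) z.2, z.1 (tau_ n) = x_ n (tau_ n) &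
      z.2 (tau_ n) = psi_ n (tau_ n)].
  move=> n; have [x' xs' xe] := solx_exists M (x_ n (tau_ n)) nb bu (t0 n).
  have [c nc bx'] := ac_bctrl (acdx_ac xs'); have [N [nN un xn]] := bctrlD nb nc bu bx'.
  have [p' ps'' pe] := solpsi_exists M (lam_ n) (psi_ n (tau_ n)) nN un xn (t0 n).
  by exists (x', p').
move=> /choice[z hz].
have ln0 n : 0 <= lam_ n by have [[_ _ /andP[]]] := clo n.
pose w n t : state := ((z n).2 t, (z n).1 t, lam_ n).
have ws n : joint_system P u0 (w n).
  by have [h1 h2 _ _] := hz n; have H := solutions_joint nb bu h1 h2 (ln0 n); exact: H.
(* Condition (2), read at the time [tau_ n] from which [w n] was solved backwards, controls the
   value of [w n] at time 0. *)
have w0 n : [/\ `|(z n).2 0 - psi 0| <= de n, `|(z n).1 0 - xinit P| <= de n & `|lam_ n - lam| <= de n].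
  have [_ _ h3 h4] := hz n.
  have := kap n (tau_ n) ((Time_ge0 _).2 (t0 n)).
  rewrite (kappaP M nb bu (ws n) (t0 n)); last by rewrite /w h3 h4.
  by move=> [h1 h2 h3']; split; rewrite ?(le_trans (norm_le_enorm _)).
have cx : (fun n => (z n).1 0) @ \oo --> traj P u0 0.
  by apply: (cvg_dist0 _ dec) => n; rewrite x00; have [] := w0 n.
have cp : (fun n => (z n).2 0) @ \oo --> psi 0 by apply: (cvg_dist0 _ dec) => n; have [] := w0 n.
have cl : lam_ @ \oo --> lam by apply: (@cvg_dist0 R R^o _ _ _ _ dec) => n; have [] := w0 n.
have van : vanishing P tau (traj P u0) u0 lam psi.
  exists tau_, w; split => //; last by move=> n; have [_ _ _ h] := hz n; rewrite /w /= h pz.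
  move=> t /Time_ge0 tge0.
  have H e := @flow_cvg R m k P M b u0 (traj P u0) psi lam (fun n => (z n).1) (fun n => (z n).2) lam_ t e
    nb bu xs ps' (fun n => let: And4 h _ _ _ := hz n in h) (fun n => let: And4 _ h _ _ := hz n in h) cx cp cl tge0.
  have tt : 0 <= t <= t by rewrite tge0 lexx.
  have h1 : (fun n => (z n).2 t) @ \oo --> psi t.
    by apply/cvgrPdistC_lt => e e0; have := H e e0; apply: filterS => n /(_ t tt)[].
  have h2 : (fun n => (z n).1 t) @ \oo --> traj P u0 t.
    by apply/cvgrPdistC_lt => e e0; have := H e e0; apply: filterS => n /(_ t tt)[].
  exact: cvg_pair_intro (cvg_pair_intro h1 h2) cl.
split=> //.
(* By [enorm (psi 0) + lam = 1] the multiplier is already normalized when [lam = 0]; otherwise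
   division by [lam] normalizes it. *)
have [lz|lp] := eqVneq lam 0.
  exists 1; have -> : (fun t => 1 *: psi t) = psi by apply/funext => t; rewrite scale1r.
  rewrite mul1r; split => //; split=> //; right; split => //.
  by move: en; rewrite lz addr0.
have lpos : 0 < lam by rewrite lt_def lp l0.
exists lam^-1; split; first by rewrite invr_gt0.
  split; last by left; rewrite mulVf.
  apply: (lagrangeZ nb bu uU bx _ _ lag); first by rewrite invr_gt0.
  by rewrite mulVf.
by apply: (vanishingZ nb bu _ van); rewrite invr_gt0.
Qed.

End Multipliers.

Section Vanishing.
Context {R : realType} {m k : nat} {P : control_problem R m k} (M : model P).
Local Notation mu := (@lebesgue_measure R).
Local Notation X := 'cV[R]_m.
Local Notation Xr := 'rV[R]_m.
Local Notation UU := 'cV[R]_k.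

Lemma oriented_ae_eq (h h' : R -> R) (s t : R) : {ae mu, forall r, Time r -> h r = h' r} ->
  0 <= s -> 0 <= t -> oriented_integral s t h = oriented_integral s t h'.
Proof.
move=> hh s0 t0; rewrite /oriented_integral.
have aux a b : 0 <= a -> \int[mu]_(r in `[a, b]) h r = \int[mu]_(r in `[a, b]) h' r.
  move=> a0; apply: Rintegral_ae_eq; apply: (aeS hh) => r hr; rewrite /= in_itv/= => /andP[ar _].
  by apply: hr; apply/Time_ge0; exact: le_trans ar.
by case: ifP => _; rewrite aux.
Qed.

Lemma near_seq_conv (Q : nat -> Prop) : (\forall n \near \oo, Q n) -> exists N, forall n, Q (n + N)%N.
Proof. by move=> [N _ HN]; exists N => n; apply: HN => /=; rewrite leq_addl. Qed.

Lemma cvg_shiftn_ (V : topologicalType) (f : nat -> V) (l : V) N : f @ \oo --> l ->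
  (fun n => f (n + N)%N) @ \oo --> l.
Proof. by move=> H; apply: cvg_comp H; exact: cvg_addnr. Qed.

Section FixedControl.
Context (b : R -> nat) (u : R -> UU).
Hypotheses (nb : ndec b) (bu : bctrl b u).

Lemma traj_shiftP xi : solx M u (traj_shift P u xi) /\ traj_shift P u xi 0 = xinit P + xi.
Proof. exact: (trajP M nb bu). Qed.

Lemma shift_fundP xi : [/\ solA M u (traj_shift P u xi) (fund P u xi), fund P u xi 0 = 1%:M &
  forall t, 0 <= t -> fund P u xi t \in unitmx].
Proof.
have [xs x0] := traj_shiftP xi.
have [c nc bx] := ac_bctrl (acdx_ac xs); have [n [nn un xn]] := bctrlD nb nc bu bx.
exact: (fundP M nn un xn).
Qed.

(** All three identities are [psi_fund], taken at [T] and at the time [t'] where [psi] vanishes. *)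
Lemma vanishing_dpay xi (lam : R) psi t' : solpsi M u (traj_shift P u xi) lam psi ->
  0 <= t' -> psi t' = 0 ->
  [/\ lam *: dpayoff P u xi t' = psi 0,
    forall T, 0 <= T -> lam *: ((dpayoff P u xi t' - dpayoff P u xi T) *m invmx (fund P u xi T)) = psi T &
    forall T, 0 <= T -> lam *: (\row_j oriented_integral T t' (fun t => dcost P u xi t 0 j)) =
      psi T *m fund P u xi T].
Proof.
move=> ps t0 pt.
have [xs x0] := traj_shiftP xi; have [As A0 Au] := shift_fundP xi.
have [c nc bx] := ac_bctrl (acdx_ac xs); have [n [nn un xn]] := bctrlD nb nc bu bx.
have dE T : dpayoff P u xi T = dpay M u (traj_shift P u xi) (fund P u xi) T.
  exact: (dpayoffP M u (traj_shift P u xi) (fund P u xi) T).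
have pA := psi_fund nn un xn ps As A0.
have p0 : lam *: dpayoff P u xi t' = psi 0.
  by have := pA t' t0; rewrite pt mul0mx dE => /eqP; rewrite eq_sym subr_eq0 => /eqP ->.
have dd T : 0 <= T -> lam *: (dpayoff P u xi t' - dpayoff P u xi T) = psi T *m fund P u xi T.
  by move=> T0; rewrite scalerBr p0 (dE T) (pA T T0).
split=> // T T0; first by rewrite scalemxAl dd// mulmxK// Au.
rewrite -dd//; congr (_ *: _); apply/rowP => j; rewrite !dE !mxE.
rewrite (@oriented_ae_eq _ (fun t => (mGx M t (traj_shift P u xi t) (u t) *m fund P u xi t) 0 j))//.
  by rewrite oriented_prim//; exact: (lint_dpay nn un xn).
by apply: (aeS (model_ae M)) => r H /H[_ _ _ e _]; rewrite /dcost e.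
Qed.

(** The first two expressions equal [psi n] at 0 and at [T] exactly. In the third, [psi n T] is
    followed by the fundamental matrix for [xi n] and the inverse of the one for 0, a product that
    tends to the identity locally uniformly. *)
Lemma vanishing_limits x0 psi0 (lam0 : R) (xi : nat -> X) (lam : nat -> R) (psi : nat -> R -> Xr) (tau' : nat -> R) :
  x0 = traj P u -> solpsi M u x0 lam0 psi0 ->
  xi @ \oo --> (0 : X) -> lam @ \oo --> lam0 -> (fun n => psi n 0) @ \oo --> psi0 0 ->
  (forall n, 0 <= tau' n) ->
  (forall n, solpsi M u (traj_shift P u (xi n)) (lam n) (psi n)) -> (forall n, psi n (tau' n) = 0) ->
  [/\ lam n *: dpayoff P u (xi n) (tau' n) @[n --> \oo] --> psi0 0,
      locally_uniform_limit (fun n T => lam n *: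
         ((dpayoff P u (xi n) (tau' n) - dpayoff P u (xi n) T) *m invmx (fund P u (xi n) T))) psi0 &
      locally_uniform_limit (fun n T => lam n *:
         ((\row_j oriented_integral T (tau' n) (fun t => dcost P u (xi n) t 0 j))
            *m invmx (fund P u 0 T))) psi0].
Proof.
move=> x0E ps0 cxi cl cp t0 ps pz.
have H n := vanishing_dpay (ps n) (t0 n) (pz n).
have E0 : traj_shift P u 0 = traj P u by rewrite /traj_shift addr0.
have [xs x00] : solx M u x0 /\ x0 0 = xinit P by rewrite x0E; exact: (trajP M nb bu).
have cx : (fun n => traj_shift P u (xi n) 0) @ \oo --> x0 0.
  rewrite (_ : (fun n => _) = (fun n => xinit P + xi n)); last first.
    by apply/funext => n; have [_ ->] := traj_shiftP (xi n).
  by rewrite x00 -[X in _ --> X]addr0; apply: cvgD => //; exact: cvg_cst.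
have F T e := @flow_cvg R m k P M b u x0 psi0 lam0 (fun n => traj_shift P u (xi n)) psi lam T e
  nb bu xs ps0 (fun n => (traj_shiftP (xi n)).1) ps cx cp cl.
have [As A0 Au] := shift_fundP 0; rewrite E0 -x0E in As.
split.
- rewrite (_ : (fun n => _) = (fun n => psi n 0))//.
  by apply/funext => n; have [] := H n.
- apply: locally_uniformP => T e T0 e0; have := F T e T0 e0; apply: filterS => n Hn t tT.
  have /andP[t_0 _] := tT; have [_ -> // _] := H n; by have [] := Hn t tT.
- apply: locally_uniformP => T e T0 e0.
  have [c nc bx] := ac_bctrl (acdx_ac xs); have [N [nN un xn]] := bctrlD nb nc bu bx.
  have [K hK] := fund_inv_bounded nN un T xn As A0.
  have [KA hA] := acdx_bounded T As; have [Kp hp] := acdx_bounded T ps0.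
  (* [Q * d] bounds the error once [psi n] and the fundamental matrix are within [d] of their
     limits: two factors [m] from matrix products, then the bounds of the inverse, of [psi n] and of
     the limit matrix. *)
  pose Q : R := m%:R * m%:R * `|K| * (`|Kp| + 1 + `|KA|).
  have Q0 : 0 <= Q by rewrite !mulr_ge0// !addr_ge0.
  pose d := Num.min 1 (e / (Q + 1)).
  have Q1 : 0 < Q + 1 by rewrite ltr_wpDl.
  have d0 : 0 < d by rewrite lt_min ltr01 divr_gt0.
  have Qd : Q * d < e.
    have : d <= e / (Q + 1) by rewrite ge_min lexx orbT.
    rewrite ler_pdivlMr//; move: Q0 d0; clear; nra.
  have d1 : d <= 1 by rewrite ge_min lexx.
  have := F T d T0 d0; apply: filterS => n Hn t tT.
  have /andP[t_0 _] := tT; have [_ _ h3] := H n; rewrite scalemxAl h3//.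
  have [_ dp dA] := Hn t tT; have [Asn An0 _] := shift_fundP (xi n).
  have {}dA := dA _ _ Asn As An0 A0.
  move: (hK t tT) (hA t tT) (hp t tT) (Au t t_0) dp dA.
  move: (fund P u 0 t) (fund P u (xi n) t) (psi n t) (psi0 t) => A A1 p1 p hk ha hp' ua dp dA.
  have -> : p1 *m A1 *m invmx A - p = (p1 *m (A1 - A) + (p1 - p) *m A) *m invmx A.
    by rewrite mulmxBr mulmxBl addrA subrK mulmxBl mulmxK.
  apply: le_lt_trans Qd; apply: le_trans (mx_norm_mul _ _) _.
  have n1 : `|p1 *m (A1 - A)| <= m%:R * (`|Kp| + 1) * d.
    apply: le_trans (mx_norm_mul _ _) _; apply: ler_pM => //; [|exact: ltW].
    rewrite ler_wpM2l// -(subrK p p1) (le_trans (ler_normD _ _))// addrC lerD//.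
      exact: le_trans hp' (ler_norm _).
    exact: le_trans (ltW dp) d1.
  have n2 : `|(p1 - p) *m A| <= m%:R * d * `|KA|.
    apply: le_trans (mx_norm_mul _ _) _; apply: ler_pM => //; [|exact: le_trans ha (ler_norm _)].
    by rewrite ler_wpM2l// ltW.
  have n3 := le_trans (ler_normD _ _) (lerD n1 n2).
  apply: (@le_trans _ _ (m%:R * (m%:R * (`|Kp| + 1) * d + m%:R * d * `|KA|) * `|K|)).
    apply: ler_pM => //; [|exact: le_trans hk (ler_norm _)].
    by rewrite ler_wpM2l.
  have aux (a c1 c2 m' d' : R) :
    m' * (m' * (a + 1) * d' + m' * d' * c1) * c2 = m' * m' * c2 * (a + 1 + c1) * d' by ring.
  by rewrite aux.
Qed.

Lemma vanishing_sequences (tau : nat -> R) (lam0 : R) psi0 : (forall n, 0 <= tau n) ->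
  normalized_multiplier P (traj P u) u lam0 psi0 -> vanishing P tau (traj P u) u lam0 psi0 ->
  exists (tau' : nat -> R) (xi : nat -> X) (lam : nat -> R),
          [/\ subsequence_of tau' tau,
              xi @ \oo --> (0 : 'cV[R]_m),
              (forall n, 0 < lam n <= 1) /\ lam @ \oo --> lam0,
              [/\ lam n *: dpayoff P u (xi n) (tau' n) @[n --> \oo] -->
                    psi0 0,
                  locally_uniform_limit
                    (fun n T => lam n *:
                      ((dpayoff P u (xi n) (tau' n) - dpayoff P u (xi n) T)
                         *m invmx (fund P u (xi n) T)))
                    psi0 &
                  locally_uniform_limit
                    (fun n T => lam n *:
                      ((\row_j oriented_integral T (tau' n)
                                 (fun t => dcost P u (xi n) t 0 j))
                         *m invmx (fund P u 0 T)))
                    psi0] &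
              0 < lam0 -> lam0 = 1 /\ forall n, lam n = 1].
Proof.
move=> tau0 [lag nrm] [tau' [z [st zs zc z0]]].
have t'0 n : 0 <= tau' n by case: st => s _ ->; exact: tau0.
have [xs x00] : solx M u (traj P u) /\ traj P u 0 = xinit P := trajP M nb bu (xinit P).
have [c nc bx] := ac_bctrl (acdx_ac xs); have [nn [nN un xn]] := bctrlD nb nc bu bx.
have ps0 : solpsi M u (traj P u) lam0 psi0 by case: lag => _ _ _ h _; apply/(solpsi_adjoint M nN un xn).
have zJ n := joint_solutions M nb bu (zs n).
pose l n : R := (z n 0).2.
have [/cvg_pair_inv[/= cp cx] /= cl] := cvg_pair_inv (zc 0 ((Time_ge0 0).2 (lexx 0))).
pose xi' n := (z n 0).1.2 - xinit P.
have ex n t : 0 <= t -> (z n t).1.2 = traj_shift P u (xi' n) t.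
  move=> t0; have [h1 _ _ _] := zJ n; have [h2 h3] := traj_shiftP (xi' n).
  by apply: (solx_uniq nb bu h1 h2 (lexx 0) _ t0); rewrite h3 /xi' addrC subrK.
have ps n : solpsi M u (traj_shift P u (xi' n)) (l n) (fun t => (z n t).1.1).
  by have [_ h _ _] := zJ n; apply: eq_solpsi h => // t; exact: ex.
have lge0 n : 0 <= l n by have [] := zJ n.
(* The first terms are dropped. When [lam0 = 0], the vector [psi0 0] is nonzero, whereas [l n = 0]
   would force the adjoint of [z n] to vanish at 0 by [vanishing_dpay]; hence [l n] is eventually
   positive. *)
have [N hN] : exists N, forall n, 0 < l (n + N)%N /\ (lam0 = 1 \/ l (n + N)%N <= 1).
  apply: (@near_seq_conv (fun n => 0 < l n /\ (lam0 = 1 \/ l n <= 1))); case: nrm => [l1|[l0 e1]].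
    have /cvgrPdistC_lt /(_ 1 ltr01) : l @ \oo --> lam0 by exact: cl.
    apply: filterS => n; rewrite l1 ltr_norml => /andP[h _]; split; last by left.
    by move: h; rewrite ltrBrDl subrr.
  have p0 : psi0 0 != 0.
    apply/negP => /eqP pz; move: e1; rewrite pz.
    have -> : enorm (0 : Xr) = 0.
      by apply/eqP; rewrite -sqrtr0 /enorm; apply/eqP; congr Num.sqrt; rewrite big1// => i _; rewrite big1// => j _; rewrite mxE expr0n.
    by move=> /eqP; rewrite eq_sym oner_eq0.
  have h1 : \forall n \near \oo, `|l n - lam0| < 1.
    have /cvgrPdistC_lt /(_ 1 ltr01) : l @ \oo --> lam0 by exact: cl.
    by apply: filterS => n.
  have h2 : \forall n \near \oo, `|(z n 0).1.1 - psi0 0| < `|psi0 0|.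
    by move/cvgrPdistC_lt : cp; apply; rewrite normr_gt0.
  near=> n; have a1 : `|l n - lam0| < 1 by near: n.
  have a2 : `|(z n 0).1.1 - psi0 0| < `|psi0 0| by near: n.
  split; last by right; move: a1; rewrite l0 subr0 => /ltW; exact: le_trans (ler_norm _).
  rewrite lt_def lge0 andbT; apply/negP => /eqP ln.
  have [+ _ _] := vanishing_dpay (ps n) (t'0 n) (z0 n).
  rewrite ln scale0r => e; move: a2; rewrite -e sub0r normrN ltxx.
  by [].
(* Division by [l] makes every [lam n] equal to 1 when [lam0 = 1]; when [lam0 = 0], the shift by [N]
   already ensures values at most 1. *)
pose r n : R := if lam0 == 1 then (l (n + N)%N)^-1 else 1.
pose lam n := r n * l (n + N)%N.
have lpos n : 0 < l (n + N)%N by have [] := hN n.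
have lam1 : lam0 = 1 -> forall n, lam n = 1.
  by move=> e n; rewrite /lam /r e eqxx mulVf// gt_eqF.
have clN : (fun n => l (n + N)%N) @ \oo --> lam0 by exact: (@cvg_shiftn_ R l lam0 N cl).
have cr : r @ \oo --> (1 : R).
  rewrite /r; have [e|ne] := eqVneq lam0 1; last exact: cvg_cst.
  rewrite -[X in _ --> X]invr1; apply: cvgV; [exact: oner_neq0|by rewrite -e; exact: clN].
have clam : lam @ \oo --> lam0.
  by rewrite -[lam0]mul1r; exact: cvgM cr clN.
exists (fun n => tau' (n + N)%N), (fun n => xi' (n + N)%N), lam.
have cxi : (fun n => xi' (n + N)%N) @ \oo --> (0 : X).
  apply: (@cvg_shiftn_ _ xi' 0 N); rewrite /xi' -(subrr (xinit P)).
  by apply: cvgB; [rewrite -[X in _ --> X]x00; exact: cx|exact: cvg_cst].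
split=> //.
- case: st => s sh ->; exists (fun n => s (n + N)%N) => // i j ij.
  by apply: sh; rewrite ltn_add2r.
- split=> // n; have [h1 h2] := hN n.
  rewrite /lam /r; case: eqVneq => [e|ne]; first by rewrite mulVf ?gt_eqF// ltr01 lexx.
  by rewrite mul1r h1/=; case: h2 => // e; rewrite e eqxx in ne.
- pose psi' n t := r n *: (z (n + N)%N t).1.1.
  have cp' : (fun n => psi' n 0) @ \oo --> psi0 0.
    rewrite -[psi0 0]scale1r; apply: cvgZ cr _.
    exact: (@cvg_shiftn_ Xr (fun n => (z n 0).1.1) (psi0 0) N cp).
  have ps' n : solpsi M u (traj_shift P u (xi' (n + N)%N)) (lam n) (psi' n).
    exact: solpsiZ (ps (n + N)%N).
  have pz' n : psi' n (tau' (n + N)%N) = 0 by rewrite /psi' z0 scaler0.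
  exact: (@vanishing_limits (traj P u) psi0 lam0 (fun n => xi' (n + N)%N) lam psi'
    (fun n => tau' (n + N)%N) erefl ps0 cxi clam cp' (fun n => t'0 (n + N)%N) ps' pz').
- move=> l0; case: nrm => [e|[e _]]; first by split=> //; exact: lam1.
  by rewrite e ltxx in l0.
Unshelve. all: by end_near. Qed.

End FixedControl.
End Vanishing.

(** * Almost optimal controls *)

Section Needle.
Context {R : realType} {m k : nat} {P : control_problem R m k} (M : model P).
Local Notation X := 'cV[R]_m.
Local Notation Xr := 'rV[R]_m.
Local Notation UU := 'cV[R]_k.

Definition mH t (x : X) (v : UU) (lam : R) (psi : Xr) := (psi *m mF M t x v) 0 0 + lam * mG M t x v.

Definition splice (E : set R) (v u : R -> UU) (s : R) := if `[< E s >] then v s else u s.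

Lemma splice_in E v u s : E s -> splice E v u s = v s.
Proof. by move=> Es; rewrite /splice asboolT. Qed.

Lemma splice_out E v u s : ~ E s -> splice E v u s = u s.
Proof. by move=> Es; rewrite /splice asboolF. Qed.

Lemma measurable_splice (E : set R) (v u : R -> UU) i : measurable E ->
  measurable_fun Time (fun t => v t i 0) -> measurable_fun Time (fun t => u t i 0) ->
  measurable_fun Time (fun t => splice E v u t i 0).
Proof.
move=> mE mv mu_; rewrite (_ : (fun t => _) = (fun t => v t i 0 * \1_E t + u t i 0 * (1 - \1_E t))).
  apply: measurable_funD; apply: measurable_funM => //.
  by apply: measurable_funB => //; exact: measurable_funTS (measurable_indic mE).
apply/funext => t; rewrite /splice indicE; case: asboolP => Et.
  by rewrite mem_set// mulr1 subrr mulr0 addr0.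
by rewrite memNset// mulr0 subr0 mulr1 add0r.
Qed.

Lemma bctrl_splice b E v u : measurable E -> bctrl b v -> bctrl b u -> bctrl b (splice E v u).
Proof.
move=> mE [mv vb] [mu_ ub]; split=> [i|t t0]; first exact: measurable_splice.
by rewrite /splice; case: asboolP => _; [exact: vb|exact: ub].
Qed.

Let sub00 (A B : 'M[R]_1) : (A - B) 0 0 = A 0 0 - B 0 0. Proof. by rewrite mxE [in X in _ + X]mxE. Qed.
Let add00 (A B : 'M[R]_1) : (A + B) 0 0 = A 0 0 + B 0 0. Proof. by rewrite mxE. Qed.
Let opp00 (A : 'M[R]_1) : (- A) 0 0 = - A 0 0. Proof. by rewrite mxE. Qed.

Let z00 : (0 : 'M[R]_1) 0 0 = 0. Proof. by rewrite mxE. Qed.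

Let le00 (p : Xr) (q : X) (a c : R) : `|p| <= a -> `|q| <= c -> 0 <= a -> - (m%:R * a * c) <= (p *m q) 0 0.
Proof.
move=> pa qc a0; rewrite lerNl (le_trans (ler_norm _))// normrN.
rewrite (le_trans (mx_norm_entry _ _ _))// (le_trans (mx_norm_mul _ _))//.
by rewrite -!mulrA ler_wpM2l// ler_pM.
Qed.

(* The first-order terms in [y - x] cancel against the adjoint equation; what is
   left is the increment of the Hamiltonian, a mixed term and a quadratic one. *)
Lemma needle_pointwise N t (x y : X) (u w : UU) (psi : Xr) (Psi : R) : 0 <= t ->
  `|x| <= N%:R -> `|y| <= N%:R -> `|u| <= N%:R -> `|w| <= N%:R -> `|psi| <= Psi ->
  mH t x w 1 psi - mH t x u 1 psi
    + ((psi *m mFx M t x w + mGx M t x w - psi *m mFx M t x u - mGx M t x u) *m (y - x)) 0 0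
    - (1 + m%:R * Psi) * (`|y - x| ^+ 2 * ell M N t)
  <= mG M t y w - mG M t x u + (- (psi *m mFx M t x u + 1 *: mGx M t x u) *m (y - x)
      + psi *m (mF M t y w - mF M t x u)) 0 0.
Proof.
move=> t0 xN yN uN wN pP; have P0 := le_trans (normr_ge0 psi) pP.
have hF := mF_taylor M t0 xN yN wN; have hG := mG_taylor M t0 xN yN wN.
have h1 := le00 pP hF P0.
have {}hG : - (`|y - x| ^+ 2 * ell M N t) <= mG M t y w - mG M t x w - (mGx M t x w *m (y - x)) 0 0.
  by rewrite lerNl (le_trans (ler_norm _))// normrN.
move: h1; rewrite /mH scale1r ?mulmxBr ?mulNmx ?mulmxBl ?mulmxDl ?mulmxBr ?mulmxA.
rewrite !(sub00, add00, opp00) !mul1r.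
move: hG; rewrite mulmxBr sub00.
move: (`|y - x| ^+ 2 * ell M N t) (mG M t y w) (mG M t x w) (mG M t x u) => Q g1 g2 g3.
move: ((mGx M t x w *m y) 0 0) ((mGx M t x w *m x) 0 0) ((mGx M t x u *m y) 0 0) ((mGx M t x u *m x) 0 0).
move: ((psi *m mF M t y w) 0 0) ((psi *m mF M t x w) 0 0) ((psi *m mF M t x u) 0 0).
move: ((psi *m mFx M t x w *m y) 0 0) ((psi *m mFx M t x w *m x) 0 0).
move: ((psi *m mFx M t x u *m y) 0 0) ((psi *m mFx M t x u *m x) 0 0).
by move: (m%:R) => *; lra.
Qed.

(** With terminal value 0 the backward Gronwall estimate leaves only the source term, which depends
    on [N] and [T] but not on the control. *)
Lemma psi_final_bound N (T : R) : ndec N -> 0 <= T -> exists2 Psi : R, 0 <= Psi &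
  forall u x psi, bctrl N u -> bctrl N x -> solpsi M u x 1 psi -> psi T = 0 ->
  forall t, 0 <= t <= T -> `|psi t| <= Psi.
Proof.
move=> nN T0; have il := ellb_lint M nN; have il1 := lintZ m%:R il.
have L0 (s : R) : 0 <= s -> 0 <= m%:R * ellb M N s by move=> s0; rewrite mulr_ge0// ellb_ge0.
pose E s := expR (prim (fun s => m%:R * ellb M N s) s).
have El0 (r : R) : 0 <= r -> 0 <= E r * ellb M N r.
  by move=> r0; exact: mulr_ge0 (expR_ge0 _) (ellb_ge0 M N r0).
exists (prim (fun s => E s * ellb M N s) T).
  exact: prim_ge0.
move=> u x psi bu bx ps pT t tT; have /andP[t0 _] := tT.
have h (s : R) : 0 <= s <= T -> `|psidot M u x 1 psi s| <= `|psi s| * (m%:R * ellb M N s) + ellb M N s.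
  by move=> /andP[s0 _]; have := psidot_bound M 1 psi (bu.2 s s0) (bx.2 s s0) s0; rewrite normr1 mul1r.
have H := acdx_bwd ps il1 L0 il h tT; have pz : `|psi T| = 0 by rewrite pT normr0.
have E1 : 1 <= E t by rewrite -expR0 ler_expR; exact: prim_ge0.
have p0 : 0 <= prim (fun s => E s * ellb M N s) t := prim_ge0 t El0.
have aux (a e p q f z : R) : z = 0 -> 1 <= e -> 0 <= a -> 0 <= q -> e * a <= f * z + (p - q) -> a <= p.
  move=> -> e1 a0 q0; rewrite mulr0 add0r lerBrDr => hh.
  by apply: le_trans (ler_peMl a0 e1) (le_trans _ hh); rewrite lerDl.
exact: aux pz E1 (normr_ge0 _) p0 H.
Qed.

(** Since [psi T = 0] and [x 0 = y 0], the derivative of [psi *m (y - x)] integrates to 0; adding it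
    to the payoff difference reduces the claim to [needle_pointwise]. Gronwall bounds the distance
    of [y] and [x] by [K2 * rho], with [rho] the mass of [E]. The mixed term lives on [E], so it is
    of order [rho ^+ 2] like the quadratic one. *)
Lemma needle N (T : R) : ndec N -> 0 <= T -> exists2 C : R, 0 <= C &
  forall u v (E : set R) x y psi, bctrl N u -> bctrl N v -> bctrl N x -> bctrl N y -> measurable E ->
  solx M u x -> solx M (splice E v u) y -> x 0 = y 0 -> solpsi M u x 1 psi -> psi T = 0 ->
  prim (fun s => (mH s (x s) (v s) 1 (psi s) - mH s (x s) (u s) 1 (psi s)) * \1_E s) T
   - C * prim (fun s => ellb M N s * \1_E s) T ^+ 2
  <= prim (fun s => mG M s (y s) (splice E v u s)) T - prim (fun s => mG M s (x s) (u s)) T.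
Proof.
move=> nN T0; have [Psi P0 HPsi] := psi_final_bound nN T0.
have il := ellb_lint M nN; have l0 := ellb_ge0 M N.
set La := prim (ellb M N) T.
have La0 : 0 <= La by exact: prim_ge0.
have [K K0 KX] : exists2 K, 0 <= K & forall t, 0 <= t <= T -> expR (prim (ellb M N) t) <= K.
  exists (expR La); first exact: expR_ge0.
  by move=> t /andP[t0 tT]; rewrite ler_expR; exact: prim_homo l0 t0 tT.
pose K2 := K * 2.
have K20 : 0 <= K2 by rewrite mulr_ge0.
pose c1 := 1 + m%:R * Psi.
have c10 : 0 <= c1 by rewrite addr_ge0// mulr_ge0.
exists (c1 * (K2 ^+ 2 * La + 2 * m%:R * K2)).
  by rewrite mulr_ge0// addr_ge0// mulr_ge0// ?exprn_ge0// mulr_ge0.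
move=> u v E x y psi bu bv bx by_ mE xs ys xy0 ps pT.
have bw := bctrl_splice mE bv bu.
have iE := lint_indic il mE.
have lE0 (s : R) : 0 <= s -> 0 <= ellb M N s * \1_E s by move=> s0; rewrite mulr_ge0// l0.
set rho := prim (fun s => ellb M N s * \1_E s) T.
have rho0 : 0 <= rho by exact: prim_ge0.
have dxi t : 0 <= t <= T -> `|y t - x t| <= K2 * rho.
  move=> tT; have /andP[t0 tT'] := tT.
  have i2 := lintZ 2 iE.
  have m0 (s : R) : 0 <= s -> 0 <= 2 * (ellb M N s * \1_E s) by move=> s0; rewrite mulr_ge0// lE0.
  have h (s : R) : 0 <= s <= T ->
     `|mF M s (y s) (splice E v u s) - mF M s (x s) (u s)| <= `|y s - x s| * ellb M N s + 2 * (ellb M N s * \1_E s).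
    move=> /andP[s0 sT]; have [Es|Es] := pselect (E s).
      rewrite splice_in// indicE mem_set// mulr1 (le_trans (ler_normB _ _))// ler_wpDl ?mulr_ge0 ?l0//.
      rewrite mulr2n mulrDl mul1r lerD//; first exact: mF_bound (by_.2 s s0) (bv.2 s s0).
      exact: mF_bound (bx.2 s s0) (bu.2 s s0).
    rewrite splice_out// ler_wpDr ?m0//.
    exact: mF_lip (by_.2 s s0) (bx.2 s s0) (bu.2 s s0).
  have := acdx_fwd (acdxB ys xs) il l0 i2 m0 h tT; rewrite xy0 subrr normr0 add0r.
  move=> /le_trans; apply; rewrite -[leRHS]mulrA; apply: ler_pM; [exact: expR_ge0| |exact: KX|].
    exact: prim_ge0.
  by rewrite (primZ 2 t iE) ler_wpM2l//; exact: prim_homo.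
have iGx := lint_mG M nN bu bx; have iGy := lint_mG M nN bw by_.
have dpsi := acdx_mul ps (acdxB ys xs) 0 0.
have [iD hD] := dpsi.
have D0 : prim (fun s => (psidot M u x 1 psi s *m (y s - x s) +
   psi s *m (mF M s (y s) (splice E v u s) - mF M s (x s) (u s))) 0 0) T = 0.
  have := hD T T0; rewrite pT mul0mx xy0 subrr mulmx0 z00 add0r => e.
  exact: esym e.
rewrite -(primB T iGy iGx) -[leRHS]addr0 -D0 -primD; last 2 first.
- exact: lintB.
- exact: iD.
have [iFv iFu] : lint (fun s => mH s (x s) (v s) 1 (psi s)) /\ lint (fun s => mH s (x s) (u s) 1 (psi s)).
  have aux (z : R -> UU) : bctrl N z -> lint (fun s => mH s (x s) (z s) 1 (psi s)).
    move=> bz; rewrite /mH; apply: lintD; last exact: lintZ (lint_mG M nN bz bx).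
    rewrite (_ : (fun s => _) = (fun s => \sum_l psi s 0 l * mF M s (x s) (z s) l 0)).
      by apply: lint_sum => l; apply: lint_acdM (ps 0 l) (lint_mF M nN bz bx l).
    by apply/funext => s; rewrite mxE.
  by split; exact: aux.
pose q s := c1 * ((K2 * rho) ^+ 2 * ellb M N s + 2 * m%:R * (K2 * rho) * (ellb M N s * \1_E s)).
have iq : lint q by apply: lintZ; apply: lintD; exact: lintZ.
have iH := lint_indic (lintB iFv iFu) mE.
have -> : c1 * (K2 ^+ 2 * La + 2 * m%:R * K2) * rho ^+ 2 = prim q T.
  rewrite /q primZ; last by apply: lintD; exact: lintZ.
  rewrite primD; [|exact: lintZ|exact: lintZ].
  rewrite (primZ _ T il) (primZ _ T iE) -/La -/rho.
  by move: m%:R => mm; ring.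
rewrite -primB//; apply: prim_le => //.
- exact: lintB.
- by apply: lintD => //; exact: lintB.
move=> s sT; have /andP[s0 sT'] := sT.
have wN := bw.2 s s0.
have np := needle_pointwise s0 (bx.2 s s0) (by_.2 s s0) (bu.2 s s0) wN (HPsi _ _ _ bu bx ps pT s sT).
apply: le_trans np.
have hxi := dxi s sT; have l0s := l0 s s0.
have hq : c1 * (`|y s - x s| ^+ 2 * ell M (N s) s) <= c1 * ((K2 * rho) ^+ 2 * ellb M N s).
  by rewrite ler_wpM2l// ler_wpM2r// lerXn2r// ?nnegrE ?mulr_ge0.
have [Es|Es] := pselect (E s).
  have hK : - (2 * m%:R * c1 * ellb M N s * (K2 * rho)) <=
    ((psi s *m mFx M s (x s) (v s) + mGx M s (x s) (v s) - psi s *m mFx M s (x s) (u s) - mGx M s (x s) (u s))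
      *m (y s - x s)) 0 0.
    have hz (z : UU) : `|z| <= (N s)%:R -> `|psi s *m mFx M s (x s) z + mGx M s (x s) z| <= c1 * ellb M N s.
      move=> zN; rewrite (le_trans (ler_normD _ _))// /c1 mulrDl mul1r addrC lerD//.
        exact: mGx_bound (bx.2 s s0) zN.
      rewrite (le_trans (mx_norm_mul _ _))// ler_pM ?mulr_ge0//.
        by apply: ler_wpM2l => //; exact: HPsi bu bx ps pT s sT.
      exact: mFx_bound (bx.2 s s0) zN.
    have hh : `|psi s *m mFx M s (x s) (v s) + mGx M s (x s) (v s) - psi s *m mFx M s (x s) (u s) - mGx M s (x s) (u s)|
       <= 2 * (c1 * ellb M N s).
      rewrite -addrA -opprD (le_trans (ler_normB _ _))// mulr2n mulrDl mul1r lerD// hz//.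
        exact: bv.2.
      exact: bu.2.
    apply: le_trans (le00 hh hxi _); last by rewrite mulr_ge0// mulr_ge0.
    by rewrite lerN2 le_eqVlt; apply/orP; left; apply/eqP; move: m%:R => mm; ring.
  have aux (h g K' L0 c r mm z c2 : R) : - (2 * mm * c * L0 * r) <= z -> c2 <= c * (r ^+ 2 * L0) ->
      (h - g) * 1 - c * (r ^+ 2 * L0 + 2 * mm * r * (L0 * 1)) <= h - g + z - c2.
    move=> a1 a2; rewrite -subr_ge0.
    rewrite (_ : _ - _ = (z + 2 * mm * c * L0 * r) + (c * (r ^+ 2 * L0) - c2)); last by ring.
    by rewrite addr_ge0 ?subr_ge0// -lerBlDr sub0r.
  by rewrite splice_in// /q indicE mem_set//; exact: aux hK hq.
have aux (h c r L0 mm c2 : R) : c2 <= c * (r ^+ 2 * L0) ->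
    h * 0 - c * (r ^+ 2 * L0 + 2 * mm * r * (L0 * 0)) <= - c2.
  by move=> a2; rewrite !mulr0 addr0 sub0r lerN2.
have e (A B : Xr) : A + B - A - B = 0 by rewrite -addrA -opprD subrr.
rewrite splice_out// e mul0mx z00 addr0 subrr sub0r /q indicE memNset//.
exact: aux hq.
Qed.

End Needle.

(** * Backward solutions near a trajectory *)

Section Tube.
Context {R : realType} {m k : nat} {P : control_problem R m k} (M : model P).
Local Notation X := 'cV[R]_m.
Local Notation UU := 'cV[R]_k.

Definition neq (u v : R -> UU) : set R := [set s | 0 <= s /\ u s <> v s].

Lemma measurable_neq b c u v : bctrl b u -> bctrl c v -> measurable (neq u v).
Proof.
move=> [mu_ _] [mv _].
have -> : neq u v = \bigcup_(i in [set: 'I_k]) (Time `&` (fun s => u s i 0 - v s i 0) @^-1` (~` [set 0])).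
  apply/seteqP; split=> s.
    move=> [s0 uv]; have [i hi] : exists i, u s i 0 <> v s i 0.
      apply: contrapT => H; apply: uv; apply/matrixP => i j; rewrite ord1.
      by apply: contrapT => h; apply: H; exists i.
    exists i => //; split; first exact/Time_ge0.
    by move=> /eqP; rewrite subr_eq0 => /eqP.
  move=> [i _ [/Time_ge0 s0 h]]; split=> // e; apply: h.
  by rewrite /= e subrr.
apply: fin_bigcup_measurable => [|i _]; first exact: finite_finset.
have := measurable_funB (mu_ i) (mv i); apply; first exact: measurable_Time.
exact: measurableC (measurable_set1 0).
Qed.

Lemma acdx_row p q1 q2 (A H : R -> 'M[R]_(p, q1)) (B K : R -> 'M[R]_(p, q2)) :
  acdx A H -> acdx B K -> acdx (fun t => row_mx (A t) (B t)) (fun t => row_mx (H t) (K t)).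
Proof.
move=> AH BK i j; case: (splitP j) => l jl.
  have -> : j = lshift q2 l by apply/val_inj.
  by apply: eq_acd (AH i l) => t _; rewrite row_mxEl.
have -> : j = rshift q1 l by apply/val_inj.
by apply: eq_acd (BK i l) => t _; rewrite row_mxEr.
Qed.

Lemma acdx_tr p q (A H : R -> 'M[R]_(p, q)) : acdx A H -> acdx (fun t => (A t)^T) (fun t => (H t)^T).
Proof. by move=> AH i j; apply: eq_acd (AH j i) => t _; rewrite mxE. Qed.

Lemma norm_row_le p q1 q2 (A : 'M[R]_(p, q1)) (B : 'M[R]_(p, q2)) (c : R) : `|A| <= c -> `|B| <= c ->
  `|row_mx A B| <= c.
Proof.
move=> Ac Bc; apply: mx_norm_le => [|i j]; first exact: le_trans (normr_ge0 _) Ac.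
case: (splitP j) => l jl.
  have -> : j = lshift q2 l by apply/val_inj.
  by rewrite row_mxEl (le_trans (mx_norm_entry _ _ _)).
have -> : j = rshift q1 l by apply/val_inj.
by rewrite row_mxEr (le_trans (mx_norm_entry _ _ _)).
Qed.

Lemma norm_row_ge p q1 q2 (A : 'M[R]_(p, q1)) (B : 'M[R]_(p, q2)) :
  `|A| <= `|row_mx A B| /\ `|B| <= `|row_mx A B|.
Proof.
split; apply: mx_norm_le => // i j.
  by have := mx_norm_entry (row_mx A B) i (lshift q2 j); rewrite row_mxEl.
by have := mx_norm_entry (row_mx A B) i (rshift q1 j); rewrite row_mxEr.
Qed.

Lemma norm_tr p q (A : 'M[R]_(p, q)) : `|A^T| = `|A|.
Proof.
have le a b (B : 'M[R]_(a, b)) : `|B^T| <= `|B|.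
  by apply: mx_norm_le => // i j; rewrite mxE mx_norm_entry.
by apply/eqP; rewrite eq_le le/= -{1}(trmxK A) le.
Qed.

(** The coefficient produced by [psidot_diff] when the adjoint is at most [N] and [lam] at most 1:
    the summands account for the adjoint error, and for the state error acting through [mFx] and
    through [mGx]. *)
Definition rate (N : R -> nat) s := (m%:R + m%:R * (N s)%:R + 1) * ellb M N s.
(* The Gronwall factor is part of the weight, so that the weighted distance of a
   control to [u0] bounds the error of [kappa] uniformly in time. *)
Definition weight N s := expR (prim (rate N) s) * (2 * rate N s).

Lemma rate_ge N s : 0 <= s -> ellb M N s <= rate N s.
Proof.
move=> s0; rewrite ler_peMl ?ellb_ge0// lerDr addr_ge0// mulr_ge0//.
Qed.

Lemma rate_ge0 N s : 0 <= s -> 0 <= rate N s.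
Proof. by move=> s0; apply: le_trans (rate_ge N s0); exact: ellb_ge0. Qed.

Lemma lint_rate N : ndec N -> lint (rate N).
Proof.
move=> nN; apply: lint_bounded (ellb_lint M nN) _.
  by apply: measurable_funD => //; apply: measurable_funD => //; apply: measurable_funM => //; exact: ndec_measurable.
move=> b; exists (m%:R + m%:R * (N b)%:R + 1) => t /andP[t0 tb].
rewrite ger0_norm ?addr_ge0 ?mulr_ge0// lerD2r lerD2l ler_wpM2l// ler_nat; exact: nN.
Qed.

Lemma lint_weight N : ndec N -> lint (weight N).
Proof.
move=> nN; have iL := lint_rate nN.
exact: lint_acdM (acd_exp (acd_prim iL)) (lintZ 2 iL).
Qed.

Lemma weight_ge N s : ndec N -> 0 <= s -> 2 * rate N s <= weight N s.
Proof.
move=> nN s0; have W1 : 1 <= expR (prim (rate N) s).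
  by rewrite -expR0 ler_expR; apply: prim_ge0 => r r0; exact: rate_ge0.
exact: ler_peMl (mulr_ge0 (ler0n _ 2) (rate_ge0 N s0)) W1.
Qed.

Lemma weight_ge0 N s : ndec N -> 0 <= s -> 0 <= weight N s.
Proof. by move=> nN s0; apply: le_trans (weight_ge nN s0); rewrite mulr_ge0// rate_ge0. Qed.

Lemma weighted_bwd p q (Z H : R -> 'M[R]_(p, q)) N (D : set R) (t d : R) : ndec N -> measurable D ->
  acdx Z H -> 0 <= t -> Z t = 0 ->
  (forall s, 0 <= s <= t -> `|H s| <= `|Z s| * rate N s + 2 * rate N s * \1_D s) ->
  prim (fun s => weight N s * \1_D s) t <= d -> forall s, 0 <= s <= t -> `|Z s| <= d.
Proof.
move=> nN mD ZH t0 Zt hH hd s st; have /andP[s0 st'] := st.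
have iL := lint_rate nN; have L0 := rate_ge0 N.
have im := lint_indic (lintZ 2 iL) mD.
have h := acdx_bwd ZH iL L0 im hH st.
have e : (fun s => expR (prim (rate N) s) * (2 * rate N s * \1_D s)) = (fun s => weight N s * \1_D s).
  by apply/funext => r; rewrite /weight mulrA.
rewrite e in h.
have W1 : 1 <= expR (prim (rate N) s) by rewrite -expR0 ler_expR; apply: prim_ge0.
have w0 : 0 <= prim (fun s => weight N s * \1_D s) s.
  by apply: prim_ge0 => r r0; apply: mulr_ge0 => //; exact: weight_ge0.
have z0 : `|Z t| = 0 by rewrite Zt normr0.
have aux (a e1 f z p' q' : R) : z = 0 -> 1 <= e1 -> 0 <= a -> 0 <= q' -> p' <= d -> e1 * a <= f * z + (p' - q') -> a <= d.
  move=> -> h1 a0 q0 pd; rewrite mulr0 add0r lerBrDr => hh.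
  by apply: le_trans (ler_peMl a0 h1) (le_trans (le_trans _ hh) pd); rewrite lerDl.
exact: aux z0 W1 (normr_ge0 _) w0 hd h.
Qed.

(* Solving backwards from a point of a trajectory of [u], the solution of the
   system for [u0] could leave every bounded set; truncating the vector field
   around the trajectory keeps the estimate independent of [t]. *)
Lemma tube N u0 u x (lam : R) psi (t d : R) : ndec N -> bctrl N u0 -> bctrl N u ->
  solx M u x -> (forall s, 0 <= s -> `|x s| + 1 <= (N s)%:R) ->
  solpsi M u x lam psi -> (forall s, 0 <= s -> `|psi s| <= (N s)%:R) -> 0 <= lam <= 1 ->
  0 <= t -> d <= 1 -> prim (fun s => weight N s * \1_(neq u u0) s) t <= d ->
  exists q p, [/\ solx M u0 q, solpsi M u0 q lam p, q t = x t, p t = psi t &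
    `|q 0 - x 0| <= d /\ `|p 0 - psi 0| <= d].
Proof.
move=> nN bu0 bu xs xN ps pN l01 t0 d1 hd.
have mD := measurable_neq bu bu0.
have il := ellb_lint M nN; have l0 := ellb_ge0 M N.
have tt : 0 <= t <= t by rewrite t0 lexx.
have z0t : 0 <= (0 : R) <= t by rewrite lexx.
have xN' (s : R) : 0 <= s -> `|x s| <= (N s)%:R.
  by move=> s0; apply: le_trans (xN s s0); rewrite lerDl.
have bx : bctrl N x by split=> // i; exact: acdx_measurable xs.
have xc (s : R) (z : X) : 0 <= s -> `|x s + clip 1 (z - x s)| <= (N s)%:R.
  move=> s0; apply: le_trans (ler_normD _ _) (le_trans _ (xN s s0)).
  by rewrite lerD2l; exact: clip_norm.
pose Fn s z := mF M s (x s + clip 1 (z - x s)) (u0 s).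
have mFn (Z : R -> X) : (forall i j, measurable_fun Time (fun t => Z t i j)) ->
    forall i j, measurable_fun Time (fun t => Fn t (Z t) i j).
  move=> mZ i j; rewrite ord1; apply: mF_comp => //.
  - exact: measurable_Time.
  - by move=> w /Time_ge0.
  - move=> l; rewrite (_ : (fun t => _) = (fun t => x t l 0 + Num.min 1 (Num.max (- 1) (Z t l 0 - x t l 0)))).
      apply: measurable_funD; first exact: acdx_measurable xs.
      apply: measurable_minr => //; apply: measurable_maxr => //.
      by apply: measurable_funB => //; exact: acdx_measurable xs.
    by apply/funext => r; rewrite !mxE.
  - exact: bu0.1.
have lipFn (s : R) z z' : 0 <= s -> `|Fn s z - Fn s z'| <= `|z - z'| * ellb M N s.
  move=> s0; apply: le_trans (mF_lip M s0 (xc s z s0) (xc s z' s0) (bu0.2 s s0)) _.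
  apply: ler_wpM2r; first exact: l0.
  have -> : x s + clip 1 (z - x s) - (x s + clip 1 (z' - x s)) = clip 1 (z - x s) - clip 1 (z' - x s).
    by rewrite opprD addrACA subrr add0r.
  by apply: le_trans (clip_lip _ _ ler01) _; rewrite opprB addrA subrK.
have Fn0 (s : R) : 0 <= s -> `|Fn s 0| <= ellb M N s.
  by move=> s0; apply: mF_bound => //; [exact: xc|exact: bu0.2].
have [qt [qts qtt]] := picard il l0 t0 (x t) mFn lipFn Fn0.
have Zt : qt t - x t = 0 by rewrite qtt subrr.
have hH (s : R) : 0 <= s <= t -> `|Fn s (qt s) - mF M s (x s) (u s)| <=
    `|qt s - x s| * rate N s + 2 * rate N s * \1_(neq u u0) s.
  move=> /andP[s0 st]; have := rate_ge N s0; have := rate_ge0 N s0; move=> r0 lr.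
  have [e|ne] := pselect (u s = u0 s).
    have -> : \1_(neq u u0) s = 0 :> R by rewrite indicE memNset// => -[].
    rewrite mulr0 addr0 /Fn e; apply: le_trans (mF_lip M s0 (xc s _ s0) (xN' s s0) (bu0.2 s s0)) _.
    rewrite addrAC subrr add0r; apply: ler_pM => //; [exact: l0|exact: clip_norm2].
  have -> : \1_(neq u u0) s = 1 :> R by rewrite indicE mem_set.
  rewrite mulr1; apply: ler_wpDl; first exact: mulr_ge0.
  apply: le_trans (ler_normB _ _) _; rewrite mulr2n mulrDl mul1r.
  have h1 := mF_bound M s0 (xc s (qt s) s0) (bu0.2 s s0); have h2 := mF_bound M s0 (xN' s s0) (bu.2 s s0).
  exact: lerD (le_trans h1 lr) (le_trans h2 lr).
have dq := weighted_bwd nN mD (acdxB qts xs) t0 Zt hH hd.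
have [q qs qtE] := solx_exists M (x t) nN bu0 t0.
have [n nn bq] := solx_bctrl qs.
(* As [d <= 1], the truncation is inactive along [qt] on [[0, t]], so the true solution through
   [x t] coincides with [qt] there. *)
have qE (s : R) : 0 <= s <= t -> q s = qt s.
  pose N2 s := (N s + n s)%N.
  have nN2 : ndec N2 by move=> r r' r0 rr; rewrite leq_add ?nN ?nn.
  have uN2 : bctrl N2 u0 by apply: bctrlW bu0 => r _; rewrite leq_addr.
  have qN2 : bctrl N2 q by apply: bctrlW bq => r _; rewrite leq_addl.
  have h (r : R) : 0 <= r <= t -> `|mF M r (q r) (u0 r) - Fn r (qt r)| <= `|q r - qt r| * ellb M N2 r.
    move=> /andP[r0 rt]; rewrite /Fn clip_id; last by apply: le_trans d1; apply: dq; rewrite r0.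
    have e : x r + (qt r - x r) = qt r by rewrite addrC subrK.
    have b2 : `|qt r| <= (N2 r)%:R.
      rewrite -e; apply: le_trans (ler_normD _ _) _.
      apply: le_trans (_ : (N r)%:R <= _); last by rewrite ler_nat leq_addr.
      apply: le_trans (xN r r0); rewrite lerD2l; apply: le_trans d1; apply: dq; rewrite r0.
      by [].
    by rewrite e; exact: mF_lip (qN2.2 r r0) b2 (uN2.2 r r0).
  by move=> st; apply: (acdx_uniq qs qts (ellb_lint M nN2) (ellb_ge0 M N2) h tt _ st); rewrite qtE qtt.
have qN (s : R) : 0 <= s <= t -> `|q s| <= (N s)%:R.
  move=> st; have /andP[s0 _] := st; rewrite (qE s st) -(subrK (x s) (qt s)).
  apply: le_trans (ler_normD _ _) (le_trans _ (xN s s0)).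
  by rewrite addrC lerD2l; apply: le_trans d1; exact: dq.
have [n2 [nn2 b1 b2]] := bctrlD nN nn bu0 bq.
have [p pps pt] := solpsi_exists M lam (psi t) nn2 b1 b2 t0.
exists q, p; split=> //.
(* State and adjoint errors are stacked into one row vector, so that a single Gronwall estimate in
   the max-norm bounds both by the same [d]. *)
have ZZ := acdx_row (acdx_tr (acdxB qs xs)) (acdxB pps ps).
have Z0 : row_mx (q t - x t)^T (p t - psi t) = 0.
  by rewrite qtE pt !subrr trmx0 row_mx0.
suff HH (s : R) : 0 <= s <= t ->
    `|row_mx (mF M s (q s) (u0 s) - mF M s (x s) (u s))^T (psidot M u0 q lam p s - psidot M u x lam psi s)| <=
    `|row_mx (q s - x s)^T (p s - psi s)| * rate N s + 2 * rate N s * \1_(neq u u0) s.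
  have h := weighted_bwd nN mD ZZ t0 Z0 HH hd z0t.
  have [h1 h2] := norm_row_ge (q 0 - x 0)^T (p 0 - psi 0).
  by rewrite norm_tr in h1; split; [exact: le_trans h1 h|exact: le_trans h2 h].
move=> st; have /andP[s0 st'] := st.
have [g1 g2] := norm_row_ge (q s - x s)^T (p s - psi s); rewrite norm_tr in g1.
move: g1 g2; set Z := `|row_mx _ _| => g1 g2.
have Zp : 0 <= Z by exact: normr_ge0.
have lr := rate_ge N s0; have r0 := rate_ge0 N s0; have l0s := l0 s s0.
have /andP[lam0 lam1] := l01.
have [e|ne] := pselect (u s = u0 s).
  have -> : \1_(neq u u0) s = 0 :> R by rewrite indicE memNset// => -[].
  rewrite mulr0 addr0; apply: norm_row_le.
    rewrite norm_tr e; apply: le_trans (mF_lip M s0 (qN s st) (xN' s s0) (bu0.2 s s0)) _.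
    by apply: ler_pM => //; exact: l0.
  have -> : psidot M u x lam psi s = psidot M u0 x lam psi s by rewrite /psidot e.
  apply: le_trans (psidot_diff M lam lam _ (bu0.2 s s0) (qN s st) (xN' s s0) s0 (pN s s0)) _.
  rewrite subrr normr0 addr0 (ger0_norm lam0) /rate -/(ellb M N s).
  move: g1 g2 Zp lam0 lam1 l0s (normr_ge0 (p s - psi s)) (normr_ge0 (q s - x s)) (ler0n R m) (ler0n R (N s)).
  move: (ellb M N s) (m%:R : R) ((N s)%:R : R) `|p s - psi s| `|q s - x s| => L mm NN a c.
  move=> cZ aZ Z0' la0 la1 L0 a0 c0 m0 n0.
  have h1 : a * (mm * L) <= Z * (mm * L) by rewrite ler_wpM2r// mulr_ge0.
  have h2 : (mm * NN + lam) * c * L <= (mm * NN + 1) * Z * L.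
    rewrite ler_wpM2r// ler_pM// ?addr_ge0 ?mulr_ge0//; by rewrite lerD2l.
  apply: le_trans (lerD h1 h2) _; rewrite le_eqVlt; apply/orP; left; apply/eqP; ring.
have -> : \1_(neq u u0) s = 1 :> R by rewrite indicE mem_set.
rewrite mulr1; apply: norm_row_le.
  rewrite norm_tr; apply: ler_wpDl; first exact: mulr_ge0.
  apply: le_trans (ler_normB _ _) _; rewrite mulr2n mulrDl mul1r.
  have h1 := mF_bound M s0 (qN s st) (bu0.2 s s0); have h2 := mF_bound M s0 (xN' s s0) (bu.2 s s0).
  exact: lerD (le_trans h1 lr) (le_trans h2 lr).
apply: le_trans (ler_normB _ _) _.
have h1 := psidot_bound M lam p (bu0.2 s s0) (qN s st) s0.
have h2 := psidot_bound M lam psi (bu.2 s s0) (xN' s s0) s0.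
apply: le_trans (lerD h1 h2) _; rewrite (ger0_norm lam0) /rate -/(ellb M N s).
have g3 : `|p s| <= Z + (N s)%:R.
  by rewrite -(subrK (psi s) (p s)) (le_trans (ler_normD _ _))// lerD// pN.
move: g3 (pN s s0) Zp lam0 lam1 l0s (ler0n R m) (ler0n R (N s)) (normr_ge0 (p s)) (normr_ge0 (psi s)).
move: (ellb M N s) (m%:R : R) ((N s)%:R : R) `|p s| `|psi s| => L mm NN a c.
move=> aZ cN Z0' la0 la1 L0 m0 n0 a0 c0.
have mL : 0 <= mm * L by rewrite mulr_ge0.
have k1 := ler_wpM2r mL aZ; have k2 := ler_wpM2r mL cN; have k3 := ler_wpM2r L0 la1.
have k4 := mulr_ge0 Z0' L0; have k5 := mulr_ge0 Z0' (mulr_ge0 m0 (mulr_ge0 n0 L0)).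
move: k1 k2 k3 k4 k5 mL L0; clear.
move: (Z) => Z'; lra.
Qed.

End Tube.

(** * Almost maximization and pieces of equal mass *)

Section Tools.
Context {R : realType}.
Local Notation mu := (@lebesgue_measure R).

(** If the point found near the supremum lies below [Phi a0], then [a0] is itself an almost
    maximizer; thus the comparison with [a0] holds without error. *)
Lemma near_max (T : Type) (A : set T) (Phi : T -> R) a0 B eta : A a0 -> (forall a, A a -> Phi a <= B) ->
  0 < eta -> exists a, [/\ A a, Phi a0 <= Phi a & forall v, A v -> Phi v <= Phi a + eta].
Proof.
move=> Aa0 AB e0; have hs : has_sup (Phi @` A).
  by split; [exists (Phi a0); exists a0|exists B => _ [a Aa <-]; exact: AB].
have [_ [a Aa <-] h] := sup_adherent e0 hs.
have ub v : A v -> Phi v <= sup (Phi @` A) by move=> Av; apply: ub_le_sup; [case: hs|exists v].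
have [h1|h1] := leP (Phi a0) (Phi a).
  by exists a; split => // v Av; rewrite (le_trans (ub v Av))// -lerBlDr ltW.
exists a0; split => // v Av; rewrite (le_trans (ub v Av))// -lerBlDr.
by rewrite (le_trans (ltW h))// ltW.
Qed.

Lemma mem_iff (A B : set R) s : (A s <-> B s) -> (s \in A) = (s \in B).
Proof. by move=> H; apply/idP/idP; rewrite !inE => /H. Qed.

Lemma prim_support (h : R -> R) (E : set R) (a c : R) : lint (fun s => h s * \1_E s) ->
  0 <= a -> a <= c -> (forall s, E s -> s <= a) ->
  prim (fun s => h s * \1_E s) c = prim (fun s => h s * \1_E s) a.
Proof.
move=> ih a0 ac Ea; apply/eqP; rewrite -subr_eq0 prim_incr//; apply/eqP.
rewrite (@eq_Rintegral _ _ _ mu _ (fun=> 0)) ?Rintegral_cst ?mul0r//.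
move=> s; rewrite inE /= in_itv/= => /andP[as_ _].
rewrite indicE memNset ?mulr0// => Es; have := Ea s Es.
by rewrite leNgt as_.
Qed.

Lemma prim_before (h : R -> R) (E : set R) (c t : R) : 0 <= c <= t -> lint h -> measurable E ->
  prim (fun s => h s * \1_(E `&` [set r | r <= c]) s) t = prim (fun s => h s * \1_E s) c.
Proof.
move=> /andP[c0 ct] ih mE.
have mc : measurable [set r : R | r <= c].
  by rewrite (_ : mkset _ = `]-oo, c]%classic)//; apply/seteqP; split=> r; rewrite /= in_itv.
have iE := lint_indic ih (measurableI _ _ mE mc).
rewrite (prim_support iE c0 ct); last by move=> s [].
apply: eq_prim => s /andP[_ sc]; rewrite !indicE; congr (_ * (_ : bool)%:R).
by apply: mem_iff; split=> [[]|].
Qed.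

(** The mass of [E] up to time [c] is continuous in [c], so some [c] cuts it in half. *)
Lemma lint_halve (l : R -> R) (E : set R) (T : R) : lint l -> (forall s, 0 <= s -> 0 <= l s) -> 0 <= T ->
  measurable E -> exists E1 E2, [/\ measurable E1, measurable E2, E1 `<=` E, E2 `<=` E &
    [/\ (forall s, \1_E s = \1_E1 s + \1_E2 s :> R),
     prim (fun s => l s * \1_E1 s) T = prim (fun s => l s * \1_E s) T / 2 &
     prim (fun s => l s * \1_E2 s) T = prim (fun s => l s * \1_E s) T / 2]].
Proof.
move=> il l0 T0 mE; have iE := lint_indic il mE.
set r := prim (fun s => l s * \1_E s).
have r0 : r 0 = 0 by exact: prim0.
have rT : 0 <= r T by apply: prim_ge0 => s s0; rewrite mulr_ge0// l0.
have cr : {within `[0, T], continuous r}.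
  apply: (@continuous_subspaceW _ _ _ (@Time R)); first exact: itv_Time.
  exact: ac_continuous (acd_ac (acd_prim iE)).
have mid : Num.min (r 0) (r T) <= r T / 2 <= Num.max (r 0) (r T).
  rewrite r0 min_l// max_r// divr_ge0//= ler_pdivrMr// ler_peMr//.
  by rewrite ler1n.
have [c c0T rc] := IVT T0 cr mid.
have {}c0T : 0 <= c <= T by move: c0T; rewrite in_itv.
pose B := [set s : R | s <= c].
have mB : measurable B.
  by rewrite (_ : B = `]-oo, c]%classic)//; apply/seteqP; split=> s; rewrite /B /= in_itv.
have mE1 := measurableI _ _ mE mB; have mE2 := measurableD mE mB.
have ind s : \1_E s = \1_(E `&` B) s + \1_(E `\` B) s :> R.
  rewrite !indicE; have [Bs|Bs] := pselect (B s).
    rewrite (memNset (A := E `\` B)); last by move=> [].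
    by rewrite addr0; congr (_ : bool)%:R; apply: mem_iff; split=> [|[]].
  rewrite (memNset (A := E `&` B)); last by move=> [].
  by rewrite add0r; congr (_ : bool)%:R; apply: mem_iff; split=> [|[]].
have e1 : prim (fun s => l s * \1_(E `&` B) s) T = r T / 2 by rewrite prim_before// -rc.
have e2 : r T = prim (fun s => l s * \1_(E `&` B) s) T + prim (fun s => l s * \1_(E `\` B) s) T.
  rewrite -primD; [|exact: lint_indic|exact: lint_indic].
  by apply: eq_prim => s _; rewrite ind mulrDr.
exists (E `&` B), (E `\` B); split=> //; split=> //.
have aux (a b' c' : R) : a = b' + c' -> b' = a / 2 -> c' = a / 2 by move=> h1 h2; lra.
exact: aux e2 e1.
Qed.

(* Splitting [E] into [2 ^ n] pieces of equal [l]-mass makes the quadratic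
   remainder negligible. *)
Lemma halving (h l : R -> R) (D : set R) (T C eta : R) : lint h -> lint l -> (forall s, 0 <= s -> 0 <= l s) ->
  0 <= T ->
  (forall E, measurable E -> E `<=` D ->
    prim (fun s => h s * \1_E s) T <= C * prim (fun s => l s * \1_E s) T ^+ 2 + eta) ->
  forall n E, measurable E -> E `<=` D ->
    prim (fun s => h s * \1_E s) T <= C * prim (fun s => l s * \1_E s) T ^+ 2 / 2 ^+ n + 2 ^+ n * eta.
Proof.
move=> ih il l0 T0 H; elim => [E mE ED|n IH E mE ED]; first by rewrite expr0 divr1 mul1r; exact: H.
have [E1 [E2 [m1 m2 s1 s2 [ind e1 e2]]]] := lint_halve il l0 T0 mE.
have h1 := IH E1 m1 (subset_trans s1 ED); have h2 := IH E2 m2 (subset_trans s2 ED).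
have e : prim (fun s => h s * \1_E s) T = prim (fun s => h s * \1_E1 s) T + prim (fun s => h s * \1_E2 s) T.
  rewrite -primD; [|exact: lint_indic|exact: lint_indic].
  by apply: eq_prim => s _; rewrite ind mulrDr.
rewrite e; apply: le_trans (lerD h1 h2) _; rewrite e1 e2.
move: (prim _ T) => r; rewrite (exprS 2 n).
have : (2 : R) ^+ n != 0 by rewrite expf_neq0// pnatr_eq0.
move: ((2 : R) ^+ n) => p p0.
by rewrite le_eqVlt; apply/orP; left; apply/eqP; field.
Qed.

Lemma limn_esup_lt (g : nat -> \bar R) (e : R) : 0 < e -> limn_esup g = 0%E ->
  exists N, forall n, (N <= n)%N -> (g n < e%:E)%E.
Proof.
move=> e0 h; have : (limn_esup g < e%:E)%E by rewrite h lte_fin.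
move=> /ereal_inf_lt[_ [V [N _ HN] <-] hV]; exists N => n Nn.
by apply: le_lt_trans hV; apply: ereal_sup_ubound; exists n => //; exact: HN.
Qed.

Lemma enormZ p q (c : R) (A : 'M[R]_(p, q)) : enorm (c *: A) = `|c| * enorm A.
Proof.
rewrite /enorm -sqrtr_sqr -sqrtrM ?sqr_ge0//; congr Num.sqrt.
rewrite mulr_sumr; apply: eq_bigr => i _; rewrite mulr_sumr; apply: eq_bigr => j _.
by rewrite mxE exprMn.
Qed.

End Tools.

(** * Construction of the almost optimal control *)

Section NearOptimal.
Context {R : realType} {m k : nat} {P : control_problem R m k} (M : model P).
Local Notation Xr := 'rV[R]_m.
Local Notation UU := 'cV[R]_k.

Lemma admissible_intro b u : ndec b -> bctrl b u -> (forall t, Time t -> cset P t (u t)) -> admissible P u.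
Proof.
move=> nb [mu_ ub] uU; split=> //; first exact: entry_borel_fun (@measurable_Time R) mu_.
move=> K cK KT; have [M0 [_ hM]] := compact_bounded cK.
pose T := `|M0| + 1.
have KM t : K t -> 0 <= t <= T.
  move=> Kt; have := KT _ Kt; rewrite /Time /= in_itv/= andbT => ->/=.
  apply: le_trans (ler_norm t) _; apply: (hM T) => //.
  by rewrite (le_lt_trans (ler_norm M0))// ltrDl.
exists (b T)%:R; split=> [|r br _ [t Kt <-]]; first exact: num_real.
have /andP[t0 tT] := KM t Kt.
rewrite /=; apply: le_trans (ub t t0) (le_trans _ (ltW br)).
by rewrite ler_nat; exact: nb.
Qed.

Lemma traj_solx b u : ndec b -> bctrl b u -> solx M u (traj P u) /\ traj P u 0 = xinit P.
Proof. by move=> nb bu; exact: (trajP M nb bu). Qed.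

Lemma payoff_prim u T : payoff P u T = prim (fun t => mG M t (traj P u t) (u t)) T.
Proof. exact: payoffP. Qed.

Lemma pow2_large (a c : R) : 0 <= a -> 0 < c -> exists n : nat, a / 2 ^+ n <= c.
Proof.
move=> a0 c0; exists (Num.truncn (a / c)).+1.
rewrite ler_pdivrMr ?exprn_gt0// mulrC -ler_pdivrMr//.
apply: le_trans (ltW (truncnS_gt _)) _; rewrite -natrX ler_nat; exact/ltnW/ltn_expl.
Qed.

Lemma near_optimal (tau : nat -> R) u0 b0 n : increasing_to_infinity tau -> tau_optimal P tau u0 ->
  ndec b0 -> bctrl b0 u0 ->
  exists (u : R -> UU) (i : nat) (lam : R) (psi : R -> Xr),
  [/\ (n <= i)%N /\ n%:R <= tau i,
    [/\ extremal_system P (traj P u) u lam psi, psi (tau i) = 0 & solpsi M u (traj P u) lam psi],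
    0 <= payoff P u (tau i) - payoff P u0 (tau i) <= n.+1%:R^-1,
    forall t, 0 <= t -> prim (fun s => ell M n s * \1_(neq u u0) s) t <= n.+1%:R^-1 &
    (forall t, 0 <= t -> exists q p, [/\ solx M u0 q, solpsi M u0 q lam p, q t = traj P u t, p t = psi t &
      `|q 0 - xinit P| <= n.+1%:R^-1 /\ `|p 0 - psi 0| <= n.+1%:R^-1]) /\
    forall v (E : set R), admissible P v -> bctrl (fun s => b0 s + n)%N v -> measurable E ->
      (forall s, E s -> 0 <= s <= n%:R) ->
      prim (fun s => (mH M s (traj P u s) (v s) lam (psi s) -
          mH M s (traj P u s) (u s) lam (psi s)) * \1_E s) (tau i) <= 2 * n.+1%:R^-1].
Proof.
move=> [tau0 _ tauoo] [au0 esup0] nb0 bu0.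
set nu : R := n.+1%:R^-1.
have nu0 : 0 < nu by rewrite invr_gt0.
have nu1 : nu <= 1 by rewrite invf_le1// ler1n.
have [b hb] : exists b, b = fun s => (b0 s + n)%N by eexists.
have nb : ndec b by move=> s t s0 st; rewrite hb leq_add2r nb0.
have bu0b : bctrl b u0 by apply: bctrlW bu0 => t _; rewrite hb leq_addr.
rewrite -hb.
(* [c1] bounds every trajectory of a control below [b]; the successor in [N0] leaves the margin 1
   that [tube] asks for; [N] also bounds every adjoint with [psi 0] and [lam] at most 1 in norm. *)
have [c1 [nc1 bc1 H1]] := solx_unif_bound M `|xinit P| nb.
pose N0 t := (c1 t).+1.
have nN0 : ndec N0 by move=> s t s0 st; rewrite ltnS nc1.
have [N [nN N0N H2]] := solpsi_unif_bound M nN0 (@ler01 R).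
have bN t : 0 <= t -> (b t <= N t)%N by move=> t0; apply: leq_trans (N0N t t0); rewrite ltnW// ltnS bc1.
pose w := weight M N.
have iw : lint w by exact: lint_weight.
have w0 (s : R) : 0 <= s -> 0 <= w s by exact: weight_ge0.
have il := ellb_lint M nN; have l0 := ellb_ge0 M N.
have lw (s : R) : 0 <= s -> ellb M N s <= w s.
  move=> s0; apply: le_trans (weight_ge M nN s0); apply: le_trans (rate_ge M N s0) _.
  by rewrite ler_peMl ?rate_ge0// ler1n.
have elw (s : R) : 0 <= s -> ell M n s <= w s.
  move=> s0; apply: le_trans (lw s s0); apply: ell_mono => //.
  by apply: leq_trans (bN s s0); rewrite hb leq_addl.
pose Pw := prim w n%:R.
have Pw0 : 0 <= Pw by exact: prim_ge0.
(* Chosen so that [d <= nu] and [d * Pw <= nu]; the second bound limits the additional penalty of a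
   variation inside [[0, n]]. *)
pose d := nu / (1 + Pw).
have Pw1 : 0 < 1 + Pw by rewrite ltr_wpDr.
have d0 : 0 < d by rewrite divr_gt0.
have dnu : d <= nu by rewrite ler_pdivrMr// ler_peMr ?(ltW nu0)// lerDl.
have dPw : d * Pw <= nu.
  by rewrite /d mulrAC ler_pdivrMr// ler_wpM2l ?(ltW nu0)// lerDr.
have dd0 : 0 < d * d by rewrite mulr_gt0.
have [N1 HN1] := limn_esup_lt dd0 esup0.
have [N2 HN2] : exists N2, forall i, (N2 <= i)%N -> n%:R <= tau i.
  by have /cvgryPge/(_ n%:R)[N2 _ HN2] := tauoo; exists N2 => i /HN2.
pose i := (N1 + N2 + n)%N; pose T := tau i.
have T0 : 0 <= T by exact: tau0.
have nT : n%:R <= T by apply: HN2; rewrite /i addnAC leq_addl.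
have gap v : admissible P v -> payoff P v T - payoff P u0 T <= d * d.
  move=> av; rewrite -lee_fin; apply: le_trans (ltW (HN1 i _)); last by rewrite /i -addnA leq_addr.
  by apply: ereal_sup_ubound; exists v.
have [C C0 Hneedle] := needle M nN T0.
set La := prim (ellb M N) T.
have La0 : 0 <= La by exact: prim_ge0.
have CL0 : 0 <= C * La ^+ 2 by rewrite mulr_ge0// exprn_ge0.
have nu20 : 0 < nu / 2 by rewrite divr_gt0.
(* [K] halvings bring the quadratic remainder below [nu / 2]. Each of the [2 ^+ K] pieces costs one
   maximization error [eta], and these add up to [nu / 2] as well. *)
have [K HK] := pow2_large CL0 nu20.
pose eta := nu / 2 / 2 ^+ K.
have eta0 : 0 < eta by rewrite divr_gt0// exprn_gt0.
(* Competitors agree with [u0] after [T], so the penalty [D], an integral up to [T], records the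
   difference at all times. *)
pose A : set (R -> UU) := [set v | [/\ admissible P v, bctrl b v & forall s, T < s -> v s = u0 s]].
have bx v : bctrl b v -> [/\ bctrl N v, solx M v (traj P v), traj P v 0 = xinit P,
    bctrl N0 (traj P v) & forall s, 0 <= s -> `|traj P v s| + 1 <= (N s)%:R].
  move=> bv; have [xs x0] := traj_solx nb bv.
  have bc : bctrl c1 (traj P v) by apply: H1 bv xs _; rewrite x0.
  split=> //; [exact: bctrlW bv|by apply: bctrlW bc => t _; rewrite /N0|].
  move=> s s0; apply: le_trans (_ : (N0 s)%:R <= _); last by rewrite ler_nat N0N.
  by rewrite /N0 -natr1 lerD2r; exact: bc.2.
have uU v : admissible P v -> forall t, Time t -> cset P t (v t) by case.
pose D v := prim (fun s => w s * \1_(neq v u0) s) T.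
pose J v := payoff P v T.
have iwn v : bctrl b v -> lint (fun s => w s * \1_(neq v u0) s).
  by move=> bv; apply: lint_indic iw (measurable_neq bv bu0b).
have D0 : D u0 = 0.
  rewrite /D (@eq_prim _ _ (cst 0)) ?prim_cst ?mul0r// => s _.
  by rewrite indicE memNset ?mulr0// => -[].
have A0 : A u0 by [].
have JB v : A v -> J v - d * D v <= La.
  move=> [av bv _]; have [bvN xs _ bxv _] := bx v bv.
  have bxN : bctrl N (traj P v) by apply: bctrlW bxv.
  have h1 : J v <= La.
    rewrite /J payoff_prim; apply: prim_le => //; first exact: lint_mG bvN bxN.
    move=> r /andP[r0 _]; apply: le_trans (ler_norm _) _.
    exact: mG_bound (bxN.2 r r0) (bvN.2 r r0).
  apply: le_trans h1; rewrite gerBl mulr_ge0 ?(ltW d0)//.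
  by apply: prim_ge0 => s s0; rewrite mulr_ge0// w0.
(* The penalty [d * D] keeps the almost maximizer [u] close to [u0]. *)
have [u [[au bu uT] Ju Jmax]] := near_max A0 JB eta0.
have [buN xs x0 bxN0 xN] := bx u bu.
have bxN : bctrl N (traj P u) by apply: bctrlW bxN0.
have mneq := measurable_neq bu bu0b.
have wn0 (s : R) : 0 <= s -> 0 <= w s * \1_(neq u u0) s by move=> s0; rewrite mulr_ge0// w0.
have Du0 : 0 <= D u by exact: prim_ge0.
have gu := gap u au.
(* Comparison with [u0], whose penalty is 0, bounds the penalty of [u] by its payoff gap, which is
   at most [d * d]. *)
have dD : d * D u <= J u - J u0.
  by move: Ju; rewrite D0 mulr0 subr0 -/(J u) => Ju; rewrite lerBrDr addrC -lerBrDr.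
have Dd : D u <= d.
  by rewrite -(ler_pM2l d0) (le_trans dD).
have Dt t : 0 <= t -> prim (fun s => w s * \1_(neq u u0) s) t <= d.
  move=> t0; apply: le_trans Dd; have [tT|Tt] := leP t T.
    exact: prim_homo (iwn u bu) wn0 t0 tT.
  rewrite (prim_support (iwn u bu) T0 (ltW Tt))//.
  by move=> s [_ us]; have [//|Ts] := leP s T; have := us (uT s Ts).
have [psi1 ps1 psT] := solpsi_exists M 1 0 nN buN bxN T0.
(* Rescaling the adjoint for multiplier 1 in this way gives [enorm (psi 0) + lam = 1] and keeps
   [lam] positive. *)
pose lam : R := (1 + enorm (psi1 0))^-1.
have e1 : 0 < 1 + enorm (psi1 0) by rewrite ltr_wpDr// enorm_ge0.
have lam0 : 0 < lam by rewrite invr_gt0.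
have lam1 : lam <= 1 by rewrite invf_le1// lerDl enorm_ge0.
pose psi t := lam *: psi1 t.
have ps : solpsi M u (traj P u) lam psi by have := solpsiZ lam ps1; rewrite mulr1.
have norm1 : enorm (psi 0) + lam = 1.
  rewrite /psi enormZ ger0_norm ?(ltW lam0)// -{2}(mulr1 lam) -mulrDr addrC.
  by rewrite mulVf// gt_eqF.
have psi01 : `|psi 0| <= 1.
  by rewrite (le_trans (norm_le_enorm _))// -norm1 lerDl ltW.
have psiN t : 0 <= t -> `|psi t| <= (N t)%:R.
  apply: (H2 _ _ _ _ _ bxN0 ps) => //; last by rewrite ger0_norm// ltW.
  by apply: bctrlW bu => t' t'0; rewrite /N0 ltnW// ltnS bc1.
exists u, i, lam, psi; split.
- by split=> //; rewrite /i leq_addl.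
- split=> //; last by rewrite /psi psT scaler0.
  split=> //; [by rewrite (ltW lam0)|split=> //|].
    exact: (solx_ode M nN buN _).1.
  exact: (solpsi_adjoint M nN buN bxN _ _).1.
- apply/andP; split; first by apply: le_trans dD; rewrite mulr_ge0// ltW.
  apply: le_trans gu (le_trans _ dnu); rewrite ler_piMl// ?(ltW d0)//.
  exact: le_trans dnu nu1.
- move=> t t0; apply: le_trans dnu; apply: le_trans (Dt t t0).
  apply: prim_le => //; [exact: lint_indic (ell_lint M n) mneq|exact: iwn|].
  by move=> r /andP[r0 _]; apply: ler_wpM2r => //; exact: elw.
split.
  move=> t t0; have l01 : 0 <= lam <= 1 by rewrite (ltW lam0).
  have [q [p [h1 h2 h3 h4 [h5 h6]]]] := tube nN (bctrlW bN bu0b) buN xs xN ps psiN l01 t0 (le_trans dnu nu1) (Dt t t0).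
  exists q, p; split=> //; rewrite -x0; split; [exact: le_trans h5 dnu|exact: le_trans h6 dnu].
move=> v E av bv mE En.
have bvN : bctrl N v by exact: bctrlW bv.
pose h s := mH M s (traj P u s) (v s) 1 (psi1 s) - mH M s (traj P u s) (u s) 1 (psi1 s).
have ih : lint h.
  have aux (z : R -> UU) : bctrl N z -> lint (fun s => mH M s (traj P u s) (z s) 1 (psi1 s)).
    move=> bz; rewrite /mH; apply: lintD; last exact: lintZ (lint_mG M nN bz bxN).
    rewrite (_ : (fun s => _) = (fun s => \sum_l psi1 s 0 l * mF M s (traj P u s) (z s) l 0)).
      by apply: lint_sum => l; apply: lint_acdM (ps1 0 l) (lint_mF M nN bz bxN l).
    by apply/funext => s; rewrite mxE.
  by apply: lintB; exact: aux.
(* The variation of [u] on [E'] is a competitor: [needle] bounds its gain from below, almost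
   maximality bounds it from above, and its penalty exceeds that of [u] by at most the weight of
   [E']. *)
have step (E' : set R) : measurable E' -> E' `<=` [set s : R | 0 <= s <= n%:R] ->
    prim (fun s => (h s - d * w s) * \1_E' s) T <= C * prim (fun s => ellb M N s * \1_E' s) T ^+ 2 + eta.
  move=> mE' En'.
  pose y := splice E' v u.
  have by_ : bctrl b y by exact: bctrl_splice.
  have ay : admissible P y.
    apply: (admissible_intro nb by_) => t tT; rewrite /y /splice; case: asboolP => _; exact: uU.
  have Ay : A y.
    split=> // s Ts; rewrite /y splice_out; first exact: uT.
    by move=> /En'/andP[_ sn]; have := le_lt_trans (le_trans sn nT) Ts; rewrite ltxx.
  have [byN xsy y0 bxy _] := bx y by_.
  have bxyN : bctrl N (traj P y) by apply: bctrlW bxy.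
  have hn := Hneedle _ _ _ _ _ _ buN bvN bxN bxyN mE' xs xsy (etrans x0 (esym y0)) ps1 psT.
  rewrite -!payoff_prim -/(J y) -/(J u) in hn.
  have hmax := Jmax y Ay.
  have Dy : D y <= D u + prim (fun s => w s * \1_E' s) T.
    rewrite /D -primD; [|exact: iwn|exact: lint_indic].
    apply: prim_le => //; [exact: iwn|by apply: lintD; [exact: iwn|exact: lint_indic]|].
    move=> s /andP[s0 _]; rewrite -mulrDr ler_wpM2l ?w0//.
    have [Es|Es] := pselect (E' s).
      have -> : \1_E' s = 1 :> R by rewrite indicE mem_set.
      by rewrite ler_wpDl// indicE lern1 leq_b1.
    have -> : \1_E' s = 0 :> R by rewrite indicE memNset.
    rewrite addr0 !indicE (@mem_iff _ (neq y u0) (neq u u0))//.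
    by rewrite /neq /= /y splice_out.
  have -> : prim (fun s => (h s - d * w s) * \1_E' s) T =
      prim (fun s => h s * \1_E' s) T - d * prim (fun s => w s * \1_E' s) T.
    have iwE := lint_indic iw mE'.
    rewrite -(primZ d T iwE) -primB; [|exact: lint_indic|exact: lintZ].
    by apply: eq_prim => s _; rewrite mulrBl mulrA.
  move: hn hmax Dy; rewrite -/(h _).
  move: (prim (fun s => h s * \1_E' s) T) (prim (fun s => w s * \1_E' s) T) => a c.
  move: (prim (fun s => ellb M N s * \1_E' s) T) => rho hn hmax Dy.
  have := ler_wpM2l (ltW d0) Dy; move: hn hmax; clear -R.
  move: (J y) (J u) (D y) (D u) d eta => *.
  lra.
have iho : lint (fun s => h s - d * w s) by apply: lintB => //; exact: lintZ.
have En' : E `<=` [set s : R | 0 <= s <= n%:R] by move=> s /En.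
have final := halving iho il l0 T0 step K mE En'.
have iwE := lint_indic iw mE; have ihE := lint_indic ih mE; have ilE := lint_indic il mE.
have split_h : prim (fun s => (h s - d * w s) * \1_E s) T =
    prim (fun s => h s * \1_E s) T - d * prim (fun s => w s * \1_E s) T.
  rewrite -(primZ d T iwE) -primB; [|exact: ihE|exact: lintZ].
  by apply: eq_prim => s _; rewrite mulrBl mulrA.
have ind1 (s : R) : \1_E s <= 1 :> R by rewrite indicE lern1 leq_b1.
have rhoLa : prim (fun s => ellb M N s * \1_E s) T <= La.
  apply: prim_le => // r /andP[r0 _]; by rewrite ler_piMr// l0.
have rho0 : 0 <= prim (fun s => ellb M N s * \1_E s) T.
  by apply: prim_ge0 => r r0; rewrite mulr_ge0// l0.
have wE : prim (fun s => w s * \1_E s) T <= Pw.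
  rewrite (prim_support iwE (ler0n R n) nT); last by move=> s /En/andP[].
  by apply: prim_le => // r /andP[r0 _]; rewrite ler_piMr// w0.
have goalE : prim (fun s => (mH M s (traj P u s) (v s) lam (psi s) -
      mH M s (traj P u s) (u s) lam (psi s)) * \1_E s) (tau i) = lam * prim (fun s => h s * \1_E s) T.
  rewrite -(primZ lam T ihE); apply: eq_prim => s _; rewrite mulrA; congr (_ * _).
  have mHZ (z : UU) : mH M s (traj P u s) z lam (psi s) = lam * mH M s (traj P u s) z 1 (psi1 s).
    by rewrite /mH /psi -scalemxAl mxE mulrDr mulrA mulr1.
  by rewrite !mHZ -mulrBr.
have sq : C * prim (fun s => ellb M N s * \1_E s) T ^+ 2 / 2 ^+ K <= nu / 2.
  apply: le_trans HK; rewrite ler_wpM2r ?invr_ge0 ?exprn_ge0//.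
  by rewrite ler_wpM2l// lerXn2r// nnegrE.
have etaE : 2 ^+ K * eta = nu / 2 by rewrite /eta mulrC divfK// gt_eqF// exprn_gt0.
have dwE := le_trans (ler_wpM2l (ltW d0) wE) dPw.
rewrite goalE; move: final; rewrite split_h etaE => final.
have le2 : prim (fun s => h s * \1_E s) T <= 2 * nu.
  move: final sq dwE; move: (C * _ / _) (prim _ T) (d * _) => a c e.
  clear -R; move: nu => nu0 *; lra.
have aux (l a c : R) : 0 <= l -> l <= 1 -> a <= c -> 0 <= c -> l * a <= c.
  move=> l0' l1 ac c0; apply: le_trans (ler_wpM2l l0' ac) _; exact: ler_piMl.
by apply: aux => //; [exact: ltW|rewrite mulr_ge0// ltW].
Qed.

End NearOptimal.

(** * The maximum condition *)

Section OpenSigmaAlgebra.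
Context {R : realType} {k : nat}.
Local Notation V := (R^o * 'cV[R]_k)%type.
Local Notation TV := (g_sigma_algebraType (@open V)).

Lemma open_sigma (A : set V) : open A -> measurable (A : set TV).
Proof. by move=> oA; exact: sub_sigma_algebra. Qed.

Lemma closed_sigma (A : set V) : closed A -> measurable (A : set TV).
Proof.
move=> cA; rewrite -[A]setCK; apply: measurableC; apply: open_sigma.
exact: closed_openC.
Qed.

Lemma continuous_measurable (c : V -> R) : continuous c -> measurable_fun setT (c : TV -> R).
Proof.
move=> cc; apply: (measurability (@RGenOInfty.G R)); first exact: RGenOInfty.measurableE.
move=> _ [_ [a ->] <-]; rewrite setTI; apply: open_sigma.
by apply: open_comp => //; exact: open_gt.
Qed.

End OpenSigmaAlgebra.

Section MaximumCondition.
Context {R : realType} {m k : nat} {P : control_problem R m k} (M : model P).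
Local Notation mu := (@lebesgue_measure R).
Local Notation X := 'cV[R]_m.
Local Notation Xr := 'rV[R]_m.
Local Notation UU := 'cV[R]_k.

Lemma mH_comp d (T : measurableType d) (D : set T) (h : T -> R) (x : T -> X) (u : T -> UU) (lam : R) (psi : T -> Xr) :
  measurable D -> measurable_fun D h -> (forall w, D w -> 0 <= h w) ->
  (forall i, measurable_fun D (fun w => x w i 0)) -> (forall i, measurable_fun D (fun w => u w i 0)) ->
  (forall i, measurable_fun D (fun w => psi w 0 i)) ->
  measurable_fun D (fun w => mH M (h w) (x w) (u w) lam (psi w)).
Proof.
move=> mD mh h0 mx mu_ mp; rewrite (_ : (fun w => _) = (fun w =>
   \sum_l psi w 0 l * mF M (h w) (x w) (u w) l 0 + lam * mG M (h w) (x w) (u w))).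
  apply: measurable_funD.
    by apply: measurable_sum => l; apply: measurable_funM => //; exact: mF_comp.
  by apply: measurable_funM => //; exact: mG_comp.
by apply/funext => w; rewrite /mH mxE.
Qed.

Lemma model_hamiltonian : {ae mu, forall t, Time t -> forall x u lam psi,
  hamiltonian P x t u lam psi = mH M t x u lam psi}.
Proof.
apply: (aeS (model_ae M)) => t H /H[e1 e2 _ _ _] x u lam psi.
by rewrite /hamiltonian /mH e1 e2.
Qed.

(** A failure at time [t] is witnessed in one of countably many sets [B i n], where a control value
    of norm at most [n] gains at least [i.+1%:R^-1] over [u0]. If one of them had a non-negligible
    projection, a selection from it, spliced into [u0], would violate the integrated inequality. *)
Lemma maximum_from_integral u0 b0 (x0 : R -> X) (lam : R) (psi : R -> Xr) : borel_graph P -> admissible P u0 -> ndec b0 -> bctrl b0 u0 ->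
  (forall i, measurable_fun Time (fun t => x0 t i 0)) -> (forall i, measurable_fun Time (fun t => psi t 0 i)) ->
  (forall n v, admissible P v -> bctrl (fun s => b0 s + n)%N v ->
     lint (fun s => mH M s (x0 s) (v s) lam (psi s) - mH M s (x0 s) (u0 s) lam (psi s))) ->
  (forall n v (E : set R), admissible P v -> bctrl (fun s => b0 s + n)%N v -> measurable E ->
     (forall s, E s -> 0 <= s <= n%:R) ->
     prim (fun s => (mH M s (x0 s) (v s) lam (psi s) - mH M s (x0 s) (u0 s) lam (psi s)) * \1_E s) n%:R <= 0) ->
  maximum_condition P x0 u0 lam psi.
Proof.
move=> hgr au nb bu mx mp iH H; have [_ _ uU] := au.
pose B (i n : nat) := [set z : R * UU | (Time z.1 /\ cset P z.1 z.2) /\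
  ((0 <= z.1 <= n%:R /\ `|z.2| <= n%:R) /\
   i.+1%:R^-1 <= mH M z.1 (x0 z.1) z.2 lam (psi z.1) - mH M z.1 (x0 z.1) (u0 z.1) lam (psi z.1))].
have bB i n : <<s @open (R * UU)%type >> (B i n).
  pose TY := g_sigma_algebraType (@open (R^o * UU)%type).
  have mfst : measurable_fun setT (fst : TY -> R).
    by apply: (@continuous_measurable R k fst) => z; exact: cvg_fst.
  have msnd l : measurable_fun setT (fun z : TY => (z : R * UU).2 l 0).
    apply: (@continuous_measurable R k (fun z => z.2 l 0)) => z.
    apply: (@cvg_comp _ _ _ snd (fun p : UU => p l 0) _ (nbhs z.2)); first exact: cvg_snd.
    exact: coord_continuous.
  pose D := [set z : TY | 0 <= (z : R * UU).1 <= n%:R].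
  have mD : measurable D.
    have := mfst measurableT `[0, n%:R]%classic (measurable_itv _); rewrite setTI.
    by rewrite (_ : _ @^-1` _ = D)//; apply/seteqP; split=> z; rewrite /D /preimage /= in_itv.
  have DT : fst @` D `<=` (@Time R).
    by move=> _ [z /andP[z0 _] <-]; apply/Time_ge0.
  have cmp (f : R -> R) : measurable_fun Time f -> measurable_fun D (fun z : TY => f (z : R * UU).1).
    move=> mf; apply: (measurable_comp (@measurable_Time R) DT mf).
    exact: measurable_funTS.
  have m1 : measurable_fun D (fun z : TY => mH M (z : R * UU).1 (x0 (z : R * UU).1) (z : R * UU).2 lam (psi (z : R * UU).1)
     - mH M (z : R * UU).1 (x0 (z : R * UU).1) (u0 (z : R * UU).1) lam (psi (z : R * UU).1)).
    apply: measurable_funB; apply: mH_comp => //.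
    - exact: measurable_funTS.
    - by move=> z /andP[].
    - by move=> l; exact: (cmp (fun t => x0 t l 0)).
    - by move=> l; apply: measurable_funTS; exact: msnd.
    - by move=> l; exact: (cmp (fun t => psi t 0 l)).
    - exact: measurable_funTS.
    - by move=> z /andP[].
    - by move=> l; exact: (cmp (fun t => x0 t l 0)).
    - by move=> l; apply: (cmp (fun t => u0 t l 0)); exact: bu.1.
    - by move=> l; exact: (cmp (fun t => psi t 0 l)).
  have mB2 := m1 mD _ (measurable_itv `[i.+1%:R^-1, +oo[).
  have mB1 : measurable ([set z : R * UU | Time z.1 /\ cset P z.1 z.2] : set TY) by exact: hgr.
  have mB3 : measurable ([set z : R * UU | `|z.2| <= n%:R] : set TY).
    apply: closed_sigma; rewrite (_ : mkset _ = (fun z : R * UU => `|z.2|) @^-1` [set r | r <= n%:R])//.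
    apply: closed_comp => [z _|]; last exact: closed_le.
    apply: (@cvg_comp _ _ _ snd (fun p : UU => `|p|) _ (nbhs z.2)); first exact: cvg_snd.
    exact: norm_continuous.
  have := measurableI _ _ mB1 (measurableI _ _ mB3 mB2).
  rewrite (_ : _ `&` _ = B i n); first exact.
  apply/seteqP; split=> z.
    by move=> [z1 [z3 [z2]]]; rewrite /preimage /= in_itv/= andbT.
  by move=> [z1 [[z2 z3] z4]]; split=> //; split=> //; split=> //; rewrite /preimage /= in_itv/= andbT.
have neg i n : mu.-negligible (fst @` B i n).
  apply: contrapT => nn.
  have Bb t p : B i n (t, p) -> 0 <= t <= n%:R /\ `|p| <= n%:R by move=> [_ []].
  have [E [v [mE E0 mv hv]]] := borel_selection (bB i n) Bb nn.
  have En s : E s -> 0 <= s <= n%:R by move=> /hv/Bb[].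
  (* The selection is measurable on [E] only; extended by 0 it becomes measurable for all times
     before being spliced into [u0]. *)
  pose v2 t : UU := \col_l ((fun t => v t l 0) \_ E) t.
  have v2E t : E t -> v2 t = v t.
    by move=> Et; apply/matrixP => a c; rewrite ord1 mxE patchE mem_set.
  pose w := splice E v2 u0.
  have bw : bctrl (fun s => b0 s + n)%N w.
    split=> [l|t t0].
      apply: measurable_splice => //; last exact: bu.1.
      apply: measurable_funTS; rewrite (_ : (fun t => _) = (fun t => v t l 0) \_ E).
        exact/(measurable_restrictT _ mE).
      by apply/funext => t; rewrite mxE.
    have [Et|nEt] := pselect (E t).
      rewrite /w splice_in// v2E//; have [_ h] := Bb _ _ (hv t Et).
      by apply: le_trans h _; rewrite ler_nat leq_addl.
    rewrite /w splice_out//; apply: le_trans (bu.2 t t0) _.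
    by rewrite ler_nat leq_addr.
  have nbn : ndec (fun s => b0 s + n)%N by move=> s t s0 st; rewrite leq_add2r nb.
  have aw : admissible P w.
    apply: (admissible_intro nbn bw) => t tT; have [Et|nEt] := pselect (E t).
      by rewrite /w splice_in// v2E//; have [[_ ]] := hv t Et.
    by rewrite /w splice_out//; exact: uU.
  have := H n w E aw bw mE En; apply/negP; rewrite -ltNge.
  have i1 : lint (fun s => \1_E s : R).
    apply: eq_lint (lint_indic (lint_cst 1) mE) => s _; by rewrite mul1r.
  have n0 : 0 <= n%:R :> R by [].
  have c0 : 0 < (i.+1%:R^-1 : R) by rewrite invr_gt0.
  apply: (@lt_le_trans _ _ (prim (fun s => i.+1%:R^-1 * \1_E s) n%:R)).
    rewrite (primZ _ _ i1) mulr_gt0//.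
    rewrite prim_indic//.
    have EI : E `&` `[0, n%:R]%classic = E.
      by apply/setIidPl => s /En; rewrite /= in_itv.
    rewrite EI fine_gt0// E0/=.
    apply: (@le_lt_trans _ _ (mu `[0, n%:R]%classic)).
      by apply: le_measure; rewrite ?inE//; move=> s /En; rewrite /= in_itv.
    by rewrite lebesgue_measure_itv /=; case: ifP => _; rewrite ?ltry.
  apply: prim_le => //; [exact: lintZ|exact: lint_indic (iH n w aw bw) mE|].
  move=> s _; rewrite !indicE; have [Es|nEs] := pselect (E s); last by rewrite memNset// !mulr0.
  rewrite mem_set// !mulr1 /w splice_in// v2E//; by have [_ [_]] := hv s Es.
have ae1 : {ae mu, forall t, forall i n, ~ (fst @` B i n) t}.
  apply: ae_foralln => i; apply: ae_foralln => n.
  by apply: (negligibleS _ (neg i n)) => t /contrapT.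
apply: (aeS2 ae1 model_hamiltonian) => t h1 h2 tT.
apply/(max_condP _ _ _ (uU t tT)) => p pU; rewrite !h2//.
rewrite leNgt; apply/negP => hlt.
have t0 := (Time_ge0 t).1 tT.
have d0 : 0 < mH M t (x0 t) p lam (psi t) - mH M t (x0 t) (u0 t) lam (psi t) by rewrite subr_gt0.
have [i _ /(_ i (leqnn i)) id] := near_infty_natSinv_lt (PosNum d0).
pose n := (Num.truncn t + Num.truncn `|p|).+1.
apply: (h1 i n); exists (t, p) => //; split=> //; split; last exact: ltW id.
split; rewrite /= ?t0/=.
  by apply: le_trans (ltW (truncnS_gt t)) _; rewrite ler_nat ltnS leq_addr.
by apply: le_trans (ltW (truncnS_gt _)) _; rewrite ler_nat ltnS leq_addl.
Qed.

End MaximumCondition.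

(** * Passage to the limit *)

Section Subsequences.
Context {R : realType}.

(** The next index is sought beyond [i (s n)] rather than [s n], so that the terminal times
    [tau (i (s n))] form a genuine subsequence of [tau]. *)
Lemma extract_subsequence (Y : normedModType R) (a : nat -> Y) (i : nat -> nat) (Q : set Y) :
  compact Q -> (forall n, Q (a n)) -> (forall n, (n <= i n)%N) ->
  exists (l : Y) (s : nat -> nat), [/\ Q l, forall n, (n <= s n)%N,
    forall n, (i (s n) < i (s n.+1))%N & forall n, `|a (s n) - l| <= n.+1%:R^-1].
Proof.
move=> cQ Qa ni; have [|l [Ql cl]] := cQ (a @ \oo) _.
  by exists 0%N => // n _; exact: Qa.
have H (kp : nat * nat) : exists n, (kp.2 <= n)%N /\ `|a n - l| <= kp.1.+1%:R^-1.
  have nb : nbhs l (ball l (kp.1.+1%:R^-1 : R)) by apply: nbhsx_ballx; rewrite invr_gt0.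
  have Fn : (a @ \oo) [set z | exists2 n, (kp.2 <= n)%N & z = a n].
    by exists kp.2 => // n /= pn; exists n.
  have [z [[n pn ->] bz]] := cl _ _ Fn nb.
  by exists n; split => //; move: bz; rewrite -ball_normE /= distrC => /ltW.
have [f hf] := choice H.
pose s := fix s n := if n is n'.+1 then f (n, (i (s n')).+1) else f (0%N, 0%N).
exists l, s; split => // [n|n|n].
- elim: n => // n IH; have [h _] := hf (n.+1, (i (s n)).+1).
  by apply: leq_trans h; rewrite ltnS (leq_trans IH)// ni.
- by have [h _] := hf (n.+1, (i (s n)).+1); apply: leq_trans h (ni _).
- by case: n => [|n] /=; [have [_] := hf (0%N, 0%N)|have [_] := hf (n.+1, (i (s n)).+1)].
Qed.

Lemma enorm_cvg p q (a : nat -> 'M[R]_(p, q)) l : a @ \oo --> l -> (fun n => enorm (a n)) @ \oo --> enorm l.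
Proof.
move=> al; rewrite /enorm.
apply: (@cvg_comp _ _ _ (fun n => \sum_i \sum_j a n i j ^+ 2) Num.sqrt _ (nbhs (\sum_i \sum_j l i j ^+ 2))); last exact: sqrt_continuous.
apply: cvg_big => [|i _]; first exact: add_continuous.
apply: cvg_big => [|j _]; first exact: add_continuous.
rewrite expr2; under eq_fun do rewrite expr2.
have h : (fun n => a n i j) @ \oo --> l i j.
  by apply: (@cvg_comp _ _ _ a (fun A : 'M[R]_(p, q) => A i j) _ (nbhs l)) => //; exact: coord_continuous.
exact: cvgM.
Qed.

End Subsequences.

Section LimitStage.
Context {R : realType} {m k : nat} {P : control_problem R m k} (M : model P).
Local Notation X := 'cV[R]_m.
Local Notation Xr := 'rV[R]_m.
Local Notation UU := 'cV[R]_k.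

Lemma mH_dist n t (x y : X) (z : UU) (lam nu : R) (psi phi : Xr) (e : R) : 0 <= t -> e <= 1 ->
  `|x| <= n%:R -> `|y| <= n%:R -> `|z| <= n%:R -> `|phi| <= n%:R -> 0 <= nu <= 1 ->
  `|x - y| <= e -> `|psi - phi| <= e -> `|lam - nu| <= e ->
  `|mH M t x z lam psi - mH M t y z nu phi| <= (m%:R + m%:R * n%:R + 1 + m%:R + 1) * (e * ell M n t).
Proof.
move=> t0 e1 xn yn zn pn /andP[n0 n1] xe pe le_.
have e0 := le_trans (normr_ge0 _) le_.
have l0 := ell_ge0 M n t0.
have mul00 (p : Xr) (q : X) (a c : R) : `|p| <= a -> `|q| <= c -> `|(p *m q) 0 0| <= m%:R * (a * c).
  move=> pa qc; apply: le_trans (mx_norm_entry _ _ _) (le_trans (mx_norm_mul _ _) _).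
  by rewrite -mulrA ler_wpM2l// ler_pM.
have hF := mF_lip M t0 xn yn zn.
have t1 : `|((psi - phi) *m mF M t x z) 0 0| <= m%:R * (e * ell M n t) by apply: mul00 => //; exact: mF_bound.
have t2 : `|(phi *m (mF M t x z - mF M t y z)) 0 0| <= m%:R * (n%:R * (e * ell M n t)).
  by apply: mul00 => //; apply: le_trans hF _; rewrite ler_wpM2r.
have t3 : `|(lam - nu) * mG M t x z| <= e * ell M n t.
  by rewrite normrM ler_pM//; exact: mG_bound.
have t4 : `|mG M t x z - mG M t y z| <= m%:R * (ell M n t * e) + e * ell M n t.
  have hG := mG_taylor M t0 yn xn zn.
  have g1 : `|(mGx M t y z *m (x - y)) 0 0| <= m%:R * (ell M n t * e).
    by apply: mul00 => //; exact: mGx_bound.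
  rewrite -(subrK ((mGx M t y z *m (x - y)) 0 0) (mG M t x z - mG M t y z)).
  apply: le_trans (ler_normD _ _) _; rewrite addrC lerD//; apply: le_trans hG _.
  rewrite ler_wpM2r// expr2; apply: le_trans (ler_pM _ _ xe xe) _ => //.
  by rewrite ler_piMr.
have t5 : `|nu * (mG M t x z - mG M t y z)| <= m%:R * (ell M n t * e) + e * ell M n t.
  rewrite normrM (ger0_norm n0); apply: le_trans (ler_wpM2l n0 t4) _.
  by rewrite ler_piMl// addr_ge0 ?mulr_ge0.
have -> : mH M t x z lam psi - mH M t y z nu phi =
  ((psi - phi) *m mF M t x z) 0 0 + (phi *m (mF M t x z - mF M t y z)) 0 0 +
  (lam - nu) * mG M t x z + nu * (mG M t x z - mG M t y z).
  have sub00 (A B : 'M[R]_1) : (A - B) 0 0 = A 0 0 - B 0 0 by rewrite mxE [in X in _ + X]mxE.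
  by rewrite /mH mulmxBl mulmxBr !sub00; ring.
apply: le_trans (ler_normD _ _) (le_trans (lerD (ler_normD _ _) (lexx _)) _).
apply: le_trans (lerD (lerD (ler_normD _ _) (lexx _)) (lexx _)) _.
apply: le_trans (lerD (lerD (lerD t1 t2) t3) t5) _.
rewrite le_eqVlt; apply/orP; left; apply/eqP.
by move: (m%:R : R) (n%:R : R) (ell M n t) => mm nn L; ring.
Qed.

Lemma mH_bound n t (x : X) (z : UU) (lam : R) (psi : Xr) : 0 <= t ->
  `|x| <= n%:R -> `|z| <= n%:R -> `|psi| <= n%:R -> 0 <= lam <= 1 ->
  `|mH M t x z lam psi| <= (m%:R * n%:R + 1) * ell M n t.
Proof.
move=> t0 xn zn pn /andP[l0 l1]; rewrite /mH (le_trans (ler_normD _ _))// mulrDl mul1r lerD//.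
  apply: le_trans (mx_norm_entry _ _ _) (le_trans (mx_norm_mul _ _) _).
  by rewrite ler_pM ?mulr_ge0// ?ler_wpM2l//; exact: mF_bound.
rewrite normrM (ger0_norm l0); apply: le_trans (ler_wpM2l l0 (mG_bound M t0 xn zn)) _.
by rewrite ler_piMl// ell_ge0.
Qed.

Lemma lint_mH b x u (lam : R) psi phi : ndec b -> bctrl b u -> bctrl b x -> acdx psi phi ->
  lint (fun s => mH M s (x s) (u s) lam (psi s)).
Proof.
move=> nb bu bx ps; rewrite /mH; apply: lintD; last exact: lintZ (lint_mG M nb bu bx).
rewrite (_ : (fun s => _) = (fun s => \sum_l psi s 0 l * mF M s (x s) (u s) l 0)).
  by apply: lint_sum => l; apply: lint_acdM (ps 0 l) (lint_mF M nb bu bx l).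
by apply/funext => s; rewrite mxE.
Qed.

End LimitStage.

(** * The limit multiplier *)

Section Approximation.
Context {R : realType} {m k : nat} {P : control_problem R m k} (M : model P).
Local Notation X := 'cV[R]_m.
Local Notation Xr := 'rV[R]_m.
Local Notation UU := 'cV[R]_k.

Let invS (n p : nat) : (n <= p)%N -> p.+1%:R^-1 <= n.+1%:R^-1 :> R.
Proof. by move=> np; rewrite lef_pV2 ?posrE// ler_nat ltnS. Qed.

Lemma small_invS (c e : R) : 0 < e -> \forall n \near \oo, c * n.+1%:R^-1 < e.
Proof.
move=> e0; pose d := e / (`|c| + 1).
have c1 : 0 < `|c| + 1 by rewrite ltr_wpDl.
have d0 : 0 < d by rewrite divr_gt0.
have := near_infty_natSinv_lt (PosNum d0); apply: filterS => n /= nd.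
have n0 : 0 <= n.+1%:R^-1 :> R by rewrite invr_ge0.
apply: (@le_lt_trans _ _ ((`|c| + 1) * n.+1%:R^-1)).
  by rewrite ler_wpM2r// (le_trans (ler_norm c))// lerDl.
by rewrite mulrC -ltr_pdivlMr.
Qed.

(* The approximations are tested only off the small set where [u_ n] differs from
   [u0]; there all integrands converge uniformly. *)
Lemma integral_limit u0 (x0 : R -> X) (psi : R -> Xr) (lam : R) (u_ : nat -> R -> UU) (x_ : nat -> R -> X)
    (psi_ : nat -> R -> Xr) (lam_ : nat -> R) (c0 : R -> nat) (v : R -> UU) (E : set R) (N : nat) :
  ndec c0 -> bctrl c0 u0 -> bctrl c0 x0 -> (exists phi, acdx psi phi) -> (forall t, 0 <= t -> `|psi t| <= (c0 t)%:R) ->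
  bctrl c0 v -> 0 <= lam <= 1 -> measurable E ->
  (forall n, exists c, [/\ ndec c, bctrl c (u_ n) & bctrl c (x_ n)]) -> (forall n, exists phi, acdx (psi_ n) phi) ->
  (forall T e : R, 0 <= T -> 0 < e -> \forall n \near \oo, forall t, 0 <= t <= T ->
     `|x_ n t - x0 t| < e /\ `|psi_ n t - psi t| < e) ->
  (forall n, `|lam_ n - lam| <= n.+1%:R^-1) ->
  (forall n t, 0 <= t -> prim (fun s => ell M n s * \1_(neq (u_ n) u0) s) t <= n.+1%:R^-1) ->
  (\forall n \near \oo, prim (fun s => (mH M s (x_ n s) (v s) (lam_ n) (psi_ n s) -
      mH M s (x_ n s) (u_ n s) (lam_ n) (psi_ n s)) * \1_(E `\` neq (u_ n) u0) s) N%:R <= 2 * n.+1%:R^-1) ->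
  prim (fun s => (mH M s (x0 s) (v s) lam (psi s) - mH M s (x0 s) (u0 s) lam (psi s)) * \1_E s) N%:R <= 0.
Proof.
move=> nc bu bx [phi ps] pc bv l01 mE hb hp lim hlam hneq hint.
(* The successor absorbs the deviation of the approximating states and adjoints, which is at most
   [d <= 1]. *)
pose N' := (c0 N%:R).+1.
have N'b (a : R) (s : R) : 0 <= s <= N%:R -> a <= (c0 s)%:R -> a <= N'%:R.
  by move=> /andP[s0 sN] h; apply: le_trans h _; rewrite ler_nat leqW// nc.
have N'1 (a b' : R) (s : R) : 0 <= s <= N%:R -> b' <= (c0 s)%:R -> a <= b' + 1 -> a <= N'%:R.
  move=> /andP[s0 sN] h1 h2; apply: le_trans h2 _; rewrite -natr1 lerD2r; apply: le_trans h1 _.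
  by rewrite ler_nat nc.
pose La := prim (ell M N') N%:R.
have il := ell_lint M N'; have l0 := ell_ge0 M N'.
have La0 : 0 <= La by exact: prim_ge0.
pose K1 : R := m%:R + m%:R * N'%:R + 1 + m%:R + 1; pose K2 : R := m%:R * N'%:R + 1.
have K10 : 0 <= K1 by rewrite !addr_ge0// mulr_ge0.
have K20 : 0 <= K2 by rewrite addr_ge0// mulr_ge0.
have cu := bctrlW (fun s _ => leqnn (c0 s)) bu.
have iH0 : lint (fun s => mH M s (x0 s) (v s) lam (psi s) - mH M s (x0 s) (u0 s) lam (psi s)).
  by apply: lintB; [exact: lint_mH nc bv bx ps|exact: lint_mH nc bu bx ps].
apply/ler_addgt0Pr => e e0; rewrite add0r.
pose d := Num.min 1 (e / 2 / (2 * K1 * La + 1)).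
have Q0 : 0 < 2 * K1 * La + 1 by rewrite ltr_wpDl// !mulr_ge0.
have d0 : 0 < d by rewrite lt_min ltr01 !divr_gt0.
have d1 : d <= 1 by rewrite ge_min lexx.
have dLa : 2 * K1 * d * La <= e / 2.
  have h : d <= e / 2 / (2 * K1 * La + 1) by rewrite ge_min lexx orbT.
  rewrite ler_pdivlMr// in h.
  have aux (a f d' l : R) : 0 <= d' -> d' * (2 * a * l + 1) <= f -> 2 * a * d' * l <= f by move=> *; lra.
  exact: aux (ltW d0) h.
have hlim := lim N%:R d (ler0n _ _) d0.
have hsmall := @small_invS 1 d d0; have e20 : 0 < e / 2 by rewrite divr_gt0.
have hsmall2 := @small_invS (2 + 2 * K2) (e / 2) e20.
suff : \forall n \near \oo, prim (fun s => (mH M s (x0 s) (v s) lam (psi s) - mH M s (x0 s) (u0 s) lam (psi s)) * \1_E s) N%:R <= e.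
  by move=> [n _ /(_ n (leqnn n))].
near=> n.
have hl : forall t, 0 <= t <= N%:R -> `|x_ n t - x0 t| < d /\ `|psi_ n t - psi t| < d by near: n.
have hs : 1 * n.+1%:R^-1 < d by near: n.
have hs2 : (2 + 2 * K2) * n.+1%:R^-1 < e / 2 by near: n.
have hi : prim (fun s => (mH M s (x_ n s) (v s) (lam_ n) (psi_ n s) -
      mH M s (x_ n s) (u_ n s) (lam_ n) (psi_ n s)) * \1_(E `\` neq (u_ n) u0) s) N%:R <= 2 * n.+1%:R^-1 by near: n.
have N'n : (N' <= n)%N by near: n; exists N'.
have [c [nc' bun bxn]] := hb n; have [phin psn] := hp n.
pose Nb s := (c s + c0 s)%N.
have nNb : ndec Nb by move=> s t s0 st; rewrite leq_add ?nc ?nc'.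
have w1 p (z : R -> 'cV[R]_p) : bctrl c z -> bctrl Nb z by apply: bctrlW => s _; rewrite leq_addr.
have w2 p (z : R -> 'cV[R]_p) : bctrl c0 z -> bctrl Nb z by apply: bctrlW => s _; rewrite leq_addl.
have mneq := measurable_neq bun bu.
have mE' := measurableD mE mneq.
have iHn : lint (fun s => mH M s (x_ n s) (v s) (lam_ n) (psi_ n s) - mH M s (x_ n s) (u_ n s) (lam_ n) (psi_ n s)).
  by apply: lintB; [exact: lint_mH nNb (w2 _ _ bv) (w1 _ _ bxn) psn|exact: lint_mH nNb (w1 _ _ bun) (w1 _ _ bxn) psn].
have iN := lint_indic il mneq.
have i1 := lint_indic iHn mE'; have i2 := lintZ (2 * K1 * d) il; have i3 := lintZ (2 * K2) iN.
have dl : `|lam_ n - lam| <= d by apply: le_trans (hlam n) _; rewrite mul1r in hs; exact: ltW.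
(* Where [u_ n] equals [u0], both Hamiltonians change by at most [K1 * d * ell]; on [neq] the
   integrand is bounded crudely by [2 * K2 * ell]; off [E] the right-hand side is nonnegative. *)
have main : prim (fun s => (mH M s (x0 s) (v s) lam (psi s) - mH M s (x0 s) (u0 s) lam (psi s)) * \1_E s) N%:R <=
  prim (fun s => (mH M s (x_ n s) (v s) (lam_ n) (psi_ n s) -
      mH M s (x_ n s) (u_ n s) (lam_ n) (psi_ n s)) * \1_(E `\` neq (u_ n) u0) s + 2 * K1 * d * ell M N' s
      + 2 * K2 * (ell M N' s * \1_(neq (u_ n) u0) s)) N%:R.
  apply: prim_le => //; [exact: lint_indic|by apply: lintD => //; exact: lintD|].
  move=> s sN; have /andP[s0 _] := sN; have ls := l0 s s0.
  have [xd pd] := hl s sN.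
  have near1 (V : normedModType R) (z z' : V) : `|z - z'| < d -> `|z'| <= (c0 s)%:R -> `|z| <= N'%:R.
    move=> h hz; apply: N'1 sN hz _; rewrite -(subrK z' z) (le_trans (ler_normD _ _))// addrC lerD2l.
    exact: le_trans (ltW h) d1.
  have xn : `|x_ n s| <= N'%:R := near1 _ _ _ xd (bx.2 s s0).
  have x0n : `|x0 s| <= N'%:R := N'b _ s sN (bx.2 s s0).
  have p0n : `|psi s| <= N'%:R := N'b _ s sN (pc s s0).
  have vn : `|v s| <= N'%:R := N'b _ s sN (bv.2 s s0).
  have un : `|u0 s| <= N'%:R := N'b _ s sN (bu.2 s s0).
  have dist z : `|z| <= N'%:R -> `|mH M s (x_ n s) z (lam_ n) (psi_ n s) - mH M s (x0 s) z lam (psi s)| <= K1 * (d * ell M N' s).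
    by move=> zn; exact: mH_dist s0 d1 xn x0n zn p0n l01 (ltW xd) (ltW pd) dl.
  have b1 := mH_bound M s0 x0n vn p0n l01; have b2 := mH_bound M s0 x0n un p0n l01.
  have K1d : 0 <= 2 * K1 * d * ell M N' s by rewrite !mulr_ge0// ltW.
  have K2d : 0 <= 2 * K2 * (ell M N' s * \1_(neq (u_ n) u0) s) by rewrite !mulr_ge0.
  have [Es|nEs] := pselect (E s); last first.
    have -> : \1_E s = 0 :> R by rewrite indicE memNset.
    have -> : \1_(E `\` neq (u_ n) u0) s = 0 :> R by rewrite indicE memNset// => -[].
    by rewrite !mulr0 add0r addr_ge0.
  have -> : \1_E s = 1 :> R by rewrite indicE mem_set.
  rewrite mulr1; have [e'|ne] := pselect (u_ n s = u0 s).
    have -> : \1_(E `\` neq (u_ n) u0) s = 1 :> R by rewrite indicE mem_set//; split=> // -[].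
    have -> : \1_(neq (u_ n) u0) s = 0 :> R by rewrite indicE memNset// => -[].
    rewrite mulr1 !mulr0 addr0 e'.
    have := dist _ vn; have := dist _ un; rewrite !ler_norml => /andP[a1 a2] /andP[a3 a4].
    move: a1 a2 a3 a4; move: (mH _ _ _ _ _ _) (mH _ _ _ _ _ _) (mH _ _ _ _ _ _) (mH _ _ _ _ _ _) => h1 h2 h3 h4.
    have -> : 2 * K1 * d * ell M N' s = K1 * (d * ell M N' s) + K1 * (d * ell M N' s) by ring.
    move: (K1 * (d * _)) => kk; clear -R => *; lra.
  have -> : \1_(E `\` neq (u_ n) u0) s = 0 :> R by rewrite indicE memNset// => -[_]; apply.
  have -> : \1_(neq (u_ n) u0) s = 1 :> R by rewrite indicE mem_set.
  rewrite mulr0 add0r mulr1; apply: ler_wpDl => //.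
  apply: le_trans (ler_norm _) (le_trans (ler_normB _ _) _).
  have -> : 2 * K2 * ell M N' s = K2 * ell M N' s + K2 * ell M N' s by ring.
  exact: lerD b1 b2.
apply: le_trans main _; rewrite primD; [|exact: lintD|exact: i3].
rewrite primD; [|exact: i1|exact: i2].
rewrite (primZ _ _ il) (primZ _ _ iN) -/La.
have hN : prim (fun s => ell M N' s * \1_(neq (u_ n) u0) s) N%:R <= n.+1%:R^-1.
  apply: le_trans (hneq n N%:R (ler0n _ _)); apply: prim_le => //.
    exact: lint_indic (ell_lint M n) mneq.
  by move=> r /andP[r0 _]; rewrite ler_wpM2r//; exact: ell_mono.
have K22 : 0 <= 2 * K2 by rewrite mulr_ge0.
have aux (a b' c' nu' K e' : R) : a <= 2 * nu' -> (2 + 2 * K) * nu' < e' / 2 -> c' <= e' / 2 ->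
  b' <= 2 * K * nu' -> a + c' + b' <= e' by move=> *; lra.
exact: aux hi hs2 dLa (ler_wpM2l K22 hN).
Unshelve. all: by end_near. Qed.

Lemma approximation (tau : nat -> R) u0 b0 : borel_graph P -> increasing_to_infinity tau ->
  tau_optimal P tau u0 -> ndec b0 -> bctrl b0 u0 ->
  exists (u_ : nat -> R -> UU) (i : nat -> nat) (lam_ : nat -> R) (psi_ : nat -> R -> Xr) (lam : R) (psi : R -> Xr),
  [/\ forall n, (i n < i n.+1)%N,
    forall n, [/\ extremal_system P (traj P (u_ n)) (u_ n) (lam_ n) (psi_ n), psi_ n (tau (i n)) = 0,
      solpsi M (u_ n) (traj P (u_ n)) (lam_ n) (psi_ n) &
      0 <= payoff P (u_ n) (tau (i n)) - payoff P u0 (tau (i n)) <= n.+1%:R^-1],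
    (forall n t, 0 <= t -> prim (fun s => ell M n s * \1_(neq (u_ n) u0) s) t <= n.+1%:R^-1) /\
    extremal P (traj P u0) u0 lam psi,
    forall n, `|lam_ n - lam| <= n.+1%:R^-1 /\ forall t, 0 <= t -> exists q p,
      [/\ solx M u0 q, solpsi M u0 q (lam_ n) p, q t = traj P (u_ n) t, p t = psi_ n t &
        `|q 0 - xinit P| <= 2 * n.+1%:R^-1 /\ `|p 0 - psi 0| <= 2 * n.+1%:R^-1] &
    forall T e : R, 0 <= T -> 0 < e -> \forall n \near \oo, forall t, 0 <= t <= T ->
      `|traj P (u_ n) t - traj P u0 t| < e /\ `|psi_ n t - psi t| < e].
Proof.
move=> hgr htau hopt nb0 bu0.
have H n : exists d : (R -> UU) * nat * R * (R -> Xr), let: (u, i, lam, psi) := d in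
  [/\ (n <= i)%N /\ n%:R <= tau i,
    [/\ extremal_system P (traj P u) u lam psi, psi (tau i) = 0 & solpsi M u (traj P u) lam psi],
    0 <= payoff P u (tau i) - payoff P u0 (tau i) <= n.+1%:R^-1,
    forall t, 0 <= t -> prim (fun s => ell M n s * \1_(neq u u0) s) t <= n.+1%:R^-1 &
    (forall t, 0 <= t -> exists q p, [/\ solx M u0 q, solpsi M u0 q lam p, q t = traj P u t, p t = psi t &
      `|q 0 - xinit P| <= n.+1%:R^-1 /\ `|p 0 - psi 0| <= n.+1%:R^-1]) /\
    forall v (E : set R), admissible P v -> bctrl (fun s => b0 s + n)%N v -> measurable E ->
      (forall s, E s -> 0 <= s <= n%:R) ->
      prim (fun s => (mH M s (traj P u s) (v s) lam (psi s) -
          mH M s (traj P u s) (u s) lam (psi s)) * \1_E s) (tau i) <= 2 * n.+1%:R^-1].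
  have [u [i [lam [psi h]]]] := near_optimal M n htau hopt nb0 bu0.
  by exists (u, i, lam, psi).
have [dd hd] := choice H.
pose du n := (dd n).1.1.1; pose di n := (dd n).1.1.2; pose dl n := (dd n).1.2; pose dp n := (dd n).2.
have {}hd n : [/\ (n <= di n)%N /\ n%:R <= tau (di n),
    [/\ extremal_system P (traj P (du n)) (du n) (dl n) (dp n), dp n (tau (di n)) = 0 &
      solpsi M (du n) (traj P (du n)) (dl n) (dp n)],
    0 <= payoff P (du n) (tau (di n)) - payoff P u0 (tau (di n)) <= n.+1%:R^-1,
    forall t, 0 <= t -> prim (fun s => ell M n s * \1_(neq (du n) u0) s) t <= n.+1%:R^-1 &
    (forall t, 0 <= t -> exists q p, [/\ solx M u0 q, solpsi M u0 q (dl n) p, q t = traj P (du n) t, p t = dp n t &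
      `|q 0 - xinit P| <= n.+1%:R^-1 /\ `|p 0 - dp n 0| <= n.+1%:R^-1]) /\
    forall v (E : set R), admissible P v -> bctrl (fun s => b0 s + n)%N v -> measurable E ->
      (forall s, E s -> 0 <= s <= n%:R) ->
      prim (fun s => (mH M s (traj P (du n) s) (v s) (dl n) (dp n s) -
          mH M s (traj P (du n) s) (du n s) (dl n) (dp n s)) * \1_E s) (tau (di n)) <= 2 * n.+1%:R^-1].
  by have := hd n; rewrite /du /di /dl /dp; case: (dd n) => [[[u i] l] p].
(* Compactness is applied only to the initial adjoint, transposed to a column, and to [lam];
   convergence of the functions then follows from the flow of (S) for [u0]. *)
pose Y : normedModType R := ('cV[R]_m * R^o)%type.
pose a n : Y := ((dp n 0)^T, dl n).
have cQ := compact_setX (@cV_ball_compact R m 1) (@segment_compact R 0 1).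
have aQ n : ([set x : 'cV[R]_m | `|x| <= 1%:R] `*` `[(0 : R), 1]%classic) (a n).
  have [_ [[_ l01 _ _ e1] _ _] _ _ _] := hd n; have /andP[l0 l1] := l01.
  split; last by rewrite /= in_itv.
  by rewrite /= norm_tr (le_trans (norm_le_enorm _))// -e1 lerDl.
have di_ge n : (n <= di n)%N by have [[]] := hd n.
have [l [s [[lQ1 lQ2] ss si sl]]] := @extract_subsequence R Y a di _ cQ aQ di_ge.
pose lam : R := l.2; pose q0 : Xr := (l.1)^T.
have lam01 : 0 <= lam <= 1 by move: lQ2; rewrite /= in_itv.
have sl2 n : `|dl (s n) - lam| <= n.+1%:R^-1.
  by apply: le_trans (sl n); rewrite [leRHS]prod_normE le_max; apply/orP; right.
have sl1 n : `|dp (s n) 0 - q0| <= n.+1%:R^-1.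
  apply: le_trans (sl n); rewrite [leRHS]prod_normE le_max; apply/orP; left.
  by rewrite /= -norm_tr linearB /= trmxK.
have [au0 _] := hopt.
have [xs0 x00] := traj_solx M nb0 bu0.
have [c1 nc1 bx1] := ac_bctrl (acdx_ac xs0); have [b1 [nb1 bu1 bx1']] := bctrlD nb0 nc1 bu0 bx1.
have [psi ps psi0] := solpsi_exists M lam q0 nb1 bu1 bx1' (lexx 0).
have inv0 : (fun n => n.+1%:R^-1 : R) @ \oo --> (0 : R).
  by apply/cvgrPdist_lt => e e0; have := @small_invS 1 e e0; apply: filterS => n; rewrite mul1r sub0r normrN ger0_norm// invr_ge0.
have norm1 : enorm (psi 0) + lam = 1.
  have c1' : (fun n => enorm (dp (s n) 0)) @ \oo --> enorm (psi 0).
    by apply: enorm_cvg; apply: (cvg_dist0 _ inv0) => n; rewrite psi0.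
  have c2 : (fun n => dl (s n)) @ \oo --> lam.
    by apply: (@cvg_dist0 R R^o _ _ _ _ inv0) => n; exact: sl2.
  have c3 : (fun n => enorm (dp (s n) 0) + dl (s n)) @ \oo --> enorm (psi 0) + lam by exact: cvgD.
  have e : (fun n => enorm (dp (s n) 0) + dl (s n)) = (fun=> 1).
    by apply/funext => n; have [_ [[_ _ _ _ ->] _ _] _ _ _] := hd (s n).
  rewrite e in c3; apply/esym; have := cvg_lim _ c3; rewrite lim_cst//; apply; exact: Rhausdorff.
have neqS n t : 0 <= t -> prim (fun r => ell M n r * \1_(neq (du (s n)) u0) r) t <= n.+1%:R^-1.
  move=> t0; have [_ [[au _ _ _ _] _ _] _ h _] := hd (s n).
  have [c nc bc] := admissible_bctrl au; have mn := measurable_neq bc bu0.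
  apply: le_trans (le_trans (h t t0) (invS (ss n))); apply: prim_le => //.
  - exact: lint_indic (ell_lint M n) mn.
  - exact: lint_indic (ell_lint M (s n)) mn.
  - by move=> r /andP[r0 _]; rewrite ler_wpM2r//; exact: ell_mono.
(* The factor 2 combines the tube error with the distance of the initial adjoint from its limit. *)
have kap n t : 0 <= t -> exists q p, [/\ solx M u0 q, solpsi M u0 q (dl (s n)) p, q t = traj P (du (s n)) t,
    p t = dp (s n) t & `|q 0 - xinit P| <= 2 * n.+1%:R^-1 /\ `|p 0 - psi 0| <= 2 * n.+1%:R^-1].
  move=> t0; have [_ _ _ _ [+ _]] := hd (s n) => /(_ t t0)[q [p [h1 h2 h3 h4 [h5 h6]]]].
  exists q, p; split=> //; have i0 : 0 <= n.+1%:R^-1 :> R by rewrite invr_ge0.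
  rewrite mulr2n mulrDl mul1r; split.
    by apply: le_trans h5 (le_trans (invS (ss n)) _); rewrite lerDl.
  rewrite -(subrK (dp (s n) 0) (p 0)) -addrA (le_trans (ler_normD _ _))// lerD//.
    exact: le_trans h6 (invS (ss n)).
  by rewrite psi0.
have lim T e : 0 <= T -> 0 < e -> \forall n \near \oo, forall t, 0 <= t <= T ->
      `|traj P (du (s n)) t - traj P u0 t| < e /\ `|dp (s n) t - psi t| < e.
  (* For each [t], the state and adjoint at [t] lie on a solution of (S) for [u0] with initial value
     near the limit, so [flow_lip] only compares solutions for one control. The constant 5 below is
     2 + 2 + 1, for adjoint, state and [lam]. *)
  move=> T0 e0; pose C0 : R := `|xinit P| + 3.
  have C00 : 0 <= C0 by rewrite addr_ge0.
  have [C [Cp HC]] := flow_lip M nb1 bu1 C00 T0.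
  have h1 := @small_invS (C * 5) e e0.
  apply: filterS h1 => n hn t tT; have /andP[t0 _] := tT.
  have [q [p [qs pps qt pt [q0' p0']]]] := kap n t t0.
  have i1 : n.+1%:R^-1 <= 1 :> R by rewrite invf_le1// ler1n.
  have i0 : 0 <= n.+1%:R^-1 :> R by rewrite invr_ge0.
  have qC : `|q 0| <= C0.
    rewrite -(subrK (xinit P) (q 0)) (le_trans (ler_normD _ _))// addrC lerD2l (le_trans q0')//.
    by rewrite -[leRHS]mulr1 ler_pM// ler_nat.
  have xC : `|traj P u0 0| <= C0 by rewrite x00 lerDl.
  have c3 (r : R) : r <= 1 -> r <= C0 by move=> r1; rewrite (le_trans r1)// ler_wpDl// ler1n.
  have lC : `|dl (s n)| <= C0.
    by have [_ [[_ /andP[a0 a1] _ _ _] _ _] _ _ _] := hd (s n); rewrite ger0_norm// c3.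
  have lC' : `|lam| <= C0 by have /andP[a0 a1] := lam01; rewrite ger0_norm// c3.
  have pC : `|psi 0| <= C0.
    by apply: c3; rewrite (le_trans (norm_le_enorm _))// -norm1 lerDl; have /andP[] := lam01.
  have [H1 _ H3] := HC _ _ qs xs0 qC xC.
  rewrite -qt -pt; have d1 := H1 t tT; have d3 := H3 _ _ _ _ pps ps lC lC' pC t tT.
  rewrite x00 in d1; rewrite x00 in d3.
  have big (r : R) : r <= 5 * n.+1%:R^-1 -> C * r < e.
    by move=> hr; apply: le_lt_trans hn; rewrite -mulrA ler_wpM2l.
  split; [apply: le_lt_trans d1 (big _ _)|apply: le_lt_trans d3 (big _ _)].
    by apply: le_trans q0' _; rewrite ler_wpM2r// ler_nat.
  apply: le_trans (lerD (lerD p0' q0') (sl2 n)) _.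
  have aux (r : R) : 2 * r + 2 * r + r <= 5 * r by lra.
  exact: aux.
have mx i : measurable_fun Time (fun t => traj P u0 t i 0) by exact: acdx_measurable xs0.
have mp i : measurable_fun Time (fun t => psi t 0 i) by exact: acdx_measurable ps.
have psb : exists2 c, ndec c & forall t, 0 <= t -> `|psi t| <= (c t)%:R.
  by apply: ndec_bound => T; exact: acdx_bounded ps.
have [c2 nc2 pc2] := psb.
exists (fun n => du (s n)), (fun n => di (s n)), (fun n => dl (s n)), (fun n => dp (s n)), lam, psi.
split=> //.
- move=> n; have [_ [h1 h2 h3] /andP[h4 h5] _ _] := hd (s n); split=> //.
  by rewrite h4 (le_trans h5)// invS.
- split=> //; split.
    split=> //; first by split=> //; exact: (solx_ode M nb0 bu0 _).1.
    exact: (solpsi_adjoint M nb1 bu1 bx1' _ _).1.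
  apply: (@maximum_from_integral _ _ _ P M _ _ _ _ _ hgr au0 nb0 bu0 mx mp).
    move=> n v av bv; pose cc t := (b1 t + (b0 t + n))%N.
    have ncc : ndec cc by move=> r t r0 rt; rewrite leq_add ?nb1// leq_add2r nb0.
    have bv' : bctrl cc v by apply: bctrlW bv => t _; rewrite leq_addl.
    have bu' : bctrl cc u0 by apply: bctrlW bu1 => t _; rewrite leq_addr.
    have bx' : bctrl cc (traj P u0) by apply: bctrlW bx1' => t _; rewrite leq_addr.
    by apply: lintB; [exact: lint_mH ncc bv' bx' ps|exact: lint_mH ncc bu' bx' ps].
  move=> n v E av bv mE En; pose cc t := (b1 t + c2 t + (b0 t + n))%N.
  have ncc : ndec cc by move=> r t r0 rt; rewrite !leq_add ?nb1 ?nc2 ?nb0.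
  have bv' : bctrl cc v by apply: bctrlW bv => t _; rewrite leq_addl.
  have le1 t : (b1 t <= cc t)%N by rewrite /cc -addnA leq_addr.
  have bu' : bctrl cc u0 by apply: bctrlW bu1.
  have bx' : bctrl cc (traj P u0) by apply: bctrlW bx1'.
  have pb' t : 0 <= t -> `|psi t| <= (cc t)%:R.
    by move=> t0; rewrite (le_trans (pc2 t t0))// ler_nat /cc addnAC leq_addl.
  apply: (@integral_limit u0 (traj P u0) psi lam (fun n => du (s n)) (fun n => traj P (du (s n))) (fun n => dp (s n)) (fun n => dl (s n)) cc v E n ncc bu' bx' _ pb' bv' lam01 mE _ _ lim sl2 neqS).
  + by exists (psidot M u0 (traj P u0) lam psi).
  + move=> p; have [_ [[au _ _ _ _] _ _] _ _ _] := hd (s p).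
    have [c nc bc] := admissible_bctrl au; have [xs _] := traj_solx M nc bc.
    have [c' nc' bc'] := ac_bctrl (acdx_ac xs); have [c'' [h1 h2 h3]] := bctrlD nc nc' bc bc'.
    by exists c''.
  + by move=> p; have [_ [_ _ h] _ _ _] := hd (s p); exists (psidot M (du (s p)) (traj P (du (s p))) (dl (s p)) (dp (s p))).
  near=> p; have np : (n <= p)%N by near: p; exists n.
  have [[_ ptau] [[au _ _ _ _] _ pss] _ _ [_ hmax]] := hd (s p).
  have nsp : (n <= s p)%N by exact: leq_trans np (ss p).
  have bvp : bctrl (fun t => b0 t + s p)%N v by apply: bctrlW bv => t _; rewrite leq_add2l.
  have [c nc bc] := admissible_bctrl au; have mn := measurable_neq bc bu0.
  have mE' := measurableD mE mn.
  have hE' t : (E `\` neq (du (s p)) u0) t -> 0 <= t <= (s p)%:R.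
    by move=> [/En/andP[-> tn] _] /=; rewrite (le_trans tn)// ler_nat.
  have [xs _] := traj_solx M nc bc; have [c' nc' bc'] := ac_bctrl (acdx_ac xs).
  pose c3 t := (c t + c' t + (b0 t + n))%N.
  have nc3 : ndec c3 by move=> r t r0 rt; rewrite !leq_add ?nc ?nc' ?nb0.
  have v3 : bctrl c3 v by apply: bctrlW bv => t _; rewrite leq_addl.
  have u3 : bctrl c3 (du (s p)) by apply: bctrlW bc => t _; rewrite /c3 -addnA leq_addr.
  have x3 : bctrl c3 (traj P (du (s p))) by apply: bctrlW bc' => t _; rewrite /c3 addnAC leq_addl.
  have il : lint (fun t => mH M t (traj P (du (s p)) t) (v t) (dl (s p)) (dp (s p) t) -
      mH M t (traj P (du (s p)) t) (du (s p) t) (dl (s p)) (dp (s p) t)).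
    by apply: lintB; [exact: lint_mH nc3 v3 x3 pss|exact: lint_mH nc3 u3 x3 pss].
  have ntau : n%:R <= tau (di (s p)) by rewrite (le_trans _ ptau)// ler_nat.
  (* The set lies in [[0, n]], so integrating up to [n] or up to the terminal time gives the same
     value. *)
  rewrite -(prim_support (lint_indic il mE') (ler0n R n) ntau); last by move=> t [/En/andP[]].
  apply: le_trans (hmax v _ av bvp mE' hE') _.
  by rewrite ler_wpM2l// invS.
- by move=> p; split; [exact: sl2|exact: kap].
Unshelve. all: by end_near. Qed.

End Approximation.

(** * Dirac controls *)

Section Dirac.
Context {R : realType} {m k : nat} {P : control_problem R m k} (M : model P).
Local Notation mu := (@lebesgue_measure R).
Local Notation X := 'cV[R]_m.
Local Notation UU := 'cV[R]_k.

(** [D] is Borel as a closed set and [c] as a continuous function; this fits the compact values of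
    the control set and the Carathéodory data at almost every time. *)
Lemma Rintegral_dirac (a : UU) (D : set UU) (c : UU -> R) : closed D -> D a -> continuous c ->
  \int[(dirac (a : borelType UU) : probability (borelType UU) R)]_(v in D) c v = c a.
Proof.
move=> cD Da cc; have mD : measurable (D : set (borelType UU)) by exact: borel_closed.
have mc := continuous_borel cc.
rewrite /Rintegral integral_dirac//.
  by rewrite diracE mem_set// mul1e.
by apply/measurable_EFinP; exact: measurable_funTS.
Qed.

Hypothesis hU : compact_valued P.

Let closedU t : Time t -> closed (cset P t).
Proof. by move=> tT; apply: compact_closed; [exact: norm_hausdorff|exact: hU]. Qed.

Lemma dirac_generalized u : admissible P u -> generalized P (dirac_control u).
Proof.
move=> [bu _ uU]; split=> [c cc _|].
  have cu : measurable_fun Time (fun t => c (u t)).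
    apply: (@measurable_comp _ _ _ _ _ _ setT (c : borelType UU -> R) Time u) => //.
    exact: continuous_borel.
  apply: eq_measurable_fun cu => t _; apply/esym.
  by rewrite /dirac_control (@Rintegral_dirac (u t) setT c).
apply: (aeS (model_ae M)) => t _ tT.
transitivity (\d_(u t : borelType UU) (cset P t : set (borelType UU)) : \bar R); first by [].
by rewrite diracE mem_set//; exact: uU.
Qed.

Section Fixed.
Context (u : R -> UU).
Hypothesis uU : forall t, Time t -> cset P t (u t).

Let entry_cont p q (a : UU -> 'M[R]_(p, q)) i j : continuous a -> continuous (fun w => a w i j).
Proof.
move=> ca w; apply: (@cvg_comp _ _ _ a (fun A : 'M[R]_(p, q) => A i j) _ (nbhs (a w))); first exact: ca.
exact: coord_continuous.
Qed.

Let slice_cont (V : topologicalType) (a : X * UU -> V) (x : X) : continuous a -> continuous (fun v => a (x, v)).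
Proof.
move=> ca v; apply: (@cvg_comp _ _ _ (fun v => (x, v)) a _ (nbhs (x, v))); last exact: ca.
have h1 : (fun=> x) w @[w --> nbhs v] --> x by exact: cvg_cst.
have h2 : id w @[w --> nbhs v] --> v by exact: cvg_id.
exact: cvg_pair h1 h2.
Qed.

Lemma traj_dirac : traj_gen P (dirac_control u) = traj P u.
Proof.
apply: eq_ivp_sol; apply: (aeS (model_ae M)) => t H tT; have [-> _ _ _ _] := H tT.
apply/funext => y; apply/matrixP => i j; rewrite ord1 mxE /dirac_control.
apply: (@Rintegral_dirac (u t) (cset P t) (fun v => mF M t y v i 0)); [exact: closedU|exact: uU|].
apply: (@entry_cont _ _ (fun v => mF M t y v)).
exact: (@slice_cont _ (fun w => mF M t w.1 w.2) y (@mF_cont _ _ _ _ M t ((Time_ge0 t).1 tT))).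
Qed.

Lemma fund_dirac : fund_gen P (dirac_control u) =
  ivp_sol (fun t B => dfdx P t (traj P u t) (u t) *m B) 1%:M.
Proof.
rewrite /fund_gen traj_dirac; apply: eq_ivp_sol; apply: (aeS (model_ae M)) => t H tT; have [_ _ -> _ _] := H tT.
apply/funext => B; congr (_ *m _); apply/matrixP => i j; rewrite mxE /dirac_control.
apply: (@Rintegral_dirac (u t) (cset P t) (fun v => mFx M t (traj P u t) v i j)); [exact: closedU|exact: uU|].
apply: (@entry_cont _ _ (fun v => mFx M t (traj P u t) v)).
exact: (@slice_cont _ (fun w => mFx M t w.1 w.2) _ (@mFx_cont _ _ _ _ M t ((Time_ge0 t).1 tT))).
Qed.

Lemma dpayoff_dirac T : dpayoff_gen P (dirac_control u) T =
  \row_j \int[mu]_(t in `[0, T]) (dgdx P t (traj P u t) (u t) *m fund_gen P (dirac_control u) t) 0 j.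
Proof.
apply/rowP => j; rewrite !mxE; apply: Rintegral_ae_eq; apply: (aeS (model_ae M)) => t H /itv_Time tT.
have [_ _ _ -> _] := H tT; congr ((_ *m _) _ _); apply/matrixP => i l; rewrite ord1 mxE traj_dirac /dirac_control.
apply: (@Rintegral_dirac (u t) (cset P t) (fun v => mGx M t (traj P u t) v 0 l)); [exact: closedU|exact: uU|].
apply: (@entry_cont _ _ (fun v => mGx M t (traj P u t) v)).
exact: (@slice_cont _ (fun w => mGx M t w.1 w.2) _ (@mGx_cont _ _ _ _ M t ((Time_ge0 t).1 tT))).
Qed.

Lemma payoff_dirac T : payoff_gen P (dirac_control u) T = payoff P u T.
Proof.
apply: Rintegral_ae_eq; apply: (aeS (model_ae M)) => t H /itv_Time tT.
have [_ -> _ _ _] := H tT; rewrite traj_dirac /dirac_control.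
apply: (@Rintegral_dirac (u t) (cset P t) (fun v => mG M t (traj P u t) v)); [exact: closedU|exact: uU|].
exact: (@slice_cont _ (fun w => mG M t w.1 w.2) _ (@mG_cont _ _ _ _ M t ((Time_ge0 t).1 tT))).
Qed.

Lemma dpayoff_dirac_psi b (lam T : R) psi : ndec b -> bctrl b u -> solpsi M u (traj P u) lam psi ->
  0 <= T -> psi T = 0 -> lam *: dpayoff_gen P (dirac_control u) T = psi 0.
Proof.
move=> nb bu ps T0 pT; have [xs x0] := traj_solx M nb bu.
have [c nc bx] := ac_bctrl (acdx_ac xs); have [n [nn un xn]] := bctrlD nb nc bu bx.
have [As A0 _] := fundP M nn un xn.
rewrite dpayoff_dirac fund_dirac (dpayoffP M).
have := psi_fund nn un xn ps As A0 T0.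
by rewrite pT mul0mx => /eqP; rewrite eq_sym subr_eq0 => /eqP ->.
Qed.

End Fixed.

Lemma image_in_closure x u lam psi : extremal_system P x u lam psi ->
  extremal_system_closure P (x, dirac_control u, lam, psi).
Proof.
move=> H; have [au l01 [ox _] op _] := H; split.
  split=> //; [by apply: ac_continuous; exact: ox.1|exact: dirac_generalized|].
  by apply: ac_continuous; exact: op.1.
by apply: subset_closure; exists (x, dirac_control u, lam, psi) => //; exists x, u, lam, psi.
Qed.

End Dirac.

(** * Convergence in the space of quadruples *)

Section Embedding.
Context {R : realType}.

(** For a continuous limit, compact-open convergence is uniform convergence on the compact subsets
    of the subspace [Time], each of which lies in a bounded interval. *)
Lemma compact_open_limit (V : normedModType R) (x_ : nat -> R -> V) (x : R -> V) :
  {within Time, continuous x} ->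
  (forall T e : R, 0 <= T -> 0 < e -> \forall n \near \oo, forall t, 0 <= t <= T -> `|x_ n t - x t| < e) ->
  (fun n => sigL Time (x_ n) : {compact-open, @Time R -> V}) @ \oo --> (sigL Time x : {compact-open, @Time R -> V}).
Proof.
move=> cx H; have cs : continuous (sigL Time x).
  exact: (subspace_sigL_continuousP _ _).1.
have F : Filter ((fun n => sigL Time (x_ n)) @ \oo) by exact: fmap_filter.
suff Hf : {family compact, (fun n => sigL Time (x_ n)) @ \oo --> sigL Time x}.
  by have := (compact_open_fam_compactP cs F).2 Hf.
apply/fam_cvgP => K cK Q /uniform_nbhs[E [entE EQ]].
have [e e0 eE] : exists2 e : R, 0 < e & forall y z : V, ball y e z -> E (y, z).
  move: entE; rewrite -entourage_ballE => -[e /= e0 eE]; exists e => // y z yz; exact: eE.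
have cv : compact (set_val @` K : set R).
  apply: continuous_compact => //; apply: continuous_subspaceT.
  exact: initial_continuous.
have [M0 [_ hM]] := compact_bounded cv.
have T0 : 0 <= `|M0| + 1 by rewrite addr_ge0.
have := H _ e T0 e0; apply: filterS => n Hn; apply: EQ => t Kt; apply: eE.
rewrite -ball_normE /= distrC; apply: Hn.
have tv : Time (set_val t) by exact: set_valP.
rewrite ((Time_ge0 _).1 tv)/=; apply: le_trans (ler_norm _) _; apply: (hM (`|M0| + 1)).
  by rewrite (le_lt_trans (ler_norm M0))// ltrDl.
by exists t.
Qed.

End Embedding.

Lemma prim_mul_indic {R : realType} (h : R -> R) (E : set R) (t : R) :
  prim (fun s => h s * \1_E s) t = \int[@lebesgue_measure R]_(s in `[0, t] `&` E) h s.
Proof.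
rewrite primE Rintegral_mkcondr; congr (Rintegral _ _ _); apply/funext => s.
by rewrite patchE indicE; case: ifP => _; rewrite ?mulr1 ?mulr0.
Qed.

Section TestValues.
Context {R : realType} {m k : nat} {P : control_problem R m k} (M : model P).
Local Notation mu := (@lebesgue_measure R).
Local Notation UU := 'cV[R]_k.
Hypothesis hU : compact_valued P.

(* A test function is only Caratheodory up to a null set of times, and its bound is only
   integrable for the completed measure; both are replaced by Borel versions. *)
Lemma test_function_representative (p : nat * (R -> UU -> R)) : test_functions P p ->
  exists (phi : R -> UU -> R) (H : R -> R),
  [/\ mu.-integrable setT (EFin \o H), forall v, measurable_fun Time (phi ^~ v),
     forall t, continuous (phi t), forall t v, cset P t v -> `|phi t v| <= H t &
     {ae mu, forall t, `[0, p.1%:R]%classic t -> p.2 t = phi t}].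
Proof.
case: p => N phi0 [/= [mphi cphi] iphi].
have Ncup : `[0, N%:R]%classic = \bigcup_(n in @setT nat) `[(0 : R), N%:R]%classic.
  by rewrite bigcup_const//; exists 0%N.
have mN : measurable (`[0, N%:R]%classic : set R) by exact: measurable_itv.
have [h [mh ih hh]] := completed_integrable_borel mN (fun=> mN) Ncup (fun=> iphi).
have [N1 [mN1 N10 hN1]] : {ae mu, forall t, `[0, N%:R]%classic t -> continuous (phi0 t) /\
    ereal_sup [set `|phi0 t v|%:E | v in cset P t] = (h t)%:E}.
  by apply: (aeS2 cphi hh) => t h1 h2 tN; split; [exact: h1|exact: h2].
pose G := `[0, N%:R]%classic `\` N1; have mG' : measurable G by exact: measurableD.
have hG t : G t -> continuous (phi0 t) /\ ereal_sup [set `|phi0 t v|%:E | v in cset P t] = (h t)%:E.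
  by move=> [tN t1]; apply: contrapT => c; apply: t1; apply: hN1 => /= /(_ tN).
exists (fun t v => if t \in G then phi0 t v else 0), (h \_ G); split.
- have iG : mu.-integrable G (EFin \o h) by apply: integrableS (ih 0%N) => //; exact: subDsetl.
  by have := (@integrable_mkcond _ _ _ mu G (EFin \o h) mG').1 iG; rewrite restrict_EFin.
- move=> v; rewrite (_ : (fun t => _) = (phi0 ^~ v) \_ G); last by apply/funext => t; rewrite patchE.
  apply: measurable_funTS; apply/(measurable_restrictT _ _).1 => //.
  by apply: measurable_funS (borel_fun_real mN (mphi v)) => //; exact: subDsetl.
- by move=> t; have [/set_mem/hG[h1 _]|_] := boolP (t \in G); [exact: h1|exact: cst_continuous].
- move=> t v Uv; rewrite patchE; have [/set_mem/hG[_ e]|_] := boolP (t \in G); last by rewrite normr0.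
  by rewrite -lee_fin -e; apply: ereal_sup_ubound; exists v.
- exists N1; split=> // t /= ct; apply: contrapT => nt; apply: ct => tN.
  by apply/funext => v; rewrite mem_set.
Qed.

Lemma test_values_dirac (phi : R -> UU -> R) (p : test_functions P) (u : R -> UU) :
  (forall t, continuous (phi t)) -> (forall t, Time t -> cset P t (u t)) ->
  {ae mu, forall t, `[0, (val p).1%:R]%classic t -> (val p).2 t = phi t} ->
  test_values (dirac_control u) p = prim (fun t => phi t (u t)) (val p).1%:R.
Proof.
move=> cphi uU hp; rewrite primE; apply: Rintegral_ae_eq; apply: (aeS hp) => t e tN.
have tT : Time t by exact: itv_Time tN.
rewrite (e tN) /dirac_control; apply: Rintegral_dirac => //; last exact: uU.
by apply: compact_closed; [exact: norm_hausdorff|exact: hU].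
Qed.

(** As [ell] is at least 1, the set where [u_ n] differs from [u0] has measure at most [n.+1%:R^-1]
    on bounded intervals. There the test integrands differ by at most twice the integrable bound
    [H], so absolute continuity of the integral of [H] suffices. *)
Lemma test_values_limit (u_ : nat -> R -> UU) (u0 : R -> UU) :
  admissible P u0 -> (forall n, admissible P (u_ n)) ->
  (forall n t, 0 <= t -> prim (fun s => ell M n s * \1_(neq (u_ n) u0) s) t <= n.+1%:R^-1) ->
  (fun n => test_values (dirac_control (u_ n)) : {ptws test_functions P -> R}) @ \oo -->
    (test_values (dirac_control u0) : {ptws test_functions P -> R}).
Proof.
move=> au0 au hneq.
have F : Filter ((fun n => test_values (dirac_control (u_ n)) : {ptws test_functions P -> R}) @ \oo).
  exact: fmap_filter.
(* The topology is that of pointwise convergence, so each test function is treated separately. *)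
apply/cvg_sup => p; apply/cvg_image; first by rewrite eqEsubset; split=> // v _; exists (fun=> v).
suff H0 : (fun n => test_values (dirac_control (u_ n)) p) @ \oo --> test_values (dirac_control u0) p.
  by move=> W /= HW; have := H0 W HW => HW'; exists ((fun g => g p) @^-1` W) => //; rewrite eqEsubset; split=> [j [? + <-]//|j Wj]; exists (fun=> j).
have [phi [H [iH mphi cphi bphi ephi]]] := test_function_representative (set_valP p).
pose N := (val p).1.
have val_u u : admissible P u -> test_values (dirac_control u) p = prim (fun t => phi t (u t)) N%:R.
  by move=> [_ _ uU]; exact: test_values_dirac.
have iu u : admissible P u -> lint (fun t => phi t (u t)).
  move=> [bu _ uU]; have mu_ := borel_fun_entry measurable_Time bu.
  apply: (@lint_le _ _ (fun t => `|H t|)); last by apply: lint_norm => b; exact: integrableS iH.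
    (* A state of dimension 0 adapts [caratheodory_comp] to a function of time and control alone. *)
    apply: (@caratheodory_comp R _ R 0 k (fun t _ v => phi t v) Time idfun (fun=> 0) u) => //.
    - exact: measurable_Time.
    - exact: measurable_id.
    - by move=> w wT; exact: (Time_ge0 w).1 wT.
    - move=> t _ w; apply: (@cvg_comp _ _ _ (fun w => w.2) (phi t) _ (nbhs w.2)); last exact: cphi.
      exact: cvg_snd.
  by move=> t t0; apply: le_trans (ler_norm _); apply: bphi; apply: uU; exact: (Time_ge0 t).2.
have inH : lint (fun t => `|H t|).
  by apply: lint_norm => b; exact: integrableS iH.
apply/cvgrPdist_lt => e e0.
have e20 : 0 < e / 2 by rewrite divr_gt0.
have [d [d0 hd]] := integral_normr_continuous iH e20.
have h1 := @small_invS R 1 d d0; apply: filterS h1 => n; rewrite mul1r => hn.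
have [b0 nb0 bu0] := admissible_bctrl au0; have [b nb bu] := admissible_bctrl (au n).
have mneq := measurable_neq bu bu0; have mA := measurableI _ _ (measurable_itv `[0, N%:R]) mneq.
pose IN : set R := `[0, N%:R]%classic; have mI : measurable IN by exact: measurable_itv.
have fI : (mu IN < +oo)%E.
  by rewrite /IN lebesgue_measure_itv/=; case: ifP => _; rewrite ltry.
have small : (mu (IN `&` neq (u_ n) u0) < d%:E)%E.
  rewrite setIC; have fA : mu (neq (u_ n) u0 `&` IN) \is a fin_num.
    rewrite ge0_fin_numE//; apply: le_lt_trans (le_measure mu _ _ (@subIsetr _ _ _)) _; rewrite ?inE//.
    exact: measurableI.
  rewrite -(fineK fA) lte_fin -prim_indic//; apply: le_lt_trans hn.
  apply: le_trans (hneq n N%:R (ler0n _ _)); apply: prim_le => //.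
  - by apply: eq_lint (lint_indic (lint_cst 1) mneq) => t _; rewrite mul1r.
  - exact: lint_indic (ell_lint M n) mneq.
  - by move=> r /andP[r0 _]; rewrite ler_peMl ?ell_ge1.
rewrite !val_u// -primB; [|exact: iu|exact: iu].
have ib : lint (fun s => 2 * (`|H s| * \1_(neq (u_ n) u0) s)) by apply: lintZ; exact: lint_indic.
apply: le_lt_trans (prim_norm_le _ ib (ler0n R N) _) _.
- by apply: lintB; exact: iu.
- move=> r /andP[r0 _]; have rT := (Time_ge0 r).2 r0.
  have [e'|ne] := pselect (u_ n r = u0 r); first by rewrite e' subrr normr0 !mulr_ge0.
  rewrite indicE mem_set//= mulr1 mulr2n mulrDl mul1r; apply: le_trans (ler_normB _ _) _.
  have [_ _ U0] := au0; have [_ _ Un] := au n.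
  by apply: lerD; apply: le_trans (ler_norm _); apply: bphi; [exact: U0|exact: Un].
rewrite primZ; last exact: lint_indic.
rewrite -ltr_pdivlMl// mulrC prim_mul_indic; exact: hd.
Qed.

End TestValues.

(** * The approximating sequences *)

Section Approximating.
Context {R : realType} {m k : nat} {P : control_problem R m k} (M : model P).
Local Notation X := 'cV[R]_m.
Local Notation Xr := 'rV[R]_m.

Lemma approximating_exists (tau : nat -> R) u0 : compact_valued P -> borel_graph P ->
  increasing_to_infinity tau -> tau_optimal P tau u0 ->
  exists (x_ : nat -> R -> X) (eta_ : nat -> relaxed) (lam_ : nat -> R) (psi_ : nat -> R -> Xr)
    (tau_ : nat -> R) (lam : R) (psi : R -> Xr),
    approximating_data P tau u0 x_ eta_ lam_ psi_ tau_ lam psi.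
Proof.
move=> hU hgr htau hopt; have [au0 _] := hopt; have [b0 nb0 bu0] := admissible_bctrl au0.
have [u_ [i [lam_ [psi_ [lam [psi [hi hn [hneq ext] kap lim]]]]]]] := approximation M hgr htau hopt nb0 bu0.
have au n : admissible P (u_ n) by have [[]] := hn n.
have uU n t : Time t -> cset P t (u_ n t) by have [_ _] := au n; apply.
have tau0 n : 0 <= tau n by have [] := htau.
have [[au0' l01 [ox0 x00] op0 nrm0] mc] := ext.
have inv0 : (fun n => n.+1%:R^-1 : R) @ \oo --> (0 : R).
  by apply/cvgrPdist_lt => e e0; have := @small_invS R 1 e e0; apply: filterS => n; rewrite mul1r sub0r normrN ger0_norm// invr_ge0.
exists (fun n => traj P (u_ n)), (fun n => dirac_control (u_ n)), lam_, psi_, (fun n => tau (i n)), lam, psi.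
split; first by move=> n; have [h _ _ _] := hn n; exact: image_in_closure.
split; first by exists i => //; exact: homo_ltn ltn_trans hi.
split.
- split=> //; rewrite /embed.
  apply: cvg_pair_intro; [apply: cvg_pair_intro; [apply: cvg_pair_intro|]|].
  + apply: compact_open_limit; first by apply: ac_continuous; exact: ox0.1.
    by move=> T e T0 e0; apply: filterS (lim T e T0 e0) => n h t /h[].
  + exact: test_values_limit hU _ _ au0 au hneq.
  + by apply: (@cvg_dist0 R R^o _ _ _ _ inv0) => n; have [] := kap n.
  + apply: compact_open_limit; first by apply: ac_continuous; exact: op0.1.
    by move=> T e T0 e0; apply: filterS (lim T e T0 e0) => n h t /h[].
(* The tube gives max-norm errors of at most twice [n.+1%:R^-1]; the factor [m.+1] passes to the
   Euclidean norm, and the added 1 leaves room for the error of [lam_ n]. *)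
- pose C : R := 2 * (m.+1%:R + 1).
  have C0 : 0 < C by rewrite mulr_gt0// addr_gt0.
  exists (fun n => C * n.+1%:R^-1); split.
  + by move=> n; rewrite mulr_gt0// invr_gt0.
  + by move=> n p np; rewrite ler_pM2l// lef_pV2 ?posrE// ler_nat ltnS.
  + by rewrite -(mulr0 C); apply: cvgM => //; exact: cvg_cst.
  move=> n t /Time_ge0 t0; have [dl /(_ t t0)[q [p [qs ps qt pt [q0 p0]]]]] := kap n.
  have lam0 : 0 <= lam_ n by have [[_ /andP[]]] := hn n.
  have js := solutions_joint nb0 bu0 qs ps lam0.
  have zt : (fun s => (p s, q s, lam_ n) : state) t = (psi_ n t, traj P (u_ n) t, lam_ n) by rewrite /= pt qt.
  rewrite (kappaP M nb0 bu0 js t0 zt) /=.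
  have n0 : 0 <= n.+1%:R^-1 :> R by rewrite invr_ge0.
  have S0 : 0 <= m.+1%:R :> R by [].
  have aux1 (a r s : R) : 0 <= s -> 0 <= r -> a <= 2 * r -> s * a <= 2 * (s + 1) * r.
    move=> s0 r0 h; apply: le_trans (ler_wpM2l s0 h) _; have := mulr_ge0 s0 r0; clear -r0 => *; nra.
  have aux2 (r s : R) : 0 <= s -> 0 <= r -> r <= 2 * (s + 1) * r.
    by move=> s0 r0; have := mulr_ge0 s0 r0; clear -r0 => *; nra.
  split.
  + by apply: le_trans (enorm_le _) _; rewrite mul1n; exact: aux1.
  + by apply: le_trans (enorm_le _) _; rewrite muln1; exact: aux1.
  + by apply: le_trans dl _; exact: aux2.
- have e n : payoff_gen P (dirac_control (u_ n)) (tau (i n)) = payoff P (u_ n) (tau (i n)).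
    exact: (payoff_dirac M hU (uU n)).
  have gap n : 0 <= payoff_gen P (dirac_control (u_ n)) (tau (i n)) - payoff P u0 (tau (i n)) <= n.+1%:R^-1.
    by rewrite e; have [] := hn n.
  split=> [n|]; first by have /andP[] := gap n.
  apply: (@cvg_dist0 R R^o _ _ _ _ inv0) => n; have /andP[a b] := gap n.
  by rewrite subr0 ger0_norm.
- split; last by move=> n; have [] := hn n.
  have e n : lam_ n *: dpayoff_gen P (dirac_control (u_ n)) (tau (i n)) = psi_ n 0.
    have [b nb bu] := admissible_bctrl (au n); have [_ pz ps _] := hn n.
    exact: (dpayoff_dirac_psi hU (uU n) nb bu ps (tau0 _) pz).
  rewrite (_ : (fun n => _) = (fun n => psi_ n 0)); last by apply/funext => n; rewrite e.
  apply/cvgrPdist_lt => d d0; apply: filterS (lim 0 d (lexx 0) d0) => n /(_ 0).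
  by rewrite lexx => /(_ isT)[_]; rewrite distrC.
Qed.

End Approximating.

Unset Implicit Arguments.
Theorem theorem2 (R : realType) (m k : nat) (P : control_problem R m k)
    (tau : nat -> R) (u0 : R -> 'cV[R]_k)
    (hU : compact_valued P) (hgraph : borel_graph P)
    (hreg : regular_problem P)
    (htau : increasing_to_infinity tau) (hopt : tau_optimal P tau u0) :
  let x0 := traj P u0 in
  [/\ exists (lam0 : R) (psi0 : R -> 'rV[R]_m),
        normalized_multiplier P x0 u0 lam0 psi0 /\
        vanishing P tau x0 u0 lam0 psi0,
      exists (x_ : nat -> R -> 'cV[R]_m) (eta_ : nat -> relaxed)
          (lam_ : nat -> R) (psi_ : nat -> R -> 'rV[R]_m) (tau_ : nat -> R)
          (lam : R) (psi : R -> 'rV[R]_m),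
        approximating_data P tau u0 x_ eta_ lam_ psi_ tau_ lam psi,
      forall (x_ : nat -> R -> 'cV[R]_m) (eta_ : nat -> relaxed)
          (lam_ : nat -> R) (psi_ : nat -> R -> 'rV[R]_m) (tau_ : nat -> R)
          (lam : R) (psi : R -> 'rV[R]_m),
        approximating_data P tau u0 x_ eta_ lam_ psi_ tau_ lam psi ->
        [/\ lagrange_multiplier P x0 u0 lam psi,
            vanishing P tau x0 u0 lam psi &
            exists c : R, [/\ 0 < c,
              normalized_multiplier P x0 u0 (c * lam) (fun t => c *: psi t) &
              vanishing P tau x0 u0 (c * lam) (fun t => c *: psi t)]] &
      forall (lam0 : R) (psi0 : R -> 'rV[R]_m),
        normalized_multiplier P x0 u0 lam0 psi0 ->
        vanishing P tau x0 u0 lam0 psi0 ->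
        exists (tau' : nat -> R) (xi : nat -> 'cV[R]_m) (lam : nat -> R),
          [/\ subsequence_of tau' tau,
              xi @ \oo --> (0 : 'cV[R]_m),
              (forall n, 0 < lam n <= 1) /\ lam @ \oo --> lam0,
              [/\ lam n *: dpayoff P u0 (xi n) (tau' n) @[n --> \oo] -->
                    psi0 0,
                  locally_uniform_limit
                    (fun n T => lam n *:
                      ((dpayoff P u0 (xi n) (tau' n) - dpayoff P u0 (xi n) T)
                         *m invmx (fund P u0 (xi n) T)))
                    psi0 &
                  locally_uniform_limit
                    (fun n T => lam n *:
                      ((\row_j oriented_integral T (tau' n)
                                 (fun t => dcost P u0 (xi n) t 0 j))
                         *m invmx (fund P u0 0 T)))
                    psi0] &
              0 < lam0 -> lam0 = 1 /\ forall n, lam n = 1]].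
Proof.
have [M] := model_exists hreg; have [au0 _] := hopt; have [b0 nb0 bu0] := admissible_bctrl au0.
have tau0 n : 0 <= tau n by have [] := htau.
have ex := approximating_exists M hU hgraph htau hopt.
split=> //.
- have [x_ [eta_ [lam_ [psi_ [tau_ [lam [psi h]]]]]]] := ex.
  have [_ _ [c [_ h1 h2]]] := approximating_vanishing M tau0 au0 h.
  by exists (c * lam), (fun t => c *: psi t).
- by move=> x_ eta_ lam_ psi_ tau_ lam psi; exact: approximating_vanishing.
- by move=> lam0 psi0; exact: (vanishing_sequences M nb0 bu0 tau0).
Qed.
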